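(* Let $n\ge1$ be an integer and let $\Lambda\subset\mathbb{R}^2$ be a lattice. Then $\Gamma_\Lambda$ is a sampling sequence for $\mathbf{F}^n(\mathbb{C})$ if and only if $D(\Lambda)>n$.
   Context: The polyanalytic Fock space $\mathbf{F}^n(\mathbb{C})$ is the space of functions $F(z)=\sum_{k=0}^{n-1}\bar z^k\varphi_k(z)$ with $\varphi_k$ entire on $\mathbb{C}$ and $\|F\|^2=\int_{\mathbb{C}}|F(z)|^2e^{-\pi|z|^2}dz<\infty$ (equivalently, functions with $\partial_{\bar z}^nF=0$ and finite such norm). A lattice is $\Lambda=A\mathbb{Z}^2$ with $A$ an invertible real $2\times2$ matrix; its density is $D(\Lambda)=|\det A|^{-1}$. $\Gamma_\Lambda=\{x+i\omega\in\mathbb{C}:(x,\omega)\in\Lambda\}$. $\Gamma$ is a sampling sequence for $\mathbf{F}^n(\mathbb{C})$ if there are $A,B>0$ with $A\|F\|^2\le\sum_{z\in\Gamma}|F(z)|^2e^{-\pi|z|^2}\le B\|F\|^2$ for every $F\in\mathbf{F}^n(\mathbb{C})$. *)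

(* Defs.v *)
From Stdlib Require Import Reals ZArith.
Open Scope R_scope.

Record Cx := mkC { re : R; im : R }.
Definition C0 : Cx := mkC 0 0.
Definition C1 : Cx := mkC 1 0.
Definition Cadd (z w : Cx) : Cx := mkC (re z + re w) (im z + im w).
Definition Csub (z w : Cx) : Cx := mkC (re z - re w) (im z - im w).
Definition Cmul (z w : Cx) : Cx :=
  mkC (re z * re w - im z * im w) (re z * im w + im z * re w).
Definition Cnorm2 (z : Cx) : R := re z * re z + im z * im z.
Definition Cmod (z : Cx) : R := sqrt (Cnorm2 z).
Definition Cinv (z : Cx) : Cx := mkC (re z / Cnorm2 z) (- im z / Cnorm2 z).
Definition Cdiv (z w : Cx) : Cx := Cmul z (Cinv w).
Definition Cconj (z : Cx) : Cx := mkC (re z) (- im z).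
Fixpoint Cpow (z : Cx) (k : nat) : Cx :=
  match k with O => C1 | S m => Cmul (Cpow z m) z end.
Fixpoint csum (n : nat) (g : nat -> Cx) : Cx :=
  match n with O => C0 | S m => Cadd (csum m g) (g m) end.

Definition entire (f : Cx -> Cx) : Prop :=
  forall z, exists l : Cx, forall eps, 0 < eps -> exists delta, 0 < delta /\
    forall h, h <> C0 -> Cmod h < delta ->
      Cmod (Csub (Cdiv (Csub (f (Cadd z h)) (f z)) h) l) < eps.

Definition polyanalytic (n : nat) (F : Cx -> Cx) : Prop :=
  exists phi : nat -> Cx -> Cx,
    (forall k, (k < n)%nat -> entire (phi k)) /\
    forall z, F z = csum n (fun k => Cmul (Cpow (Cconj z) k) (phi k z)).

Definition IntR (f : R -> R) (a b v : R) : Prop :=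
  exists pr : Riemann_integrable f a b, RiemannInt pr = v.

Definition SqInt (G : R -> R -> R) (r v : R) : Prop :=
  exists g : R -> R,
    (forall x, IntR (fun y => G x y) (- r) r (g x)) /\ IntR g (- r) r v.

Definition wt (F : Cx -> Cx) (z : Cx) : R :=
  Cnorm2 (F z) * exp (- PI * Cnorm2 z).

(* ||F||^2 = v : improper integral over C = R^2 (limit over exhausting squares)
   of the continuous nonnegative integrand |F|^2 e^{-pi|z|^2} *)
Definition FockNormSq (F : Cx -> Cx) (v : R) : Prop :=
  (forall r w, 0 < r -> SqInt (fun x y => wt F (mkC x y)) r w -> w <= v) /\
  (forall eps, 0 < eps -> exists r0, forall r, r0 <= r ->
     exists w, SqInt (fun x y => wt F (mkC x y)) r w /\ v - eps < w).

Definition InFock (n : nat) (F : Cx -> Cx) : Prop :=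
  polyanalytic n F /\ exists v, FockNormSq F v.

(* Lambda = A Z^2 with A = [[a, b], [c, d]]; point A (k,l)^T as x + i omega *)
Definition latpt (a b c d : R) (k l : Z) : Cx :=
  mkC (a * IZR k + b * IZR l) (c * IZR k + d * IZR l).

Definition boxsum (F : Cx -> Cx) (a b c d : R) (N : nat) : R :=
  sum_f_R0 (fun i => sum_f_R0 (fun j =>
      wt F (latpt a b c d (Z.of_nat i - Z.of_nat N) (Z.of_nat j - Z.of_nat N)))
    (2 * N)) (2 * N).

Definition density (a b c d : R) : R := / Rabs (a * d - b * c).

(* Gamma_Lambda is a sampling sequence for F^n(C): the (nonnegative) sum over
   the lattice is the supremum of the box partial sums. *)
Definition sampling (n : nat) (a b c d : R) : Prop :=
  exists A B, 0 < A /\ 0 < B /\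
    forall F v, InFock n F -> FockNormSq F v ->
      (forall N, boxsum F a b c d N <= B * v) /\
      (forall s, (forall N, boxsum F a b c d N <= s) -> A * v <= s).

(* Main.v *)
Require Import Defs.
From Stdlib Require Import Reals ZArith Psatz Lia ClassicalEpsilon FunctionalExtensionality.
From Coquelicot Require Import Coquelicot.
Open Scope R_scope.

(* Let d be the area of a cell of the lattice, so that the density is 1/d.

   Existence of vanishing functions.  If n * al * d > 1, a theta-type series
   exp(c z^2) sum_x (sum_{i<n} gamma_i(x) (x + m Y)^i) exp(sg x^2 + 2 pi i x u), with u = z / w1, Y proportional to
   Im u and m-periodic coefficients gamma_i, is polyanalytic of order n and grows at most like exp(pi al |z|^2 / 2).
   Vanishing on the lattice amounts to q linear equations in n m > q unknowns.

   If 1/d > n: the dual lattice (the lattice divided by d) carries a holomorphic function whose n-th power still grows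
   strictly slower than exp(pi |z|^2 / 2); up to a polynomial factor it is an entire E vanishing to order n on the
   nonzero dual points, with E = 1 + O(z^n).  Put kappa = sum_{i<n} (d/dz)^i (z^i E g_n) / i!, where g_n is the n-th
   z-derivative of exp(-pi |z|^2) divided by (conj z)^n.  Integrating by parts, the integrals of F kappa against all
   nontrivial dual characters vanish, and the mean of F kappa is that of F(0) g_n.  Poisson summation (by a Fejer-type
   kernel) therefore recovers F(0) from the lattice values of F kappa; translating in the Fock space and squaring gives
   the lower frame bound.  The upper bound is the same integration by parts with E = 1 and a compactly supported weight.

   If 1/d <= n: for small eps the lattice dilated by sqrt(1 + eps) has density less than n, so some nonzero F in the
   Fock space vanishes on it.  The functions z -> (translate of F by c)(sqrt(1 - eps) z), with c in the dilated lattice,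
   are small on the original lattice: summing over c, their lattice sums total O(|F|^2) while their squared norms total
   at least |F|^2 / eps up to constants, which contradicts the lower frame bound as eps tends to 0. *)

(** * Wirtinger calculus and the complex exponential *)

(** Each half of a dual character has its own role. For a dual point a the character is exp(pi
    conj(a) z) exp(-pi conj(z) a). The first factor is entire with negligible growth and joins F;
    the second turns the Gaussian into exp(-pi conj(z) (z + a)), whose conj(z)-derivative vanishes
    at -a. So E matters only through its zeros at the points -a. They must have order n because a
    factor conj(z)^j, j < n, is traded for j derivatives of the analytic factor. The derivatives
    inside kappa replace each component of F by a Taylor polynomial centred at z and evaluated at 0,
    which is the value at 0 up to O(z^n): this isolates F(0). The strict inequality of densities is
    a growth margin. If E comes from a theta function with parameter al, then F kappa has exponent
    pi/2 + n pi al / 2 - pi, negative exactly when n al < 1. What is left of the margin is a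
    Gaussian around the point of evaluation, which makes the pointwise bound summable over the
    lattice and integrable over the plane. Means are taken over large cells up to a vanishing error,
    so that Stokes and Poisson summation reduce to estimates on finite parallelograms. *)

Lemma C_ext (z w : C) : fst z = fst w -> snd z = snd w -> z = w.
Proof. destruct z, w; simpl; intros; subst; reflexivity. Qed.

Ltac csolve := apply C_ext; simpl; ring.

Lemma Cmod_minus_sym (z w : C) : Cmod (z - w) = Cmod (w - z).
Proof. rewrite <- Cmod_opp. f_equal. ring. Qed.

Lemma Cmod_triangle' (z w : C) : Cmod (z - w) <= Cmod z + Cmod w.
Proof. rewrite <- (Cmod_opp w). apply Cmod_triangle. Qed.

Lemma Cmod_triangle_rev (z w : C) : Cmod z - Cmod w <= Cmod (z - w).
Proof.
  assert (H := Cmod_triangle (z - w) w).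
  replace (z - w + w)%C with z in H by ring. lra.
Qed.

Lemma fst_le_Cmod (z : C) : Rabs (fst z) <= Cmod z.
Proof. eapply Rle_trans; [apply Rmax_l | apply Rmax_Cmod]. Qed.

Lemma snd_le_Cmod (z : C) : Rabs (snd z) <= Cmod z.
Proof. eapply Rle_trans; [apply Rmax_r | apply Rmax_Cmod]. Qed.

Lemma Cmod_le_sum (z : C) : Cmod z <= Rabs (fst z) + Rabs (snd z).
Proof.
  unfold Cmod. apply Rsqr_incr_0_var.
  - rewrite Rsqr_sqrt by nra. unfold Rsqr.
    rewrite <- (pow2_abs (fst z)), <- (pow2_abs (snd z)).
    assert (0 <= Rabs (fst z)) by apply Rabs_pos.
    assert (0 <= Rabs (snd z)) by apply Rabs_pos. nra.
  - assert (0 <= Rabs (fst z)) by apply Rabs_pos.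
    assert (0 <= Rabs (snd z)) by apply Rabs_pos. lra.
Qed.

Lemma Cmod_sqr (z : C) : Cmod z * Cmod z = fst z * fst z + snd z * snd z.
Proof. unfold Cmod. rewrite sqrt_sqrt; nra. Qed.

(* Real differentiability at [z], with Wirtinger derivatives [p] in [z] and [q] in [Cconj z]. *)
Definition WD (u : C -> C) (z p q : C) : Prop :=
  forall eps, 0 < eps -> exists d, 0 < d /\ forall h, Cmod h < d ->
    Cmod (u (z + h) - u z - (p * h + q * Cconj h))%C <= eps * Cmod h.

Definition contC (u : C -> C) : Prop :=
  forall z eps, 0 < eps -> exists d, 0 < d /\ forall h, Cmod h < d ->
    Cmod (u (z + h) - u z)%C < eps.

Definition entireC (f : C -> C) : Prop := forall z, exists l, WD f z l 0.

Lemma WD_ext (u v : C -> C) z p q p' q' :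
  (forall z, u z = v z) -> p = p' -> q = q' -> WD u z p q -> WD v z p' q'.
Proof.
  intros E <- <- H eps He. destruct (H eps He) as [d [Hd Hh]].
  exists d; split; [assumption|]. intros h Hlt. rewrite <- !E. auto.
Qed.

Lemma WD_const c z : WD (fun _ => c) z 0 0.
Proof.
  intros eps He. exists 1; split; [lra|]. intros h _.
  replace (c - c - (0 * h + 0 * Cconj h))%C with (RtoC 0) by ring.
  rewrite Cmod_0. apply Rmult_le_pos; [lra | apply Cmod_ge_0].
Qed.

Lemma WD_id z : WD (fun z => z) z 1 0.
Proof.
  intros eps He. exists 1; split; [lra|]. intros h _.
  replace (z + h - z - (1 * h + 0 * Cconj h))%C with (RtoC 0) by ring.
  rewrite Cmod_0. apply Rmult_le_pos; [lra | apply Cmod_ge_0].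
Qed.

Lemma Cconj_plus (z w : C) : Cconj (z + w) = (Cconj z + Cconj w)%C.
Proof. csolve. Qed.
Lemma Cconj_minus (z w : C) : Cconj (z - w) = (Cconj z - Cconj w)%C.
Proof. csolve. Qed.
Lemma Cconj_mult (z w : C) : Cconj (z * w) = (Cconj z * Cconj w)%C.
Proof. csolve. Qed.
Lemma Cconj_R (r : R) : Cconj (RtoC r) = RtoC r.
Proof. csolve. Qed.
Lemma Cconj_conj' (z : C) : Cconj (Cconj z) = z.
Proof. csolve. Qed.

Lemma WD_conj_comp u z p q :
  WD u z p q -> WD (fun z => Cconj (u z)) z (Cconj q) (Cconj p).
Proof.
  intros H eps He. destruct (H eps He) as [d [Hd Hh]].
  exists d; split; [assumption|]. intros h Hlt. specialize (Hh h Hlt).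
  rewrite <- Cmod_conj in Hh.
  replace (Cconj (u (z + h)) - Cconj (u z) - (Cconj q * h + Cconj p * Cconj h))%C
    with (Cconj (u (z + h)%C - u z - (p * h + q * Cconj h))); [exact Hh|].
  rewrite !Cconj_minus, Cconj_plus, !Cconj_mult, Cconj_conj'. ring.
Qed.

Lemma WD_conj z : WD Cconj z 0 1.
Proof.
  apply (WD_ext (fun z => Cconj z) _ _ (Cconj 0) (Cconj 1));
    [reflexivity | csolve | csolve | apply (WD_conj_comp (fun z => z)), WD_id].
Qed.

Lemma WD_plus u v z p q p' q' :
  WD u z p q -> WD v z p' q' -> WD (fun z => u z + v z)%C z (p + p') (q + q').
Proof.
  intros H1 H2 eps He.
  destruct (H1 (eps/2)) as [d1 [Hd1 Hh1]]; [lra|].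
  destruct (H2 (eps/2)) as [d2 [Hd2 Hh2]]; [lra|].
  exists (Rmin d1 d2); split; [apply Rmin_pos; assumption|].
  intros h Hh. specialize (Hh1 h (Rlt_le_trans _ _ _ Hh (Rmin_l _ _))).
  specialize (Hh2 h (Rlt_le_trans _ _ _ Hh (Rmin_r _ _))).
  match goal with |- Cmod ?a <= _ =>
    replace a with ((u (z+h) - u z - (p*h+q*Cconj h)) + (v (z+h) - v z - (p'*h+q'*Cconj h)))%C by ring end.
  eapply Rle_trans; [apply Cmod_triangle|]. lra.
Qed.

Lemma dlin_le (p q h : C) : Cmod (p * h + q * Cconj h) <= (Cmod p + Cmod q) * Cmod h.
Proof.
  eapply Rle_trans; [apply Cmod_triangle|]. rewrite !Cmod_mult, Cmod_conj. lra.
Qed.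

Lemma WD_lip u z p q : WD u z p q ->
  exists d, 0 < d /\ forall h, Cmod h < d ->
    Cmod (u (z + h) - u z)%C <= (Cmod p + Cmod q + 1) * Cmod h.
Proof.
  intros H. destruct (H 1) as [d [Hd Hh]]; [lra|].
  exists d; split; [assumption|]. intros h Hlt. specialize (Hh h Hlt).
  replace (u (z+h) - u z)%C with ((u (z + h) - u z - (p * h + q * Cconj h)) + (p * h + q * Cconj h))%C by ring.
  eapply Rle_trans; [apply Cmod_triangle|]. assert (D := dlin_le p q h). lra.
Qed.

Lemma WD_cont_at u z p q : WD u z p q -> forall eps, 0 < eps ->
  exists d, 0 < d /\ forall h, Cmod h < d -> Cmod (u (z + h) - u z)%C < eps.
Proof.
  intros H eps He. destruct (WD_lip _ _ _ _ H) as [d [Hd Hh]].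
  assert (P : 0 < Cmod p + Cmod q + 1) by (assert (A := Cmod_ge_0 p); assert (B := Cmod_ge_0 q); lra).
  exists (Rmin d (eps / (Cmod p + Cmod q + 1))). split.
  - apply Rmin_pos; [assumption | apply Rdiv_lt_0_compat; assumption].
  - intros h Hlt. eapply Rle_lt_trans; [apply Hh; eapply Rlt_le_trans; [exact Hlt | apply Rmin_l]|].
    assert (L : Cmod h < eps / (Cmod p + Cmod q + 1)) by (eapply Rlt_le_trans; [exact Hlt | apply Rmin_r]).
    apply (Rmult_lt_compat_l _ _ _ P) in L. field_simplify in L; lra.
Qed.

Lemma WD_cont u (p q : C -> C) : (forall z, WD u z (p z) (q z)) -> contC u.
Proof. intros H z. eapply WD_cont_at, H. Qed.

Lemma entireC_cont f : entireC f -> contC f.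
Proof. intros H z. destruct (H z) as [l Hl]. eapply WD_cont_at, Hl. Qed.

Lemma WD_mult u v z p q p' q' :
  WD u z p q -> WD v z p' q' ->
  WD (fun z => u z * v z)%C z (p * v z + u z * p') (q * v z + u z * q').
Proof.
  intros H1 H2 eps He.
  set (A := Cmod (u z)). set (B := Cmod (v z)).
  set (P := Cmod p + Cmod q + 1). set (Q := Cmod p' + Cmod q' + 1).
  assert (HA : 0 <= A) by apply Cmod_ge_0. assert (HB : 0 <= B) by apply Cmod_ge_0.
  assert (HP : 0 < P) by (unfold P; assert (a := Cmod_ge_0 p); assert (b := Cmod_ge_0 q); lra).
  assert (HQ : 0 < Q) by (unfold Q; assert (a := Cmod_ge_0 p'); assert (b := Cmod_ge_0 q'); lra).
  assert (E3 : 0 < eps / 3) by lra.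
  destruct (H1 (eps / 3 / (B + 1))) as [d1 [Hd1 Hh1]]; [apply Rdiv_lt_0_compat; lra|].
  destruct (H2 (eps / 3 / (A + 1))) as [d2 [Hd2 Hh2]]; [apply Rdiv_lt_0_compat; lra|].
  destruct (WD_lip _ _ _ _ H1) as [d3 [Hd3 Hh3]].
  destruct (WD_lip _ _ _ _ H2) as [d4 [Hd4 Hh4]].
  set (d5 := eps / 3 / (P * Q)).
  assert (Hd5 : 0 < d5) by (apply Rdiv_lt_0_compat; [lra | apply Rmult_lt_0_compat; lra]).
  exists (Rmin d5 (Rmin (Rmin d1 d2) (Rmin d3 d4))). split.
  { repeat apply Rmin_pos; assumption. }
  intros h Hh.
  assert (h5 : Cmod h < d5) by (eapply Rlt_le_trans; [exact Hh | apply Rmin_l]).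
  assert (Hh' : Cmod h < Rmin (Rmin d1 d2) (Rmin d3 d4)) by (eapply Rlt_le_trans; [exact Hh | apply Rmin_r]).
  assert (h12 : Cmod h < Rmin d1 d2) by (eapply Rlt_le_trans; [exact Hh' | apply Rmin_l]).
  assert (h34 : Cmod h < Rmin d3 d4) by (eapply Rlt_le_trans; [exact Hh' | apply Rmin_r]).
  specialize (Hh1 h (Rlt_le_trans _ _ _ h12 (Rmin_l _ _))).
  specialize (Hh2 h (Rlt_le_trans _ _ _ h12 (Rmin_r _ _))).
  specialize (Hh3 h (Rlt_le_trans _ _ _ h34 (Rmin_l _ _))).
  specialize (Hh4 h (Rlt_le_trans _ _ _ h34 (Rmin_r _ _))).
  assert (H0 := Cmod_ge_0 h).
  match goal with |- Cmod ?a <= _ => replace a with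
    ((u (z+h) - u z - (p*h+q*Cconj h)) * v z + (u z * (v (z+h) - v z - (p'*h+q'*Cconj h)))
     + (u (z+h) - u z) * (v (z+h) - v z))%C by ring end.
  eapply Rle_trans; [apply Cmod_triangle|].
  eapply Rle_trans; [apply Rplus_le_compat_r, Cmod_triangle|].
  rewrite !Cmod_mult. fold A B.
  assert (T1 : Cmod (u (z + h) - u z - (p * h + q * Cconj h))%C * B <= eps / 3 * Cmod h).
  { eapply Rle_trans; [apply Rmult_le_compat_r; [exact HB | exact Hh1]|].
    replace (eps / 3 / (B + 1) * Cmod h * B) with (eps / 3 * Cmod h * (B / (B + 1))) by (field; lra).
    rewrite <- (Rmult_1_r (eps / 3 * Cmod h)) at 2. apply Rmult_le_compat_l; [nra|].
    apply Rle_div_l; lra. }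
  assert (T2 : A * Cmod (v (z + h) - v z - (p' * h + q' * Cconj h))%C <= eps / 3 * Cmod h).
  { eapply Rle_trans; [apply Rmult_le_compat_l; [exact HA | exact Hh2]|].
    replace (A * (eps / 3 / (A + 1) * Cmod h)) with (eps / 3 * Cmod h * (A / (A + 1))) by (field; lra).
    rewrite <- (Rmult_1_r (eps / 3 * Cmod h)) at 2. apply Rmult_le_compat_l; [nra|].
    apply Rle_div_l; lra. }
  assert (T3 : Cmod (u (z + h) - u z)%C * Cmod (v (z + h) - v z)%C <= eps / 3 * Cmod h).
  { eapply Rle_trans; [apply Rmult_le_compat; [apply Cmod_ge_0 | apply Cmod_ge_0 | exact Hh3 | exact Hh4]|].
    fold P Q. replace (P * Cmod h * (Q * Cmod h)) with (Cmod h * (Cmod h * (P * Q))) by ring.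
    rewrite (Rmult_comm (eps / 3)). apply Rmult_le_compat_l; [lra|].
    assert (PQ : 0 < P * Q) by (apply Rmult_lt_0_compat; lra).
    apply Rlt_le in h5. apply (Rmult_le_compat_r (P * Q)) in h5; [|lra].
    unfold d5 in h5. replace (eps / 3 / (P * Q) * (P * Q)) with (eps / 3) in h5 by (field; lra). exact h5. }
  lra.
Qed.

Lemma WD_chain u g z p q gp gq :
  WD u (g z) p q -> WD g z gp gq ->
  WD (fun z => u (g z)) z (p * gp + q * Cconj gq) (p * gq + q * Cconj gp).
Proof.
  intros H1 H2 eps He.
  set (P := Cmod gp + Cmod gq + 1). set (K := Cmod p + Cmod q + 1).
  assert (HP : 0 < P) by (unfold P; assert (a := Cmod_ge_0 gp); assert (b := Cmod_ge_0 gq); lra).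
  assert (HK : 0 < K) by (unfold K; assert (a := Cmod_ge_0 p); assert (b := Cmod_ge_0 q); lra).
  assert (E1 : 0 < eps / 2 / P) by (apply Rdiv_lt_0_compat; lra).
  assert (E2 : 0 < eps / 2 / K) by (apply Rdiv_lt_0_compat; lra).
  destruct (H1 _ E1) as [d1 [Hd1 Hh1]]. destruct (H2 _ E2) as [d2 [Hd2 Hh2]].
  destruct (WD_lip _ _ _ _ H2) as [d3 [Hd3 Hh3]].
  destruct (WD_cont_at _ _ _ _ H2 _ Hd1) as [d4 [Hd4 Hh4]].
  exists (Rmin d2 (Rmin d3 d4)). split; [repeat apply Rmin_pos; assumption|].
  intros h Hh.
  assert (a2 : Cmod h < d2) by (eapply Rlt_le_trans; [exact Hh | apply Rmin_l]).
  assert (Hh' : Cmod h < Rmin d3 d4) by (eapply Rlt_le_trans; [exact Hh | apply Rmin_r]).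
  specialize (Hh2 h a2). specialize (Hh3 h (Rlt_le_trans _ _ _ Hh' (Rmin_l _ _))).
  specialize (Hh4 h (Rlt_le_trans _ _ _ Hh' (Rmin_r _ _))).
  specialize (Hh1 _ Hh4).
  replace (g z + (g (z + h)%C - g z))%C with (g (z + h)%C) in Hh1 by ring.
  set (k := (g (z + h)%C - g z)%C) in *.
  set (e := (k - (gp * h + gq * Cconj h))%C) in *.
  match goal with |- Cmod ?a <= _ => replace a with
    ((u (g (z + h)) - u (g z) - (p * k + q * Cconj k)) + (p * e + q * Cconj e))%C end.
  2:{ unfold e. rewrite Cconj_minus, Cconj_plus, !Cconj_mult, Cconj_conj'. ring. }
  eapply Rle_trans; [apply Cmod_triangle|].
  assert (D := dlin_le p q e). assert (H0 := Cmod_ge_0 h).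
  assert (T1 : eps / 2 / P * Cmod k <= eps / 2 * Cmod h).
  { eapply Rle_trans; [apply Rmult_le_compat_l; [lra | exact Hh3]|]. fold P.
    right. field. lra. }
  assert (T2 : (Cmod p + Cmod q) * Cmod e <= eps / 2 * Cmod h).
  { eapply Rle_trans; [apply Rmult_le_compat_l; [|exact Hh2]|].
    - assert (a := Cmod_ge_0 p); assert (b := Cmod_ge_0 q); lra.
    - replace (eps / 2 * Cmod h) with (K * (eps / 2 / K * Cmod h)) by (field; lra).
      apply Rmult_le_compat_r; [apply Rmult_le_pos; lra | unfold K; lra]. }
  lra.
Qed.

Lemma WD_scal c u z p q : WD u z p q -> WD (fun z => c * u z)%C z (c * p) (c * q).
Proof.
  intros H. eapply WD_ext; [| | | apply (WD_mult (fun _ => c) u z 0 0 p q (WD_const c z) H)];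
    [reflexivity | ring | ring].
Qed.

Lemma WD_opp u z p q : WD u z p q -> WD (fun z => - u z)%C z (- p) (- q).
Proof.
  intros H. eapply WD_ext; [| | | apply (WD_scal (-(1)) _ _ _ _ H)];
    [intros; simpl; ring | ring | ring].
Qed.

Lemma WD_minus u v z p q p' q' :
  WD u z p q -> WD v z p' q' -> WD (fun z => u z - v z)%C z (p - p') (q - q').
Proof. intros H1 H2. exact (WD_plus _ _ _ _ _ _ _ H1 (WD_opp _ _ _ _ H2)). Qed.

(** The outer function lives on the real line, outside the scope of [WD_chain]. It serves exp, cos
    and sin in [cexp] and the truncated powers in [bump]. *)
Lemma WD_comp_real (g : R -> R) (r : C -> R) z p q l :
  WD (fun z => RtoC (r z)) z p q -> is_derive g (r z) l ->
  WD (fun z => RtoC (g (r z))) z (l * p) (l * q).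
Proof.
  intros H1 H2.
  assert (D : forall eps, 0 < eps -> exists d, 0 < d /\ forall k, Rabs k < d ->
     Rabs (g (r z + k) - g (r z) - l * k) <= eps * Rabs k).
  { intros eps He. apply is_derive_Reals in H2. destruct (H2 eps He) as [[d Hd] Hk].
    exists d; split; [assumption|]. intros k Hkd.
    destruct (Req_dec k 0) as [->|N].
    - rewrite Rplus_0_r, Rabs_R0.
      replace (g (r z) - g (r z) - l * 0) with 0 by ring. rewrite Rabs_R0. lra.
    - specialize (Hk k N Hkd).
      replace (g (r z + k) - g (r z) - l * k) with (((g (r z + k) - g (r z)) / k - l) * k) by (field; assumption).
      rewrite Rabs_mult. apply Rmult_le_compat_r; [apply Rabs_pos | lra]. }
  set (P := Cmod p + Cmod q + 1).
  assert (HP : 0 < P) by (unfold P; assert (a := Cmod_ge_0 p); assert (b := Cmod_ge_0 q); lra).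
  assert (HK : 0 < Rabs l + 1) by (assert (a := Rabs_pos l); lra).
  intros eps He.
  assert (E1 : 0 < eps / 2 / P) by (apply Rdiv_lt_0_compat; lra).
  assert (E2 : 0 < eps / 2 / (Rabs l + 1)) by (apply Rdiv_lt_0_compat; lra).
  destruct (D _ E1) as [d1 [Hd1 Hh1]]. destruct (H1 _ E2) as [d2 [Hd2 Hh2]].
  destruct (WD_lip _ _ _ _ H1) as [d3 [Hd3 Hh3]].
  destruct (WD_cont_at _ _ _ _ H1 _ Hd1) as [d4 [Hd4 Hh4]].
  exists (Rmin d2 (Rmin d3 d4)). split; [repeat apply Rmin_pos; assumption|].
  intros h Hh.
  assert (a2 : Cmod h < d2) by (eapply Rlt_le_trans; [exact Hh | apply Rmin_l]).
  assert (Hh' : Cmod h < Rmin d3 d4) by (eapply Rlt_le_trans; [exact Hh | apply Rmin_r]).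
  specialize (Hh2 h a2). specialize (Hh3 h (Rlt_le_trans _ _ _ Hh' (Rmin_l _ _))).
  specialize (Hh4 h (Rlt_le_trans _ _ _ Hh' (Rmin_r _ _))).
  set (k := r (z + h)%C - r z) in *.
  assert (Ek : (RtoC (r (z + h)%C) - RtoC (r z))%C = RtoC k) by (unfold k; rewrite RtoC_minus; reflexivity).
  rewrite Ek in *. rewrite Cmod_R in Hh3, Hh4.
  specialize (Hh1 _ Hh4). replace (r z + k) with (r (z + h)%C) in Hh1 by (unfold k; ring).
  match goal with |- Cmod ?a <= _ => replace a with
    (RtoC (g (r (z+h)%C) - g (r z) - l * k) + RtoC l * (RtoC k - (p * h + q * Cconj h)))%C end.
  2:{ rewrite !RtoC_minus, RtoC_mult. ring. }
  eapply Rle_trans; [apply Cmod_triangle|]. rewrite Cmod_R, Cmod_mult, Cmod_R.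
  assert (T1 : eps / 2 / P * Rabs k <= eps / 2 * Cmod h).
  { eapply Rle_trans; [apply Rmult_le_compat_l; [lra | exact Hh3]|]. fold P.
    right. field. lra. }
  assert (T2 : Rabs l * Cmod (RtoC k - (p * h + q * Cconj h)) <= eps / 2 * Cmod h).
  { eapply Rle_trans; [apply Rmult_le_compat_l; [apply Rabs_pos | exact Hh2]|].
    assert (H0 := Cmod_ge_0 h).
    replace (eps / 2 * Cmod h) with ((Rabs l + 1) * (eps / 2 / (Rabs l + 1) * Cmod h)) by (field; lra).
    apply Rmult_le_compat_r; [apply Rmult_le_pos; lra | lra]. }
  lra.
Qed.

Lemma Re_conj (z : C) : RtoC (fst z) = ((z + Cconj z) * RtoC (/2))%C.
Proof. apply C_ext; simpl; field. Qed.
Lemma Im_conj (z : C) : RtoC (snd z) = ((z - Cconj z) * (- Ci * RtoC (/2)))%C.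
Proof. apply C_ext; simpl; field. Qed.

Lemma WD_re z : WD (fun z => RtoC (fst z)) z (RtoC (/2)) (RtoC (/2)).
Proof.
  eapply WD_ext; [| | | apply (WD_scal (RtoC (/2)) _ _ _ _ (WD_plus _ _ _ _ _ _ _ (WD_id z) (WD_conj z)))].
  - intros; simpl. rewrite Re_conj. ring.
  - ring.
  - ring.
Qed.

Lemma WD_im z : WD (fun z => RtoC (snd z)) z (- Ci * RtoC (/2)) (Ci * RtoC (/2)).
Proof.
  eapply WD_ext; [| | | apply (WD_scal (- Ci * RtoC (/2)) _ _ _ _ (WD_minus _ _ _ _ _ _ _ (WD_id z) (WD_conj z)))].
  - intros; simpl. rewrite Im_conj. ring.
  - ring.
  - ring.
Qed.

Definition cexp (z : C) : C := (RtoC (exp (fst z)) * (RtoC (cos (snd z)) + Ci * RtoC (sin (snd z))))%C.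

Lemma WD_cexp z : WD cexp z (cexp z) 0.
Proof.
  assert (E := WD_comp_real exp fst z _ _ _ (WD_re z) (is_derive_exp _)).
  assert (Co := WD_comp_real cos snd z _ _ _ (WD_im z) (is_derive_cos _)).
  assert (Si := WD_comp_real sin snd z _ _ _ (WD_im z) (is_derive_sin _)).
  eapply WD_ext; [| | | apply (WD_mult _ _ _ _ _ _ _ E (WD_plus _ _ _ _ _ _ _ Co (WD_scal Ci _ _ _ _ Si)))].
  - reflexivity.
  - unfold cexp. apply C_ext; simpl; field.
  - apply C_ext; simpl; field.
Qed.

Lemma cexp_plus z w : cexp (z + w) = (cexp z * cexp w)%C.
Proof.
  unfold cexp. simpl. rewrite exp_plus, cos_plus, sin_plus. csolve.
Qed.
Lemma cexp_0 : cexp 0 = 1%C.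
Proof. unfold cexp; apply C_ext; simpl; rewrite exp_0, cos_0, sin_0; ring. Qed.
Lemma cexp_neg z : (cexp z * cexp (- z) = 1)%C.
Proof. rewrite <- cexp_plus, <- cexp_0. f_equal. ring. Qed.
Lemma Cmod_cexp z : Cmod (cexp z) = exp (fst z).
Proof.
  unfold cexp. rewrite Cmod_mult, Cmod_R, Rabs_pos_eq by (left; apply exp_pos).
  replace (Cmod _) with 1; [ring|]. symmetry. transitivity (sqrt 1); [|apply sqrt_1].
  unfold Cmod. f_equal. simpl.
  assert (H := sin2_cos2 (snd z)). unfold Rsqr in H. nra.
Qed.
Lemma cexp_R (r : R) : cexp (RtoC r) = RtoC (exp r).
Proof. unfold cexp; apply C_ext; simpl; rewrite cos_0, sin_0; ring. Qed.
Lemma cexp_nz z : cexp z <> 0%C.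
Proof. intros H. apply Cmod_gt_0 in H; auto. rewrite Cmod_cexp. apply exp_pos. Qed.

Lemma WD_cexp_comp u z p q : WD u z p q ->
  WD (fun z => cexp (u z)) z (cexp (u z) * p) (cexp (u z) * q).
Proof.
  intros H. eapply WD_ext; [| | | apply (WD_chain cexp u z _ _ _ _ (WD_cexp (u z)) H)];
    [reflexivity | ring | ring].
Qed.

Lemma WD_unique f z l l' : WD f z l 0 -> WD f z l' 0 -> l = l'.
Proof.
  intros H1 H2. destruct (Ceq_dec l l') as [E|N]; [exact E|exfalso].
  assert (P : 0 < Cmod (l - l')).
  { apply Cmod_gt_0. intros E. apply N. replace l with (l - l' + l')%C by ring. rewrite E; ring. }
  destruct (H1 (Cmod (l - l') / 3)) as [d1 [Hd1 h1]]; [lra|].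
  destruct (H2 (Cmod (l - l') / 3)) as [d2 [Hd2 h2]]; [lra|].
  set (r := Rmin d1 d2 / 2).
  assert (Hm : 0 < Rmin d1 d2) by (apply Rmin_pos; assumption).
  assert (Hr : Cmod (RtoC r) = r) by (rewrite Cmod_R; apply Rabs_pos_eq; unfold r; lra).
  assert (L1 : Rmin d1 d2 <= d1) by apply Rmin_l. assert (L2 : Rmin d1 d2 <= d2) by apply Rmin_r.
  specialize (h1 (RtoC r)). specialize (h2 (RtoC r)). rewrite Hr in h1, h2.
  assert (A := h1 ltac:(unfold r; lra)). assert (B := h2 ltac:(unfold r; lra)).
  assert (T := Cmod_triangle' (f (z + RtoC r)%C - f z - (l' * RtoC r + 0 * Cconj (RtoC r)))
     (f (z + RtoC r)%C - f z - (l * RtoC r + 0 * Cconj (RtoC r)))).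
  match type of T with Cmod ?a <= _ => replace a with ((l - l') * RtoC r)%C in T by ring end.
  rewrite Cmod_mult, Hr in T. assert (0 < r) by (unfold r; lra). nra.
Qed.

Lemma entireC_ext f g : (forall z, f z = g z) -> entireC f -> entireC g.
Proof. intros E H z. destruct (H z) as [l Hl]. exists l. eapply WD_ext; eauto. Qed.
Lemma entireC_const c : entireC (fun _ => c).
Proof. intros z; exists 0%C; apply WD_const. Qed.
Lemma entireC_id : entireC (fun z => z).
Proof. intros z; exists 1%C; apply WD_id. Qed.
Lemma entireC_plus f g : entireC f -> entireC g -> entireC (fun z => f z + g z)%C.
Proof.
  intros Hf Hg z. destruct (Hf z) as [l Hl], (Hg z) as [l' Hl']. exists (l + l')%C.
  eapply WD_ext; [| | | apply (WD_plus _ _ _ _ _ _ _ Hl Hl')]; [reflexivity | ring | ring].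
Qed.
Lemma entireC_mult f g : entireC f -> entireC g -> entireC (fun z => f z * g z)%C.
Proof.
  intros Hf Hg z. destruct (Hf z) as [l Hl], (Hg z) as [l' Hl']. exists (l * g z + f z * l')%C.
  eapply WD_ext; [| | | apply (WD_mult _ _ _ _ _ _ _ Hl Hl')]; [reflexivity | ring | ring].
Qed.
Lemma entireC_comp f g : entireC f -> entireC g -> entireC (fun z => f (g z)).
Proof.
  intros Hf Hg z. destruct (Hg z) as [l' Hl'], (Hf (g z)) as [l Hl]. exists (l * l')%C.
  eapply WD_ext; [| | | apply (WD_chain _ _ _ _ _ _ _ Hl Hl')]; [reflexivity | ring | ring].
Qed.
Lemma entireC_scal c f : entireC f -> entireC (fun z => c * f z)%C.
Proof. intros; apply entireC_mult; [apply entireC_const | assumption]. Qed.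
Lemma entireC_minus f g : entireC f -> entireC g -> entireC (fun z => f z - g z)%C.
Proof.
  intros Hf Hg. eapply entireC_ext; [| apply (entireC_plus _ _ Hf (entireC_scal (-(1)) _ Hg))].
  intros; simpl; ring.
Qed.
Lemma entireC_cexp f : entireC f -> entireC (fun z => cexp (f z)).
Proof. apply (entireC_comp cexp). intros z; exists (cexp z); apply WD_cexp. Qed.
Lemma entireC_pow f n : entireC f -> entireC (fun z => f z ^ n)%C.
Proof.
  intros H; induction n; simpl; [apply entireC_const | apply entireC_mult; assumption].
Qed.

Lemma contC_ext u v : (forall z, u z = v z) -> contC u -> contC v.
Proof.
  intros E H z eps He. destruct (H z eps He) as [d [Hd Hh]].
  exists d; split; [assumption|]. intros h Hlt. rewrite <- !E. auto.
Qed.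
Lemma contC_const c : contC (fun _ => c).
Proof. apply entireC_cont, entireC_const. Qed.
Lemma contC_conj : contC Cconj.
Proof. apply (WD_cont _ (fun _ => 0%C) (fun _ => 1%C)), WD_conj. Qed.
Lemma contC_plus u v : contC u -> contC v -> contC (fun z => u z + v z)%C.
Proof.
  intros Hu Hv z eps He.
  destruct (Hu z (eps/2)) as [d1 [Hd1 h1]]; [lra|]. destruct (Hv z (eps/2)) as [d2 [Hd2 h2]]; [lra|].
  exists (Rmin d1 d2); split; [apply Rmin_pos; assumption|]. intros h Hh.
  specialize (h1 h (Rlt_le_trans _ _ _ Hh (Rmin_l _ _))).
  specialize (h2 h (Rlt_le_trans _ _ _ Hh (Rmin_r _ _))).
  match goal with |- Cmod ?a < _ => replace a with ((u (z+h) - u z) + (v (z+h) - v z))%C by ring end.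
  eapply Rle_lt_trans; [apply Cmod_triangle|]. lra.
Qed.
Lemma contC_comp u v : contC u -> contC v -> contC (fun z => u (v z)).
Proof.
  intros Hu Hv z eps He. destruct (Hu (v z) eps He) as [d1 [Hd1 h1]].
  destruct (Hv z d1 Hd1) as [d2 [Hd2 h2]]. exists d2; split; [assumption|]. intros h Hh.
  specialize (h1 _ (h2 h Hh)).
  replace (v z + (v (z + h)%C - v z))%C with (v (z + h)%C) in h1 by ring. exact h1.
Qed.
Lemma contC_mult u v : contC u -> contC v -> contC (fun z => u z * v z)%C.
Proof.
  intros Hu Hv z eps He. set (A := Cmod (u z) + Cmod (v z) + 1).
  assert (HA : 1 <= A) by (unfold A; assert (a := Cmod_ge_0 (u z)); assert (b := Cmod_ge_0 (v z)); lra).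
  set (e := Rmin 1 (eps / (3 * A))).
  assert (He' : 0 < e) by (apply Rmin_pos; [lra | apply Rdiv_lt_0_compat; lra]).
  destruct (Hu z e He') as [d1 [Hd1 h1]]. destruct (Hv z e He') as [d2 [Hd2 h2]].
  exists (Rmin d1 d2); split; [apply Rmin_pos; assumption|]. intros h Hh.
  specialize (h1 h (Rlt_le_trans _ _ _ Hh (Rmin_l _ _))).
  specialize (h2 h (Rlt_le_trans _ _ _ Hh (Rmin_r _ _))).
  match goal with |- Cmod ?a < _ => replace a with
    ((u (z+h) - u z) * v z + u z * (v (z+h) - v z) + (u (z+h) - u z) * (v (z+h) - v z))%C by ring end.
  eapply Rle_lt_trans; [apply Cmod_triangle|].
  eapply Rle_lt_trans; [apply Rplus_le_compat_r, Cmod_triangle|]. rewrite !Cmod_mult.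
  assert (a := Cmod_ge_0 (u z)); assert (b := Cmod_ge_0 (v z)).
  assert (c := Cmod_ge_0 (u (z+h)%C - u z)); assert (d := Cmod_ge_0 (v (z+h)%C - v z)).
  assert (e1 : e <= 1) by apply Rmin_l.
  assert (e2 : e * (3 * A) <= eps).
  { assert (M : e <= eps / (3 * A)) by apply Rmin_r. apply (Rmult_le_compat_r (3*A)) in M; [|lra].
    replace (eps / (3 * A) * (3 * A)) with eps in M by (field; lra). exact M. }
  assert (Cmod (u (z+h)%C - u z) * Cmod (v z) <= e * Cmod (v z)) by (apply Rmult_le_compat_r; lra).
  assert (Cmod (u z) * Cmod (v (z+h)%C - v z) <= Cmod (u z) * e) by (apply Rmult_le_compat_l; lra).
  assert (Cmod (u (z+h)%C - u z) * Cmod (v (z+h)%C - v z) <= e * 1) by (apply Rmult_le_compat; lra).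
  assert (e * A <= eps / 3) by lra. unfold A in *. nra.
Qed.
Lemma contC_Cmod u : contC u -> contC (fun z => RtoC (Cmod (u z))).
Proof.
  intros Hu z eps He. destruct (Hu z eps He) as [d [Hd Hh]]. exists d; split; [assumption|].
  intros h Hlt. specialize (Hh h Hlt). rewrite <- RtoC_minus, Cmod_R. eapply Rle_lt_trans; [|exact Hh].
  apply Rabs_le. split.
  - assert (T := Cmod_triangle_rev (u z) (u (z+h)%C)). rewrite Cmod_minus_sym in T. lra.
  - apply Cmod_triangle_rev.
Qed.

(** * Iterated integrals *)

Definition cont2 (G : R -> R -> R) : Prop := forall x y, continuity_2d_pt G x y.

Lemma cont2_ext G H : (forall x y, G x y = H x y) -> cont2 G -> cont2 H.
Proof. intros E HG x y. apply (continuity_2d_pt_ext G); auto. Qed.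
Lemma cont2_plus G H : cont2 G -> cont2 H -> cont2 (fun x y => G x y + H x y).
Proof. intros a b x y. apply continuity_2d_pt_plus; auto. Qed.
Lemma cont2_mult G H : cont2 G -> cont2 H -> cont2 (fun x y => G x y * H x y).
Proof. intros a b x y. apply continuity_2d_pt_mult; auto. Qed.
Lemma cont2_const c : cont2 (fun _ _ => c).
Proof. intros x y. apply continuity_2d_pt_const. Qed.
Lemma cont2_scal c G : cont2 G -> cont2 (fun x y => c * G x y).
Proof. intros. apply cont2_mult; [apply cont2_const | assumption]. Qed.
Lemma cont2_abs G : cont2 G -> cont2 (fun x y => Rabs (G x y)).
Proof.
  intros H x y. apply (continuity_1d_2d_pt_comp Rabs G); [|apply H].
  apply Rcontinuity_abs.
Qed.
Lemma cont2_x (g : R -> R) : (forall x, continuous g x) -> cont2 (fun x _ => g x).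
Proof.
  intros H x y. apply (continuity_1d_2d_pt_comp g (fun u _ => u)).
  - apply continuity_pt_filterlim, H.
  - apply continuity_2d_pt_id1.
Qed.
Lemma cont2_y (g : R -> R) : (forall x, continuous g x) -> cont2 (fun _ y => g y).
Proof.
  intros H x y. apply (continuity_1d_2d_pt_comp g (fun _ v => v)).
  - apply continuity_pt_filterlim, H.
  - apply continuity_2d_pt_id2.
Qed.

Lemma cont2_section G x y : cont2 G -> continuous (G x) y.
Proof.
  intros H. apply continuity_pt_filterlim. intros eps He.
  destruct (H x y (mkposreal eps He)) as [d Hd].
  exists d; split; [apply d|]. intros y' [_ Hy]. apply Hd; [|exact Hy].
  rewrite Rminus_eq_0, Rabs_R0. apply d.
Qed.
Lemma cont2_ex_RInt G x c d : cont2 G -> ex_RInt (G x) c d.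
Proof. intros H. apply (ex_RInt_continuous (V:=R_CompleteNormedModule)). intros; apply cont2_section, H. Qed.

(** Uniform continuity on the compact strip of half-width 1 around [x] controls the inner integrand
    for all arguments at once. The case [d < c] is reduced to the other one by swapping the
    bounds. *)
Lemma cont2_RInt G c d x : cont2 G -> continuous (fun x => RInt (G x) c d) x.
Proof.
  intros H.
  assert (K : forall c d, c <= d -> continuous (fun x => RInt (G x) c d) x).
  { clear c d. intros c d L. apply continuity_pt_filterlim. intros eps He.
    assert (He' : 0 < eps / (2 * (d - c + 1))) by (apply Rdiv_lt_0_compat; lra).
    destruct (uniform_continuity_2d G (x - 1) (x + 1) c d (fun x y _ _ => H x y) (mkposreal _ He')) as [dl Hd].
    exists (Rmin 1 dl); split; [apply Rmin_pos; [lra | apply dl]|].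
    intros x' [_ Hx']. simpl in *. unfold Rdist in *.
    assert (H1 : Rabs (x' - x) < 1) by (eapply Rlt_le_trans; [exact Hx' | apply Rmin_l]).
    assert (H2 : Rabs (x' - x) < dl) by (eapply Rlt_le_trans; [exact Hx' | apply Rmin_r]).
    apply Rabs_def2 in H1.
    replace (RInt (G x') c d - RInt (G x) c d) with (RInt (fun t => G x' t - G x t) c d)
      by (apply (RInt_minus (V:=R_CompleteNormedModule) (G x') (G x) c d); apply cont2_ex_RInt; exact H).
    eapply Rle_lt_trans; [apply (abs_RInt_le_const _ c d (eps / (2 * (d - c + 1))) L)|].
    - apply (ex_RInt_minus (V:=R_NormedModule) (G x') (G x)); apply cont2_ex_RInt; exact H.
    - intros t Ht. left. apply (Hd x t x' t); try lra.
      rewrite Rminus_eq_0, Rabs_R0. apply dl.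
    - apply Rle_lt_trans with ((d - c + 1) * (eps / (2 * (d - c + 1)))).
      + apply Rmult_le_compat_r; lra.
      + replace ((d - c + 1) * (eps / (2 * (d - c + 1)))) with (eps / 2) by (field; lra). lra. }
  destruct (Rle_dec c d) as [L|L]; [apply K, L|].
  apply (continuous_ext (fun x => opp (RInt (G x) d c))).
  - intros t. rewrite (opp_RInt_swap (V:=R_CompleteNormedModule)); [reflexivity | apply cont2_ex_RInt, H].
  - apply (continuous_opp (fun x => RInt (G x) d c)). apply K; lra.
Qed.

Definition II (G : R -> R -> R) a b c d : R := RInt (fun x => RInt (G x) c d) a b.

Lemma II_ex G a b c d : cont2 G -> ex_RInt (fun x => RInt (G x) c d) a b.
Proof. intros H. apply (ex_RInt_continuous (V:=R_CompleteNormedModule)). intros; apply cont2_RInt, H. Qed.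
Lemma II_ext G H a b c d :
  (forall x y, Rmin a b <= x <= Rmax a b -> Rmin c d <= y <= Rmax c d -> G x y = H x y) ->
  II G a b c d = II H a b c d.
Proof.
  intros E. apply RInt_ext. intros x Hx. apply RInt_ext. intros y Hy. apply E; lra.
Qed.
Lemma II_plus G H a b c d : cont2 G -> cont2 H ->
  II (fun x y => G x y + H x y) a b c d = II G a b c d + II H a b c d.
Proof.
  intros HG HH. unfold II.
  rewrite <- (RInt_plus (V:=R_CompleteNormedModule)) by (apply II_ex; assumption).
  apply RInt_ext. intros x _.
  rewrite <- (RInt_plus (V:=R_CompleteNormedModule)) by (apply cont2_ex_RInt; assumption).
  reflexivity.
Qed.
Lemma II_scal k G a b c d : cont2 G ->
  II (fun x y => k * G x y) a b c d = k * II G a b c d.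
Proof.
  intros HG. unfold II.
  rewrite <- (RInt_scal (V:=R_CompleteNormedModule)) by (apply II_ex; assumption).
  apply RInt_ext. intros x _.
  rewrite <- (RInt_scal (V:=R_CompleteNormedModule)) by (apply cont2_ex_RInt; assumption).
  reflexivity.
Qed.
Lemma II_le G H a b c d : a <= b -> c <= d -> cont2 G -> cont2 H ->
  (forall x y, a <= x <= b -> c <= y <= d -> G x y <= H x y) -> II G a b c d <= II H a b c d.
Proof.
  intros L1 L2 HG HH E. apply RInt_le; auto using II_ex.
  intros x Hx. apply RInt_le; auto using cont2_ex_RInt. intros y Hy. apply E; lra.
Qed.
Lemma II_const k a b c d : II (fun _ _ => k) a b c d = (b - a) * ((d - c) * k).
Proof.
  unfold II. rewrite (RInt_ext _ (fun _ => (d - c) * k)).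
  - rewrite RInt_const. reflexivity.
  - intros. rewrite RInt_const. reflexivity.
Qed.
Lemma II_ge_0 G a b c d : a <= b -> c <= d -> cont2 G ->
  (forall x y, a <= x <= b -> c <= y <= d -> 0 <= G x y) -> 0 <= II G a b c d.
Proof.
  intros L1 L2 HG E. replace 0 with (II (fun _ _ => 0) a b c d) by (rewrite II_const; ring).
  apply II_le; auto. apply cont2_const.
Qed.
Lemma II_abs G a b c d : a <= b -> c <= d -> cont2 G ->
  Rabs (II G a b c d) <= II (fun x y => Rabs (G x y)) a b c d.
Proof.
  intros L1 L2 HG. apply Rabs_le. split.
  - rewrite <- (Rmult_1_l (II (fun x y => Rabs (G x y)) a b c d)), <- Ropp_mult_distr_l_reverse.
    rewrite <- II_scal by (apply cont2_abs, HG).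
    apply II_le; auto using cont2_scal, cont2_abs. intros x y _ _.
    assert (T := Rle_abs (- G x y)). rewrite Rabs_Ropp in T. lra.
  - apply II_le; auto using cont2_abs. intros; apply Rle_abs.
Qed.

Lemma II_Chasles_x G a b e c d : cont2 G -> II G a b c d + II G b e c d = II G a e c d.
Proof. intros H. apply (RInt_Chasles (V:=R_CompleteNormedModule)); apply II_ex, H. Qed.
Lemma II_Chasles_y G a b c d e : cont2 G -> II G a b c d + II G a b d e = II G a b c e.
Proof.
  intros H. unfold II.
  rewrite <- (RInt_plus (V:=R_CompleteNormedModule)) by (apply II_ex; assumption).
  apply RInt_ext. intros x _. apply (RInt_Chasles (V:=R_CompleteNormedModule)); apply cont2_ex_RInt, H.
Qed.
Lemma II_sub G a b c d a' b' c' d' : cont2 G -> (forall x y, 0 <= G x y) ->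
  a' <= a -> a <= b -> b <= b' -> c' <= c -> c <= d -> d <= d' -> II G a b c d <= II G a' b' c' d'.
Proof.
  intros H P h1 h2 h3 h4 h5 h6.
  rewrite <- (II_Chasles_x G a' a b') by assumption.
  rewrite <- (II_Chasles_x G a b b') by assumption.
  rewrite <- (II_Chasles_y G a b c' c d') by assumption.
  rewrite <- (II_Chasles_y G a b c d d') by assumption.
  assert (N : forall a b c d, a <= b -> c <= d -> 0 <= II G a b c d) by (intros; apply II_ge_0; auto).
  assert (A1 := N a' a c' d' ltac:(lra) ltac:(lra)). assert (A2 := N b b' c' d' ltac:(lra) ltac:(lra)).
  assert (A3 := N a b c' c ltac:(lra) ltac:(lra)). assert (A4 := N a b d d' ltac:(lra) ltac:(lra)). lra.
Qed.

(** One half of Stokes: only boundary values of [H] survive, so the bound grows with the length of a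
    side and not with the area. Decay of [H] faster than the inverse of that length makes it
    negligible. *)
Lemma II_deriv_y G H a b c d M : a <= b -> c <= d -> cont2 G ->
  (forall x y, is_derive (fun y => H x y) y (G x y)) ->
  (forall x, a <= x <= b -> Rabs (H x c) <= M /\ Rabs (H x d) <= M) ->
  Rabs (II G a b c d) <= (b - a) * (2 * M).
Proof.
  intros L1 L2 HG D B. unfold II. apply abs_RInt_le_const; [assumption | apply II_ex, HG|].
  intros x Hx. destruct (B x Hx) as [B1 B2].
  replace (RInt (G x) c d) with (H x d - H x c).
  - eapply Rle_trans; [apply Rabs_triang|]. rewrite Rabs_Ropp. lra.
  - symmetry. apply is_RInt_unique.
    apply (is_RInt_derive (V:=R_CompleteNormedModule) (H x) (G x) c d); intros; [apply D | apply cont2_section, HG].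
Qed.

(** The derivative is now in the outer variable, hence the differentiation under the integral
    sign. *)
Lemma II_deriv_x G H a b c d M : a <= b -> c <= d -> cont2 G -> cont2 H ->
  (forall x y, is_derive (fun x => H x y) x (G x y)) ->
  (forall y, c <= y <= d -> Rabs (H a y) <= M /\ Rabs (H b y) <= M) ->
  Rabs (II G a b c d) <= (d - c) * (2 * M).
Proof.
  intros L1 L2 HG HH D B.
  assert (E : is_RInt (fun x => RInt (G x) c d) a b (RInt (H b) c d - RInt (H a) c d)).
  { apply (is_RInt_derive (V:=R_CompleteNormedModule) (fun x => RInt (H x) c d) (fun x => RInt (G x) c d) a b).
    - intros x _.
      assert (E : forall x y, Derive (fun u => H u y) x = G x y) by (intros; apply is_derive_unique, D).
      rewrite (RInt_ext (G x) (fun t => Derive (fun u => H u t) x)).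
      2:{ intros. rewrite E. reflexivity. }
      apply (is_derive_RInt_param H c d x).
      + exists (mkposreal 1 Rlt_0_1). intros; eexists; apply D.
      + intros t _. apply (continuity_2d_pt_ext G); [intros; rewrite E; reflexivity | apply HG].
      + exists (mkposreal 1 Rlt_0_1). intros; apply cont2_ex_RInt, HH.
    - intros; apply cont2_RInt, HG. }
  apply is_RInt_unique in E. unfold II. rewrite E.
  assert (A1 : Rabs (RInt (H a) c d) <= (d - c) * M)
    by (apply abs_RInt_le_const; [lra | apply cont2_ex_RInt, HH | intros t Ht; apply (B t Ht)]).
  assert (A2 : Rabs (RInt (H b) c d) <= (d - c) * M)
    by (apply abs_RInt_le_const; [lra | apply cont2_ex_RInt, HH | intros t Ht; apply (B t Ht)]).
  eapply Rle_trans; [apply Rabs_triang|]. rewrite Rabs_Ropp. lra.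
Qed.

(** * Complex-valued functions of a real variable *)

Definition RD (F : R -> C) (t : R) (l : C) : Prop :=
  is_derive (fun t => fst (F t)) t (fst l) /\ is_derive (fun t => snd (F t)) t (snd l).

Definition contRC (F : R -> C) : Prop :=
  forall t, continuous (fun t => fst (F t)) t /\ continuous (fun t => snd (F t)) t.

Definition CI (F : R -> C) (a b : R) : C :=
  (RInt (fun t => fst (F t)) a b, RInt (fun t => snd (F t)) a b).

Lemma contRC_ex1 F a b : contRC F -> ex_RInt (fun t => fst (F t)) a b.
Proof. intros H. apply (ex_RInt_continuous (V:=R_CompleteNormedModule)). intros; apply H. Qed.
Lemma contRC_ex2 F a b : contRC F -> ex_RInt (fun t => snd (F t)) a b.
Proof. intros H. apply (ex_RInt_continuous (V:=R_CompleteNormedModule)). intros; apply H. Qed.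

Lemma cont_RC F : (forall t eps, 0 < eps -> exists d, 0 < d /\ forall t', Rabs (t' - t) < d -> Cmod (F t' - F t)%C < eps) -> contRC F.
Proof.
  intros H t. split; apply continuity_pt_filterlim; intros eps He;
  (destruct (H t eps He) as [d [Hd Hh]]; exists d; split; [exact Hd|]; intros t' [_ Ht]; simpl in *; unfold Rdist in *;
   specialize (Hh t' Ht); eapply Rle_lt_trans; [|exact Hh]).
  - apply (fst_le_Cmod (F t' - F t)%C).
  - apply (snd_le_Cmod (F t' - F t)%C).
Qed.

Lemma contC_line u a b : contC u -> contRC (fun t => u (a + RtoC t * b)%C).
Proof.
  intros H. apply cont_RC. intros t eps He. destruct (H (a + RtoC t * b)%C eps He) as [d [Hd Hh]].
  assert (B := Cmod_ge_0 b).
  exists (d / (Cmod b + 1)). split; [apply Rdiv_lt_0_compat; lra|]. intros t' Ht.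
  replace (a + RtoC t' * b)%C with (a + RtoC t * b + RtoC (t' - t) * b)%C by (rewrite RtoC_minus; ring).
  apply Hh. rewrite Cmod_mult, Cmod_R. apply Rlt_div_r in Ht; [|lra].
  assert (P := Rabs_pos (t' - t)). nra.
Qed.

Lemma CI_ext F G a b : (forall t, Rmin a b < t < Rmax a b -> F t = G t) -> CI F a b = CI G a b.
Proof. intros E. unfold CI. f_equal; apply RInt_ext; intros t Ht; rewrite E; auto. Qed.
Lemma CI_plus F G a b : contRC F -> contRC G -> CI (fun t => F t + G t)%C a b = (CI F a b + CI G a b)%C.
Proof.
  intros HF HG. apply C_ext; simpl;
  [apply (RInt_plus (V:=R_CompleteNormedModule) (fun t => fst (F t)) (fun t => fst (G t)))
  |apply (RInt_plus (V:=R_CompleteNormedModule) (fun t => snd (F t)) (fun t => snd (G t)))];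
  auto using contRC_ex1, contRC_ex2.
Qed.
Lemma CI_scal k F a b : contRC F -> CI (fun t => k * F t)%C a b = (k * CI F a b)%C.
Proof.
  intros HF. assert (E1 := contRC_ex1 F a b HF). assert (E2 := contRC_ex2 F a b HF).
  assert (S1 : forall r, ex_RInt (fun t => r * fst (F t)) a b) by (intros; apply (ex_RInt_scal (V:=R_NormedModule)), E1).
  assert (S2 : forall r, ex_RInt (fun t => r * snd (F t)) a b) by (intros; apply (ex_RInt_scal (V:=R_NormedModule)), E2).
  assert (T1 : forall r, RInt (fun t => r * fst (F t)) a b = r * RInt (fun t => fst (F t)) a b)
    by (intros; apply (RInt_scal (V:=R_CompleteNormedModule)), E1).
  assert (T2 : forall r, RInt (fun t => r * snd (F t)) a b = r * RInt (fun t => snd (F t)) a b)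
    by (intros; apply (RInt_scal (V:=R_CompleteNormedModule)), E2).
  apply C_ext; simpl; rewrite <- T1, <- T2.
  - apply (RInt_minus (V:=R_CompleteNormedModule)); auto.
  - apply (RInt_plus (V:=R_CompleteNormedModule)); auto.
Qed.
Lemma contRC_plus F G : contRC F -> contRC G -> contRC (fun t => F t + G t)%C.
Proof.
  intros HF HG t. destruct (HF t), (HG t). split; simpl.
  - apply (continuous_plus (V:=R_NormedModule)); assumption.
  - apply (continuous_plus (V:=R_NormedModule)); assumption.
Qed.
Lemma contRC_mult F G : contRC F -> contRC G -> contRC (fun t => F t * G t)%C.
Proof.
  intros HF HG t. destruct (HF t), (HG t). split; simpl.
  - apply (continuous_minus (V:=R_NormedModule));
    apply (continuous_mult (K:=R_AbsRing)); assumption.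
  - apply (continuous_plus (V:=R_NormedModule));
    apply (continuous_mult (K:=R_AbsRing)); assumption.
Qed.
Lemma contRC_const k : contRC (fun _ => k).
Proof. intros t; split; apply continuous_const. Qed.
Lemma contRC_ext F G : (forall t, F t = G t) -> contRC F -> contRC G.
Proof.
  intros E H t; split; [apply (continuous_ext (fun t => fst (F t))) | apply (continuous_ext (fun t => snd (F t)))];
  try apply H; intros; rewrite E; reflexivity.
Qed.
Lemma contRC_R (g : R -> R) : (forall t, continuous g t) -> contRC (fun t => RtoC (g t)).
Proof. intros H t; split; simpl; [apply H | apply continuous_const]. Qed.
(** The factor 2 is the price of treating the two components separately; later constants only have
    to exist. *)
Lemma CI_bound F a b M : a <= b -> contRC F -> (forall t, a <= t <= b -> Cmod (F t) <= M) ->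
  Cmod (CI F a b) <= 2 * M * (b - a).
Proof.
  intros L HF B. eapply Rle_trans; [apply Cmod_le_sum|]. simpl.
  assert (A1 : Rabs (RInt (fun t => fst (F t)) a b) <= (b - a) * M).
  { apply abs_RInt_le_const; [lra | apply contRC_ex1, HF|]. intros t Ht.
    eapply Rle_trans; [apply fst_le_Cmod | apply B, Ht]. }
  assert (A2 : Rabs (RInt (fun t => snd (F t)) a b) <= (b - a) * M).
  { apply abs_RInt_le_const; [lra | apply contRC_ex2, HF|]. intros t Ht.
    eapply Rle_trans; [apply snd_le_Cmod | apply B, Ht]. }
  lra.
Qed.
Lemma CI_Chasles F a b c : contRC F -> (CI F a b + CI F b c)%C = CI F a c.
Proof.
  intros H. apply C_ext; simpl; apply (RInt_Chasles (V:=R_CompleteNormedModule)); auto using contRC_ex1, contRC_ex2.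
Qed.
Lemma CI_const k a b : CI (fun _ => k) a b = (RtoC (b - a) * k)%C.
Proof.
  apply C_ext; simpl; rewrite (RInt_const (V:=R_CompleteNormedModule)); unfold scal; simpl; unfold mult; simpl; ring.
Qed.
Lemma CI_derive F f a b : (forall t, RD F t (f t)) -> contRC f -> CI f a b = (F b - F a)%C.
Proof.
  intros D H. apply C_ext; simpl; apply is_RInt_unique.
  - apply (is_RInt_derive (V:=R_CompleteNormedModule) (fun t => fst (F t)) (fun t => fst (f t)));
    intros; [apply D | apply H].
  - apply (is_RInt_derive (V:=R_CompleteNormedModule) (fun t => snd (F t)) (fun t => snd (f t)));
    intros; [apply D | apply H].
Qed.
Lemma CI_shift F a b v : contRC F -> CI (fun t => F (t + v)) a b = CI F (a + v) (b + v).
Proof.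
  intros H. unfold CI. f_equal.
  - rewrite <- (Rmult_1_l a), <- (Rmult_1_l b), <- (RInt_comp_lin (V:=R_CompleteNormedModule) (fun t => fst (F t)) 1 v a b).
    + rewrite !Rmult_1_l. apply RInt_ext. intros t _. unfold scal; simpl; unfold mult; simpl. rewrite !Rmult_1_l. reflexivity.
    + apply contRC_ex1, H.
  - rewrite <- (Rmult_1_l a), <- (Rmult_1_l b), <- (RInt_comp_lin (V:=R_CompleteNormedModule) (fun t => snd (F t)) 1 v a b).
    + rewrite !Rmult_1_l. apply RInt_ext. intros t _. unfold scal; simpl; unfold mult; simpl. rewrite !Rmult_1_l. reflexivity.
    + apply contRC_ex2, H.
Qed.

Lemma is_derive_eps (g : R -> R) t l :
  (forall eps, 0 < eps -> exists d, 0 < d /\ forall k, Rabs k < d -> Rabs (g (t + k) - g t - l * k) <= eps * Rabs k) ->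
  is_derive g t l.
Proof.
  intros H. apply is_derive_Reals. intros eps He. destruct (H (eps / 2)) as [d [Hd Hk]]; [lra|].
  exists (mkposreal d Hd). intros k N Hkd. specialize (Hk k Hkd).
  replace ((g (t + k) - g t) / k - l) with ((g (t + k) - g t - l * k) / k) by (field; assumption).
  unfold Rdiv. rewrite Rabs_mult, Rabs_inv.
  assert (P : 0 < Rabs k) by (apply Rabs_pos_lt, N).
  apply Rmult_le_compat_r with (r := / Rabs k) in Hk; [|left; apply Rinv_0_lt_compat, P].
  rewrite Rmult_assoc, Rinv_r in Hk by lra. lra.
Qed.

Lemma WD_RD u a b t p q : WD u (a + RtoC t * b)%C p q ->
  RD (fun t => u (a + RtoC t * b)%C) t (p * b + q * Cconj b)%C.
Proof.
  intros H. set (B := Cmod b + 1). assert (HB : 0 < B) by (unfold B; assert (x := Cmod_ge_0 b); lra).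
  assert (K : forall eps, 0 < eps -> exists d, 0 < d /\ forall k, Rabs k < d ->
     Cmod (u (a + RtoC (t + k) * b) - u (a + RtoC t * b) - (p * b + q * Cconj b) * RtoC k)%C <= eps * Rabs k).
  { intros eps He. destruct (H (eps / B)) as [d [Hd Hh]]; [apply Rdiv_lt_0_compat; lra|].
    exists (d / B). split; [apply Rdiv_lt_0_compat; lra|]. intros k Hk.
    assert (P := Rabs_pos k). assert (Q := Cmod_ge_0 b).
    assert (L : Cmod (RtoC k * b) <= Rabs k * B) by (rewrite Cmod_mult, Cmod_R; unfold B; nra).
    assert (L2 : Cmod (RtoC k * b) < d).
    { eapply Rle_lt_trans; [exact L|]. apply Rlt_div_r in Hk; lra. }
    specialize (Hh _ L2).
    replace (a + RtoC (t + k) * b)%C with (a + RtoC t * b + RtoC k * b)%C by (rewrite RtoC_plus; ring).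
    rewrite Cconj_mult, Cconj_R in Hh.
    replace ((p * b + q * Cconj b) * RtoC k)%C with (p * (RtoC k * b) + q * (RtoC k * Cconj b))%C by ring.
    eapply Rle_trans; [exact Hh|].
    eapply Rle_trans; [apply Rmult_le_compat_l; [|exact L]|].
    - left; apply Rdiv_lt_0_compat; lra.
    - right. field. lra. }
  split; apply is_derive_eps; intros eps He; destruct (K eps He) as [d [Hd Hk]]; exists d; split; auto;
  intros k Hkd; specialize (Hk k Hkd); eapply Rle_trans; [|exact Hk| |exact Hk].
  - eapply Rle_trans; [|apply fst_le_Cmod]. right. f_equal. simpl. ring.
  - eapply Rle_trans; [|apply snd_le_Cmod]. right. f_equal. simpl. ring.
Qed.

Lemma contC_cont2 u w a b : contC u ->
  cont2 (fun s t => fst (u (w + RtoC s * a + RtoC t * b)%C)) /\ cont2 (fun s t => snd (u (w + RtoC s * a + RtoC t * b)%C)).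
Proof.
  intros H. assert (K : forall x y eps, 0 < eps -> exists d, 0 < d /\ forall x' y', Rabs (x' - x) < d -> Rabs (y' - y) < d ->
    Cmod (u (w + RtoC x' * a + RtoC y' * b) - u (w + RtoC x * a + RtoC y * b))%C < eps).
  { intros x y eps He. destruct (H (w + RtoC x * a + RtoC y * b)%C eps He) as [d [Hd Hh]].
    assert (A := Cmod_ge_0 a). assert (B := Cmod_ge_0 b).
    exists (d / (Cmod a + Cmod b + 1)). split; [apply Rdiv_lt_0_compat; lra|]. intros x' y' Hx Hy.
    replace (w + RtoC x' * a + RtoC y' * b)%C with
      (w + RtoC x * a + RtoC y * b + (RtoC (x' - x) * a + RtoC (y' - y) * b))%C by (rewrite !RtoC_minus; ring).
    apply Hh. eapply Rle_lt_trans; [apply Cmod_triangle|]. rewrite !Cmod_mult, !Cmod_R.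
    set (e := d / (Cmod a + Cmod b + 1)) in *.
    assert (E : e * (Cmod a + Cmod b + 1) = d) by (unfold e; field; lra).
    assert (0 < e) by (unfold e; apply Rdiv_lt_0_compat; lra).
    assert (Rabs (x' - x) * Cmod a <= e * Cmod a) by (apply Rmult_le_compat_r; lra).
    assert (Rabs (y' - y) * Cmod b <= e * Cmod b) by (apply Rmult_le_compat_r; lra). nra. }
  split; intros x y [eps He]; destruct (K x y eps He) as [d [Hd Hh]]; exists (mkposreal d Hd);
  intros x' y' Hx Hy; simpl in *; specialize (Hh x' y' Hx Hy); eapply Rle_lt_trans; [|exact Hh| |exact Hh].
  - apply (fst_le_Cmod (u _ - u _)%C).
  - apply (snd_le_Cmod (u _ - u _)%C).
Qed.

(** * Series of complex numbers *)

Fixpoint Csum (n : nat) (g : nat -> C) : C :=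
  match n with O => 0%C | S m => (Csum m g + g m)%C end.
Fixpoint Rsum (n : nat) (g : nat -> R) : R :=
  match n with O => 0 | S m => Rsum m g + g m end.

Lemma Csum_ext n f g : (forall k, (k < n)%nat -> f k = g k) -> Csum n f = Csum n g.
Proof. induction n; intros H; simpl; [reflexivity|]. rewrite IHn, H; auto. Qed.
Lemma Csum_plus n f g : Csum n (fun k => f k + g k)%C = (Csum n f + Csum n g)%C.
Proof. induction n; simpl; [ring | rewrite IHn; ring]. Qed.
Lemma Csum_scal n c f : Csum n (fun k => c * f k)%C = (c * Csum n f)%C.
Proof. induction n; simpl; [ring | rewrite IHn; ring]. Qed.
Lemma Csum_0 n : Csum n (fun _ => 0%C) = 0%C.
Proof. induction n; simpl; [reflexivity | rewrite IHn; ring]. Qed.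
Lemma Rsum_ext n f g : (forall k, (k < n)%nat -> f k = g k) -> Rsum n f = Rsum n g.
Proof. induction n; intros H; simpl; [reflexivity|]. rewrite IHn, H; auto. Qed.
Lemma Rsum_le n f g : (forall k, (k < n)%nat -> f k <= g k) -> Rsum n f <= Rsum n g.
Proof. induction n; intros H; simpl; [lra|]. assert (h := H n ltac:(lia)). assert (h2 := IHn ltac:(auto)). lra. Qed.
Lemma Rsum_plus n f g : Rsum n (fun k => f k + g k) = Rsum n f + Rsum n g.
Proof. induction n; simpl; [ring | rewrite IHn; ring]. Qed.
Lemma Rsum_scal n c f : Rsum n (fun k => c * f k) = c * Rsum n f.
Proof. induction n; simpl; [ring | rewrite IHn; ring]. Qed.
Lemma Rsum_const n c : Rsum n (fun _ => c) = INR n * c.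
Proof. induction n; [simpl; ring | rewrite S_INR; simpl Rsum; rewrite IHn; ring]. Qed.
Lemma Rsum_ge_0 n f : (forall k, (k < n)%nat -> 0 <= f k) -> 0 <= Rsum n f.
Proof. induction n; intros H; simpl; [lra|]. assert (h := H n ltac:(lia)). assert (h2 := IHn ltac:(auto)). lra. Qed.
Lemma Csum_mod n f : Cmod (Csum n f) <= Rsum n (fun k => Cmod (f k)).
Proof.
  induction n; simpl; [rewrite Cmod_0; lra|]. eapply Rle_trans; [apply Cmod_triangle|]. lra.
Qed.

(** [Series] is real and has a default value on divergent series, which is why most rules below
    carry a summable majorant of the moduli. *)
Definition CSer (a : nat -> C) : C := (Series (fun n => fst (a n)), Series (fun n => snd (a n))).

Section CSeries.
Variables (a : nat -> C) (b : nat -> R).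
Hypotheses (Hab : forall n, Cmod (a n) <= b n) (Hb : ex_series b).

Lemma CSer_ex1 : ex_series (fun n => fst (a n)).
Proof.
  apply (ex_series_le (V := R_CompleteNormedModule) _ b); [|exact Hb].
  intros n. eapply Rle_trans; [apply fst_le_Cmod | apply Hab].
Qed.
Lemma CSer_ex2 : ex_series (fun n => snd (a n)).
Proof.
  apply (ex_series_le (V := R_CompleteNormedModule) _ b); [|exact Hb].
  intros n. eapply Rle_trans; [apply snd_le_Cmod | apply Hab].
Qed.
Lemma CSer_bound : Cmod (CSer a) <= 2 * Series b.
Proof.
  eapply Rle_trans; [apply Cmod_le_sum|]. simpl.
  assert (A1 : Rabs (Series (fun n => fst (a n))) <= Series b).
  { eapply Rle_trans; [apply Series_Rabs|].
    - apply (ex_series_le (V := R_CompleteNormedModule) _ b); [|exact Hb]. intros n.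
      unfold norm; simpl; unfold abs; simpl. rewrite Rabs_Rabsolu.
      eapply Rle_trans; [apply fst_le_Cmod | apply Hab].
    - apply Series_le; [|exact Hb]. intros n. split; [apply Rabs_pos|].
      eapply Rle_trans; [apply fst_le_Cmod | apply Hab]. }
  assert (A2 : Rabs (Series (fun n => snd (a n))) <= Series b).
  { eapply Rle_trans; [apply Series_Rabs|].
    - apply (ex_series_le (V := R_CompleteNormedModule) _ b); [|exact Hb]. intros n.
      unfold norm; simpl; unfold abs; simpl. rewrite Rabs_Rabsolu.
      eapply Rle_trans; [apply snd_le_Cmod | apply Hab].
    - apply Series_le; [|exact Hb]. intros n. split; [apply Rabs_pos|].
      eapply Rle_trans; [apply snd_le_Cmod | apply Hab]. }
  lra.
Qed.
End CSeries.

Lemma CSer_ext a b : (forall n, a n = b n) -> CSer a = CSer b.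
Proof. intros E. unfold CSer. f_equal; apply Series_ext; intros; rewrite E; reflexivity. Qed.

Lemma CSer_plus a a' b b' : (forall n, Cmod (a n) <= b n) -> ex_series b ->
  (forall n, Cmod (a' n) <= b' n) -> ex_series b' ->
  CSer (fun n => a n + a' n)%C = (CSer a + CSer a')%C.
Proof.
  intros H1 H2 H3 H4. apply C_ext; simpl; apply Series_plus; eauto using CSer_ex1, CSer_ex2.
Qed.
Lemma CSer_scal k a b : (forall n, Cmod (a n) <= b n) -> ex_series b ->
  CSer (fun n => k * a n)%C = (k * CSer a)%C.
Proof.
  intros H1 H2. assert (E1 := CSer_ex1 a b H1 H2). assert (E2 := CSer_ex2 a b H1 H2).
  assert (S1 : forall r, ex_series (fun n => r * fst (a n))) by (intros; apply (ex_series_scal_l (K:=R_AbsRing) (V:=R_NormedModule)), E1).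
  assert (S2 : forall r, ex_series (fun n => r * snd (a n))) by (intros; apply (ex_series_scal_l (K:=R_AbsRing) (V:=R_NormedModule)), E2).
  apply C_ext; simpl; rewrite <- !Series_scal_l; [apply Series_minus | apply Series_plus]; auto.
Qed.
Lemma CSer_S a b : (forall n, Cmod (a n) <= b n) -> ex_series b ->
  CSer a = (a O + CSer (fun n => a (S n)))%C.
Proof.
  intros H1 H2. apply C_ext; simpl; (rewrite Series_incr_1; [reflexivity|]);
  [apply (CSer_ex1 a b) | apply (CSer_ex2 a b)]; assumption.
Qed.

(** The bound depends on the majorant only, hence is uniform over families with a common one;
    [cf_pser] and [ZS_fourier] integrate termwise on the strength of this. *)
Lemma CSer_tail a b N : (forall n, Cmod (a n) <= b n) -> ex_series b ->
  Cmod (CSer a - Csum N a)%C <= 2 * Series (fun n => b (N + n)%nat).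
Proof.
  revert a b. induction N; intros a b H1 H2; simpl.
  - replace (CSer a - 0)%C with (CSer a) by ring. apply CSer_bound; assumption.
  - assert (E : ex_series (fun n => b (S n))) by (apply (ex_series_incr_1 (V:=R_NormedModule) b), H2).
    assert (I := IHN (fun n => a (S n)) (fun n => b (S n)) (fun n => H1 (S n)) E). simpl in I.
    rewrite (CSer_S a b H1 H2).
    assert (F : forall m, (Csum m a + a m = a O + Csum m (fun n => a (S n)))%C).
    { induction m; simpl; [ring|]. rewrite IHm. ring. }
    rewrite F.
    match goal with |- Cmod ?x <= _ => replace x with (CSer (fun n => a (S n)) - Csum N (fun n => a (S n)))%C by ring end.
    exact I.
Qed.

Lemma Series_tail_lim b : ex_series b -> (forall n, 0 <= b n) -> forall eps, 0 < eps ->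
  exists N0, forall N, (N0 <= N)%nat -> 2 * Series (fun n => b (N + n)%nat) < eps.
Proof.
  intros H Hp eps He. destruct H as [l Hl]. assert (Hl' := Hl).
  apply is_series_Reals in Hl'. destruct (Hl' (eps / 2)) as [N0 HN]; [lra|].
  exists (S N0). intros N HNN.
  assert (Ex : ex_series b) by (exists l; exact Hl).
  assert (E := Series_incr_n b N ltac:(lia) Ex). rewrite (is_series_unique _ _ Hl) in E.
  specialize (HN (pred N) ltac:(lia)). rewrite E in HN. unfold Rdist in HN.
  apply Rabs_def2 in HN. lra.
Qed.

Lemma CSer_lim a b : (forall n, Cmod (a n) <= b n) -> ex_series b -> forall eps, 0 < eps ->
  exists N0, forall N, (N0 <= N)%nat -> Cmod (CSer a - Csum N a)%C < eps.
Proof.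
  intros H1 H2 eps He.
  destruct (Series_tail_lim b H2 (fun n => Rle_trans _ _ _ (Cmod_ge_0 _) (H1 n)) eps He) as [N0 HN].
  exists N0. intros N HNN. eapply Rle_lt_trans; [apply (CSer_tail a b N H1 H2) | apply HN, HNN].
Qed.

(** A quadratic remainder with a summable constant replaces uniform convergence of the derivatives:
    the summed remainder is at most a multiple of |h|^2. *)
Lemma WD_CSer (u v : nat -> C -> C) (b : nat -> R) z :
  ex_series b ->
  (forall k h, Cmod h <= 1 -> Cmod (u k (z + h)%C) <= b k) ->
  (forall k, Cmod (v k z) <= b k) ->
  (forall k h, Cmod h <= 1 -> Cmod (u k (z + h) - u k z - v k z * h)%C <= b k * Cmod h ^ 2) ->
  WD (fun w => CSer (fun k => u k w)) z (CSer (fun k => v k z)) 0.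
Proof.
  intros Hb H1 H2 H3 eps He.
  set (S := 2 * Series b + 1).
  assert (P : 0 <= Series b).
  { assert (T := CSer_bound (fun k => v k z) b H2 Hb). assert (T2 := Cmod_ge_0 (CSer (fun k => v k z))). lra. }
  exists (Rmin 1 (eps / S)). split; [apply Rmin_pos; [lra | apply Rdiv_lt_0_compat; unfold S; lra]|].
  intros h Hh.
  assert (h1 : Cmod h <= 1) by (left; eapply Rlt_le_trans; [exact Hh | apply Rmin_l]).
  assert (h2 : Cmod h < eps / S) by (eapply Rlt_le_trans; [exact Hh | apply Rmin_r]).
  assert (h0 := Cmod_ge_0 h).
  assert (Hz : forall k, Cmod (u k z) <= b k).
  { intros k. specialize (H1 k 0%C). rewrite Cplus_0_r in H1. apply H1. rewrite Cmod_0; lra. }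
  assert (E : CSer (fun k => u k (z + h) - u k z - v k z * h)%C =
     (CSer (fun k => u k (z + h)%C) - CSer (fun k => u k z) - CSer (fun k => v k z) * h)%C).
  { rewrite (CSer_ext _ (fun k => u k (z + h)%C + ((-(1)) * u k z + (- h) * v k z))%C) by (intros; simpl; ring).
    assert (D1 : forall n, Cmod (-(1) * u n z)%C <= b n).
    { intros n. rewrite Cmod_mult, Cmod_m1, Rmult_1_l. apply Hz. }
    assert (D2 : forall n, Cmod (- h * v n z)%C <= b n).
    { intros n. rewrite Cmod_mult, Cmod_opp. assert (Q := Cmod_ge_0 (v n z)). assert (T := H2 n). nra. }
    assert (bb : ex_series (fun n => b n + b n)) by (apply (ex_series_plus (V:=R_NormedModule) b b); exact Hb).
    rewrite (CSer_plus _ _ b (fun n => b n + b n)); auto.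
    2:{ intros n; eapply Rle_trans; [apply Cmod_triangle|]. assert (T1 := D1 n). assert (T2 := D2 n). lra. }
    rewrite (CSer_plus _ _ b b), (CSer_scal _ _ b), (CSer_scal _ _ b); auto. ring. }
  match goal with |- Cmod ?x <= _ => replace x with (CSer (fun k => u k (z + h) - u k z - v k z * h)%C) by (rewrite E; ring) end.
  eapply Rle_trans; [apply (CSer_bound _ (fun k => b k * Cmod h ^ 2))|].
  - intros k. apply H3, h1.
  - apply ex_series_scal_r, Hb.
  - rewrite Series_scal_r. assert (T : Cmod h * S <= eps).
    { left. apply Rlt_div_r in h2; [exact h2 | unfold S; lra]. }
    unfold S in T. simpl. nra.
Qed.

(** The remainders satisfy E(k+1) = (z + h) E(k) + k z^(k-1) h^2, and k^2 + k is at most (k +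
    1)^2. *)
Lemma pow_diff2 (z h : C) k : Cmod h <= 1 ->
  Cmod ((z + h) ^ k - z ^ k - INR k * z ^ (pred k) * h)%C <= INR k ^ 2 * (Cmod z + 1) ^ k * Cmod h ^ 2.
Proof.
  intros Hh. assert (h0 := Cmod_ge_0 h). assert (z0 := Cmod_ge_0 z).
  induction k.
  - simpl. replace (1 - 1 - 0 * 1 * h)%C with (RtoC 0) by ring. rewrite Cmod_0. lra.
  - set (E := ((z + h) ^ k - z ^ k - INR k * z ^ (pred k) * h)%C) in *.
    set (rho := Cmod z + 1) in *.
    replace ((z + h) ^ S k - z ^ S k - INR (S k) * z ^ pred (S k) * h)%C
      with ((z + h) * E + INR k * z ^ (pred k) * h ^ 2)%C.
    2:{ rewrite S_INR, RtoC_plus. unfold E. destruct k; simpl; ring. }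
    eapply Rle_trans; [apply Cmod_triangle|]. rewrite !Cmod_mult, !Cmod_pow, Cmod_R, (Rabs_pos_eq (INR k)) by apply pos_INR.
    assert (R1 : Cmod (z + h) <= rho) by (eapply Rle_trans; [apply Cmod_triangle | unfold rho; lra]).
    assert (P : 1 <= rho) by (unfold rho; lra).
    assert (Q : Cmod z ^ pred k <= rho ^ S k).
    { apply Rle_trans with (rho ^ pred k); [apply pow_incr; unfold rho; lra|]. apply Rle_pow; [lra | lia]. }
    assert (k0 := pos_INR k). assert (rk : 0 <= rho ^ S k) by (apply pow_le; lra).
    apply Rle_trans with (rho * (INR k ^ 2 * rho ^ k * Cmod h ^ 2) + INR k * rho ^ S k * Cmod h ^ 2).
    + apply Rplus_le_compat.
      * apply Rmult_le_compat; auto using Cmod_ge_0.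
      * apply Rmult_le_compat_r; [apply pow2_ge_0|]. apply Rmult_le_compat_l; assumption.
    + rewrite S_INR. replace (rho * (INR k ^ 2 * rho ^ k * Cmod h ^ 2)) with (INR k ^ 2 * rho ^ S k * Cmod h ^ 2) by (simpl; ring).
      assert (T : 0 <= rho ^ S k * Cmod h ^ 2) by (apply Rmult_le_pos; [assumption | apply pow2_ge_0]).
      nra.
Qed.

Lemma sqr_le_pow4 k : INR k ^ 2 <= 4 ^ k.
Proof.
  assert (H : INR k <= 2 ^ k).
  { induction k; [simpl; lra|]. rewrite S_INR. simpl. assert (1 <= 2 ^ k) by (apply pow_R1_Rle; lra). lra. }
  assert (k0 := pos_INR k). replace 4 with (2 * 2) by ring. rewrite Rpow_mult_distr. simpl. nra.
Qed.

(** * Power series with infinite radius of convergence *)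

Definition fastdec (a : nat -> C) : Prop := forall r, 0 < r -> exists M, forall k, Cmod (a k) * r ^ k <= M.

Lemma fastdec_dom a rho : fastdec a -> 1 <= rho ->
  exists M, 0 <= M /\ forall k, Cmod (a k) * ((INR k ^ 2 + INR k + 1) * rho ^ k) <= M * (/2) ^ k.
Proof.
  (* 8 is 4 times 2: the powers of 4 absorb the quadratic polynomial in k, those of 2 leave a
     geometric majorant. *)
  intros H Hr. destruct (H (8 * rho)) as [M HM]; [lra|].
  assert (M0 : 0 <= M).
  { specialize (HM O). simpl in HM. assert (Q := Cmod_ge_0 (a O)). lra. }
  exists (3 * M). split; [lra|]. intros k. specialize (HM k).
  rewrite Rpow_mult_distr in HM. replace 8 with (4 * 2) in HM by ring. rewrite Rpow_mult_distr in HM.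
  assert (S4 := sqr_le_pow4 k). assert (Q := Cmod_ge_0 (a k)).
  assert (rk : 0 < rho ^ k) by (apply pow_lt; lra). assert (t2 : 0 < 2 ^ k) by (apply pow_lt; lra).
  assert (t4 : 1 <= 4 ^ k) by (apply pow_R1_Rle; lra).
  rewrite pow_inv. apply Rmult_le_reg_r with (2 ^ k); [assumption|].
  replace (3 * M * / 2 ^ k * 2 ^ k) with (3 * M) by (field; lra).
  assert (INR k <= 4 ^ k).
  { destruct k; [simpl; lra|]. assert (1 <= INR (S k)) by (rewrite S_INR; assert (x := pos_INR k); lra). nra. }
  apply Rle_trans with (3 * (Cmod (a k) * (4 ^ k * 2 ^ k * rho ^ k))); [|lra].
  replace (Cmod (a k) * ((INR k ^ 2 + INR k + 1) * rho ^ k) * 2 ^ k) with (Cmod (a k) * (rho ^ k * 2 ^ k) * (INR k ^ 2 + INR k + 1)) by ring.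
  replace (3 * (Cmod (a k) * (4 ^ k * 2 ^ k * rho ^ k))) with (Cmod (a k) * (rho ^ k * 2 ^ k) * (3 * 4 ^ k)) by ring.
  apply Rmult_le_compat_l; [|lra]. apply Rmult_le_pos; [assumption|]. apply Rmult_le_pos; lra.
Qed.

Lemma ex_series_half M : ex_series (fun k => M * (/2) ^ k).
Proof.
  apply (ex_series_scal_l (K:=R_AbsRing) (V:=R_NormedModule)), ex_series_geom. rewrite Rabs_pos_eq; lra.
Qed.

Definition pser (a : nat -> C) (z : C) : C := CSer (fun k => a k * z ^ k)%C.

Lemma pser_dom a rho : fastdec a -> 1 <= rho ->
  exists b, ex_series b /\ forall z k, Cmod z <= rho -> Cmod (a k * z ^ k)%C <= b k.
Proof.
  intros H Hr. destruct (fastdec_dom a rho H Hr) as [M [M0 HM]].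
  exists (fun k => M * (/2) ^ k). split; [apply ex_series_half|].
  intros z k Hz. rewrite Cmod_mult, Cmod_pow. eapply Rle_trans; [|apply HM].
  apply Rmult_le_compat_l; [apply Cmod_ge_0|].
  assert (Cmod z ^ k <= rho ^ k) by (apply pow_incr; split; [apply Cmod_ge_0 | assumption]).
  assert (k0 := pos_INR k). assert (0 <= INR k ^ 2) by apply pow2_ge_0.
  assert (0 <= rho ^ k) by (apply pow_le; lra). nra.
Qed.

Definition shift_coef (a : nat -> C) (k : nat) : C := (INR (S k) * a (S k))%C.

Lemma WD_pser a z : fastdec a -> WD (pser a) z (pser (shift_coef a) z) 0.
Proof.
  intros H. assert (z0 := Cmod_ge_0 z).
  destruct (fastdec_dom a (Cmod z + 1) H) as [M [M0 HM]]; [lra|].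
  set (rho := Cmod z + 1) in *. assert (rho1 : 1 <= rho) by (unfold rho; lra).
  set (v := fun k w => (a k * (INR k * w ^ pred k))%C).
  assert (Hb : forall k, 0 <= INR k /\ 0 <= INR k ^ 2 /\ 0 < rho ^ k).
  { intros k. repeat split; [apply pos_INR | apply pow2_ge_0 | apply pow_lt; lra]. }
  assert (V : forall k, Cmod (v k z) <= M * (/2) ^ k).
  { intros k. unfold v. rewrite !Cmod_mult, Cmod_pow, Cmod_R. eapply Rle_trans; [|apply HM].
    apply Rmult_le_compat_l; [apply Cmod_ge_0|]. destruct (Hb k) as [b1 [b2 b3]].
    rewrite Rabs_pos_eq by assumption.
    assert (Cmod z ^ pred k <= rho ^ k).
    { apply Rle_trans with (rho ^ pred k); [apply pow_incr; unfold rho; lra | apply Rle_pow; [lra | lia]]. }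
    assert (0 <= Cmod z ^ pred k) by (apply pow_le; lra).
    assert (INR k * Cmod z ^ pred k <= INR k * rho ^ k) by (apply Rmult_le_compat_l; assumption). nra. }
  eapply WD_ext; [reflexivity | | reflexivity | apply (WD_CSer (fun k w => a k * w ^ k)%C v (fun k => M * (/2) ^ k) z)].
  - rewrite (CSer_S _ _ V (ex_series_half M)). unfold v at 1. simpl.
    unfold pser. replace (a O * (0 * 1))%C with (RtoC 0) by ring. rewrite Cplus_0_l.
    apply CSer_ext. intros n. unfold v, shift_coef. simpl pred. ring.
  - apply ex_series_half.
  - intros k h Hh. rewrite Cmod_mult, Cmod_pow. eapply Rle_trans; [|apply HM].
    apply Rmult_le_compat_l; [apply Cmod_ge_0|]. destruct (Hb k) as [b1 [b2 b3]].
    assert (Cmod (z + h) ^ k <= rho ^ k).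
    { apply pow_incr; split; [apply Cmod_ge_0|]. eapply Rle_trans; [apply Cmod_triangle | unfold rho; lra]. }
    nra.
  - exact V.
  - intros k h Hh. unfold v.
    replace (a k * (z + h) ^ k - a k * z ^ k - a k * (INR k * z ^ pred k) * h)%C
      with (a k * ((z + h) ^ k - z ^ k - INR k * z ^ (pred k) * h))%C by ring.
    rewrite Cmod_mult. eapply Rle_trans; [apply Rmult_le_compat_l; [apply Cmod_ge_0 | apply (pow_diff2 z h k Hh)]|].
    fold rho. rewrite <- Rmult_assoc. apply Rmult_le_compat_r; [apply pow2_ge_0|].
    eapply Rle_trans; [|apply HM]. apply Rmult_le_compat_l; [apply Cmod_ge_0|].
    destruct (Hb k) as [b1 [b2 b3]]. nra.
Qed.

Lemma fastdec_shift a : fastdec a -> fastdec (shift_coef a).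
Proof.
  intros H r Hr. destruct (fastdec_dom a (Rmax 1 r) H (Rmax_l _ _)) as [M [M0 HM]].
  exists (M / r). intros k. unfold shift_coef. rewrite Cmod_mult, Cmod_R, Rabs_pos_eq by apply pos_INR.
  apply (proj1 (Rle_div_r _ _ r Hr)). specialize (HM (S k)).
  assert (A := Cmod_ge_0 (a (S k))). assert (B := pos_INR (S k)).
  assert (C1 : r ^ S k <= Rmax 1 r ^ S k) by (apply pow_incr; split; [lra | apply Rmax_r]).
  assert (C2 : 0 <= r ^ S k) by (apply pow_le; lra).
  assert (C3 : (/2) ^ S k <= 1) by (rewrite <- (pow1 (S k)); apply pow_incr; lra).
  assert (C4 : 0 <= INR (S k) ^ 2) by apply pow2_ge_0.
  apply Rle_trans with (M * (/2) ^ S k); [|nra]. eapply Rle_trans; [|exact HM].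
  replace (INR (S k) * Cmod (a (S k)) * r ^ k * r) with (Cmod (a (S k)) * (INR (S k) * r ^ S k)) by (simpl pow; ring).
  apply Rmult_le_compat_l; [assumption|].
  apply Rmult_le_compat; try assumption. nra.
Qed.

Lemma entireC_pser a : fastdec a -> entireC (pser a).
Proof. intros H z. eexists. apply WD_pser, H. Qed.

(** * Goursat's theorem on rectangles *)

Definition hline (u : C -> C) (y x : R) : C := u (x, y).
Definition vline (u : C -> C) (x y : R) : C := u (x, y).

Lemma hline_eq u y x : hline u y x = u ((0, y) + RtoC x * 1)%C.
Proof. unfold hline. f_equal. csolve. Qed.
Lemma vline_eq u x y : vline u x y = u (RtoC x + RtoC y * Ci)%C.
Proof. unfold vline. f_equal. csolve. Qed.
Lemma contRC_hline u y : contC u -> contRC (hline u y).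
Proof. intros H. eapply contRC_ext; [|apply (contC_line u (0, y) 1 H)]. intros; symmetry; apply hline_eq. Qed.
Lemma contRC_vline u x : contC u -> contRC (vline u x).
Proof. intros H. eapply contRC_ext; [|apply (contC_line u (RtoC x) Ci H)]. intros; symmetry; apply vline_eq. Qed.

(** The integral of u dz along the boundary of the rectangle, counterclockwise; dz is i dy on the
    vertical sides. *)
Definition RI (u : C -> C) (a b c d : R) : C :=
  (CI (hline u c) a b - CI (hline u d) a b + Ci * (CI (vline u b) c d - CI (vline u a) c d))%C.

Lemma RI_split u a m b c e d : contC u ->
  RI u a b c d = (RI u a m c e + RI u m b c e + RI u a m e d + RI u m b e d)%C.
Proof.
  intros H. unfold RI.
  rewrite <- (CI_Chasles (hline u c) a m b), <- (CI_Chasles (hline u d) a m b),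
    <- (CI_Chasles (vline u a) c e d), <- (CI_Chasles (vline u b) c e d)
    by auto using contRC_hline, contRC_vline.
  ring.
Qed.

Lemma RI_prim u U a b c d : contC u -> (forall z, WD U z (u z) 0) -> RI u a b c d = 0%C.
Proof.
  intros H D. unfold RI.
  assert (Hh : forall y, CI (hline u y) a b = (U (b, y) - U (a, y))%C).
  { intros y. apply (CI_derive (hline U y)); [|apply contRC_hline, H]. intros t.
    assert (E := WD_RD U (0, y) 1 t _ _ (D _)).
    replace (u ((0, y) + RtoC t * 1)%C * 1 + 0 * Cconj 1)%C with (hline u y t) in E by (rewrite hline_eq; ring).
    destruct E as [E1 E2]. split.
    - eapply is_derive_ext; [|exact E1]. intros; simpl. rewrite hline_eq. reflexivity.
    - eapply is_derive_ext; [|exact E2]. intros; simpl. rewrite hline_eq. reflexivity. }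
  assert (Hv : forall x, (Ci * CI (vline u x) c d = U (x, d) - U (x, c))%C).
  { intros x. rewrite <- CI_scal by (apply contRC_vline, H).
    apply (CI_derive (vline U x)).
    - intros t. assert (E := WD_RD U (RtoC x) Ci t _ _ (D _)).
      replace (u (RtoC x + RtoC t * Ci)%C * Ci + 0 * Cconj Ci)%C with (Ci * vline u x t)%C in E by (rewrite vline_eq; ring).
      destruct E as [E1 E2]. split.
      + eapply is_derive_ext; [|exact E1]. intros; simpl. rewrite vline_eq. reflexivity.
      + eapply is_derive_ext; [|exact E2]. intros; simpl. rewrite vline_eq. reflexivity.
    - apply contRC_mult; [apply contRC_const | apply contRC_vline, H]. }
  replace (Ci * (CI (vline u b) c d - CI (vline u a) c d))%C with
    (Ci * CI (vline u b) c d - Ci * CI (vline u a) c d)%C by ring.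
  rewrite !Hh, !Hv. ring.
Qed.

Lemma RI_ext u v a b c d : (forall z, u z = v z) -> RI u a b c d = RI v a b c d.
Proof. intros E. replace v with u; [reflexivity | apply functional_extensionality, E]. Qed.

Lemma RI_plus u v a b c d : contC u -> contC v -> RI (fun z => u z + v z)%C a b c d = (RI u a b c d + RI v a b c d)%C.
Proof.
  intros Hu Hv. unfold RI.
  assert (E1 : forall y, CI (hline (fun z => u z + v z)%C y) a b = (CI (hline u y) a b + CI (hline v y) a b)%C)
    by (intros; apply CI_plus; apply contRC_hline; assumption).
  assert (E2 : forall y, CI (vline (fun z => u z + v z)%C y) c d = (CI (vline u y) c d + CI (vline v y) c d)%C)
    by (intros; apply CI_plus; apply contRC_vline; assumption).
  rewrite !E1, !E2. ring.
Qed.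

Lemma RI_bound u a b c d M : a <= b -> c <= d -> contC u ->
  (forall x y, a <= x <= b -> c <= y <= d -> Cmod (u (x, y)) <= M) ->
  Cmod (RI u a b c d) <= 4 * M * ((b - a) + (d - c)).
Proof.
  intros L1 L2 H B. unfold RI.
  eapply Rle_trans; [apply Cmod_triangle|]. rewrite Cmod_mult, Cmod_Ci.
  assert (B1 : forall y, c <= y <= d -> Cmod (CI (hline u y) a b) <= 2 * M * (b - a))
    by (intros; apply CI_bound; [assumption | apply contRC_hline, H | intros; apply B; assumption]).
  assert (B2 : forall x, a <= x <= b -> Cmod (CI (vline u x) c d) <= 2 * M * (d - c))
    by (intros; apply CI_bound; [assumption | apply contRC_vline, H | intros; apply B; assumption]).
  assert (T1 := Cmod_triangle' (CI (hline u c) a b) (CI (hline u d) a b)).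
  assert (T2 := Cmod_triangle' (CI (vline u b) c d) (CI (vline u a) c d)).
  assert (X1 := B1 c ltac:(lra)). assert (X2 := B1 d ltac:(lra)).
  assert (X3 := B2 a ltac:(lra)). assert (X4 := B2 b ltac:(lra)). lra.
Qed.

Section Goursat.
Variables (f : C -> C) (a0 c0 w h : R).
Hypotheses (Hf : entireC f) (Hw : 0 < w) (Hh : 0 < h).

Let Q (k : nat) (p : R * R) : R :=
  Cmod (RI f (fst p) (fst p + w / 2 ^ k) (snd p) (snd p + h / 2 ^ k)).

Let nxt (k : nat) (p p' : R * R) : Prop :=
  (fst p' = fst p \/ fst p' = fst p + w / 2 ^ S k) /\
  (snd p' = snd p \/ snd p' = snd p + h / 2 ^ S k) /\ Q k p <= 4 * Q (S k) p'.

Lemma goursat_step k p : exists p', nxt k p p'.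
Proof.
  destruct p as [a c]. assert (Hc := entireC_cont f Hf).
  assert (P2 : 0 < 2 ^ k) by (apply pow_lt; lra).
  set (w' := w / 2 ^ S k). set (h' := h / 2 ^ S k).
  assert (Ew : w / 2 ^ k = w' + w') by (unfold w'; simpl; field; lra).
  assert (Eh : h / 2 ^ k = h' + h') by (unfold h'; simpl; field; lra).
  assert (E := RI_split f a (a + w') (a + w / 2 ^ k) c (c + h') (c + h / 2 ^ k) Hc).
  rewrite Ew, Eh, <- !Rplus_assoc in E.
  assert (T : Q k (a, c) <= Q (S k) (a, c) + Q (S k) (a + w', c) + Q (S k) (a, c + h') + Q (S k) (a + w', c + h')).
  { unfold Q; simpl fst; simpl snd. fold w' h'. rewrite Ew, Eh, <- !Rplus_assoc, E.
    eapply Rle_trans; [apply Cmod_triangle|]. apply Rplus_le_compat_r.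
    eapply Rle_trans; [apply Cmod_triangle|]. apply Rplus_le_compat_r. apply Cmod_triangle. }
  destruct (Rle_dec (Q k (a, c)) (4 * Q (S k) (a, c))) as [L1|L1]; [exists (a, c); unfold nxt; simpl fst; simpl snd; auto|].
  destruct (Rle_dec (Q k (a, c)) (4 * Q (S k) (a + w', c))) as [L2|L2]; [exists (a + w', c); unfold nxt; simpl fst; simpl snd; auto|].
  destruct (Rle_dec (Q k (a, c)) (4 * Q (S k) (a, c + h'))) as [L3|L3]; [exists (a, c + h'); unfold nxt; simpl fst; simpl snd; auto|].
  exists (a + w', c + h'). unfold nxt; simpl fst; simpl snd. repeat split; auto. lra.
Qed.

(** Lower left corners of nested rectangles with halved sides, each chosen to carry at least a
    quarter of the previous boundary integral. *)
Let seqG : nat -> R * R := fix s k := match k with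
  O => (a0, c0) | S j => epsilon (inhabits (a0, c0)) (nxt j (s j)) end.

Lemma seqG_nxt k : nxt k (seqG k) (seqG (S k)).
Proof. simpl. apply epsilon_spec, goursat_step. Qed.

Lemma nested_point (x : nat -> R) (l : R) : 0 < l ->
  (forall k, x (S k) = x k \/ x (S k) = x k + l / 2 ^ S k) ->
  exists x0, forall k, x k <= x0 <= x k + l / 2 ^ k.
Proof.
  intros Hl Hx.
  assert (P : forall k, 0 < l / 2 ^ k) by (intros; apply Rdiv_lt_0_compat; [lra | apply pow_lt; lra]).
  assert (E : forall k, l / 2 ^ k = l / 2 ^ S k + l / 2 ^ S k).
  { intros k. simpl. field. apply pow_nonzero; lra. }
  assert (Up : forall k j, x k <= x (k + j)%nat).
  { intros k j; induction j; [rewrite Nat.add_0_r; lra|]. rewrite Nat.add_succ_r.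
    specialize (P (S (k + j))). destruct (Hx (k + j)%nat); lra. }
  assert (Dn : forall k j, x (k + j)%nat + l / 2 ^ (k + j) <= x k + l / 2 ^ k).
  { intros k j; induction j; [rewrite Nat.add_0_r; lra|]. rewrite Nat.add_succ_r.
    specialize (P (S (k + j))). specialize (E (k + j)%nat). destruct (Hx (k + j)%nat); lra. }
  assert (Bd : forall j k, x j <= x k + l / 2 ^ k).
  { intros j k. destruct (Nat.le_ge_cases j k) as [L|L].
    - assert (U := Up j (k - j)%nat). replace (j + (k - j))%nat with k in U by lia. specialize (P k). lra.
    - assert (U := Dn k (j - k)%nat). replace (k + (j - k))%nat with j in U by lia. specialize (P j). lra. }
  destruct (completeness (fun r => exists k, r = x k)) as [x0 [U1 U2]].
  - exists (x O + l / 2 ^ O). intros r [k ->]. apply Bd.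
  - exists (x O), O. reflexivity.
  - exists x0. intros k; split; [apply U1; exists k; reflexivity|].
    apply U2. intros r [j ->]. apply Bd.
Qed.

Lemma goursat : RI f a0 (a0 + w) c0 (c0 + h) = 0%C.
Proof.
  assert (Hc := entireC_cont f Hf).
  destruct (nested_point (fun k => fst (seqG k)) w Hw (fun k => proj1 (seqG_nxt k))) as [x0 Hx0].
  destruct (nested_point (fun k => snd (seqG k)) h Hh (fun k => proj1 (proj2 (seqG_nxt k)))) as [y0 Hy0].
  destruct (Hf (x0, y0)) as [l Hl].

  assert (Q4 : forall k, Q O (seqG O) <= 4 ^ k * Q k (seqG k)).
  { induction k; [simpl pow; lra|]. destruct (seqG_nxt k) as [_ [_ N]].
    assert (0 < 4 ^ k) by (apply pow_lt; lra). simpl pow. nra. }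
  assert (E0 : Q O (seqG O) = Cmod (RI f a0 (a0 + w) c0 (c0 + h))).
  { unfold Q. simpl. rewrite !Rdiv_1_r. reflexivity. }
  rewrite E0 in Q4. clear E0.
  apply Cmod_eq_0. destruct (Req_dec (Cmod (RI f a0 (a0 + w) c0 (c0 + h))) 0) as [Z|N]; [exact Z|exfalso].
  set (X := Cmod (RI f a0 (a0 + w) c0 (c0 + h))) in *.
  assert (HX : 0 < X) by (assert (x := Cmod_ge_0 (RI f a0 (a0 + w) c0 (c0 + h))); fold X in x; lra).
  (* Chosen so that 4^k times the bound 4 e D^2 for the k-th rectangle, with D = (w + h) / 2^k,
     equals X / 2. *)
  set (e := X / (8 * (w + h) ^ 2)).
  assert (W2 : 0 < (w + h) ^ 2) by (apply pow_lt; lra).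
  assert (He : 0 < e) by (apply Rdiv_lt_0_compat; lra).
  destruct (Hl e He) as [dl [Hdl Hlin]].
  destruct (pow_lt_1_zero (/2) ltac:(rewrite Rabs_pos_eq; lra) (dl / (w + h)) ltac:(apply Rdiv_lt_0_compat; lra)) as [k Hk].
  specialize (Hk k (le_n k)). rewrite Rabs_pos_eq in Hk by (apply pow_le; lra).
  rewrite pow_inv in Hk. assert (P2 : 0 < 2 ^ k) by (apply pow_lt; lra).
  set (D := (w + h) * / 2 ^ k).
  assert (HD : D < dl). { unfold D. apply Rlt_div_r in Hk; lra. }
  specialize (Q4 k). specialize (Hx0 k). specialize (Hy0 k).
  set (z0 := (x0, y0) : C) in *.
  set (lin := fun z => (f z0 + l * (z - z0))%C).
  set (err := fun z => (f z - lin z)%C).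
  assert (Hlc : contC lin).
  { apply entireC_cont. apply entireC_plus; [apply entireC_const|]. apply entireC_scal, entireC_minus; [apply entireC_id | apply entireC_const]. }
  assert (Hec : contC err).
  { apply contC_ext with (u := fun z => (f z + (-(1)) * lin z)%C); [intros; unfold err; ring|].
    apply contC_plus; [exact Hc | apply contC_mult; [apply contC_const | exact Hlc]]. }
  (* The affine part [lin] has a primitive, so only the linearisation error contributes to the
     boundary integral. *)
  assert (Es : RI f (fst (seqG k)) (fst (seqG k) + w / 2 ^ k) (snd (seqG k)) (snd (seqG k) + h / 2 ^ k)
     = RI err (fst (seqG k)) (fst (seqG k) + w / 2 ^ k) (snd (seqG k)) (snd (seqG k) + h / 2 ^ k)).
  { transitivity (RI (fun z => lin z + err z)%C (fst (seqG k)) (fst (seqG k) + w / 2 ^ k) (snd (seqG k)) (snd (seqG k) + h / 2 ^ k)).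
    - apply RI_ext. intros z; unfold err; ring.
    - rewrite RI_plus by assumption.
      rewrite (RI_prim lin (fun z => f z0 * z + l * (RtoC (/2) * (z * z) + (- z0) * z))%C); [ring | assumption|].
      intros z; eapply WD_ext; [| | |
         apply (WD_plus _ _ _ _ _ _ _ (WD_scal (f z0) _ _ _ _ (WD_id z)) (WD_scal l _ _ _ _ (WD_plus _ _ _ _ _ _ _ (WD_scal (RtoC (/2)) _ _ _ _ (WD_mult _ _ _ _ _ _ _ (WD_id z) (WD_id z))) (WD_scal (- z0) _ _ _ _ (WD_id z)))))].
      + reflexivity.
      + unfold lin. apply C_ext; simpl; field.
      + ring. }
  assert (B : Q k (seqG k) <= 4 * (e * D) * D).
  { unfold Q. rewrite Es.
    assert (ws : 0 < w / 2 ^ k) by (apply Rdiv_lt_0_compat; lra).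
    assert (hs : 0 < h / 2 ^ k) by (apply Rdiv_lt_0_compat; lra).
    assert (DD : D = w / 2 ^ k + h / 2 ^ k) by (unfold D; field; lra).
    eapply Rle_trans; [apply (RI_bound err _ _ _ _ (e * D)); [lra | lra | exact Hec|]|].
    - intros x y Hx Hy. set (zz := (x, y) : C).
      assert (Hm : Cmod (zz - z0)%C <= D).
      { eapply Rle_trans; [apply Cmod_le_sum|]. unfold zz; simpl. rewrite DD.
        apply Rplus_le_compat; apply Rabs_le; lra. }
      specialize (Hlin (zz - z0)%C ltac:(lra)).
      replace (z0 + (zz - z0))%C with zz in Hlin by ring.
      unfold err, lin. eapply Rle_trans; [|apply Rle_trans with (1 := Hlin); apply Rmult_le_compat_l; lra].
      right. f_equal. ring.
    - rewrite DD at 3. right; ring. }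
  assert (F4 : 4 ^ k * (4 * (e * D) * D) = X / 2).
  { unfold D, e. replace 4 with (2 * 2) at 1 by ring. rewrite Rpow_mult_distr. field.
    split; lra. }
  assert (0 < 4 ^ k) by (apply pow_lt; lra). nra.
Qed.
End Goursat.

(** * Fourier coefficients and a concentrating kernel *)

Definition chi (k : Z) (s : R) : C := cexp (Ci * RtoC (2 * PI * IZR k * s))%C.

Lemma chi_plus k l s : chi (k + l) s = (chi k s * chi l s)%C.
Proof. unfold chi. rewrite <- cexp_plus. f_equal. rewrite plus_IZR. csolve. Qed.
Lemma chi_0 s : chi 0 s = 1%C.
Proof. unfold chi. rewrite <- cexp_0. f_equal. csolve. Qed.
Lemma chi_add k s t : chi k (s + t) = (chi k s * chi k t)%C.
Proof. unfold chi. rewrite <- cexp_plus. f_equal. csolve. Qed.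
Lemma cexp_2PI (k : Z) : cexp (Ci * RtoC (2 * PI * IZR k))%C = 1%C.
Proof.
  assert (N : forall n : nat, cexp (Ci * RtoC (2 * PI * INR n))%C = 1%C).
  { induction n.
    - rewrite <- cexp_0. f_equal. csolve.
    - replace (Ci * RtoC (2 * PI * INR (S n)))%C with (Ci * RtoC (2 * PI * INR n) + Ci * RtoC (2 * PI))%C
        by (rewrite S_INR; csolve).
      rewrite cexp_plus, IHn. unfold cexp; apply C_ext; simpl;
      rewrite ?Rmult_0_l, ?Rmult_1_l, ?Rplus_0_l, ?Rminus_0_l, ?Ropp_0, ?Rmult_0_r; rewrite ?Ropp_0, ?exp_0, ?Rplus_0_r, ?cos_2PI, ?sin_2PI; ring. }
  destruct (Z_le_gt_dec 0 k).
  - replace k with (Z.of_nat (Z.to_nat k)) by lia. rewrite <- INR_IZR_INZ. apply N.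
  - assert (E := cexp_neg (Ci * RtoC (2 * PI * IZR k))%C).
    replace (- (Ci * RtoC (2 * PI * IZR k)))%C with (Ci * RtoC (2 * PI * INR (Z.to_nat (- k))))%C in E.
    + rewrite N, Cmult_1_r in E. exact E.
    + rewrite INR_IZR_INZ, Z2Nat.id, opp_IZR by lia. csolve.
Qed.
Lemma chi_1 k (m : Z) : chi k (IZR m) = 1%C.
Proof. unfold chi. rewrite Rmult_assoc, <- mult_IZR. apply cexp_2PI. Qed.
Lemma chi_period k s (m : Z) : chi k (s + IZR m) = chi k s.
Proof. rewrite chi_add, chi_1. ring. Qed.
Lemma Cmod_chi k s : Cmod (chi k s) = 1.
Proof. unfold chi. rewrite Cmod_cexp. simpl. rewrite <- exp_0. f_equal. ring. Qed.
Lemma chi_line k s : chi k s = cexp (0 + RtoC s * (Ci * RtoC (2 * PI * IZR k)))%C.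
Proof. unfold chi. f_equal. csolve. Qed.
Lemma contRC_chi k : contRC (chi k).
Proof.
  eapply contRC_ext; [intros; symmetry; apply chi_line|].
  apply (contC_line cexp), entireC_cont. intros z; eexists; apply WD_cexp.
Qed.
Lemma CI_chi k : k <> 0%Z -> forall a, CI (chi k) a (a + 1) = 0%C.
Proof.
  intros Hk a. set (l := (Ci * RtoC (2 * PI * IZR k))%C).
  assert (Hl : l <> 0%C).
  { intros E. assert (E2 : snd l = 0) by (rewrite E; reflexivity). unfold l in E2. simpl in E2.
    assert (P := PI_RGT_0). assert (IZR k <> 0) by (apply not_0_IZR, Hk).
    assert (2 * PI * IZR k = 0) by lra. apply Rmult_integral in H0. destruct H0; lra. }
  rewrite (CI_derive (fun s => / l * chi k s)%C).
  - rewrite (chi_period k a 1). ring.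
  - intros t. assert (E := WD_RD (fun z => / l * cexp z)%C 0 l t _ _ (WD_scal (/ l) _ _ _ _ (WD_cexp _))).
    replace (/ l * cexp (0 + t * l) * l + / l * 0 * Cconj l)%C with (chi k t) in E
      by (rewrite chi_line; fold l; field; exact Hl).
    destruct E as [E1 E2]. split.
    + eapply is_derive_ext; [|exact E1]. intros; cbv beta. rewrite chi_line. reflexivity.
    + eapply is_derive_ext; [|exact E2]. intros; cbv beta. rewrite chi_line. reflexivity.
  - apply contRC_chi.
Qed.

Lemma CI_period H a : contRC H -> (forall s, H (s + 1) = H s) -> CI H a (a + 1) = CI H 0 1.
Proof.
  intros Hc P. rewrite <- (CI_Chasles H a 0 (a + 1)), <- (CI_Chasles H 0 1 (a + 1)) by assumption.
  assert (E : CI H 1 (a + 1) = CI H 0 a).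
  { rewrite <- (Rplus_0_l 1) at 1. rewrite <- (CI_shift H 0 a 1) by assumption. apply CI_ext. intros; apply P. }
  rewrite E. assert (E2 := CI_Chasles H a 0 a Hc).
  assert (E3 : CI H a a = 0%C) by (unfold CI; rewrite !RInt_point; reflexivity).
  rewrite E3 in E2. replace (CI H a 0 + (CI H 0 1 + CI H 0 a))%C with (CI H a 0 + CI H 0 a + CI H 0 1)%C by ring.
  rewrite E2. ring.
Qed.

(** Equal to cos(pi s)^2. Its powers are nonnegative trigonometric polynomials that concentrate at
    the integers, and a factor [Kr] only mixes neighbouring frequencies ([Kr_chi]). *)
Definition Kr (s : R) : R := (1 + cos (2 * PI * s)) / 2.

Lemma Kr_pow_cont N s : continuous (fun s => Kr s ^ N) s.
Proof.
  apply (ex_derive_continuous (K:=R_AbsRing) (V:=R_NormedModule)). unfold Kr. auto_derive. trivial.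
Qed.
Lemma Kr_ge_0 s : 0 <= Kr s.
Proof. unfold Kr. assert (B := COS_bound (2 * PI * s)). lra. Qed.
Lemma Kr_even s : Kr (- s) = Kr s.
Proof. unfold Kr. replace (2 * PI * - s) with (- (2 * PI * s)) by ring. rewrite cos_neg. reflexivity. Qed.
Lemma Kr_decr s t : 0 <= s -> s < t -> t <= / 2 -> Kr t < Kr s.
Proof.
  intros H1 H2 H3. assert (P := PI_RGT_0). unfold Kr.
  assert (cos (2 * PI * t) < cos (2 * PI * s)) by (apply cos_decreasing_1; nra). lra.
Qed.
Definition mK (N : nat) : R := RInt (fun s => Kr s ^ N) (- / 2) (/ 2).

Lemma Kr_ex N a b : ex_RInt (fun s => Kr s ^ N) a b.
Proof. apply (ex_RInt_continuous (V:=R_CompleteNormedModule)). intros; apply Kr_pow_cont. Qed.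

Lemma mK_lower N e : 0 < e -> e <= / 2 -> 2 * e * Kr e ^ N <= mK N.
Proof.
  intros H1 H2. unfold mK.
  rewrite <- (RInt_Chasles (V:=R_CompleteNormedModule) _ (- /2) (- e)) by apply Kr_ex.
  rewrite <- (RInt_Chasles (V:=R_CompleteNormedModule) _ (- e) e) by apply Kr_ex.
  assert (P : forall a b, a <= b -> 0 <= RInt (fun s => Kr s ^ N) a b).
  { intros a b L. apply RInt_ge_0; [exact L | apply Kr_ex|]. intros; apply pow_le, Kr_ge_0. }
  assert (A1 := P (- /2) (- e) ltac:(lra)). assert (A2 := P e (/2) ltac:(lra)).
  assert (A3 : 2 * e * Kr e ^ N <= RInt (fun s => Kr s ^ N) (- e) e).
  { replace (2 * e * Kr e ^ N) with (RInt (fun _ => Kr e ^ N) (- e) e).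
    - apply RInt_le; [lra | apply ex_RInt_const | apply Kr_ex|]. intros x Hx.
      apply pow_incr. split; [apply Kr_ge_0|].
      destruct (Rle_dec 0 x); [left; apply Kr_decr; lra|]. rewrite <- (Kr_even x). left; apply Kr_decr; lra.
    - rewrite (RInt_const (V:=R_CompleteNormedModule)). unfold scal; simpl; unfold mult; simpl; ring. }
  unfold plus; simpl. lra.
Qed.
Lemma mK_pos N : 0 < mK N.
Proof.
  eapply Rlt_le_trans; [|apply (mK_lower N (/4)); lra].
  assert (0 < Kr (/4)).
  { assert (D := Kr_decr (/4) (/2) ltac:(lra) ltac:(lra) ltac:(lra)). assert (Q := Kr_ge_0 (/2)). lra. }
  assert (0 < Kr (/4) ^ N) by (apply pow_lt; assumption). lra.
Qed.

(** Off |s| <= eta'/2 the kernel is at most r1^N, while its mass is at least (eta'/2) r2^N by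
    [mK_lower] at eta'/4. Since r1 < r2, some N gives (r1/r2)^N < eta'^2 / 2, which makes the outer
    part of the first moment at most eta'/2 times the mass. *)
Lemma kernel_concentrates eta : 0 < eta -> exists N,
  RInt (fun s => Rabs s * Kr s ^ N) (- / 2) (/ 2) <= eta * mK N.
Proof.
  intros He0.
  set (eta' := Rmin eta (/ 2)). assert (He : 0 < eta') by (apply Rmin_pos; lra).
  assert (He2 : eta' <= /2) by apply Rmin_r. assert (He3 : eta' <= eta) by apply Rmin_l.
  set (r1 := Kr (eta' / 2)). set (r2 := Kr (eta' / 4)).
  assert (R12 : r1 < r2) by (apply Kr_decr; lra). assert (R1 : 0 <= r1) by apply Kr_ge_0.
  destruct (pow_lt_1_zero (r1 / r2)) with (y := eta' * eta' / 2) as [N HN].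
  - rewrite Rabs_pos_eq; [apply Rlt_div_l; lra|]. apply Rmult_le_pos; [lra | left; apply Rinv_0_lt_compat; lra].
  - nra.
  - exists N. specialize (HN N (le_n N)).
    assert (E : forall a b, ex_RInt (fun s => Rabs s * Kr s ^ N) a b).
    { intros. apply (ex_RInt_continuous (V:=R_CompleteNormedModule)). intros z _.
      apply (continuous_mult (K:=R_AbsRing) Rabs); [apply continuity_pt_filterlim, Rcontinuity_abs | apply Kr_pow_cont]. }
    assert (E2 : forall k a b, ex_RInt (fun s => k * Kr s ^ N) a b) by (intros; apply (ex_RInt_scal (V:=R_NormedModule)), Kr_ex).
    apply Rle_trans with (RInt (fun s => eta' / 2 * Kr s ^ N + r1 ^ N / 2) (- / 2) (/ 2)).
    + apply RInt_le; [lra | apply E | apply (ex_RInt_plus (V:=R_NormedModule)); [apply E2 | apply ex_RInt_const]|].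
      intros x Hx. assert (K0 : 0 <= Kr x ^ N) by apply pow_le, Kr_ge_0.
      assert (r0 : 0 <= r1 ^ N) by (apply pow_le; lra).
      destruct (Rle_dec (Rabs x) (eta' / 2)) as [L|L].
      * assert (Rabs x * Kr x ^ N <= eta' / 2 * Kr x ^ N) by (apply Rmult_le_compat_r; assumption). lra.
      * assert (Kx : Kr x <= r1).
        { unfold r1. unfold Rabs in L. destruct (Rcase_abs x); [rewrite <- (Kr_even x)|]; left; apply Kr_decr; lra. }
        assert (Kr x ^ N <= r1 ^ N) by (apply pow_incr; split; [apply Kr_ge_0 | assumption]).
        assert (Rabs x <= /2) by (apply Rabs_le; lra). assert (a0 := Rabs_pos x).
        assert (0 <= eta' / 2 * Kr x ^ N) by (apply Rmult_le_pos; lra). nra.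
    + replace (RInt (fun s => eta' / 2 * Kr s ^ N + r1 ^ N / 2) (- / 2) (/ 2)) with (eta' / 2 * mK N + r1 ^ N / 2).
      2:{ symmetry. etransitivity; [apply (RInt_plus (V:=R_CompleteNormedModule) (fun s => eta' / 2 * Kr s ^ N) (fun _ => r1 ^ N / 2)); [apply E2 | apply ex_RInt_const]|].
          assert (E3 : RInt (fun s => eta' / 2 * Kr s ^ N) (- / 2) (/ 2) = eta' / 2 * mK N) by (apply (RInt_scal (V:=R_CompleteNormedModule) (fun s => Kr s ^ N)), Kr_ex).
          rewrite E3, (RInt_const (V:=R_CompleteNormedModule)). unfold plus, scal; simpl; unfold mult; simpl. field. }
      assert (M := mK_lower N (eta' / 4) ltac:(lra) ltac:(lra)). fold r2 in M.
      assert (M0 := mK_pos N).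
      assert (r2N : 0 < r2 ^ N) by (apply pow_lt; lra).
      assert (r1N : r1 ^ N <= eta' * eta' / 2 * r2 ^ N).
      { unfold Rdiv at 1 in HN. rewrite Rpow_mult_distr, pow_inv in HN.
        rewrite Rabs_pos_eq in HN by (apply Rmult_le_pos; [apply pow_le; lra | left; apply Rinv_0_lt_compat; lra]).
        left. apply Rlt_div_l; [exact r2N|]. exact HN. }
      assert (r1 ^ N / 2 <= eta' / 2 * mK N) by nra.
      assert (eta' * mK N <= eta * mK N) by (apply Rmult_le_compat_r; lra). lra.
Qed.

Lemma kernel_approx (g : R -> R) L N eta : (forall s, continuous g s) -> 0 <= L ->
  RInt (fun s => Rabs s * Kr s ^ N) (- / 2) (/ 2) <= eta * mK N ->
  (forall s, Rabs s <= / 2 -> Rabs (g s - g 0) <= L * Rabs s) ->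
  Rabs (RInt (fun s => g s * Kr s ^ N) (- / 2) (/ 2) - g 0 * mK N) <= L * (eta * mK N).
Proof.
  intros Hg HL HN HgL.
  assert (C1 : forall s, continuous (fun s => g s * Kr s ^ N) s)
    by (intros; apply (continuous_mult (K:=R_AbsRing) g); [apply Hg | apply Kr_pow_cont]).
  assert (C2 : forall s, continuous (fun s => g 0 * Kr s ^ N) s)
    by (intros; apply (continuous_mult (K:=R_AbsRing) (fun _ => g 0)); [apply continuous_const | apply Kr_pow_cont]).
  assert (C3 : forall s, continuous (fun s => Rabs s * Kr s ^ N) s)
    by (intros; apply (continuous_mult (K:=R_AbsRing) Rabs); [apply continuity_pt_filterlim, Rcontinuity_abs | apply Kr_pow_cont]).
  assert (X : forall (q : R -> R) a b, (forall s, continuous q s) -> ex_RInt q a b)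
    by (intros; apply (ex_RInt_continuous (V:=R_CompleteNormedModule)); auto).
  assert (E1 : RInt (fun s => g 0 * Kr s ^ N) (- / 2) (/ 2) = g 0 * mK N)
    by (apply (RInt_scal (V:=R_CompleteNormedModule) (fun s => Kr s ^ N)), Kr_ex).
  assert (E2 : RInt (fun s => g s * Kr s ^ N - g 0 * Kr s ^ N) (- / 2) (/ 2) =
     RInt (fun s => g s * Kr s ^ N) (- / 2) (/ 2) - RInt (fun s => g 0 * Kr s ^ N) (- / 2) (/ 2))
    by (apply (RInt_minus (V:=R_CompleteNormedModule) (fun s => g s * Kr s ^ N) (fun s => g 0 * Kr s ^ N)); apply X; assumption).
  rewrite <- E1, <- E2.
  eapply Rle_trans; [apply abs_RInt_le; [lra|]|].
  - apply (ex_RInt_minus (V:=R_NormedModule)); apply X; assumption.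
  - apply Rle_trans with (RInt (fun s => L * (Rabs s * Kr s ^ N)) (- / 2) (/ 2)).
    + apply RInt_le; [lra | | apply (ex_RInt_scal (V:=R_NormedModule)), X, C3|].
      * apply X. intros s. apply (continuous_comp (fun s => g s * Kr s ^ N - g 0 * Kr s ^ N) Rabs).
        -- apply (continuous_minus (V:=R_NormedModule)); auto.
        -- apply continuity_pt_filterlim, Rcontinuity_abs.
      * intros x Hx. rewrite <- Rmult_minus_distr_r, Rabs_mult, <- Rmult_assoc.
        rewrite (Rabs_pos_eq (Kr x ^ N)) by apply pow_le, Kr_ge_0.
        apply Rmult_le_compat_r; [apply pow_le, Kr_ge_0|]. apply HgL, Rabs_le; lra.
    + rewrite (RInt_scal (V:=R_CompleteNormedModule)) by (apply X, C3). unfold scal; simpl; unfold mult; simpl.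
      apply Rmult_le_compat_l; assumption.
Qed.

Lemma Kr_chi s : RtoC (Kr s) = (RtoC (/2) * (1 + RtoC (/2) * (chi 1 s + chi (-1) s)))%C.
Proof.
  unfold Kr, chi, cexp. apply C_ext; simpl;
  rewrite ?Rmult_1_r, ?Rmult_0_l, ?Rmult_0_r, ?Rmult_1_l, ?Rplus_0_l, ?Rplus_0_r, ?Rminus_0_r, ?Rminus_0_l, ?Ropp_0, ?exp_0;
  replace (2 * PI * -1 * s) with (- (2 * PI * s)) by ring; rewrite ?cos_neg, ?sin_neg; field.
Qed.

(** Against the recentred kernel [H] integrates to 0, because powers of the kernel are trigonometric
    polynomials; by concentration the same integral is close to [H s0] times the mass. Beyond
    continuity this uses a Lipschitz bound at the single point [s0]. *)
Lemma fourier_unique H s0 L : contRC H -> (forall s, H (s + 1) = H s) ->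
  (forall k, CI (fun s => H s * chi k s)%C 0 1 = 0%C) ->
  0 <= L -> (forall s, Rabs s <= / 2 -> Cmod (H (s0 + s)%R - H s0)%C <= L * Rabs s) -> H s0 = 0%C.
Proof.
  intros Hc Hp Hz HL HLip.
  set (H1 := fun s => H (s + s0)).
  assert (H1c : contRC H1).
  { intros t. destruct (Hc (t + s0)) as [c1 c2]. split.
    - apply (continuous_comp (fun t => t + s0) (fun t => fst (H t))); [|exact c1].
      apply (continuous_plus (V:=R_NormedModule)); [apply continuous_id | apply continuous_const].
    - apply (continuous_comp (fun t => t + s0) (fun t => snd (H t))); [|exact c2].
      apply (continuous_plus (V:=R_NormedModule)); [apply continuous_id | apply continuous_const]. }
  assert (Z1 : forall k, CI (fun s => H1 s * chi k s)%C (- / 2) (/ 2) = 0%C).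
  { intros k.
    assert (Ck : contRC (fun s => H s * chi k s)%C) by (apply contRC_mult; [exact Hc | apply contRC_chi]).
    rewrite (CI_ext _ (fun s => (chi k (- s0)) * ((fun t => H t * chi k t) (s + s0)%R))%C).
    - rewrite CI_scal.
      + rewrite (CI_shift (fun t => H t * chi k t)%C) by exact Ck.
        replace (/ 2 + s0) with (- / 2 + s0 + 1) by field. rewrite CI_period, Hz; [ring | exact Ck|].
        intros s. rewrite Hp. rewrite (chi_period k s 1). reflexivity.
      + apply contRC_mult; [exact H1c|]. apply (contRC_ext (fun t => chi k t * chi k s0)%C); [intros t; symmetry; apply chi_add|].
        apply contRC_mult; [apply contRC_chi | apply contRC_const].
    - intros t _. unfold H1. rewrite chi_add.
      assert (E : (chi k (- s0) * chi k s0 = 1)%C).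
      { rewrite <- chi_add. replace (- s0 + s0) with (IZR 0) by ring. apply chi_1. }
      transitivity (H (t + s0)%R * chi k t * (chi k (- s0) * chi k s0))%C; [rewrite E; ring | ring]. }
  (* One more factor [Kr] turns frequency k into k - 1, k and k + 1, so the induction on the power
     runs over all k together. *)
  assert (ZN : forall N k, CI (fun s => H1 s * chi k s * RtoC (Kr s ^ N))%C (- / 2) (/ 2) = 0%C).
  { assert (Cn : forall N k, contRC (fun s => H1 s * chi k s * RtoC (Kr s ^ N))%C).
    { intros. apply contRC_mult; [apply contRC_mult; [exact H1c | apply contRC_chi] | apply contRC_R, Kr_pow_cont]. }
    induction N; intros k.
    - rewrite <- (Z1 k). apply CI_ext. intros; simpl. ring.
    - rewrite (CI_ext _ (fun s => RtoC (/2) * (H1 s * chi k s * RtoC (Kr s ^ N)) +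
          RtoC (/4) * ((H1 s * chi (k + 1) s * RtoC (Kr s ^ N)) + (H1 s * chi (k + -1) s * RtoC (Kr s ^ N))))%C).
      + rewrite CI_plus, !CI_scal, CI_plus, !IHN; try ring; auto using contRC_plus.
        * apply contRC_mult; [apply contRC_const | auto].
        * apply contRC_mult; [apply contRC_const | apply contRC_plus; auto].
      + intros t _. rewrite !chi_plus. change (Kr t ^ S N) with (Kr t * Kr t ^ N). rewrite RtoC_mult, Kr_chi.
        replace (/4) with (/2 * /2) by field. rewrite RtoC_mult. ring. }
  assert (F : forall N, RInt (fun s => fst (H1 s) * Kr s ^ N) (- / 2) (/ 2) = 0 /\ RInt (fun s => snd (H1 s) * Kr s ^ N) (- / 2) (/ 2) = 0).
  { intros N. assert (E := ZN N 0%Z).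
    rewrite (CI_ext _ (fun s => (fst (H1 s) * Kr s ^ N, snd (H1 s) * Kr s ^ N)))  in E by (intros; rewrite chi_0; csolve).
    unfold CI in E. simpl in E. split; [exact (f_equal fst E) | exact (f_equal snd E)]. }
  assert (G : forall g : R -> R, (forall s, continuous g s) -> (forall N, RInt (fun s => g s * Kr s ^ N) (- / 2) (/ 2) = 0) ->
     (forall s, Rabs s <= / 2 -> Rabs (g s - g 0) <= L * Rabs s) -> g 0 = 0).
  { intros g gc gz gl. destruct (Req_dec (g 0) 0) as [E|E]; [exact E|exfalso].
    assert (P : 0 < Rabs (g 0)) by (apply Rabs_pos_lt, E).
    destruct (kernel_concentrates (Rabs (g 0) / (2 * (L + 1)))) as [N HN]; [apply Rdiv_lt_0_compat; lra|].
    assert (K := kernel_approx g L N _ gc HL HN gl). rewrite gz in K.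
    replace (0 - g 0 * mK N) with (- (g 0 * mK N)) in K by ring.
    rewrite Rabs_Ropp, Rabs_mult, (Rabs_pos_eq (mK N)) in K by (left; apply mK_pos).
    assert (M := mK_pos N).
    assert (Q : L * (Rabs (g 0) / (2 * (L + 1))) <= Rabs (g 0) / 2).
    { replace (L * (Rabs (g 0) / (2 * (L + 1)))) with (Rabs (g 0) / 2 * (L / (L + 1))) by (field; lra).
      rewrite <- (Rmult_1_r (Rabs (g 0) / 2)) at 2. apply Rmult_le_compat_l; [lra | apply Rle_div_l; lra]. }
    nra. }
  assert (E0 : H1 0 = H s0) by (unfold H1; f_equal; ring).
  rewrite <- E0. apply C_ext; simpl.
  - apply (G (fun s => fst (H1 s))); [apply H1c | apply F|]. intros s Hs.
    eapply Rle_trans; [|apply (HLip s Hs)]. unfold H1. replace (0 + s0) with s0 by ring. rewrite (Rplus_comm s s0).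
    apply (fst_le_Cmod (H _ - H _)%C).
  - apply (G (fun s => snd (H1 s))); [apply H1c | apply F|]. intros s Hs.
    eapply Rle_trans; [|apply (HLip s Hs)]. unfold H1. replace (0 + s0) with s0 by ring. rewrite (Rplus_comm s s0).
    apply (snd_le_Cmod (H _ - H _)%C).
Qed.

(** * Power series expansion of entire functions *)

(** The substitution z = exp(2 pi w) turns circles into vertical segments of length 1, so that
    Goursat's theorem on rectangles becomes Cauchy's theorem on annuli. With it [cf F k x] is the
    k-th Laurent coefficient over the circle of radius exp(2 pi x). *)
Definition E2 (w : C) : C := cexp (RtoC (2 * PI) * w)%C.
Definition Ek (k : Z) (w : C) : C := cexp (RtoC (- (2 * PI * IZR k)) * w)%C.
Definition cfG (F : C -> C) (k : Z) (w : C) : C := (F (E2 w) * Ek k w)%C.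
Definition cf (F : C -> C) (k : Z) (x : R) : C := CI (vline (cfG F k) x) 0 1.

Lemma entireC_E2 : entireC E2.
Proof. apply entireC_cexp, entireC_scal, entireC_id. Qed.
Lemma entireC_cfG F k : entireC F -> entireC (cfG F k).
Proof.
  intros H. apply entireC_mult; [apply (entireC_comp F E2 H entireC_E2)|].
  apply entireC_cexp, entireC_scal, entireC_id.
Qed.
Lemma cfG_period F k w : cfG F k (w + Ci) = cfG F k w.
Proof.
  unfold cfG, E2, Ek. f_equal; [f_equal|].
  - rewrite Cmult_plus_distr_l, cexp_plus.
    replace (RtoC (2 * PI) * Ci)%C with (Ci * RtoC (2 * PI * IZR 1))%C by (csolve). rewrite cexp_2PI. ring.
  - rewrite Cmult_plus_distr_l, cexp_plus.
    replace (RtoC (- (2 * PI * IZR k)) * Ci)%C with (Ci * RtoC (2 * PI * IZR (- k)))%C by (rewrite opp_IZR; csolve).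
    rewrite cexp_2PI. ring.
Qed.
Lemma E2_polar x s : E2 (x, s) = (RtoC (exp (2 * PI * x)) * chi 1 s)%C.
Proof.
  unfold E2, chi. rewrite <- cexp_R, <- cexp_plus. f_equal. csolve.
Qed.
Lemma Ek_polar k x s : Ek k (x, s) = (RtoC (exp (- (2 * PI * IZR k * x))) * chi (- k) s)%C.
Proof.
  unfold Ek, chi. rewrite <- cexp_R, <- cexp_plus. f_equal. rewrite opp_IZR. csolve.
Qed.

(** The horizontal sides of the rectangle cancel by periodicity, and Goursat equates the two
    vertical ones. *)
Lemma cf_const F k x1 x2 : entireC F -> x1 < x2 -> cf F k x1 = cf F k x2.
Proof.
  intros H L. assert (G := goursat (cfG F k) x1 0 (x2 - x1) 1 (entireC_cfG F k H) ltac:(lra) ltac:(lra)).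
  replace (x1 + (x2 - x1)) with x2 in G by ring. rewrite Rplus_0_l in G.
  unfold RI in G. fold (cf F k x1) (cf F k x2) in G.
  assert (Eh : CI (hline (cfG F k) 1) x1 x2 = CI (hline (cfG F k) 0) x1 x2).
  { apply CI_ext. intros t _. unfold hline. rewrite <- (cfG_period F k (t, 0)). f_equal. csolve. }
  rewrite Eh in G.
  assert (G2 : (Ci * (cf F k x2 - cf F k x1) = 0)%C) by (rewrite <- G; ring).
  assert (G3 : (cf F k x2 - cf F k x1 = 0)%C).
  { replace (cf F k x2 - cf F k x1)%C with (- Ci * (Ci * (cf F k x2 - cf F k x1)))%C by (csolve).
    rewrite G2. ring. }
  replace (cf F k x1) with (cf F k x2 - (cf F k x2 - cf F k x1))%C by ring. rewrite G3. ring.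
Qed.
Lemma cf_const' F k x1 x2 : entireC F -> cf F k x1 = cf F k x2.
Proof.
  intros H. destruct (Rtotal_order x1 x2) as [L|[->|L]]; [apply cf_const; auto | auto | symmetry; apply cf_const; auto].
Qed.

Lemma contRC_cfG F k x : entireC F -> contRC (vline (cfG F k) x).
Proof. intros H. apply contRC_vline, entireC_cont, entireC_cfG, H. Qed.

Lemma cf_bound F k x M : entireC F -> (forall z, Cmod z = exp (2 * PI * x) -> Cmod (F z) <= M) ->
  Cmod (cf F k x) <= 2 * M * exp (- (2 * PI * IZR k * x)).
Proof.
  intros H B. unfold cf.
  replace (2 * M * exp (- (2 * PI * IZR k * x))) with (2 * (M * exp (- (2 * PI * IZR k * x))) * (1 - 0)) by ring.
  apply CI_bound; [lra | apply contRC_cfG, H|]. intros t _. unfold vline, cfG.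
  rewrite Ek_polar, !Cmod_mult, Cmod_chi, Cmod_R, Rmult_1_r, Rabs_pos_eq by (left; apply exp_pos).
  apply Rmult_le_compat_r; [left; apply exp_pos|]. apply B.
  rewrite E2_polar, Cmod_mult, Cmod_chi, Cmod_R, Rabs_pos_eq by (left; apply exp_pos). ring.
Qed.

Lemma cf_lin F G c k x : entireC F -> entireC G ->
  cf (fun z => F z + c * G z)%C k x = (cf F k x + c * cf G k x)%C.
Proof.
  intros HF HG. unfold cf. rewrite <- CI_scal, <- CI_plus; auto using contRC_cfG.
  - apply CI_ext. intros; unfold vline, cfG; ring.
  - apply contRC_mult; [apply contRC_const | apply contRC_cfG, HG].
Qed.

Lemma cf_pow j k : cf (fun z => z ^ j)%C k 0 = if Z.eq_dec (Z.of_nat j) k then 1%C else 0%C.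
Proof.
  unfold cf. rewrite (CI_ext _ (chi (Z.of_nat j - k))).
  - destruct (Z.eq_dec (Z.of_nat j) k) as [E|N].
    + rewrite (CI_ext _ (fun _ => 1%C)); [rewrite CI_const; csolve|].
      intros; rewrite E, Z.sub_diag. apply chi_0.
    + rewrite <- (Rplus_0_l 1). apply CI_chi. lia.
  - intros t _. unfold vline, cfG. rewrite E2_polar, Ek_polar, !Rmult_0_r, Ropp_0, exp_0, Cmult_1_l, Cmult_1_l.
    unfold Z.sub. rewrite chi_plus. f_equal.
    induction j; [simpl; symmetry; apply chi_0|].
    rewrite Nat2Z.inj_succ. unfold Z.succ. rewrite chi_plus, <- IHj. simpl. ring.
Qed.

(** For partial sums this is orthogonality of the characters, and the series converges uniformly on
    the unit circle. *)
Lemma cf_pser a k : fastdec a -> cf (pser a) k 0 = match k with Zneg _ => 0%C | _ => a (Z.to_nat k) end.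
Proof.
  intros H. destruct (pser_dom a 1 H (Rle_refl 1)) as [b [Hb Hd]].
  assert (Hp : entireC (pser a)) by apply entireC_pser, H.
  set (S := fun N z => Csum N (fun j => a j * z ^ j)%C).
  assert (HS : forall N, entireC (S N)).
  { induction N; [apply entireC_const|]. apply entireC_plus; [exact IHN|].
    apply entireC_scal, entireC_pow, entireC_id. }
  assert (CS : forall N, cf (S N) k 0 = Csum N (fun j => a j * (if Z.eq_dec (Z.of_nat j) k then 1 else 0))%C).
  { induction N.
    - unfold cf, S; simpl. rewrite (CI_ext _ (fun _ => 0%C)); [rewrite CI_const; ring|].
      intros; unfold vline, cfG. ring.
    - change (S (Datatypes.S N)) with (fun z => S N z + a N * z ^ N)%C.
      rewrite cf_lin; [|apply HS | apply entireC_pow, entireC_id]. rewrite IHN, cf_pow. reflexivity. }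
  set (target := match k with Zneg _ => 0%C | _ => a (Z.to_nat k) end).
  assert (CT : forall N, (Z.to_nat k < N)%nat -> cf (S N) k 0 = target).
  { intros N HN. rewrite CS. destruct (Z_lt_le_dec k 0) as [Lk|Lk].
    - unfold target. destruct k; try lia. rewrite (Csum_ext _ _ (fun _ => 0%C)); [apply Csum_0|].
      intros j _. destruct (Z.eq_dec (Z.of_nat j) (Z.neg p)); [lia | ring].
    - assert (T : target = a (Z.to_nat k)) by (unfold target; destruct k; try reflexivity; lia).
      rewrite T. clear T CS. induction N; [lia|]. simpl.
      destruct (Nat.eq_dec (Z.to_nat k) N) as [E|E].
      + rewrite (Csum_ext _ _ (fun _ => 0%C)).
        * rewrite Csum_0. destruct (Z.eq_dec (Z.of_nat N) k); [rewrite <- E; ring | lia].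
        * intros j Hj. destruct (Z.eq_dec (Z.of_nat j) k); [lia | ring].
      + rewrite IHN by lia. destruct (Z.eq_dec (Z.of_nat N) k); [lia | ring]. }
  assert (D : forall eps, 0 < eps -> Cmod (cf (pser a) k 0 - target)%C <= eps).
  { intros eps He.
    assert (b0 : forall n, 0 <= b n).
    { intros n. eapply Rle_trans; [apply Cmod_ge_0 | apply (Hd 0%C n)]. rewrite Cmod_0; lra. }
    destruct (Series_tail_lim b Hb b0 (eps / 2)) as [N0 HN]; [lra|].
    set (N := (Nat.max N0 (Datatypes.S (Z.to_nat k)))).
    rewrite <- (CT N) by (unfold N; lia).
    replace (cf (pser a) k 0 - cf (S N) k 0)%C with (cf (fun z => pser a z + (-(1)) * S N z)%C k 0)
      by (rewrite cf_lin by auto; ring).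
    eapply Rle_trans; [apply (cf_bound _ k 0 (eps / 2))|].
    - apply entireC_plus; [exact Hp | apply entireC_scal, HS].
    - intros z Hz. rewrite Rmult_0_r, exp_0 in Hz.
      replace (pser a z + -(1) * S N z)%C with (pser a z - S N z)%C by ring.
      left. eapply Rle_lt_trans; [apply (CSer_tail _ b N); [intros n; apply Hd; lra | exact Hb] | apply HN; unfold N; lia].
    - rewrite Rmult_0_r, Ropp_0, exp_0. lra. }
  destruct (Req_dec (Cmod (cf (pser a) k 0 - target)%C) 0) as [E|E].
  - apply Cmod_eq_0 in E. replace (cf (pser a) k 0) with (cf (pser a) k 0 - target + target)%C by ring. rewrite E; ring.
  - assert (P := Cmod_ge_0 (cf (pser a) k 0 - target)%C). specialize (D (Cmod (cf (pser a) k 0 - target)%C / 2)). lra.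
Qed.

Lemma contRC_bounded F a b : a <= b -> contRC F -> exists M, 0 <= M /\ forall t, a <= t <= b -> Cmod (F t) <= M.
Proof.
  intros L H.
  assert (Q : forall g : R -> R, (forall t, continuous g t) -> exists M, 0 <= M /\ forall t, a <= t <= b -> Rabs (g t) <= M).
  { intros g Hg.
    assert (Hc : forall c, a <= c <= b -> continuity_pt (fun t => Rabs (g t)) c).
    { intros c _. apply continuity_pt_filterlim. apply (continuous_comp g Rabs); [apply Hg|].
      apply continuity_pt_filterlim, Rcontinuity_abs. }
    destruct (continuity_ab_maj _ a b L Hc) as [x [Hx _]]. exists (Rabs (g x)). split; [apply Rabs_pos | exact Hx]. }
  destruct (Q (fun t => fst (F t))) as [M1 [P1 H1]]; [apply H|].
  destruct (Q (fun t => snd (F t))) as [M2 [P2 H2]]; [apply H|].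
  exists (M1 + M2). split; [lra|]. intros t Ht. eapply Rle_trans; [apply Cmod_le_sum|].
  specialize (H1 t Ht). specialize (H2 t Ht). lra.
Qed.

Lemma polar (z : C) : z <> 0%C -> exists x s, z = E2 (x, s).
Proof.
  intros Hz. apply Cmod_gt_0 in Hz. assert (PI0 := PI_RGT_0).
  set (r := Cmod z) in *.
  assert (U : (fst z / r) * (fst z / r) + (snd z / r) * (snd z / r) = 1).
  { assert (S := Cmod_sqr z). fold r in S.
    replace ((fst z / r) * (fst z / r) + (snd z / r) * (snd z / r)) with ((fst z * fst z + snd z * snd z) / (r * r)) by (field; lra).
    rewrite <- S. field. lra. }
  set (p := fst z / r) in *. set (q := snd z / r) in *.
  assert (Hp : -1 <= p <= 1) by nra.
  assert (Sq : sqrt (1 - p ^ 2) = Rabs q).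
  { rewrite <- sqrt_Rsqr_abs. f_equal. unfold Rsqr. lra. }
  assert (T : exists th, cos th = p /\ sin th = q).
  { destruct (Rle_dec 0 q).
    - exists (acos p). split; [apply cos_acos, Hp|]. rewrite sin_acos by exact Hp. unfold Rsqr.
      replace (1 - p * p) with (1 - p ^ 2) by ring. rewrite Sq. apply Rabs_pos_eq; assumption.
    - exists (- acos p). rewrite cos_neg, sin_neg. split; [apply cos_acos, Hp|]. rewrite sin_acos by exact Hp. unfold Rsqr.
      replace (1 - p * p) with (1 - p ^ 2) by ring. rewrite Sq. rewrite Rabs_left; lra. }
  destruct T as [th [T1 T2]].
  exists (ln r / (2 * PI)), (th / (2 * PI)). rewrite E2_polar. unfold chi, cexp.
  replace (2 * PI * (ln r / (2 * PI))) with (ln r) by (field; lra). rewrite exp_ln by assumption.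
  replace (2 * PI * 1 * (th / (2 * PI))) with th by (field; lra).
  assert (F1 : fst z = r * p) by (unfold p; field; lra). assert (F2 : snd z = r * q) by (unfold q; field; lra).
  rewrite <- T1 in F1. rewrite <- T2 in F2.
  apply C_ext; simpl;
  rewrite ?Rmult_0_l, ?Rmult_1_l, ?Rmult_0_r, ?Rplus_0_l, ?Rplus_0_r, ?Rminus_0_r, ?Rminus_0_l, ?Ropp_0, ?exp_0; [rewrite F1 | rewrite F2]; ring.
Qed.

(** The difference of f and its Taylor series has no Laurent coefficients on any circle, so
    [fourier_unique] makes it vanish there; the Cauchy kernel is avoided. The last clause is the
    Cauchy estimate up to a factor 2. *)
Theorem entire_pser f : entireC f -> exists a, fastdec a /\ (forall z, f z = pser a z) /\
  forall r M, 0 < r -> (forall z, Cmod z = r -> Cmod (f z) <= M) -> forall k, Cmod (a k) * r ^ k <= 2 * M.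
Proof.
  intros Hf. assert (P := PI_RGT_0).
  set (a := fun k : nat => cf f (Z.of_nat k) 0).
  assert (Ha : forall r M, 0 < r -> (forall z, Cmod z = r -> Cmod (f z) <= M) -> forall k, Cmod (a k) * r ^ k <= 2 * M).
  { intros r M Hr HM k. set (x := ln r / (2 * PI)).
    assert (Ex : exp (2 * PI * x) = r).
    { unfold x. replace (2 * PI * (ln r / (2 * PI))) with (ln r) by (field; lra). apply exp_ln, Hr. }
    unfold a. rewrite (cf_const' f _ 0 x Hf).
    assert (B := cf_bound f (Z.of_nat k) x M Hf ltac:(rewrite Ex; exact HM)).
    assert (Er : exp (- (2 * PI * IZR (Z.of_nat k) * x)) * r ^ k = 1).
    { rewrite <- INR_IZR_INZ, <- Ex. clear. induction k.
      - simpl. rewrite Rmult_0_r, Rmult_0_l, Ropp_0, exp_0. ring.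
      - rewrite S_INR. replace (- (2 * PI * (INR k + 1) * x)) with (- (2 * PI * INR k * x) + - (2 * PI * x)) by ring.
        rewrite exp_plus. simpl. transitivity ((exp (- (2 * PI * INR k * x)) * exp (2 * PI * x) ^ k) * (exp (- (2 * PI * x)) * exp (2 * PI * x))); [ring|].
        rewrite IHk, <- exp_plus. rewrite Rplus_opp_l, exp_0. ring. }
    apply (Rmult_le_compat_r (r ^ k)) in B; [|apply pow_le; lra]. rewrite Rmult_assoc, Er in B. lra. }
  assert (Hbd : forall r, 0 < r -> exists M, 0 <= M /\ forall z, Cmod z = r -> Cmod (f z) <= M).
  { intros r Hr. set (x := ln r / (2 * PI)).
    destruct (contRC_bounded (vline (fun w => f (E2 w)) x) 0 1 ltac:(lra)) as [M [M0 HM]].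
    - apply contRC_vline, entireC_cont, (entireC_comp f E2 Hf entireC_E2).
    - exists M. split; [exact M0|]. intros z Hz.
      assert (Hz0 : z <> 0%C) by (apply Cmod_gt_0; lra).
      destruct (polar z Hz0) as [x' [s' Es]].
      assert (Ex : x' = x).
      { rewrite Es, E2_polar, Cmod_mult, Cmod_chi, Cmod_R, Rabs_pos_eq in Hz by (left; apply exp_pos).
        rewrite Rmult_1_r in Hz. unfold x. rewrite <- Hz, ln_exp. field. lra. }
      set (m := up s'). destruct (archimed s') as [U1 U2]. fold m in U1, U2.
      assert (Es2 : z = E2 (x, s' - IZR (m - 1))).
      { rewrite Es, Ex, !E2_polar. f_equal. replace s' with (s' - IZR (m - 1) + IZR (m - 1)) at 1 by ring. apply chi_period. }
      rewrite Es2. apply (HM (s' - IZR (m - 1))). rewrite minus_IZR. lra. }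
  assert (Hfd : fastdec a).
  { intros r Hr. destruct (Hbd r Hr) as [M [M0 HM]]. exists (2 * M). apply (Ha r M Hr HM). }
  exists a. split; [exact Hfd|]. split; [|exact Ha].
  set (D := fun z => (f z + (-(1)) * pser a z)%C).
  assert (HD : entireC D) by (apply entireC_plus; [exact Hf | apply entireC_scal, entireC_pser, Hfd]).
  assert (Dcf : forall k x, cf D k x = 0%C).
  { intros k x. rewrite (cf_const' D k x 0 HD). unfold D. rewrite cf_lin by (auto using entireC_pser).
    rewrite cf_pser by exact Hfd. destruct (Z_lt_le_dec k 0) as [Lk|Lk].
    (* For negative k: f is bounded near 0, so the estimate on a circle of radius R decays like
       R^|k|, whereas the coefficient does not depend on R. *)
    - assert (T : cf f k 0 = 0%C).
      { destruct (entireC_cont f Hf 0%C 1 Rlt_0_1) as [d [Hd Hdd]].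
        set (M := Cmod (f 0%C) + 1).
        assert (HM : 0 < M) by (unfold M; assert (x0 := Cmod_ge_0 (f 0%C)); lra).
        apply Cmod_eq_0. apply Rle_antisym; [|apply Cmod_ge_0]. apply Rnot_lt_le. intros Hpos.
        set (X := Cmod (cf f k 0)) in *.
        set (y := ln (Rmin (d / 2) (X / (4 * M))) / (2 * PI)).
        assert (Hmin : 0 < Rmin (d / 2) (X / (4 * M))) by (apply Rmin_pos; [lra | apply Rdiv_lt_0_compat; lra]).
        assert (Ey : exp (2 * PI * y) = Rmin (d / 2) (X / (4 * M))).
        { unfold y. replace (2 * PI * (ln (Rmin (d / 2) (X / (4 * M))) / (2 * PI))) with (ln (Rmin (d / 2) (X / (4 * M)))) by (field; lra).
          apply exp_ln, Hmin. }
        assert (Hb2 : forall y', y' <= y -> X <= 2 * M * exp (- (2 * PI * IZR k * y'))).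
        { intros y' Ly. unfold X. rewrite (cf_const' f k 0 y' Hf). apply cf_bound; [exact Hf|].
          intros z Hz. assert (Lz : Cmod z < d).
          { rewrite Hz. apply Rle_lt_trans with (exp (2 * PI * y)).
            - destruct Ly as [Ly|Ly]; [left; apply exp_increasing; nra | right; rewrite Ly; reflexivity].
            - rewrite Ey. eapply Rle_lt_trans; [apply Rmin_l | lra]. }
          specialize (Hdd z Lz). rewrite Cplus_0_l in Hdd.
          assert (Q := Cmod_triangle_rev (f z) (f 0%C)). unfold M. lra. }
        (* A radius at most 1 makes R^|k| at most R for every k <= -1. *)
        set (y' := Rmin y 0). assert (Ly : y' <= y) by apply Rmin_l. assert (Ly0 : y' <= 0) by apply Rmin_r.
        specialize (Hb2 y' Ly).
        assert (IZR k <= -1) by (apply IZR_le; lia).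
        assert (exp (- (2 * PI * IZR k * y')) <= exp (2 * PI * y')).
        { destruct (Req_dec (- (2 * PI * IZR k * y')) (2 * PI * y')) as [E|E]; [rewrite E; lra|].
          assert (Q1 : 0 <= (- IZR k - 1) * - y') by (apply Rmult_le_pos; lra).
          assert (Q2 : 0 <= PI * ((- IZR k - 1) * - y')) by (apply Rmult_le_pos; lra).
          left. apply exp_increasing. lra. }
        assert (exp (2 * PI * y') <= exp (2 * PI * y)).
        { destruct Ly as [Ly|Ly]; [left; apply exp_increasing; nra | right; rewrite Ly; reflexivity]. }
        assert (exp (2 * PI * y) <= X / (4 * M)) by (rewrite Ey; apply Rmin_r).
        assert (2 * M * (X / (4 * M)) = X / 2) by (field; lra). nra. }
      rewrite T. destruct k; try lia. ring.
    - assert (E : match k with Zneg _ => 0%C | _ => a (Z.to_nat k) end = cf f k 0).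
      { unfold a. destruct k; try lia; rewrite Z2Nat.id by lia; reflexivity. }
      rewrite E. ring. }
  assert (D0 : forall x s, D (E2 (x, s)) = 0%C).
  { intros x s. set (G := fun w => D (E2 w)).
    assert (HG : entireC G) by apply (entireC_comp D E2 HD entireC_E2).
    assert (Hc : contRC (vline G x)) by (apply contRC_vline, entireC_cont, HG).
    assert (Lip : exists L, 0 <= L /\ forall t, Rabs t <= / 2 -> Cmod (vline G x (s + t) - vline G x s)%C <= L * Rabs t).
    { destruct (HG (x, s)) as [l Hl]. destruct (WD_lip _ _ _ _ Hl) as [d [Hd Hh]].
      destruct (contRC_bounded (vline G x) (s - 1) (s + 1) ltac:(lra) Hc) as [M [M0 HM]].
      assert (Cl := Cmod_ge_0 l). rewrite Cmod_0, Rplus_0_r in Hh.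
      exists (Rmax (Cmod l + 1) (2 * M / d)). split; [eapply Rle_trans; [|apply Rmax_l]; lra|].
      intros t Ht. assert (t0 := Rabs_pos t). apply Rabs_le_between in Ht.
      destruct (Rlt_dec (Rabs t) d) as [Lt|Lt].
      - eapply Rle_trans; [|apply Rmult_le_compat_r; [exact t0 | apply Rmax_l]].
        specialize (Hh (RtoC t * Ci)%C). rewrite Cmod_mult, Cmod_R, Cmod_Ci, Rmult_1_r in Hh. specialize (Hh Lt).
        unfold vline. replace ((x, s + t) : C) with ((x, s) + RtoC t * Ci)%C by (csolve). exact Hh.
      - eapply Rle_trans; [|apply Rmult_le_compat_r; [exact t0 | apply Rmax_r]].
        eapply Rle_trans; [apply Cmod_triangle'|].
        assert (A1 := HM (s + t) ltac:(lra)). assert (A2 := HM s ltac:(lra)).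
        apply Rle_trans with (2 * M / d * d).
        + replace (2 * M / d * d) with (2 * M) by (field; lra). lra.
        + apply Rmult_le_compat_l; [|lra]. apply Rmult_le_pos; [lra | left; apply Rinv_0_lt_compat; lra]. }
    destruct Lip as [L [L0 HL]].
    apply (fourier_unique (vline G x) s L Hc).
    - intros t. unfold vline, G. f_equal. rewrite !E2_polar. f_equal. apply (chi_period 1 t 1).
    - intros k. assert (Z := Dcf (- k)%Z x). unfold cf in Z.
      rewrite (CI_ext _ (fun t => RtoC (exp (2 * PI * IZR k * x)) * (vline G x t * chi k t))%C) in Z.
      + rewrite CI_scal in Z by (apply contRC_mult; [exact Hc | apply contRC_chi]).
        apply (f_equal (fun z => RtoC (exp (- (2 * PI * IZR k * x))) * z)%C) in Z.
        rewrite Cmult_assoc, <- RtoC_mult, <- exp_plus, Rplus_opp_l, exp_0, Cmult_1_l, Cmult_0_r in Z. exact Z.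
      + intros t _. unfold vline, cfG, G. rewrite Ek_polar, opp_IZR, Z.opp_involutive.
        replace (- (2 * PI * - IZR k * x)) with (2 * PI * IZR k * x) by ring. ring.
    - exact L0.
    - exact HL. }
  (* The origin lies on no circle and is reached by continuity. *)
  assert (Dz : forall z, D z = 0%C).
  { intros z. destruct (Ceq_dec z 0) as [->|N].
    - apply Cmod_eq_0. apply Rle_antisym; [|apply Cmod_ge_0]. apply Rnot_lt_le. intros Hpos.
      destruct (entireC_cont D HD 0%C _ Hpos) as [d [Hd Hdd]].
      specialize (Hdd (RtoC (d / 2))). rewrite Cmod_R, Rabs_pos_eq, Cplus_0_l in Hdd by lra.
      destruct (polar (RtoC (d / 2))) as [x [s E]]; [intros Hz0; apply (f_equal fst) in Hz0; simpl in Hz0; lra|].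
      rewrite E, D0 in Hdd at 1. specialize (Hdd ltac:(lra)).
      replace (0 - D 0)%C with (- D 0)%C in Hdd by ring. rewrite Cmod_opp in Hdd. lra.
    - destruct (polar z N) as [x [s ->]]. apply D0. }
  intros z. specialize (Dz z). unfold D in Dz.
  replace (f z) with (f z + -(1) * pser a z + pser a z)%C by ring. rewrite Dz. ring.
Qed.

(** * Derivatives, division and growth of entire functions *)

(* Junk value where [f] is not complex differentiable. *)
Definition der (f : C -> C) (z : C) : C := epsilon (inhabits (RtoC 0)) (fun l => WD f z l 0).

Lemma WD_der f z : entireC f -> WD f z (der f z) 0.
Proof. intros H. apply (epsilon_spec (inhabits (RtoC 0)) (fun l => WD f z l 0)), H. Qed.
Lemma der_eq f z l : WD f z l 0 -> der f z = l.
Proof.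
  intros H. apply (WD_unique f z); [|exact H].
  apply (epsilon_spec (inhabits (RtoC 0)) (fun l => WD f z l 0)). exists l; exact H.
Qed.
Lemma der_ext f g z : (forall z, f z = g z) -> der f z = der g z.
Proof. intros E. replace g with f; [reflexivity | apply functional_extensionality, E]. Qed.

Lemma entireC_der f : entireC f -> entireC (der f).
Proof.
  intros H. destruct (entire_pser f H) as [a [Ha [E _]]].
  apply entireC_ext with (f := pser (shift_coef a)).
  - intros z. symmetry. apply der_eq. eapply WD_ext; [| | | apply (WD_pser a z Ha)]; auto.
  - apply entireC_pser, fastdec_shift, Ha.
Qed.

Lemma der_plus f g z : entireC f -> entireC g -> der (fun z => f z + g z)%C z = (der f z + der g z)%C.
Proof.
  intros Hf Hg. apply der_eq. eapply WD_ext; [| | | apply (WD_plus _ _ _ _ _ _ _ (WD_der f z Hf) (WD_der g z Hg))];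
  [reflexivity | reflexivity | ring].
Qed.
Lemma der_mult f g z : entireC f -> entireC g -> der (fun z => f z * g z)%C z = (der f z * g z + f z * der g z)%C.
Proof.
  intros Hf Hg. apply der_eq. eapply WD_ext; [| | | apply (WD_mult _ _ _ _ _ _ _ (WD_der f z Hf) (WD_der g z Hg))];
  [reflexivity | reflexivity | ring].
Qed.
Lemma der_scal c f z : entireC f -> der (fun z => c * f z)%C z = (c * der f z)%C.
Proof.
  intros Hf. apply der_eq. eapply WD_ext; [| | | apply (WD_scal c _ _ _ _ (WD_der f z Hf))];
  [reflexivity | reflexivity | ring].
Qed.
Lemma der_const c z : der (fun _ => c) z = 0%C.
Proof. apply der_eq, WD_const. Qed.
Lemma der_id z : der (fun z => z) z = 1%C.
Proof. apply der_eq, WD_id. Qed.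

Lemma entireC_shift f w : entireC f -> entireC (fun z => f (z + w)%C).
Proof. intros H. apply (entireC_comp f (fun z => z + w)%C H), entireC_plus; [apply entireC_id | apply entireC_const]. Qed.

Lemma pser_0 a : fastdec a -> pser a 0%C = a O.
Proof.
  intros H. destruct (pser_dom a 1 H (Rle_refl 1)) as [b [Hb Hd]].
  unfold pser. rewrite (CSer_S _ b); [|intros n; apply Hd; rewrite Cmod_0; lra | exact Hb].
  rewrite (CSer_ext _ (fun _ => 0 * 0)%C) by (intros; simpl; ring).
  rewrite (CSer_scal 0 (fun _ => 0%C) b); [simpl; ring | | exact Hb].
  intros n. rewrite Cmod_0. eapply Rle_trans; [apply Cmod_ge_0 | apply (Hd 0%C n)]. rewrite Cmod_0; lra.
Qed.

Lemma der_cauchy f z M : entireC f -> (forall w, Cmod w = 1 -> Cmod (f (z + w)%C) <= M) -> Cmod (der f z) <= 2 * M.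
Proof.
  intros H B. set (g := fun w => f (w + z)%C).
  assert (Hg : entireC g) by apply entireC_shift, H.
  destruct (entire_pser g Hg) as [a [Ha [E Hb]]].
  assert (D : der f z = a 1%nat).
  { apply der_eq.
    assert (W : WD g 0 (pser (shift_coef a) 0) 0) by (eapply WD_ext; [| | | apply (WD_pser a 0 Ha)]; auto).
    rewrite pser_0 in W by apply fastdec_shift, Ha. unfold shift_coef in W. simpl in W. rewrite Cmult_1_l in W.
    intros eps He. destruct (W eps He) as [d [Hd Hh]]. exists d; split; [exact Hd|]. intros h Hlt.
    specialize (Hh h Hlt). unfold g in Hh. rewrite !Cplus_0_l, (Cplus_comm h z) in Hh. exact Hh. }
  rewrite D. specialize (Hb 1 M Rlt_0_1). rewrite <- (Rmult_1_r (Cmod (a 1%nat))).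
  rewrite <- (pow_1 1). apply Hb. intros w Hw. unfold g. rewrite Cplus_comm. apply B, Hw.
Qed.

Lemma entire_bounded f r : entireC f -> exists M, 0 <= M /\ forall z, Cmod z <= r -> Cmod (f z) <= M.
Proof.
  intros H. destruct (entire_pser f H) as [a [Ha [E _]]].
  destruct (pser_dom a (Rmax 1 r) Ha (Rmax_l _ _)) as [b [Hb Hd]].
  assert (B : forall z, Cmod z <= r -> Cmod (f z) <= 2 * Series b).
  { intros z Hz. rewrite E. apply CSer_bound; [|exact Hb]. intros n; apply Hd. eapply Rle_trans; [exact Hz | apply Rmax_r]. }
  exists (Rmax 0 (2 * Series b)). split; [apply Rmax_l|]. intros z Hz. eapply Rle_trans; [apply B, Hz | apply Rmax_r].
Qed.

Lemma fastdec_S a : fastdec a -> fastdec (fun k => a (S k)).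
Proof.
  intros H r Hr. destruct (H r Hr) as [M HM]. exists (M / r). intros k.
  apply (proj1 (Rle_div_r _ _ r Hr)). specialize (HM (S k)). simpl in HM. lra.
Qed.
Lemma pser_S a z : fastdec a -> pser a z = (a O + z * pser (fun k => a (S k)) z)%C.
Proof.
  intros H. destruct (pser_dom a (Rmax 1 (Cmod z)) H (Rmax_l _ _)) as [b [Hb Hd]].
  destruct (pser_dom _ (Rmax 1 (Cmod z)) (fastdec_S a H) (Rmax_l _ _)) as [b' [Hb' Hd']].
  unfold pser. rewrite (CSer_S _ b); [|intros n; apply Hd, Rmax_r | exact Hb].
  rewrite <- (CSer_scal z _ b') by (auto; intros; apply Hd', Rmax_r). f_equal; [simpl; ring|].
  apply CSer_ext. intros; simpl; ring.
Qed.

Lemma entire_div0 f : entireC f -> f 0%C = 0%C -> exists g, entireC g /\ forall z, f z = (z * g z)%C.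
Proof.
  intros H H0. destruct (entire_pser f H) as [a [Ha [E _]]].
  exists (pser (fun k => a (S k))). split; [apply entireC_pser, fastdec_S, Ha|].
  intros z. rewrite E, pser_S by exact Ha. replace (a O) with (RtoC 0); [ring|].
  rewrite <- H0, E, pser_0 by exact Ha. reflexivity.
Qed.
Lemma entire_div f b : entireC f -> f b = 0%C -> exists g, entireC g /\ forall z, f z = ((z - b) * g z)%C.
Proof.
  intros H Hb. destruct (entire_div0 (fun z => f (z + b)%C)) as [g [Hg E]].
  - apply entireC_shift, H.
  - rewrite Cplus_0_l. exact Hb.
  - exists (fun z => g (z + - b)%C). split; [apply entireC_shift, Hg|].
    intros z. specialize (E (z - b)%C). replace (z - b + b)%C with z in E by ring. exact E.
Qed.
Lemma entire_order f z1 : entireC f -> f z1 <> 0%C ->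
  exists p g, entireC g /\ g 0%C <> 0%C /\ forall z, f z = (z ^ p * g z)%C.
Proof.
  intros H Hz. destruct (entire_pser f H) as [a [Ha [E _]]].
  assert (N : exists k, a k <> 0%C).
  { destruct (excluded_middle_informative (exists k, a k <> 0%C)) as [e|e]; [exact e|exfalso].
    apply Hz. rewrite E. unfold pser. rewrite (CSer_ext _ (fun _ => 0 * 0)%C).
    - rewrite (CSer_scal 0 (fun _ => 0%C) (fun k => 0 * (/2) ^ k)); [ring | intros; rewrite Cmod_0; lra | apply ex_series_half].
    - intros n. destruct (Ceq_dec (a n) 0) as [->|n0]; [ring | exfalso; apply e; eauto]. }
  assert (K : forall k a, fastdec a -> a k <> 0%C -> exists p g, entireC g /\ g 0%C <> 0%C /\ forall z, pser a z = (z ^ p * g z)%C).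
  { clear. induction k; intros a Ha N.
    - exists O, (pser a). split; [apply entireC_pser, Ha|]. split; [rewrite pser_0 by exact Ha; exact N | intros; simpl; ring].
    - destruct (Ceq_dec (a O) 0) as [Z|Z].
      + destruct (IHk (fun k => a (S k)) (fastdec_S a Ha) N) as [p [g [Hg [g0 Eg]]]].
        exists (S p), g. split; [exact Hg|]. split; [exact g0|].
        intros z. rewrite pser_S, Z, Eg by exact Ha. simpl. ring.
      + exists O, (pser a). split; [apply entireC_pser, Ha|]. split; [rewrite pser_0 by exact Ha; exact Z | intros; simpl; ring]. }
  destruct N as [k Nk]. destruct (K k a Ha Nk) as [p [g [Hg [g0 Eg]]]].
  exists p, g. split; [exact Hg|]. split; [exact g0|]. intros z. rewrite E. apply Eg.
Qed.

(* Growth at most [exp (k * Cmod z ^ 2)], up to an arbitrarily small loss in [k]. *)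
Definition Gr (k : R) (f : C -> C) : Prop :=
  forall k', k < k' -> exists M, 0 <= M /\ forall z, Cmod (f z) <= M * exp (k' * Cmod z ^ 2).

Lemma Gr_ext k f g : (forall z, f z = g z) -> Gr k f -> Gr k g.
Proof. intros E H k' L. destruct (H k' L) as [M [M0 HM]]. exists M; split; [exact M0|]. intros; rewrite <- E; apply HM. Qed.
Lemma Gr_le k1 k2 f : k1 <= k2 -> Gr k1 f -> Gr k2 f.
Proof. intros L H k' L'. apply H; lra. Qed.
Lemma Gr_plus k f g : Gr k f -> Gr k g -> Gr k (fun z => f z + g z)%C.
Proof.
  intros H1 H2 k' L. destruct (H1 k' L) as [M1 [P1 B1]], (H2 k' L) as [M2 [P2 B2]].
  exists (M1 + M2); split; [lra|]. intros z. eapply Rle_trans; [apply Cmod_triangle|].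
  specialize (B1 z). specialize (B2 z). lra.
Qed.
Lemma Gr_mult k1 k2 f g : Gr k1 f -> Gr k2 g -> Gr (k1 + k2) (fun z => f z * g z)%C.
Proof.
  intros H1 H2 k' L. set (e := (k' - k1 - k2) / 2).
  destruct (H1 (k1 + e)) as [M1 [P1 B1]]; [unfold e; lra|].
  destruct (H2 (k2 + e)) as [M2 [P2 B2]]; [unfold e; lra|].
  exists (M1 * M2); split; [apply Rmult_le_pos; assumption|]. intros z. rewrite Cmod_mult.
  replace (k' * Cmod z ^ 2) with ((k1 + e) * Cmod z ^ 2 + (k2 + e) * Cmod z ^ 2) by (unfold e; field).
  rewrite exp_plus.
  replace (M1 * M2 * (exp ((k1 + e) * Cmod z ^ 2) * exp ((k2 + e) * Cmod z ^ 2))) with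
    (M1 * exp ((k1 + e) * Cmod z ^ 2) * (M2 * exp ((k2 + e) * Cmod z ^ 2))) by ring.
  apply Rmult_le_compat; auto using Cmod_ge_0.
Qed.
Lemma exp_ge_1 x : 0 <= x -> 1 <= exp x.
Proof. intros H. assert (E := exp_ineq1_le x). lra. Qed.
Lemma Gr_const c : Gr 0 (fun _ => c).
Proof.
  intros k' L. exists (Cmod c); split; [apply Cmod_ge_0|]. intros z.
  rewrite <- (Rmult_1_r (Cmod c)) at 1. apply Rmult_le_compat_l; [apply Cmod_ge_0|]. apply exp_ge_1.
  apply Rmult_le_pos; [lra | apply pow2_ge_0].
Qed.
Lemma Gr_scal c k f : Gr k f -> Gr k (fun z => c * f z)%C.
Proof. intros H. rewrite <- (Rplus_0_l k). apply Gr_mult; [apply Gr_const | exact H]. Qed.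
Lemma Gr_lin (g : C -> C) A : (forall z, Cmod (g z) <= A * Cmod z) -> 0 <= A -> Gr 0 g.
Proof.
  intros H HA k' L. exists (A * (1 + / k')). assert (P : 0 < / k') by (apply Rinv_0_lt_compat; lra).
  split; [apply Rmult_le_pos; lra|]. intros z. eapply Rle_trans; [apply H|].
  rewrite Rmult_assoc. apply Rmult_le_compat_l; [exact HA|].
  assert (E := exp_ineq1_le (k' * Cmod z ^ 2)). assert (z0 := Cmod_ge_0 z).
  assert (Q : Cmod z <= 1 + Cmod z ^ 2) by nra. assert (Q2 := pow2_ge_0 (Cmod z)).
  apply Rle_trans with ((1 + / k') * (1 + k' * Cmod z ^ 2)); [|apply Rmult_le_compat_l; lra].
  replace ((1 + / k') * (1 + k' * Cmod z ^ 2)) with (1 + Cmod z ^ 2 + / k' + k' * Cmod z ^ 2) by (field; lra).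
  assert (0 <= k' * Cmod z ^ 2) by (apply Rmult_le_pos; lra). lra.
Qed.
Lemma Gr_id : Gr 0 (fun z => z).
Proof. apply (Gr_lin _ 1); intros; lra. Qed.
Lemma Gr_conj : Gr 0 Cconj.
Proof. apply (Gr_lin _ 1); intros; rewrite ?Cmod_conj; lra. Qed.
Lemma Gr_pow f n : Gr 0 f -> Gr 0 (fun z => f z ^ n)%C.
Proof.
  intros H; induction n; simpl; [apply Gr_const|]. rewrite <- (Rplus_0_l 0). apply Gr_mult; assumption.
Qed.
Lemma Gr_cexp (g : C -> C) A : (forall z, Rabs (fst (g z)) <= A * Cmod z) -> Gr 0 (fun z => cexp (g z)).
Proof.
  intros H k' L. exists (exp (A ^ 2 / k')). split; [left; apply exp_pos|].
  intros z. rewrite Cmod_cexp, <- exp_plus.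
  assert (Q : fst (g z) <= A ^ 2 / k' + k' * Cmod z ^ 2).
  { eapply Rle_trans; [apply Rle_abs|]. eapply Rle_trans; [apply H|].
    assert (I : 0 <= (A - k' * Cmod z) ^ 2 / k') by (apply Rmult_le_pos; [apply pow2_ge_0 | left; apply Rinv_0_lt_compat; lra]).
    assert (I2 : 0 <= A ^ 2 / k') by (apply Rmult_le_pos; [apply pow2_ge_0 | left; apply Rinv_0_lt_compat; lra]).
    assert (I3 : 0 <= k' * Cmod z ^ 2) by (apply Rmult_le_pos; [lra | apply pow2_ge_0]).
    replace ((A - k' * Cmod z) ^ 2 / k') with (A ^ 2 / k' - 2 * (A * Cmod z) + k' * Cmod z ^ 2) in I by (field; lra). lra. }
  destruct Q as [Q|Q]; [left; apply exp_increasing, Q | right; rewrite Q; reflexivity].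
Qed.
Lemma exp_le x y : x <= y -> exp x <= exp y.
Proof. intros [L|E]; [left; apply exp_increasing, L | right; rewrite E; reflexivity]. Qed.

(** A bounded shift changes |z|^2 by a term linear in |z|, which e |z|^2 absorbs after completing
    the square. The sign of k is arbitrary: growth and decay are both treated. *)
Lemma exp_sq_shift k e W : 0 < e -> 0 <= W -> exists M, 0 < M /\ forall z w, Cmod w <= W ->
  exp (k * Cmod (z + w) ^ 2) <= M * exp ((k + e) * Cmod z ^ 2).
Proof.
  intros He HW. set (K := Rabs k). assert (K0 : 0 <= K) by apply Rabs_pos.
  exists (exp (K * W ^ 2 + (K * W) ^ 2 / e)). split; [apply exp_pos|]. intros z w Hw.
  rewrite <- exp_plus. apply exp_le.
  set (a := Cmod z). set (b := Cmod (z + w)). assert (a0 : 0 <= a) by apply Cmod_ge_0. assert (b0 : 0 <= b) by apply Cmod_ge_0.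
  assert (w0 := Cmod_ge_0 w).
  assert (T1 : b <= a + W) by (unfold b, a; eapply Rle_trans; [apply Cmod_triangle | lra]).
  assert (T2 : a - W <= b).
  { unfold a, b. assert (T := Cmod_triangle_rev z (- w)). rewrite Cmod_opp in T.
    replace (z - - w)%C with (z + w)%C in T by ring. lra. }
  assert (D : k * (b ^ 2 - a ^ 2) <= K * (2 * a * W + W ^ 2)).
  { eapply Rle_trans; [apply Rle_abs|]. rewrite Rabs_mult. apply Rmult_le_compat_l; [exact K0|].
    apply Rabs_le. split; nra. }
  assert (I : 0 <= (K * W - e * a) ^ 2 / e) by (apply Rmult_le_pos; [apply pow2_ge_0 | left; apply Rinv_0_lt_compat; lra]).
  replace ((K * W - e * a) ^ 2 / e) with ((K * W) ^ 2 / e - 2 * (K * W * a) + e * a ^ 2) in I by (field; lra).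
  nra.
Qed.

Lemma Gr_der k f : entireC f -> Gr k f -> Gr k (der f).
Proof.
  intros Hf H k' L. set (e := (k' - k) / 2). destruct (H (k + e)) as [M [M0 B]]; [unfold e; lra|].
  destruct (exp_sq_shift (k + e) e 1) as [M' [P' B']]; [unfold e; lra | lra|].
  exists (2 * (M * M')). split; [apply Rmult_le_pos; [lra | apply Rmult_le_pos; lra]|]. intros z.
  rewrite !Rmult_assoc. apply der_cauchy; [exact Hf|]. intros w Hw. eapply Rle_trans; [apply B|].
  apply Rmult_le_compat_l; [exact M0|]. replace k' with (k + e + e) by (unfold e; field). apply B'; lra.
Qed.
(** Where |z - b| >= 1 the quotient is no larger than f; near b it is bounded by compactness, which
    the constant absorbs. *)
Lemma Gr_div k f g b : entireC g -> (forall z, f z = ((z - b) * g z)%C) -> Gr k f -> Gr k g.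
Proof.
  intros Hg E H k' L. destruct (H k' L) as [M [M0 B]].
  set (r := Cmod b + 1). assert (r0 : 1 <= r) by (unfold r; assert (x := Cmod_ge_0 b); lra).
  destruct (entire_bounded g r Hg) as [M1 [P1 B1]].
  exists (M + M1 * exp (Rabs k' * r ^ 2)). assert (X : 0 < exp (Rabs k' * r ^ 2)) by apply exp_pos.
  split; [nra|]. intros z. assert (Ez := exp_pos (k' * Cmod z ^ 2)).
  destruct (Rle_dec (Cmod (z - b)) 1) as [D|D].
  - assert (Lz : Cmod z <= r).
    { unfold r. assert (T := Cmod_triangle (z - b) b). replace (z - b + b)%C with z in T by ring. lra. }
    eapply Rle_trans; [apply B1, Lz|].
    assert (Q : 1 <= exp (Rabs k' * r ^ 2) * exp (k' * Cmod z ^ 2)).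
    { rewrite <- exp_plus. apply exp_ge_1. assert (z0 := Cmod_ge_0 z).
      assert (Cmod z ^ 2 <= r ^ 2) by (apply pow_incr; lra). assert (A := Rabs_pos k').
      assert (N : - Rabs k' <= k') by (assert (a := Rle_abs (- k')); rewrite Rabs_Ropp in a; lra).
      assert (0 <= Cmod z ^ 2) by apply pow2_ge_0. nra. }
    assert (0 <= M * exp (k' * Cmod z ^ 2)) by (apply Rmult_le_pos; lra). nra.
  - specialize (B z). rewrite E, Cmod_mult in B. assert (g0 := Cmod_ge_0 (g z)).
    assert (Cmod (g z) <= Cmod (z - b) * Cmod (g z)) by nra.
    assert (0 <= M1 * exp (Rabs k' * r ^ 2) * exp (k' * Cmod z ^ 2)) by (repeat apply Rmult_le_pos; lra). lra.
Qed.

(** * Negligible averages *)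

Lemma Cmod_im_conj (a b : C) : Rabs (snd (Cconj a * b)%C) <= Cmod a * Cmod b.
Proof. eapply Rle_trans; [apply snd_le_Cmod|]. rewrite Cmod_mult, Cmod_conj. lra. Qed.

(* [snd (Cconj w1 * w2)] is the determinant of the basis [(w1, w2)]. *)
Lemma lattice_lower (w1 w2 : C) : snd (Cconj w1 * w2)%C <> 0 ->
  exists k, 0 < k /\ forall s t : R, k * (Rabs s + Rabs t) <= Cmod (RtoC s * w1 + RtoC t * w2)%C.
Proof.
  intros H. set (d := Rabs (snd (Cconj w1 * w2)%C)). assert (Hd : 0 < d) by (apply Rabs_pos_lt, H).
  set (S := Cmod w1 + Cmod w2 + 1).
  assert (a1 := Cmod_ge_0 w1). assert (a2 := Cmod_ge_0 w2).
  exists (d / S). split; [apply Rdiv_lt_0_compat; unfold S; lra|]. intros s t.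
  set (z := (RtoC s * w1 + RtoC t * w2)%C).
  assert (B1 : Rabs t * d <= Cmod w1 * Cmod z).
  { eapply Rle_trans; [|apply Cmod_im_conj]. right. unfold d. rewrite <- Rabs_mult. f_equal. unfold z. simpl. ring. }
  assert (B2 : Rabs s * d <= Cmod w2 * Cmod z).
  { eapply Rle_trans; [|apply Cmod_im_conj]. right. unfold d. rewrite <- Rabs_mult, <- (Rabs_Ropp (snd _)). f_equal. unfold z. simpl. ring. }
  assert (z0 := Cmod_ge_0 z).
  replace (d / S * (Rabs s + Rabs t)) with ((d * (Rabs s + Rabs t)) / S) by (unfold S; field; lra).
  apply Rle_div_l; [unfold S; lra|]. unfold S. nra.
Qed.

Section Null.
Variables (w1 w2 : C).

Definition lp (w : C) (s t : R) : C := (w + RtoC s * w1 + RtoC t * w2)%C.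
(** Integration in lattice coordinates keeps cells and characters simple; the constant Jacobian is
    dropped, as such integrals are only compared with one another. *)
Definition IC (u : C -> R) (w : C) (r : R) : R := II (fun s t => u (lp w s t)) (- r) r (- r) r.
Definition CIC (u : C -> C) (w : C) (r : R) : C := (IC (fun z => fst (u z)) w r, IC (fun z => snd (u z)) w r).
(* Negligible average over large cells: derivatives of decaying functions have this property by Stokes. *)
Definition Null (u : C -> C) : Prop :=
  contC u /\ forall w eta, 0 < eta -> exists R0, forall R, R0 <= R -> Cmod (CIC u w R) <= eta.

Lemma cont2_fst u w : contC u -> cont2 (fun s t => fst (u (lp w s t))).
Proof. intros H. apply (contC_cont2 u w w1 w2 H). Qed.
Lemma cont2_snd u w : contC u -> cont2 (fun s t => snd (u (lp w s t))).
Proof. intros H. apply (contC_cont2 u w w1 w2 H). Qed.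
Lemma cont2_mod u w : contC u -> cont2 (fun s t => Cmod (u (lp w s t))).
Proof. intros H. apply (cont2_fst (fun z => RtoC (Cmod (u z))) w), contC_Cmod, H. Qed.

Lemma CIC_ext u v w R : (forall z, u z = v z) -> CIC u w R = CIC v w R.
Proof. intros E. replace v with u; [reflexivity | apply functional_extensionality, E]. Qed.
Lemma CIC_plus u v w R : contC u -> contC v -> CIC (fun z => u z + v z)%C w R = (CIC u w R + CIC v w R)%C.
Proof.
  intros Hu Hv. apply C_ext; simpl; unfold IC.
  - apply (II_plus (fun s t => fst (u (lp w s t))) (fun s t => fst (v (lp w s t)))); apply cont2_fst; assumption.
  - apply (II_plus (fun s t => snd (u (lp w s t))) (fun s t => snd (v (lp w s t)))); apply cont2_snd; assumption.
Qed.
Lemma CIC_scal c u w R : contC u -> CIC (fun z => c * u z)%C w R = (c * CIC u w R)%C.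
Proof.
  intros Hu. assert (F := cont2_fst u w Hu). assert (S := cont2_snd u w Hu).
  apply C_ext; simpl; unfold IC.
  - rewrite (II_ext _ (fun s t => fst c * fst (u (lp w s t)) + (- snd c) * snd (u (lp w s t)))) by (intros; simpl; ring).
    rewrite II_plus by (apply cont2_scal; assumption). rewrite !II_scal by assumption. ring.
  - rewrite (II_plus (fun s t => fst c * snd (u (lp w s t))) (fun s t => snd c * fst (u (lp w s t)))) by (apply cont2_scal; assumption). rewrite !II_scal by assumption. ring.
Qed.
Lemma CIC_le u w R : 0 <= R -> contC u -> Cmod (CIC u w R) <= 2 * IC (fun z => Cmod (u z)) w R.
Proof.
  intros HR Hu. eapply Rle_trans; [apply Cmod_le_sum|]. simpl. unfold IC.
  assert (A1 : Rabs (II (fun s t => fst (u (lp w s t))) (- R) R (- R) R) <= II (fun s t => Cmod (u (lp w s t))) (- R) R (- R) R).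
  { eapply Rle_trans; [apply II_abs; try lra; apply cont2_fst, Hu|].
    apply II_le; try lra; [apply cont2_abs, cont2_fst, Hu | apply cont2_mod, Hu | intros; apply fst_le_Cmod]. }
  assert (A2 : Rabs (II (fun s t => snd (u (lp w s t))) (- R) R (- R) R) <= II (fun s t => Cmod (u (lp w s t))) (- R) R (- R) R).
  { eapply Rle_trans; [apply II_abs; try lra; apply cont2_snd, Hu|].
    apply II_le; try lra; [apply cont2_abs, cont2_snd, Hu | apply cont2_mod, Hu | intros; apply snd_le_Cmod]. }
  lra.
Qed.

Lemma Null_ext u v : (forall z, u z = v z) -> Null u -> Null v.
Proof. intros E. replace v with u; [auto | apply functional_extensionality, E]. Qed.
Lemma Null_plus u v : Null u -> Null v -> Null (fun z => u z + v z)%C.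
Proof.
  intros [Cu Nu] [Cv Nv]. split; [apply contC_plus; assumption|]. intros w eta He.
  destruct (Nu w (eta/2)) as [R1 H1]; [lra|]. destruct (Nv w (eta/2)) as [R2 H2]; [lra|].
  exists (Rmax R1 R2). intros R HR. rewrite CIC_plus by assumption.
  specialize (H1 R (Rle_trans _ _ _ (Rmax_l _ _) HR)). specialize (H2 R (Rle_trans _ _ _ (Rmax_r _ _) HR)).
  eapply Rle_trans; [apply Cmod_triangle|]. lra.
Qed.
Lemma Null_scal c u : Null u -> Null (fun z => c * u z)%C.
Proof.
  intros [Cu Nu]. split; [apply contC_mult; [apply contC_const | assumption]|]. intros w eta He.
  assert (c0 := Cmod_ge_0 c).
  destruct (Nu w (eta / (Cmod c + 1))) as [R1 H1]; [apply Rdiv_lt_0_compat; lra|].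
  exists R1. intros R HR. rewrite CIC_scal, Cmod_mult by assumption. specialize (H1 R HR).
  assert (x0 := Cmod_ge_0 (CIC u w R)).
  apply (Rmult_le_compat_l (Cmod c + 1)) in H1; [|lra].
  replace ((Cmod c + 1) * (eta / (Cmod c + 1))) with eta in H1 by (field; lra). nra.
Qed.
Lemma Null_0 : Null (fun _ => 0%C).
Proof.
  split; [apply contC_const|]. intros w eta He. exists 0. intros R _.
  replace (CIC (fun _ => 0%C) w R) with (RtoC 0); [rewrite Cmod_0; lra|].
  apply C_ext; simpl; unfold IC; rewrite II_const; ring.
Qed.

(** The perimeter of a cell grows linearly, so o(1/|z|) is what makes the boundary terms of Stokes
    vanish. *)
Definition decays (u : C -> C) : Prop :=
  forall eta, 0 < eta -> exists R0, forall z, R0 <= Cmod z -> Cmod z * Cmod (u z) <= eta.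

Hypothesis det : snd (Cconj w1 * w2)%C <> 0.

Lemma boundary_small u w eta : decays u -> 0 < eta -> exists R0, 0 < R0 /\ forall R s t, R0 <= R ->
  (Rabs s = R \/ Rabs t = R) -> Cmod (u (lp w s t)) <= eta / (8 * R).
Proof.
  intros H He. destruct (lattice_lower w1 w2 det) as [k [Hk L]].
  destruct (H (eta * k / 16)) as [R1 HR1]; [apply Rdiv_lt_0_compat; [apply Rmult_lt_0_compat; lra | lra]|].
  assert (w0 := Cmod_ge_0 w).
  set (R0 := Rmax (2 * Cmod w / k) (2 * R1 / k)).
  exists (Rmax 1 R0). split; [eapply Rlt_le_trans; [apply Rlt_0_1 | apply Rmax_l]|]. intros R s t HR Hst.
  assert (H1 : 1 <= R) by (eapply Rle_trans; [apply Rmax_l | exact HR]).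
  assert (H2 : R0 <= R) by (eapply Rle_trans; [apply Rmax_r | exact HR]).
  assert (H3 : 2 * Cmod w / k <= R) by (eapply Rle_trans; [apply Rmax_l | exact H2]).
  assert (H4 : 2 * R1 / k <= R) by (eapply Rle_trans; [apply Rmax_r | exact H2]).
  apply Rle_div_l in H3; [|lra]. apply Rle_div_l in H4; [|lra].
  specialize (L s t). assert (s0 := Rabs_pos s). assert (t0 := Rabs_pos t).
  assert (L2 : k * R <= Cmod (RtoC s * w1 + RtoC t * w2)%C) by (destruct Hst; nra).
  assert (Lz : k * R / 2 <= Cmod (lp w s t)).
  { unfold lp. assert (T := Cmod_triangle_rev (RtoC s * w1 + RtoC t * w2) (- w)). rewrite Cmod_opp in T.
    replace (RtoC s * w1 + RtoC t * w2 - - w)%C with (w + RtoC s * w1 + RtoC t * w2)%C in T by ring. lra. }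
  specialize (HR1 (lp w s t) ltac:(lra)).
  apply (proj1 (Rle_div_r _ _ (8 * R) ltac:(lra))). assert (u0 := Cmod_ge_0 (u (lp w s t))).
  assert (Q : k * R / 2 * Cmod (u (lp w s t)) <= eta * k / 16) by nra.
  assert (kR : 0 < k * R) by (apply Rmult_lt_0_compat; lra).
  apply Rmult_le_reg_l with (k / 16); [lra|]. nra.
Qed.

(** Stokes in each lattice direction makes the directional derivatives of u along w1 and w2 null. *)
Lemma Null_exact u p q : (forall z, WD u z (p z) (q z)) -> contC p -> contC q -> decays u -> Null p /\ Null q.
Proof.
  intros D Cp Cq Du. assert (Cu := WD_cont u p q D).
  assert (N1 : Null (fun z => p z * w1 + q z * Cconj w1)%C).
  { assert (Cf : contC (fun z => p z * w1 + q z * Cconj w1)%C)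
      by (apply contC_plus; apply contC_mult; auto using contC_const).
    split; [exact Cf|]. intros w eta He. destruct (boundary_small u w eta Du He) as [R0 [HR0 B]].
    exists R0. intros R HR.
    assert (RDx : forall x y, RD (fun x => u (lp w x y)) x (p (lp w x y) * w1 + q (lp w x y) * Cconj w1)%C).
    { intros x y. assert (E := WD_RD u (w + RtoC y * w2)%C w1 x _ _ (D _)).
      assert (Ez : forall x, (w + RtoC y * w2 + RtoC x * w1)%C = lp w x y) by (intros; unfold lp; ring).
      rewrite Ez in E. destruct E as [E1 E2]. split;
      [eapply is_derive_ext; [|exact E1] | eapply is_derive_ext; [|exact E2]]; intros t; cbv beta; rewrite Ez; reflexivity. }
    eapply Rle_trans; [apply Cmod_le_sum|]. simpl. unfold IC.
    assert (X1 := II_deriv_x (fun s t => fst (p (lp w s t) * w1 + q (lp w s t) * Cconj w1)%C) (fun s t => fst (u (lp w s t)))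
       (- R) R (- R) R (eta / (8 * R)) ltac:(lra) ltac:(lra) (cont2_fst _ w Cf) (cont2_fst u w Cu) (fun x y => proj1 (RDx x y))).
    assert (X2 := II_deriv_x (fun s t => snd (p (lp w s t) * w1 + q (lp w s t) * Cconj w1)%C) (fun s t => snd (u (lp w s t)))
       (- R) R (- R) R (eta / (8 * R)) ltac:(lra) ltac:(lra) (cont2_snd _ w Cf) (cont2_snd u w Cu) (fun x y => proj2 (RDx x y))).
    assert (F : (R - - R) * (2 * (eta / (8 * R))) = eta / 2) by (field; lra). rewrite F in X1, X2.
    assert (Y1 := X1 ltac:(intros y _; split; (eapply Rle_trans; [apply fst_le_Cmod | apply B; [exact HR | left; rewrite ?Rabs_Ropp; apply Rabs_pos_eq; lra]]))).
    assert (Y2 := X2 ltac:(intros y _; split; (eapply Rle_trans; [apply snd_le_Cmod | apply B; [exact HR | left; rewrite ?Rabs_Ropp; apply Rabs_pos_eq; lra]]))).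
    simpl in Y1, Y2. lra. }
  assert (N2 : Null (fun z => p z * w2 + q z * Cconj w2)%C).
  { assert (Cf : contC (fun z => p z * w2 + q z * Cconj w2)%C)
      by (apply contC_plus; apply contC_mult; auto using contC_const).
    split; [exact Cf|]. intros w eta He. destruct (boundary_small u w eta Du He) as [R0 [HR0 B]].
    exists R0. intros R HR.
    assert (RDy : forall x y, RD (fun y => u (lp w x y)) y (p (lp w x y) * w2 + q (lp w x y) * Cconj w2)%C)
      by (intros x y; exact (WD_RD u (w + RtoC x * w1)%C w2 y _ _ (D _))).
    eapply Rle_trans; [apply Cmod_le_sum|]. simpl. unfold IC.
    assert (X1 := II_deriv_y (fun s t => fst (p (lp w s t) * w2 + q (lp w s t) * Cconj w2)%C) (fun s t => fst (u (lp w s t)))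
       (- R) R (- R) R (eta / (8 * R)) ltac:(lra) ltac:(lra) (cont2_fst _ w Cf) (fun x y => proj1 (RDy x y))).
    assert (X2 := II_deriv_y (fun s t => snd (p (lp w s t) * w2 + q (lp w s t) * Cconj w2)%C) (fun s t => snd (u (lp w s t)))
       (- R) R (- R) R (eta / (8 * R)) ltac:(lra) ltac:(lra) (cont2_snd _ w Cf) (fun x y => proj2 (RDy x y))).
    assert (F : (R - - R) * (2 * (eta / (8 * R))) = eta / 2) by (field; lra). rewrite F in X1, X2.
    assert (Y1 := X1 ltac:(intros y _; split; (eapply Rle_trans; [apply fst_le_Cmod | apply B; [exact HR | right; rewrite ?Rabs_Ropp; apply Rabs_pos_eq; lra]]))).
    assert (Y2 := X2 ltac:(intros y _; split; (eapply Rle_trans; [apply snd_le_Cmod | apply B; [exact HR | right; rewrite ?Rabs_Ropp; apply Rabs_pos_eq; lra]]))).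
    simpl in Y1, Y2. lra. }
  (* The determinant of the linear system that recovers p and q from the derivatives along w1 and
     w2. *)
  assert (Dn : (w1 * Cconj w2 - w2 * Cconj w1)%C <> 0%C).
  { intros E. apply det. apply (f_equal snd) in E. simpl in E |- *. lra. }
  split.
  - eapply Null_ext; [|apply (Null_scal (/ (w1 * Cconj w2 - w2 * Cconj w1)) _
      (Null_plus _ _ (Null_scal (Cconj w2) _ N1) (Null_scal (- Cconj w1) _ N2)))].
    intros z. cbv beta. field. exact Dn.
  - eapply Null_ext; [|apply (Null_scal (/ (w1 * Cconj w2 - w2 * Cconj w1)) _
      (Null_plus _ _ (Null_scal (- w2) _ N1) (Null_scal w1 _ N2)))].
    intros z. cbv beta. field. exact Dn.
Qed.
End Null.

Lemma Gr_decays k u : k < 0 -> Gr k u -> decays u.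
Proof.
  intros Hk H eta He. destruct (Gr_mult 0 k _ _ Gr_id H (k / 2)) as [M [M0 B]]; [lra|].
  set (R0 := Rmax 1 (M / (eta * (- k / 2)))).
  exists R0. intros z Hz. specialize (B z). rewrite Cmod_mult in B. eapply Rle_trans; [exact B|].
  assert (z1 : 1 <= Cmod z) by (eapply Rle_trans; [apply Rmax_l | exact Hz]).
  assert (z2 : M / (eta * (- k / 2)) <= Cmod z) by (eapply Rle_trans; [apply Rmax_r | exact Hz]).
  assert (ek : 0 < eta * (- k / 2)) by (apply Rmult_lt_0_compat; lra).
  apply Rle_div_l in z2; [|exact ek].
  assert (X : exp (k / 2 * Cmod z ^ 2) * exp (- (k / 2 * Cmod z ^ 2)) = 1) by (rewrite <- exp_plus, Rplus_opp_r, exp_0; reflexivity).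
  assert (Y := exp_ineq1_le (- (k / 2 * Cmod z ^ 2))). assert (P := exp_pos (k / 2 * Cmod z ^ 2)).
  set (x := exp (k / 2 * Cmod z ^ 2)) in *. set (y := exp (- (k / 2 * Cmod z ^ 2))) in *.
  assert (Y2 : (- k / 2) * Cmod z <= y) by nra.
  assert (M <= eta * y) by nra. assert (Mx : M * x <= eta * y * x) by (apply Rmult_le_compat_r; lra).
  replace (eta * y * x) with (eta * (x * y)) in Mx by ring. rewrite X in Mx. lra.
Qed.

(** * Reproducing kernels *)

Fixpoint Van (n : nat) (f : C -> C) (b : C) : Prop :=
  match n with O => True | S m => f b = 0%C /\ Van m (der f) b end.

Lemma Van_ext n f g b : (forall z, f z = g z) -> Van n f b -> Van n g b.
Proof. intros E. replace g with f; [auto | apply functional_extensionality, E]. Qed.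
Lemma Van_pred n f b : Van (S n) f b -> Van n f b.
Proof.
  revert f. induction n; intros f H; [exact I|]. destruct H as [H1 H2].
  split; [exact H1 | apply IHn, H2].
Qed.
Lemma Van_plus n f g b : entireC f -> entireC g -> Van n f b -> Van n g b -> Van n (fun z => f z + g z)%C b.
Proof.
  revert f g. induction n; intros f g Hf Hg H1 H2; [exact I|].
  destruct H1 as [a1 b1], H2 as [a2 b2]. split; [rewrite a1, a2; ring|].
  apply (Van_ext n (fun z => der f z + der g z)%C); [intros; symmetry; apply der_plus; assumption|].
  apply IHn; auto using entireC_der.
Qed.
Lemma Van_mult_l n f g b : entireC f -> entireC g -> Van n f b -> Van n (fun z => g z * f z)%C b.
Proof.
  revert f g. induction n; intros f g Hf Hg H; [exact I|]. assert (H' := Van_pred _ _ _ H).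
  destruct H as [a1 b1]. split; [rewrite a1; ring|].
  apply (Van_ext n (fun z => der g z * f z + g z * der f z)%C); [intros; symmetry; apply der_mult; assumption|].
  apply Van_plus; auto using entireC_der, entireC_mult.
Qed.
Lemma Van_mult m n f g b : entireC f -> entireC g -> Van m f b -> Van n g b -> Van (m + n) (fun z => f z * g z)%C b.
Proof.
  (* Each term of Leibniz' rule lowers only one of the two orders, hence the induction on a bound
     for m + n. *)
  assert (K : forall N m n f g, (m + n <= N)%nat -> entireC f -> entireC g -> Van m f b -> Van n g b -> Van (m + n) (fun z => f z * g z)%C b).
  { clear. induction N; intros m n f g L Hf Hg H1 H2; [replace (m + n)%nat with O by lia; exact I|].
    destruct m as [|m]; [apply Van_mult_l; assumption|].
    destruct n as [|n].
    { rewrite Nat.add_0_r. apply (Van_ext _ (fun z => g z * f z)%C); [intros; ring|]. apply Van_mult_l; assumption. }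
    assert (h1 := H1). assert (h2 := H2). destruct H1 as [a1 b1], H2 as [a2 b2].
    split; [rewrite a1; ring|].
    apply (Van_ext _ (fun z => der f z * g z + f z * der g z)%C); [intros; symmetry; apply der_mult; assumption|].
    apply Van_plus; auto using entireC_der, entireC_mult.
    - apply (IHN m (S n)); auto using entireC_der. lia.
    - replace (m + S n)%nat with (S m + n)%nat by lia. apply (IHN (S m) n); auto using entireC_der. lia. }
  intros. apply (K (m + n)%nat); auto.
Qed.
Lemma Van_pow n f b : entireC f -> f b = 0%C -> Van n (fun z => f z ^ n)%C b.
Proof.
  intros Hf H. induction n; [exact I|]. change (S n) with (1 + n)%nat. simpl Cpow.
  apply (Van_mult 1 n f (fun z => f z ^ n)%C); auto using entireC_pow. split; [exact H | exact I].
Qed.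
Definition dern (i : nat) (f : C -> C) : C -> C := Nat.iter i der f.
Lemma entireC_dern i f : entireC f -> entireC (dern i f).
Proof. intros H. induction i; [exact H | apply entireC_der, IHi]. Qed.
Lemma dern_S i f : dern (S i) f = dern i (der f).
Proof. unfold dern. rewrite Nat.iter_succ_r. reflexivity. Qed.
Lemma Van_dern n j f b : (j < n)%nat -> Van n f b -> dern j f b = 0%C.
Proof.
  revert n f. induction j; intros n f L H.
  - destruct n; [lia|]. apply H.
  - destruct n; [lia|]. rewrite dern_S. apply (IHj n); [lia | apply H].
Qed.

Lemma INR_fact_nz n : INR (fact n) <> 0.
Proof. apply INR_fact_neq_0. Qed.

(* Truncated Taylor expansion of [psi 0] centred at [z]. *)
Definition tayl (n : nat) (psi : C -> C) (z : C) : C :=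
  Csum n (fun i => RtoC (/ INR (fact i)) * ((- (1)) ^ i * z ^ i * dern i psi z))%C.

Lemma entireC_tayl n psi : entireC psi -> entireC (tayl n psi).
Proof.
  intros H. induction n; [apply entireC_const|]. unfold tayl; simpl. apply entireC_plus; [exact IHn|].
  apply entireC_scal, entireC_mult; [|apply entireC_dern, H]. apply entireC_scal, entireC_pow, entireC_id.
Qed.
Lemma der_pow n z : der (fun z => z ^ n)%C z = (INR n * z ^ pred n)%C.
Proof.
  induction n.
  - change (fun z => z ^ 0)%C with (fun _ : C => RtoC 1). rewrite der_const. simpl. ring.
  - change (fun z => z ^ S n)%C with (fun z : C => z * z ^ n)%C. rewrite der_mult, der_id, IHn; auto using entireC_id, entireC_pow.
    rewrite S_INR, RtoC_plus. destruct n; simpl; ring.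
Qed.
(** The product rule telescopes: only the top term survives, and it carries the power z^n. This is
    the source of the vanishing in [Van_tayl]. *)
Lemma der_tayl n psi z : entireC psi ->
  der (tayl (S n) psi) z = (RtoC (/ INR (fact n)) * ((- (1)) ^ n * z ^ n * dern (S n) psi z))%C.
Proof.
  intros H. induction n.
  - unfold tayl; simpl. apply der_eq. eapply WD_ext; [| | | apply (WD_der psi z H)].
    + intros; simpl. rewrite Rinv_1. ring.
    + rewrite Rinv_1. ring.
    + reflexivity.
  - change (tayl (S (S n)) psi) with (fun z => tayl (S n) psi z + RtoC (/ INR (fact (S n))) * ((- (1)) ^ S n * z ^ S n * dern (S n) psi z))%C.
    assert (E1 : entireC (fun z => (- (1)) ^ S n * z ^ S n)%C) by (apply entireC_scal, entireC_pow, entireC_id).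
    assert (E2 : entireC (dern (S n) psi)) by apply entireC_dern, H.
    rewrite der_plus; [| apply entireC_tayl, H | apply entireC_scal, entireC_mult; assumption].
    rewrite IHn, der_scal by (apply entireC_mult; assumption).
    rewrite der_mult by assumption. rewrite der_scal by apply entireC_pow, entireC_id.
    rewrite der_pow. change (dern (S (S n)) psi z) with (der (dern (S n) psi) z).
    replace (fact (S n)) with (S n * fact n)%nat by reflexivity. rewrite mult_INR.
    assert (N1 : INR (S n) <> 0) by (apply not_0_INR; lia). assert (N2 := INR_fact_nz n).
    rewrite Rinv_mult, RtoC_mult.
    assert (X : (RtoC (/ INR (S n)) * RtoC (INR (S n)) = 1)%C) by (rewrite <- RtoC_mult, Rinv_l by exact N1; reflexivity).
    simpl pred. set (d := dern (S n) psi z). set (d' := der (dern (S n) psi) z).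
    set (i1 := RtoC (/ INR (S n))) in *. set (i2 := RtoC (/ INR (fact n))). set (s := RtoC (INR (S n))) in *.
    transitivity (i2 * ((- (1)) ^ n * z ^ n * d) + i2 * (-(1)) ^ S n * ((i1 * s) * z ^ n * d) + i1 * i2 * ((-(1)) ^ S n * z ^ S n * d'))%C;
    [simpl; ring | rewrite X; simpl; ring].
Qed.
Lemma tayl_0 n psi : tayl (S n) psi 0%C = psi 0%C.
Proof.
  induction n.
  - unfold tayl; simpl. rewrite Rinv_1. ring.
  - change (tayl (S (S n)) psi 0%C) with (tayl (S n) psi 0%C + RtoC (/ INR (fact (S n))) * ((- (1)) ^ S n * 0 ^ S n * dern (S n) psi 0%C))%C.
    rewrite IHn. simpl Cpow. ring.
Qed.
Lemma Van_tayl n psi : entireC psi -> Van n (fun z => tayl n psi z - psi 0%C)%C 0%C.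
Proof.
  intros H. destruct n as [|n]; [exact I|]. split; [rewrite tayl_0; ring|].
  apply (Van_ext n (fun z => (RtoC (/ INR (fact n)) * (-(1)) ^ n * dern (S n) psi z) * z ^ n)%C).
  - intros z. transitivity (der (tayl (S n) psi) z).
    + rewrite der_tayl by exact H. ring.
    + symmetry. rewrite (der_ext _ (fun z => tayl (S n) psi z + - psi 0%C)%C) by (intros; ring).
      rewrite der_plus, der_const; [ring | apply entireC_tayl, H | apply entireC_const].
  - apply Van_mult_l; [apply entireC_pow, entireC_id | apply entireC_scal, entireC_dern, H |].
    apply Van_pow; [apply entireC_id | reflexivity].
Qed.

Section Reproducing.
(** The argument is run for a compactly supported weight and for Gaussians, hence the axiomatic
    form. By [g_WD], [g k] behaves like the k-th derivative of a function of t at t = conj(z) (z +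
    a). [P1] is meant for the analytic components of F, [P2] for the factor E, [P] for their
    products, and [Dk] for the decay of such products times the weight. *)
Variables (w1 w2 a : C) (K : nat) (g : nat -> C -> C).
Variables (Dk P P1 P2 : (C -> C) -> Prop).
Hypothesis det : snd (Cconj w1 * w2)%C <> 0.
Hypothesis g_WD : forall k z, (k < K)%nat -> WD (g k) z (Cconj z * g (S k) z) ((z + a) * g (S k) z).
Hypothesis g_cont : forall k, (k <= K)%nat -> contC (g k).
Hypothesis Dk_ext : forall u v, (forall z, u z = v z) -> Dk u -> Dk v.
Hypothesis Dk_decays : forall u, Dk u -> decays u.
Hypothesis Dk_plus : forall u v, Dk u -> Dk v -> Dk (fun z => u z + v z)%C.
Hypothesis Dk_conj : forall u, Dk u -> Dk (fun z => Cconj z * u z)%C.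
Hypothesis Dk_P : forall f k, P f -> (k <= K)%nat -> Dk (fun z => f z * g k z)%C.
Hypothesis P_ext : forall u v, (forall z, u z = v z) -> P u -> P v.
Hypothesis P_entire : forall f, P f -> entireC f.
Hypothesis P_const : forall c, P (fun _ => c).
Hypothesis P_scal : forall c f, P f -> P (fun z => c * f z)%C.
Hypothesis P_plus : forall u v, P u -> P v -> P (fun z => u z + v z)%C.
Hypothesis P_der : forall f, P f -> P (der f).
Hypothesis P_div : forall f h b, P f -> entireC h -> (forall z, f z = ((z - b) * h z)%C) -> P h.
Hypothesis P1_entire : forall f, P1 f -> entireC f.
Hypothesis P2_entire : forall f, P2 f -> entireC f.
Hypothesis P1_der : forall f, P1 f -> P1 (der f).
Hypothesis P2_der : forall f, P2 f -> P2 (der f).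
Hypothesis P2_z : forall f, P2 f -> P2 (fun z => z * f z)%C.
Hypothesis P12 : forall f h, P1 f -> P2 h -> P (fun z => f z * h z)%C.

(* [TT i k h] is the [i]-th [z]-derivative of [h * g k]. *)
Fixpoint TT (i k : nat) (h : C -> C) (z : C) : C :=
  match i with
  | O => (h z * g k z)%C
  | S j => (TT j k (der h) z + Cconj z * TT j (S k) h z)%C
  end.

Lemma TT_ext i k h h' z : (forall z, h z = h' z) -> TT i k h z = TT i k h' z.
Proof. intros E. replace h' with h; [reflexivity | apply functional_extensionality, E]. Qed.

Lemma TT_plus i k h h' z : entireC h -> entireC h' -> TT i k (fun z => h z + h' z)%C z = (TT i k h z + TT i k h' z)%C.
Proof.
  revert k h h' z. induction i; intros k h h' z Hh Hh'; simpl; [ring|].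
  rewrite (TT_ext i k (der (fun z => h z + h' z)%C) (fun z => der h z + der h' z)%C) by (intros; apply der_plus; assumption).
  rewrite !IHi; auto using entireC_der. ring.
Qed.

(** In the conj(z)-derivative, the term from differentiating the factor [Cconj z] matches the one
    from differentiating z + a inside [h]. *)
Lemma TT_WD i k h z : entireC h -> (i + k < K)%nat ->
  WD (TT i k h) z (TT (S i) k h z) (TT i (S k) (fun z => (z + a) * h z)%C z).
Proof.
  revert k h z. induction i; intros k h z Hh L.
  - eapply WD_ext; [| | | apply (WD_mult _ _ _ _ _ _ _ (WD_der h z Hh) (g_WD k z ltac:(lia)))];
    [reflexivity | simpl; ring | simpl; ring].
  - eapply WD_ext; [| | | apply (WD_plus _ _ _ _ _ _ _ (IHi k (der h) z (entireC_der h Hh) ltac:(lia))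
       (WD_mult _ _ _ _ _ _ _ (WD_conj z) (IHi (S k) h z Hh ltac:(lia))))].
    + reflexivity.
    + simpl. ring.
    + assert (Ea : entireC (fun z => z + a)%C) by (apply entireC_plus; [apply entireC_id | apply entireC_const]).
      change (TT (S i) (S k) (fun z => (z + a) * h z)%C z) with
       (TT i (S k) (der (fun z => (z + a) * h z)%C) z + Cconj z * TT i (S (S k)) (fun z => (z + a) * h z)%C z)%C.
      rewrite (TT_ext i (S k) (der (fun z => (z + a) * h z)%C) (fun z => h z + (z + a) * der h z)%C).
      * rewrite TT_plus; [ring | exact Hh | apply entireC_mult; [exact Ea | apply entireC_der, Hh]].
      * intros z'. rewrite der_mult by assumption. rewrite der_plus, der_id, der_const; auto using entireC_id, entireC_const. ring.
Qed.

Lemma TT_cont i k h : entireC h -> (i + k <= K)%nat -> contC (TT i k h).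
Proof.
  revert k h. induction i; intros k h Hh L.
  - apply contC_mult; [apply entireC_cont, Hh | apply g_cont; lia].
  - simpl. apply contC_plus; [apply IHi; auto using entireC_der; lia|].
    apply contC_mult; [apply contC_conj | apply IHi; auto; lia].
Qed.

Lemma TT_Dk i k psi h : P1 psi -> P2 h -> (i + k <= K)%nat -> Dk (fun z => psi z * TT i k h z)%C.
Proof.
  revert k h. induction i; intros k h H1 H2 L.
  - apply (Dk_ext (fun z => (psi z * h z) * g k z)%C); [intros; simpl; ring|].
    apply (Dk_P (fun z => psi z * h z)%C); [apply P12; assumption | lia].
  - apply (Dk_ext (fun z => psi z * TT i k (der h) z + Cconj z * (psi z * TT i (S k) h z))%C); [intros; simpl; ring|].
    apply Dk_plus; [apply IHi; auto; lia | apply Dk_conj, IHi; auto; lia].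
Qed.

Lemma Dk_pow_conj j u : Dk u -> Dk (fun z => Cconj z ^ j * u z)%C.
Proof.
  intros H. induction j; [apply (Dk_ext u); [intros; simpl; ring | exact H]|].
  apply (Dk_ext (fun z => Cconj z * (Cconj z ^ j * u z))%C); [intros; simpl; ring | apply Dk_conj, IHj].
Qed.

Lemma WD_conj_pow j z : WD (fun z => Cconj z ^ j)%C z 0 (RtoC (INR j) * Cconj z ^ pred j).
Proof.
  induction j.
  - eapply WD_ext; [| | | apply (WD_const 1)]; [intros; reflexivity | reflexivity | simpl; ring].
  - eapply WD_ext; [| | | apply (WD_mult _ _ _ _ _ _ _ (WD_conj z) IHj)]; [reflexivity | ring |].
    rewrite S_INR, RtoC_plus. destruct j; simpl; ring.
Qed.

Lemma contC_conj_pow j : contC (fun z => Cconj z ^ j)%C.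
Proof. exact (WD_cont _ _ _ (WD_conj_pow j)). Qed.

(* Modulo null functions, a derivative on the weight may be moved to the analytic factor. *)
Lemma parts1 i j k psi h : P1 psi -> P2 h -> (i + k < K)%nat ->
  Null w1 w2 (fun z => Cconj z ^ j * (psi z * TT (S i) k h z + der psi z * TT i k h z))%C.
Proof.
  intros H1 H2 L. assert (E1 := P1_entire _ H1). assert (E2 := P2_entire _ H2).
  assert (Ea : entireC (fun z => (z + a) * h z)%C) by (apply entireC_mult; [apply entireC_plus; [apply entireC_id | apply entireC_const] | exact E2]).
  eapply (proj1 (Null_exact w1 w2 det (fun z => Cconj z ^ j * (psi z * TT i k h z))%C _
     (fun z => RtoC (INR j) * Cconj z ^ pred j * (psi z * TT i k h z) + Cconj z ^ j * (psi z * TT i (S k) (fun z => (z + a) * h z)%C z))%C _ _ _ _)).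
  Unshelve.
  - intros z. eapply WD_ext; [| | | apply (WD_mult _ _ _ _ _ _ _ (WD_conj_pow j z) (WD_mult _ _ _ _ _ _ _ (WD_der psi z E1) (TT_WD i k h z E2 L)))];
    [reflexivity | ring | ring].
  - apply contC_mult; [apply contC_conj_pow|]. apply contC_plus; apply contC_mult;
    auto using entireC_cont, entireC_der; apply TT_cont; auto; lia.
  - apply contC_plus.
    + apply contC_mult; [apply contC_mult; [apply contC_const | apply contC_conj_pow]|].
      apply contC_mult; [apply entireC_cont, E1 | apply TT_cont; auto; lia].
    + apply contC_mult; [apply contC_conj_pow|]. apply contC_mult; [apply entireC_cont, E1 | apply TT_cont; auto; lia].
  - apply Dk_decays, Dk_pow_conj, TT_Dk; auto; lia.
Qed.

Lemma parts i j k psi h : P1 psi -> P2 h -> (i + k <= K)%nat ->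
  Null w1 w2 (fun z => Cconj z ^ j * (psi z * TT i k h z - (-(1)) ^ i * dern i psi z * h z * g k z))%C.
Proof.
  revert psi. induction i; intros psi H1 H2 L.
  - eapply Null_ext; [|apply Null_0]. intros; simpl. ring.
  - eapply Null_ext; [|apply (Null_plus _ _ _ _ (parts1 i j k psi h H1 H2 ltac:(lia))
       (Null_scal _ _ (-(1)) _ (IHi (der psi) (P1_der _ H1) H2 ltac:(lia))))].
    intros z. cbv beta. rewrite dern_S. simpl. ring.
Qed.

(** conj(z) g (S k) is the z-derivative of g k, and conj(z)^j is a constant for d/dz: one power of
    conj(z) is exchanged for one derivative of [H]. *)
Lemma lower1 j k H : P H -> (k < K)%nat ->
  Null w1 w2 (fun z => Cconj z ^ S j * (g (S k) z * H z) + Cconj z ^ j * (g k z * der H z))%C.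
Proof.
  intros HP L. assert (E := P_entire _ HP).
  eapply Null_ext; [|refine (proj1 (Null_exact w1 w2 det (fun z => Cconj z ^ j * (g k z * H z))%C
     (fun z => Cconj z ^ j * (Cconj z * g (S k) z * H z + g k z * der H z))%C
     (fun z => RtoC (INR j) * Cconj z ^ pred j * (g k z * H z) + Cconj z ^ j * ((z + a) * g (S k) z * H z))%C _ _ _ _))].
  - intros z; simpl; ring.
  - intros z. eapply WD_ext; [| | | apply (WD_mult _ _ _ _ _ _ _ (WD_conj_pow j z) (WD_mult _ _ _ _ _ _ _ (g_WD k z L) (WD_der H z E)))];
    [reflexivity | ring | ring].
  - apply contC_mult; [apply contC_conj_pow|]. apply contC_plus; repeat apply contC_mult;
    auto using entireC_cont, entireC_der, contC_conj; apply g_cont; lia.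
  - apply contC_plus; repeat apply contC_mult; auto using entireC_cont, contC_const, contC_conj_pow; try (apply g_cont; lia).
    apply contC_plus; [apply entireC_cont, entireC_id | apply contC_const].
  - apply Dk_decays, Dk_pow_conj. apply (Dk_ext (fun z => H z * g k z)%C); [intros; ring|]. apply Dk_P; [assumption | lia].
Qed.

Lemma lower j k H : P H -> (j <= k)%nat -> (k <= K)%nat ->
  Null w1 w2 (fun z => Cconj z ^ j * (g k z * H z) - (-(1)) ^ j * (g (k - j)%nat z * dern j H z))%C.
Proof.
  revert k H. induction j; intros k H HP L1 L2.
  - eapply Null_ext; [|apply Null_0]. intros; simpl. rewrite Nat.sub_0_r. ring.
  - destruct k as [|k]; [lia|].
    eapply Null_ext; [|apply (Null_plus _ _ _ _ (lower1 j k H HP ltac:(lia))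
      (Null_scal _ _ (-(1)) _ (IHj k (der H) (P_der _ HP) ltac:(lia) ltac:(lia))))].
    intros z. cbv beta. rewrite dern_S. replace (S k - S j)%nat with (k - j)%nat by lia. simpl. ring.
Qed.

(** Writing H = (z + a) h, the product is the conj(z)-derivative of h g k, since h is analytic. *)
Lemma null_vanish k H : P H -> H (- a)%C = 0%C -> (k < K)%nat -> Null w1 w2 (fun z => g (S k) z * H z)%C.
Proof.
  intros HP Hv L. assert (E := P_entire _ HP).
  destruct (entire_div H (- a) E Hv) as [h [Hh Eh]]. assert (Ph := P_div H h (- a)%C HP Hh Eh).
  eapply Null_ext; [|refine (proj2 (Null_exact w1 w2 det (fun z => h z * g k z)%C
     (fun z => der h z * g k z + h z * (Cconj z * g (S k) z))%C
     (fun z => h z * ((z + a) * g (S k) z))%C _ _ _ _))].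
  - intros z; cbv beta. rewrite Eh. ring.
  - intros z. eapply WD_ext; [| | | apply (WD_mult _ _ _ _ _ _ _ (WD_der h z Hh) (g_WD k z L))];
    [reflexivity | ring | ring].
  - apply contC_plus; repeat apply contC_mult; auto using entireC_cont, entireC_der, contC_conj; apply g_cont; lia.
  - repeat apply contC_mult; auto using entireC_cont; try (apply g_cont; lia).
    apply contC_plus; [apply entireC_cont, entireC_id | apply contC_const].
  - apply Dk_decays, Dk_P; [assumption | lia].
Qed.

(* Moving the [i]-fold derivatives onto [psi] turns [psi * kap n E] into [E * g n] times the Taylor expansion of [psi 0] at [z]. *)
Definition kap (n : nat) (E : C -> C) (z : C) : C :=
  Csum n (fun i => RtoC (/ INR (fact i)) * TT i n (fun z => z ^ i * E z)%C z)%C.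

Lemma P2_pow i E : P2 E -> P2 (fun z => z ^ i * E z)%C.
Proof.
  intros H. induction i.
  - replace (fun z => z ^ 0 * E z)%C with E; [exact H | apply functional_extensionality; intros; simpl; ring].
  - replace (fun z => z ^ S i * E z)%C with (fun z => z * (z ^ i * E z))%C; [apply P2_z, IHi | apply functional_extensionality; intros; simpl; ring].
Qed.
Lemma P1_dern i psi : P1 psi -> P1 (dern i psi).
Proof. intros H; induction i; [exact H | apply P1_der, IHi]. Qed.
Lemma P_dern i f : P f -> P (dern i f).
Proof. intros H; induction i; [exact H | apply P_der, IHi]. Qed.

Lemma P_tayl m psi E : P1 psi -> P2 E -> P (fun z => E z * tayl m psi z)%C.
Proof.
  intros H1 H2. induction m.
  - apply (P_ext (fun _ => 0%C)); [intros; unfold tayl; simpl; ring | apply P_const].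
  - apply (P_ext (fun z => E z * tayl m psi z + RtoC (/ INR (fact m)) * (-(1)) ^ m * (dern m psi z * (z ^ m * E z)))%C);
      [intros; unfold tayl; simpl; ring|].
    apply P_plus; [exact IHm|]. apply P_scal, P12; [apply P1_dern, H1 | apply P2_pow, H2].
Qed.

Lemma kap_reduce n j psi E : P1 psi -> P2 E -> (2 * n <= K)%nat ->
  Null w1 w2 (fun z => Cconj z ^ j * (psi z * kap n E z) - Cconj z ^ j * (g n z * (E z * tayl n psi z)))%C.
Proof.
  intros H1 H2 L.
  assert (Q : forall m, (m <= n)%nat -> Null w1 w2 (fun z =>
    Cconj z ^ j * (psi z * Csum m (fun i => RtoC (/ INR (fact i)) * TT i n (fun z => z ^ i * E z)%C z)%C)
     - Cconj z ^ j * (g n z * (E z * tayl m psi z)))%C).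
  { induction m; intros Lm.
    - eapply Null_ext; [|apply Null_0]. intros; unfold tayl; simpl. ring.
    - eapply Null_ext; [|apply (Null_plus _ _ _ _ (IHm ltac:(lia)) (Null_scal _ _ (RtoC (/ INR (fact m))) _
        (parts m j n psi (fun z => z ^ m * E z)%C H1 (P2_pow m E H2) ltac:(lia))))].
      intros z. unfold tayl. simpl. ring. }
  apply Q; lia.
Qed.

Lemma P_minus_const c f : P f -> P (fun z => f z - c)%C.
Proof. intros H. apply (P_plus f (fun _ => - c)%C H), P_const. Qed.

(** [lower] leaves the weight g (n - j) with n - j >= 1 and the j-th derivative of H, which still
    vanishes at -a since j < n. Here the order n of the zeros is used. *)
Lemma vanish_null n j H : P H -> (n <= K)%nat -> (j < n)%nat -> Van n H (- a)%C ->
  Null w1 w2 (fun z => Cconj z ^ j * (g n z * H z))%C.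
Proof.
  intros HP L Lj V.
  assert (N := null_vanish (n - j - 1) (dern j H) (P_dern j H HP) (Van_dern n j H _ Lj V) ltac:(lia)).
  replace (S (n - j - 1)) with (n - j)%nat in N by lia.
  eapply Null_ext; [|apply (Null_plus _ _ _ _ (lower j n H HP ltac:(lia) L) (Null_scal _ _ ((-(1)) ^ j) _ N))].
  intros z. cbv beta. ring.
Qed.

Theorem kap_null n j psi E : P1 psi -> P2 E -> (2 * n <= K)%nat -> (j < n)%nat ->
  Van n E (- a)%C -> Null w1 w2 (fun z => Cconj z ^ j * (psi z * kap n E z))%C.
Proof.
  intros H1 H2 L Lj V.
  assert (V' : Van n (fun z => E z * tayl n psi z)%C (- a)%C).
  { apply (Van_ext n (fun z => tayl n psi z * E z)%C); [intros; ring|].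
    apply Van_mult_l; auto. apply entireC_tayl; auto. }
  eapply Null_ext; [|apply (Null_plus _ _ _ _ (kap_reduce n j psi E H1 H2 L)
     (vanish_null n j _ (P_tayl n psi E H1 H2) ltac:(lia) Lj V'))].
  intros z. cbv beta. ring.
Qed.

(** E times the Taylor polynomial is psi 0 up to O(z^n), and that remainder is null. For j > 0 the
    constant contributes nothing either, because [lower] differentiates it. *)
Theorem kap_repr n j psi E : a = 0%C -> P1 psi -> P2 E -> (2 * n <= K)%nat -> (j < n)%nat ->
  Van n (fun z => E z - 1)%C 0%C ->
  Null w1 w2 (fun z => Cconj z ^ j * (psi z * kap n E z) - (match j with O => psi 0%C | _ => 0%C end) * g n z)%C.
Proof.
  intros Ha H1 H2 L Lj V. assert (E1 := P1_entire _ H1). assert (E2 := P2_entire _ H2).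
  assert (P0 := P_minus_const (psi 0%C) _ (P_tayl n psi E H1 H2)).
  assert (V0 : Van n (fun z => E z * tayl n psi z - psi 0%C)%C (- a)%C).
  { rewrite Ha. replace (- 0)%C with (RtoC 0) by ring.
    apply (Van_ext n (fun z => psi 0%C * (E z - 1) + E z * (tayl n psi z - psi 0%C))%C); [intros; ring|].
    assert (Ee : entireC (fun z => E z - 1)%C) by (apply entireC_minus; [exact E2 | apply entireC_const]).
    assert (Et : entireC (fun z => tayl n psi z - psi 0%C)%C) by (apply entireC_minus; [apply entireC_tayl, E1 | apply entireC_const]).
    apply Van_plus.
    - apply entireC_scal, Ee.
    - apply entireC_mult; assumption.
    - apply Van_mult_l; auto using entireC_const.
    - apply Van_mult_l; auto using Van_tayl. }
  assert (N1 := kap_reduce n j psi E H1 H2 L).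
  assert (N2 := vanish_null n j _ P0 ltac:(lia) Lj V0).
  destruct j as [|j].
  - eapply Null_ext; [|apply (Null_plus _ _ _ _ N1 N2)]. intros z. simpl. ring.
  - assert (N3 := lower (S j) n (fun _ => psi 0%C) (P_const _) ltac:(lia) ltac:(lia)).
    assert (Z : forall i, dern (S i) (fun _ => psi 0%C) = (fun _ => 0%C)).
    { induction i; apply functional_extensionality; intros z; [apply der_const|].
      change (dern (S (S i)) (fun _ => psi 0%C) z) with (der (dern (S i) (fun _ => psi 0%C)) z). rewrite IHi. apply der_const. }
    rewrite Z in N3.
    eapply Null_ext; [|apply (Null_plus _ _ _ _ (Null_plus _ _ _ _ N1 N2) N3)]. intros z. cbv beta. ring.
Qed.
End Reproducing.

(** * Polyanalytic functions and local estimates *)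

(** All [phi k] are entire, also beyond the summation range, so that the components can be handled
    without carrying the bound k < n. *)
Definition PA (n : nat) (F : C -> C) : Prop :=
  exists phi : nat -> C -> C, (forall k, entireC (phi k)) /\ forall z, F z = Csum n (fun k => Cconj z ^ k * phi k z)%C.

Lemma PA_ext n F G : (forall z, F z = G z) -> PA n F -> PA n G.
Proof. intros E. replace G with F; [auto | apply functional_extensionality, E]. Qed.
Lemma PA_plus n F G : PA n F -> PA n G -> PA n (fun z => F z + G z)%C.
Proof.
  intros [f [Hf Ef]] [g [Hg Eg]]. exists (fun k z => f k z + g k z)%C. split.
  - intros; apply entireC_plus; auto.
  - intros z. rewrite Ef, Eg, <- Csum_plus. apply Csum_ext. intros; ring.
Qed.
Lemma PA_entire_mult n F g : entireC g -> PA n F -> PA n (fun z => g z * F z)%C.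
Proof.
  intros Hg [f [Hf Ef]]. exists (fun k z => g z * f k z)%C. split.
  - intros; apply entireC_mult; auto.
  - intros z. rewrite Ef, <- Csum_scal. apply Csum_ext. intros; ring.
Qed.
Lemma PA_scal n F c : PA n F -> PA n (fun z => c * F z)%C.
Proof. apply (PA_entire_mult n F (fun _ => c)), entireC_const. Qed.
Lemma PA_S n F : PA n F -> PA (S n) F.
Proof.
  intros [f [Hf Ef]]. exists (fun k => if Nat.ltb k n then f k else fun _ => RtoC 0). split.
  - intros k. destruct (Nat.ltb k n); [auto | apply entireC_const].
  - intros z. simpl. rewrite Nat.ltb_irrefl, Ef.
    rewrite (Csum_ext n _ (fun k => Cconj z ^ k * (if Nat.ltb k n then f k else fun _ => RtoC 0) z)%C); [ring|].
    intros k Hk. apply Nat.ltb_lt in Hk. rewrite Hk. reflexivity.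
Qed.
Lemma PA_le m n F : (m <= n)%nat -> PA m F -> PA n F.
Proof. intros L H. induction L; auto using PA_S. Qed.
Lemma Csum_S_l n f : Csum (S n) f = (f O + Csum n (fun k => f (S k)))%C.
Proof. induction n; simpl in *; [ring|]. rewrite IHn. ring. Qed.
Lemma PA_conj n F : PA n F -> PA (S n) (fun z => Cconj z * F z)%C.
Proof.
  intros [f [Hf Ef]]. exists (fun k => match k with O => fun _ => RtoC 0 | S j => f j end). split.
  - intros [|k]; [apply entireC_const | auto].
  - intros z. rewrite Csum_S_l, Ef, <- Csum_scal.
    rewrite (Csum_ext n _ (fun k => Cconj z ^ S k * f k z)%C) by (intros; simpl; ring). ring.
Qed.
Lemma PA_entire g : entireC g -> PA 1 g.
Proof. intros H. exists (fun _ => g). split; [auto|]. intros; simpl; ring. Qed.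
Lemma PA_0 n : PA n (fun _ => RtoC 0).
Proof.
  exists (fun _ _ => RtoC 0). split; [intros; apply entireC_const|]. intros z.
  rewrite (Csum_ext _ _ (fun _ => RtoC 0)) by (intros; ring). symmetry; apply Csum_0.
Qed.
Lemma PA_Csum n m (F : nat -> C -> C) : (forall k, (k < m)%nat -> PA n (F k)) -> PA n (fun z => Csum m (fun k => F k z)).
Proof.
  intros H. induction m; simpl; [apply PA_0|]. apply PA_plus; [apply IHm; auto | apply H; lia].
Qed.
Lemma PA_affine_conj n F (al be : C) : PA n F -> PA n (fun z => F (al * z + be)%C).
Proof.
  intros [f [Hf Ef]].
  apply (PA_ext n (fun z => Csum n (fun k => Cconj (al * z + be) ^ k * f k (al * z + be)%C)%C)); [intros; symmetry; apply Ef|].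
  assert (Ha : entireC (fun z => al * z + be)%C) by (apply entireC_plus; [apply entireC_scal, entireC_id | apply entireC_const]).
  apply (PA_Csum n n (fun k z => Cconj (al * z + be) ^ k * f k (al * z + be))%C). intros k Hk.
  apply (PA_le (S k)); [lia|]. assert (Hg : entireC (fun z => f k (al * z + be)%C)) by (apply (entireC_comp (f k)); auto).
  clear Hk. set (g := fun z => f k (al * z + be)%C) in *.
  change (fun z => Cconj (al * z + be) ^ k * f k (al * z + be))%C with (fun z => Cconj (al * z + be) ^ k * g z)%C.
  clearbody g. induction k.
  - apply (PA_ext 1 g); [intros; simpl; ring | apply PA_entire, Hg].
  - apply (PA_ext _ (fun z => Cconj z * (Cconj al * (Cconj (al * z + be) ^ k * g z)) + Cconj be * (Cconj (al * z + be) ^ k * g z))%C).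
    + intros z. rewrite Cconj_plus, Cconj_mult. simpl. ring.
    + apply PA_plus; [apply PA_conj, PA_scal, IHk | apply PA_scal, PA_S, IHk].
Qed.
Lemma PA_shift n F w : PA n F -> PA n (fun z => F (z + w)%C).
Proof.
  intros H. apply (PA_ext n (fun z => F (1 * z + w)%C)); [intros; f_equal; ring | apply PA_affine_conj, H].
Qed.

Lemma PA_WD n F : PA n F -> exists p q, PA n p /\ PA n q /\ forall z, WD F z (p z) (q z).
Proof.
  intros [f [Hf Ef]].
  exists (fun z => Csum n (fun k => Cconj z ^ k * der (f k) z)%C),
    (fun z => Csum n (fun k => RtoC (INR k) * Cconj z ^ pred k * f k z)%C). repeat split.
  - exists (fun k => der (f k)). split; [intros; apply entireC_der; auto | auto].
  - apply (PA_Csum n n (fun k z => RtoC (INR k) * Cconj z ^ pred k * f k z)%C). intros k Hk.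
    destruct k as [|k].
    + apply (PA_ext n (fun _ => RtoC 0)); [intros; simpl; ring | apply PA_0].
    + exists (fun j => if Nat.eqb j k then fun z => (RtoC (INR (S k)) * f (S k) z)%C else fun _ => RtoC 0). split.
      * intros j. destruct (Nat.eqb j k); [apply entireC_scal; auto | apply entireC_const].
      * intros z. simpl pred. assert (Lk : (k < n)%nat) by lia. clear - Lk. induction n; [lia|]. cbn [Csum].
        destruct (Nat.eqb_spec n k) as [E|E].
        -- rewrite E. rewrite (Csum_ext k _ (fun _ => RtoC 0)); [rewrite Csum_0; ring|].
           intros j Hj. destruct (Nat.eqb_spec j k); [lia | ring].
        -- rewrite <- IHn by lia. ring.
  - intros z. eapply WD_ext with (u := fun z => Csum n (fun k => Cconj z ^ k * f k z)%C); [intros; symmetry; apply Ef | reflexivity | reflexivity |].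
    clear Ef. induction n; [exact (WD_const 0 z)|].
    cbn [Csum]. apply (WD_plus (fun z => Csum n (fun k => Cconj z ^ k * f k z)%C) (fun z => Cconj z ^ n * f n z)%C); [apply IHn|].
    eapply WD_ext; [| | | apply (WD_mult _ _ _ _ _ _ _ (WD_conj_pow n z) (WD_der (f n) z (Hf n)))]; [reflexivity | ring | ring].
Qed.
Lemma PA_cont n F : PA n F -> contC F.
Proof. intros H. destruct (PA_WD n F H) as [p [q [_ [_ W]]]]. apply (WD_cont F p q W). Qed.

(** * A compactly supported weight of finite smoothness *)

Definition mx (e : nat) (u : R) : R := Rmax 0 u ^ e.
Lemma mx_derive e u : (2 <= e)%nat -> is_derive (mx e) u (INR e * mx (pred e) u).
Proof.
  intros He. unfold mx. destruct (Rtotal_order u 0) as [L|[E|L]].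
  - apply (is_derive_ext_loc (fun _ => 0)).
    + exists (mkposreal (- u) ltac:(lra)). intros y Hy. change (Rabs (y - u) < - u) in Hy. apply Rabs_def2 in Hy.
      rewrite Rmax_left by lra. rewrite pow_i by lia. reflexivity.
    + rewrite Rmax_left by lra. rewrite pow_i by lia. rewrite Rmult_0_r. apply (is_derive_const (K:=R_AbsRing) (V:=R_NormedModule)).
  - subst u. apply is_derive_eps. intros eps Heps. exists (Rmin 1 eps). split; [apply Rmin_pos; lra|].
    intros k Hk. assert (k1 : Rabs k < 1) by (eapply Rlt_le_trans; [exact Hk | apply Rmin_l]).
    assert (k2 : Rabs k < eps) by (eapply Rlt_le_trans; [exact Hk | apply Rmin_r]).
    rewrite (Rmax_left 0 0) by lra. rewrite !pow_i by lia. rewrite Rmult_0_r, Rmult_0_l, !Rminus_0_r, Rplus_0_l.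
    destruct e as [|[|e]]; try lia.
    assert (m0 : 0 <= Rmax 0 k <= Rabs k).
    { split; [apply Rmax_l | apply Rmax_lub; [apply Rabs_pos | apply Rle_abs]]. }
    rewrite Rabs_pos_eq by (apply pow_le; lra). simpl.
    assert (p1 : Rmax 0 k ^ e <= 1) by (rewrite <- (pow1 e); apply pow_incr; lra).
    assert (p0 : 0 <= Rmax 0 k ^ e) by (apply pow_le; lra).
    assert (k0 := Rabs_pos k). assert (Rmax 0 k * Rmax 0 k ^ e <= eps) by nra. nra.
  - apply (is_derive_ext_loc (fun u => u ^ e)).
    + exists (mkposreal u L). intros y Hy. change (Rabs (y - u) < u) in Hy. apply Rabs_def2 in Hy.
      rewrite Rmax_right by lra. reflexivity.
    + rewrite Rmax_right by lra. auto_derive; [trivial|]. ring.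
Qed.

Section Bump.
Variable K : nat.

(** [bump k] is the k-th derivative of t -> max(0, 1 - t)^(K+2) at t = |z|^2, and [cb k] collects
    the constants. The exponent K + 2 keeps all powers up to k = K at least 2, hence
    differentiable. *)
Fixpoint cb (k : nat) : R := match k with O => 1 | S j => - INR (K + 2 - j) * cb j end.
Definition bump (k : nat) (z : C) : C := RtoC (cb k * mx (K + 2 - k) (1 - Cmod z * Cmod z)).

Lemma cb_nz k : (k <= K)%nat -> cb k <> 0.
Proof.
  induction k; intros L; simpl; [lra|]. apply Rmult_integral_contrapositive. split; [|apply IHk; lia].
  apply Ropp_neq_0_compat, not_0_INR. lia.
Qed.
Lemma WD_normsq z : WD (fun z => RtoC (1 - Cmod z * Cmod z)) z (- Cconj z) (- z).
Proof.
  eapply WD_ext; [| | | apply (WD_minus _ _ _ _ _ _ _ (WD_const 1 z) (WD_mult _ _ _ _ _ _ _ (WD_id z) (WD_conj z)))].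
  - intros z'. cbv beta. rewrite Cmod_sqr. csolve.
  - ring.
  - ring.
Qed.
Lemma bump_WD k z : (k < K)%nat -> WD (bump k) z (Cconj z * bump (S k) z) ((z + 0) * bump (S k) z).
Proof.
  intros L. assert (D := mx_derive (K + 2 - k) (1 - Cmod z * Cmod z) ltac:(lia)).
  eapply WD_ext; [| | | apply (WD_scal (RtoC (cb k)) _ _ _ _ (WD_comp_real _ (fun z => 1 - Cmod z * Cmod z) z _ _ _ (WD_normsq z) D))].
  - intros z'. unfold bump. rewrite RtoC_mult. reflexivity.
  - unfold bump. simpl cb. replace (K + 2 - S k)%nat with (pred (K + 2 - k)) by lia.
    rewrite !RtoC_mult, RtoC_opp. ring.
  - unfold bump. simpl cb. replace (K + 2 - S k)%nat with (pred (K + 2 - k)) by lia.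
    rewrite !RtoC_mult, RtoC_opp. ring.
Qed.
Lemma bump_cont k : (k <= K)%nat -> contC (bump k).
Proof.
  intros L z eps He.
  assert (D := mx_derive (K + 2 - k) (1 - Cmod z * Cmod z) ltac:(lia)).
  eapply WD_cont_at; [|exact He].
  eapply WD_ext; [| reflexivity | reflexivity | apply (WD_scal (RtoC (cb k)) _ _ _ _ (WD_comp_real _ (fun z => 1 - Cmod z * Cmod z) z _ _ _ (WD_normsq z) D))].
  intros z'. unfold bump. rewrite RtoC_mult. reflexivity.
Qed.

Definition Dkb (u : C -> C) : Prop :=
  (exists M, 0 <= M /\ forall z, Cmod (u z) <= M) /\ forall z, 1 <= Cmod z -> u z = 0%C.

Lemma Dkb_ext u v : (forall z, u z = v z) -> Dkb u -> Dkb v.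
Proof. intros E. replace v with u; [auto | apply functional_extensionality, E]. Qed.
Lemma Dkb_decays u : Dkb u -> decays u.
Proof.
  intros [_ H] eta He. exists 1. intros z Hz. rewrite H by assumption. rewrite Cmod_0. lra.
Qed.
Lemma Dkb_plus u v : Dkb u -> Dkb v -> Dkb (fun z => u z + v z)%C.
Proof.
  intros [[M1 [P1 B1]] H1] [[M2 [P2 B2]] H2]. split.
  - exists (M1 + M2). split; [lra|]. intros z. eapply Rle_trans; [apply Cmod_triangle|]. specialize (B1 z). specialize (B2 z). lra.
  - intros z Hz. rewrite H1, H2 by assumption. ring.
Qed.
Lemma Dkb_mult f u : (exists M, 0 <= M /\ forall z, Cmod z <= 1 -> Cmod (f z) <= M) -> Dkb u -> Dkb (fun z => f z * u z)%C.
Proof.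
  intros [M [M0 B]] [[M1 [P1 B1]] H1]. split.
  - exists (M * M1). split; [apply Rmult_le_pos; assumption|]. intros z. destruct (Rle_dec (Cmod z) 1) as [L|L].
    + rewrite Cmod_mult. apply Rmult_le_compat; auto using Cmod_ge_0.
    + rewrite H1 by lra. rewrite Cmult_0_r, Cmod_0. apply Rmult_le_pos; assumption.
  - intros z Hz. rewrite H1 by assumption. ring.
Qed.
Lemma Dkb_conj u : Dkb u -> Dkb (fun z => Cconj z * u z)%C.
Proof. apply Dkb_mult. exists 1. split; [lra|]. intros; rewrite Cmod_conj; assumption. Qed.
Lemma Dkb_bump k : (k <= K)%nat -> Dkb (bump k).
Proof.
  intros L. split.
  - exists (Rabs (cb k)). split; [apply Rabs_pos|]. intros z. unfold bump. rewrite Cmod_R, Rabs_mult.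
    rewrite <- (Rmult_1_r (Rabs (cb k))) at 2. apply Rmult_le_compat_l; [apply Rabs_pos|].
    unfold mx. assert (m0 : 0 <= Rmax 0 (1 - Cmod z * Cmod z) <= 1).
    { split; [apply Rmax_l | apply Rmax_lub; [lra|]]. assert (x := Cmod_ge_0 z). nra. }
    rewrite Rabs_pos_eq by (apply pow_le; lra). apply Rle_trans with (1 ^ (K + 2 - k)); [apply pow_incr; lra | rewrite pow1; lra].
  - intros z Hz. unfold bump, mx. rewrite Rmax_left by nra. rewrite pow_i by lia. rewrite Rmult_0_r. reflexivity.
Qed.
Lemma Dkb_P f k : entireC f -> (k <= K)%nat -> Dkb (fun z => f z * bump k z)%C.
Proof.
  intros Hf L. apply Dkb_mult; [|apply Dkb_bump, L]. apply entire_bounded, Hf.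
Qed.
Lemma det_std : snd (Cconj 1 * Ci)%C <> 0.
Proof. simpl. lra. Qed.
End Bump.

Lemma Dkb_scal c u : Dkb u -> Dkb (fun z => c * u z)%C.
Proof. apply Dkb_mult. exists (Cmod c). split; [apply Cmod_ge_0 | intros; lra]. Qed.

Section BumpKernel.
Variable n : nat.
Let K := (2 * n + 1)%nat.
Let g := bump K.
Let kb := kap g n (fun _ => RtoC 1).
(** The kernels [kb1] and [kb2] are the Wirtinger derivatives of [kb]: derivatives of F are
    estimated by moving them onto the kernel. *)
Definition kb1 (z : C) : C := Csum n (fun i => RtoC (/ INR (fact i)) * TT g (S i) n (fun z => z ^ i * 1)%C z)%C.
Definition kb2 (z : C) : C := Csum n (fun i => RtoC (/ INR (fact i)) * TT g i (S n) (fun z => (z + 0) * (z ^ i * 1))%C z)%C.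

Let ent_i i : entireC (fun z => z ^ i * 1)%C.
Proof. apply entireC_mult; [apply entireC_pow, entireC_id | apply entireC_const]. Qed.
Let ent_i' i : entireC (fun z => (z + 0) * (z ^ i * 1))%C.
Proof. apply entireC_mult; [apply entireC_plus; [apply entireC_id | apply entireC_const] | apply ent_i]. Qed.

Lemma TTb_Dk i k h : entireC h -> (i + k <= K)%nat -> Dkb (TT g i k h).
Proof.
  intros Hh L. apply (Dkb_ext (fun z => 1 * TT g i k h z)%C); [intros; ring|].
  apply (TT_Dk K g Dkb entireC entireC entireC Dkb_ext Dkb_plus Dkb_conj (Dkb_P K) entireC_der entireC_mult i k (fun _ => RtoC 1) h (entireC_const 1) Hh L).
Qed.
Lemma Dkb_Csum m (u : nat -> C -> C) : (forall k, (k < m)%nat -> Dkb (u k)) -> Dkb (fun z => Csum m (fun k => u k z)).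
Proof.
  intros H. induction m; simpl.
  - split; [exists 0; split; [lra | intros; rewrite Cmod_0; lra] | reflexivity].
  - apply Dkb_plus; [apply IHm; auto | apply H; lia].
Qed.
Lemma kb_Dk : Dkb kb.
Proof.
  apply (Dkb_Csum n (fun i z => RtoC (/ INR (fact i)) * TT g i n (fun z => z ^ i * 1)%C z)%C).
  intros k Hk. apply Dkb_scal, TTb_Dk; [apply ent_i | unfold K; lia].
Qed.
Lemma kb1_Dk : Dkb kb1.
Proof.
  apply (Dkb_Csum n (fun i z => RtoC (/ INR (fact i)) * TT g (S i) n (fun z => z ^ i * 1)%C z)%C).
  intros k Hk. apply Dkb_scal, TTb_Dk; [apply ent_i | unfold K; lia].
Qed.
Lemma kb2_Dk : Dkb kb2.
Proof.
  apply (Dkb_Csum n (fun i z => RtoC (/ INR (fact i)) * TT g i (S n) (fun z => (z + 0) * (z ^ i * 1))%C z)%C).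
  intros k Hk. apply Dkb_scal, TTb_Dk; [apply ent_i' | unfold K; lia].
Qed.
Lemma contC_Csum m (u : nat -> C -> C) : (forall k, (k < m)%nat -> contC (u k)) -> contC (fun z => Csum m (fun k => u k z)).
Proof. intros H. induction m; simpl; [apply contC_const | apply contC_plus; [apply IHm; auto | apply H; lia]]. Qed.
Lemma kb1_cont : contC kb1.
Proof.
  apply (contC_Csum n (fun i z => RtoC (/ INR (fact i)) * TT g (S i) n (fun z => z ^ i * 1)%C z)%C). intros k Hk.
  apply contC_mult; [apply contC_const | apply (TT_cont K g (bump_cont K)); [apply ent_i | unfold K; lia]].
Qed.
Lemma kb2_cont : contC kb2.
Proof.
  apply (contC_Csum n (fun i z => RtoC (/ INR (fact i)) * TT g i (S n) (fun z => (z + 0) * (z ^ i * 1))%C z)%C). intros k Hk.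
  apply contC_mult; [apply contC_const | apply (TT_cont K g (bump_cont K)); [apply ent_i' | unfold K; lia]].
Qed.
Lemma kb_WD z : WD kb z (kb1 z) (kb2 z).
Proof.
  unfold kb, kap, kb1, kb2. assert (Q : forall m, (m <= n)%nat ->
   WD (fun z => Csum m (fun i => RtoC (/ INR (fact i)) * TT g i n (fun z => z ^ i * 1)%C z)%C) z
    (Csum m (fun i => RtoC (/ INR (fact i)) * TT g (S i) n (fun z => z ^ i * 1)%C z)%C)
    (Csum m (fun i => RtoC (/ INR (fact i)) * TT g i (S n) (fun z => (z + 0) * (z ^ i * 1))%C z)%C)).
  { induction m; intros L; [exact (WD_const 0 z)|]. simpl Csum. apply WD_plus; [apply IHm; lia|].
    apply WD_scal. apply (TT_WD 0 K g (bump_WD K)); [apply ent_i | unfold K; lia]. }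
  apply Q; lia.
Qed.

(** [kap_repr] with E = 1, summed over the components: a mean value property that recovers F(0) from
    a disk. *)
Lemma kb_repr F : PA n F -> Null 1 Ci (fun z => F z * kb z - F 0%C * g n z)%C.
Proof.
  intros [f [Hf Ef]].
  assert (Q : forall m, (m <= n)%nat -> Null 1 Ci (fun z => Csum m (fun k => Cconj z ^ k * f k z) * kb z
     - (match m with O => RtoC 0 | S _ => f O (RtoC 0) end) * g n z)%C).
  { induction m; intros L.
    - eapply Null_ext; [|apply Null_0]. intros; simpl; ring.
    - assert (N := kap_repr 1 Ci 0 K g Dkb entireC entireC entireC det_std (bump_WD K) (bump_cont K) Dkb_ext Dkb_decays Dkb_plus Dkb_conj (Dkb_P K)
        entireC_ext (fun f H => H) entireC_const entireC_scal entireC_plus entireC_der (fun f h b _ Hh _ => Hh) (fun f H => H) (fun f H => H)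
        entireC_der entireC_der (fun f H => entireC_mult _ _ entireC_id H) entireC_mult n m (f m) (fun _ => RtoC 1) eq_refl (Hf m) (entireC_const 1)
        ltac:(unfold K; lia) ltac:(lia)).
      assert (V : Van n (fun _ : C => 1 - 1)%C 0%C).
      { apply (Van_ext n (fun _ => 0 * 0)%C); [intros; ring|]. apply (Van_mult_l n (fun _ => RtoC 0) (fun _ => RtoC 0)); auto using entireC_const.
        clear. induction n; [exact I|]. split; [reflexivity|]. apply (Van_ext n0 (fun _ => RtoC 0)); [intros; symmetry; apply der_const | exact IHn0]. }
      specialize (N V). eapply Null_ext; [|apply (Null_plus _ _ _ _ (IHm ltac:(lia)) N)].
      intros z. cbv beta. simpl. fold kb. destruct m; simpl; ring. }
  specialize (Q n (le_n n)).
  assert (F0 : F 0%C = match n with O => RtoC 0 | S _ => f O (RtoC 0) end).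
  { rewrite Ef. destruct n as [|m]; [reflexivity|]. rewrite Csum_S_l. rewrite (Csum_ext m _ (fun _ => RtoC 0)).
    - rewrite Csum_0. simpl. ring.
    - intros k _. simpl. replace (Cconj 0) with (RtoC 0) by csolve. ring. }
  eapply Null_ext; [|exact Q]. intros z. cbv beta. rewrite F0, Ef. destruct n; reflexivity.
Qed.
End BumpKernel.

Lemma IC_lower w1 w2 (mu : C -> R) mu0 rho : snd (Cconj w1 * w2)%C <> 0 ->
  contC (fun z => RtoC (mu z)) -> (forall z, 0 <= mu z) -> 0 < mu0 -> 0 < rho ->
  (forall z, Cmod z <= rho -> mu0 <= mu z) ->
  exists c0, 0 < c0 /\ forall w, exists R0, forall R, R0 <= R -> c0 <= IC w1 w2 mu w R.
Proof.
  intros det Hc Hp Hm Hr Hl. assert (a1 := Cmod_ge_0 w1). assert (a2 := Cmod_ge_0 w2).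
  set (e := rho / (Cmod w1 + Cmod w2 + 1)). assert (He : 0 < e) by (apply Rdiv_lt_0_compat; lra).
  exists ((2 * e) * ((2 * e) * mu0)). split; [apply Rmult_lt_0_compat; [lra | apply Rmult_lt_0_compat; lra]|]. intros w.
  set (D := snd (Cconj w1 * w2)%C) in *.
  (* Coordinates of the origin as seen from w, by Cramer's rule; the square of half-side e around
     them stays within distance rho of 0. *)
  set (s0 := snd (Cconj w2 * w)%C / D). set (t0 := - snd (Cconj w1 * w)%C / D).
  assert (E0 : (w + RtoC s0 * w1 + RtoC t0 * w2 = 0)%C).
  { unfold s0, t0, D in *. apply C_ext; simpl in *; field; lra. }
  exists (Rabs s0 + Rabs t0 + e). intros R HR.
  assert (C2 : cont2 (fun s t => mu (lp w1 w2 w s t))) by apply (cont2_fst w1 w2 (fun z => RtoC (mu z)) w Hc).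
  apply Rle_trans with (II (fun s t => mu (lp w1 w2 w s t)) (s0 - e) (s0 + e) (t0 - e) (t0 + e)).
  - replace ((2 * e) * ((2 * e) * mu0)) with (II (fun _ _ => mu0) (s0 - e) (s0 + e) (t0 - e) (t0 + e)) by (rewrite II_const; ring).
    apply II_le; try lra; [apply cont2_const | exact C2|]. intros s t Hs Ht. apply Hl.
    unfold lp. replace (w + RtoC s * w1 + RtoC t * w2)%C with (RtoC (s - s0) * w1 + RtoC (t - t0) * w2)%C.
    + eapply Rle_trans; [apply Cmod_triangle|]. rewrite !Cmod_mult, !Cmod_R.
      assert (Rabs (s - s0) <= e) by (apply Rabs_le; lra). assert (Rabs (t - t0) <= e) by (apply Rabs_le; lra).
      assert (Ee : e * (Cmod w1 + Cmod w2 + 1) = rho) by (unfold e; field; lra). nra.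
    + rewrite !RtoC_minus. transitivity (w + RtoC s * w1 + RtoC t * w2 - (w + RtoC s0 * w1 + RtoC t0 * w2))%C; [ring | rewrite E0; ring].
  - unfold IC. assert (A := Rle_abs s0). assert (B := Rle_abs (- s0)). assert (A' := Rle_abs t0). assert (B' := Rle_abs (- t0)).
    rewrite Rabs_Ropp in B, B'. assert (P := Rabs_pos s0). assert (P' := Rabs_pos t0).
    apply II_sub; auto; lra.
Qed.

Lemma contC_real_exp (c : R) : contC (fun z => RtoC (exp (c * Cmod z ^ 2))).
Proof.
  apply contC_ext with (u := fun z => cexp (RtoC c * (z * Cconj z))%C).
  - intros z. rewrite <- cexp_R. f_equal. rewrite RtoC_mult. f_equal. rewrite <- Cmod2_conj, RtoC_pow. reflexivity.
  - apply (contC_comp cexp).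
    + apply entireC_cont. intros z; eexists; apply WD_cexp.
    + apply contC_mult; [apply contC_const|]. apply contC_mult; [apply entireC_cont, entireC_id | apply contC_conj].
Qed.

Lemma contC_shift u w : contC u -> contC (fun z => u (z + w)%C).
Proof. intros H. apply (contC_comp u (fun z => z + w)%C H), entireC_cont, entireC_plus; [apply entireC_id | apply entireC_const]. Qed.

Section LocalEstimate.
Variable n : nat.
Let K := (2 * n + 1)%nat.
Let g := bump K.
Let kb := kap g n (fun _ => RtoC 1).

(** The null identity is solved for v: the mean of [g n] is bounded below, as it has constant sign,
    and the other mean is controlled by the weighted integral of F. *)
Lemma kb_ineq kappa : Dkb kappa -> contC kappa -> exists C0, 0 < C0 /\ forall F v xi Q R0, contC F -> Cmod xi <= 1 ->
  Null 1 Ci (fun z => F (z + xi) * kappa z + v * g n z)%C ->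
  (forall R, R0 <= R -> IC 1 Ci (fun z => Cmod (F z) * exp (- (PI / 2 + 1) * Cmod z ^ 2)) 0 R <= Q) -> Cmod v <= C0 * Q.
Proof.
  intros [[M [M0 B]] Z] Ck. assert (PI0 := PI_RGT_0).
  destruct (IC_lower 1 Ci (fun z => mx (K + 2 - n) (1 - Cmod z * Cmod z)) (mx (K + 2 - n) (3/4)) (/2)) as [c0 [Hc0 HL]].
  - exact det_std.
  - assert (Hb := bump_cont K n ltac:(unfold K; lia)).
    apply contC_ext with (u := fun z => (RtoC (/ cb K n) * bump K n z)%C); [|apply contC_mult; [apply contC_const | exact Hb]].
    intros z. unfold bump. rewrite <- RtoC_mult. f_equal. field. apply cb_nz. unfold K; lia.
  - intros z. apply pow_le, Rmax_l.
  - apply pow_lt. rewrite Rmax_right; lra.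
  - lra.
  - intros z Hz. assert (z0 := Cmod_ge_0 z). apply pow_incr. split; [apply Rmax_l|]. apply Rle_max_compat_l. nra.
  - set (cn := Rabs (cb K n)). assert (Hcn : 0 < cn) by (apply Rabs_pos_lt, cb_nz; unfold K; lia).
    (* [kappa (z - xi)] lives on |z - xi| < 1, so |z| <= 2 because |xi| <= 1; the exponential undoes
       the weight there. *)
    set (M' := M * exp ((PI / 2 + 1) * 4)). assert (M0' : 0 <= M') by (apply Rmult_le_pos; [exact M0 | left; apply exp_pos]).
    exists ((2 * M' + 1) / (cn * c0)). assert (Hcc : 0 < cn * c0) by (apply Rmult_lt_0_compat; lra).
    split; [apply Rdiv_lt_0_compat; lra|]. intros F v xi Q R0 CF Hxi HN HQ.
    assert (CFx : contC (fun z => F (z + xi) * kappa z)%C) by (apply contC_mult; [apply contC_shift, CF | exact Ck]).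
    assert (Cg : contC (g n)) by (apply bump_cont; unfold K; lia).
    assert (Cw : cont2 (fun s t => Cmod (F (lp 1 Ci 0 s t)) * exp (- (PI / 2 + 1) * Cmod (lp 1 Ci 0 s t) ^ 2))).
    { apply (cont2_ext (fun s t => fst (((fun z => RtoC (Cmod (F z)) * RtoC (exp (- (PI / 2 + 1) * Cmod z ^ 2)))%C) (lp 1 Ci 0 s t)))).
      - intros; simpl; ring.
      - apply (cont2_fst 1 Ci (fun z => RtoC (Cmod (F z)) * RtoC (exp (- (PI / 2 + 1) * Cmod z ^ 2)))%C).
        apply contC_mult; [apply contC_Cmod, CF | apply contC_real_exp]. }
    assert (Key : forall eta, 0 < eta -> Cmod v * (cn * c0) <= 2 * M' * Q + eta).
    { intros eta He. destruct HN as [_ HN]. destruct (HN (- xi)%C eta He) as [R1 HR1].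
      destruct (HL (- xi)%C) as [R2 HR2].
      set (R := Rmax 0 (Rmax R0 (Rmax R1 R2))).
      assert (r0 : 0 <= R) by apply Rmax_l.
      assert (q0 : Rmax R0 (Rmax R1 R2) <= R) by apply Rmax_r.
      assert (q1 : R0 <= R) by (eapply Rle_trans; [apply Rmax_l | exact q0]).
      assert (q2 : Rmax R1 R2 <= R) by (eapply Rle_trans; [apply Rmax_r | exact q0]).
      assert (q3 : R1 <= R) by (eapply Rle_trans; [apply Rmax_l | exact q2]).
      assert (q4 : R2 <= R) by (eapply Rle_trans; [apply Rmax_r | exact q2]).
      specialize (HR1 R q3). specialize (HR2 R q4). specialize (HQ R q1).
      rewrite CIC_plus, CIC_scal in HR1; auto; [|apply contC_mult; [apply contC_const | exact Cg]].
      assert (L1 : cn * c0 <= Cmod (CIC 1 Ci (g n) (- xi) R)).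
      { eapply Rle_trans; [|apply fst_le_Cmod].
        assert (E : II (fun s t => fst (g n (lp 1 Ci (- xi) s t))) (- R) R (- R) R
          = cb K n * IC 1 Ci (fun z => mx (K + 2 - n) (1 - Cmod z * Cmod z)) (- xi)%C R).
        { unfold IC. rewrite <- II_scal; [reflexivity|].
          apply (cont2_ext (fun s t => / cb K n * fst (g n (lp 1 Ci (- xi) s t)))).
          - intros. unfold g, bump. simpl fst. field. apply cb_nz; unfold K; lia.
          - apply cont2_scal, cont2_fst, Cg. }
        apply Rle_trans with (Rabs (cb K n * IC 1 Ci (fun z => mx (K + 2 - n) (1 - Cmod z * Cmod z)) (- xi)%C R)); [|right; f_equal; symmetry; exact E].
        rewrite Rabs_mult. fold cn. apply Rmult_le_compat_l; [lra|].
        eapply Rle_trans; [exact HR2 | apply Rle_abs]. }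
      assert (L2 : Cmod (CIC 1 Ci (fun z => F (z + xi) * kappa z)%C (- xi) R) <= 2 * (M' * Q)).
      { eapply Rle_trans; [apply CIC_le; assumption|]. apply Rmult_le_compat_l; [lra|].
        eapply Rle_trans; [|apply Rmult_le_compat_l; [exact M0' | exact HQ]]. unfold IC.
        rewrite <- II_scal by exact Cw. apply II_le; try lra.
        - apply (cont2_mod 1 Ci (fun z => F (z + xi) * kappa z)%C), CFx.
        - apply cont2_scal, Cw.
        - intros s t _ _. set (z := lp 1 Ci 0 s t).
          assert (Ez : lp 1 Ci (- xi) s t = (z - xi)%C) by (unfold z, lp; ring). rewrite Ez.
          replace (z - xi + xi)%C with z by ring. rewrite Cmod_mult.
          replace (M' * (Cmod (F z) * exp (- (PI / 2 + 1) * Cmod z ^ 2))) with (Cmod (F z) * (M' * exp (- (PI / 2 + 1) * Cmod z ^ 2))) by ring.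
          apply Rmult_le_compat_l; [apply Cmod_ge_0|].
          destruct (Rle_dec 1 (Cmod (z - xi))) as [L|L].
          + rewrite (Z _ L), Cmod_0. apply Rmult_le_pos; [exact M0' | left; apply exp_pos].
          + eapply Rle_trans; [apply B|]. unfold M'. rewrite Rmult_assoc, <- exp_plus.
            rewrite <- (Rmult_1_r M) at 1. apply Rmult_le_compat_l; [exact M0|]. apply exp_ge_1.
            assert (T := Cmod_triangle (z - xi) xi). replace (z - xi + xi)%C with z in T by ring.
            assert (z0 := Cmod_ge_0 z). assert (Cmod z ^ 2 <= 4) by nra. nra. }
      assert (T := Cmod_triangle_rev (v * CIC 1 Ci (g n) (- xi) R) (- CIC 1 Ci (fun z => F (z + xi) * kappa z)%C (- xi) R)).
      rewrite Cmod_opp, Cmod_mult in T.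
      replace (v * CIC 1 Ci (g n) (- xi) R - - CIC 1 Ci (fun z : C => F (z + xi)%C * kappa z) (- xi) R)%C
        with (CIC 1 Ci (fun z : C => F (z + xi)%C * kappa z)%C (- xi) R + v * CIC 1 Ci (g n) (- xi) R)%C in T by ring.
      assert (v0 := Cmod_ge_0 v).
      assert (Cmod v * (cn * c0) <= Cmod v * Cmod (CIC 1 Ci (g n) (- xi) R)) by (apply Rmult_le_compat_l; assumption).
      lra. }
    assert (Q0 : 0 <= Q).
    { specialize (HQ (Rmax 0 R0) (Rmax_r _ _)). eapply Rle_trans; [|exact HQ].
      assert (x := Rmax_l 0 R0). apply II_ge_0; try lra; [exact Cw|]. intros. apply Rmult_le_pos; [apply Cmod_ge_0 | left; apply exp_pos]. }
    replace ((2 * M' + 1) / (cn * c0) * Q) with (((2 * M' + 1) * Q) / (cn * c0)) by (field; lra).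
    apply (proj1 (Rle_div_r _ _ _ Hcc)).
    apply Rnot_lt_le. intros L. set (d := Cmod v * (cn * c0) - 2 * M' * Q).
    assert (Hd : 0 < d) by (unfold d; nra). specialize (Key (d / 2) ltac:(lra)). unfold d in Key. lra.
Qed.

(** The derivatives are bounded by F alone: F [kb] is compactly supported, so p [kb] + F [kb1] is
    null, and the mean value property for p lets its value be read off from F [kb1]. The same holds
    for q with [kb2]. *)
Theorem local_estimate : exists C0, 0 < C0 /\ forall F p q, PA n F -> PA n p -> PA n q -> (forall z, WD F z (p z) (q z)) ->
  forall xi Q R0, Cmod xi <= 1 ->
  (forall R, R0 <= R -> IC 1 Ci (fun z => Cmod (F z) * exp (- (PI / 2 + 1) * Cmod z ^ 2)) 0 R <= Q) ->
  Cmod (F xi) <= C0 * Q /\ Cmod (p xi) <= C0 * Q /\ Cmod (q xi) <= C0 * Q.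
Proof.
  assert (Ck : contC kb) by apply (WD_cont kb _ _ (kb_WD n)).
  destruct (kb_ineq kb (kb_Dk n) Ck) as [A0 [a0 H0]].
  destruct (kb_ineq (kb1 n) (kb1_Dk n) (kb1_cont n)) as [A1 [a1 H1]].
  destruct (kb_ineq (kb2 n) (kb2_Dk n) (kb2_cont n)) as [A2 [a2 H2]].
  exists (Rmax A0 (Rmax A1 A2)). split; [eapply Rlt_le_trans; [exact a0 | apply Rmax_l]|].
  intros F p q PF Pp Pq W xi Q R0 Hxi HQ.
  assert (CF := PA_cont n F PF).
  assert (Q0 : 0 <= Q).
  { specialize (HQ (Rmax 0 R0) (Rmax_r _ _)). eapply Rle_trans; [|exact HQ].
    assert (x := Rmax_l 0 R0). apply II_ge_0; try lra; [|intros; apply Rmult_le_pos; [apply Cmod_ge_0 | left; apply exp_pos]].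
    apply (cont2_ext (fun s t => fst (((fun z => RtoC (Cmod (F z)) * RtoC (exp (- (PI / 2 + 1) * Cmod z ^ 2)))%C) (lp 1 Ci 0 s t)))).
      - intros; simpl; ring.
      - apply (cont2_fst 1 Ci (fun z => RtoC (Cmod (F z)) * RtoC (exp (- (PI / 2 + 1) * Cmod z ^ 2)))%C).
        apply contC_mult; [apply contC_Cmod, CF | apply contC_real_exp]. }
  assert (N0 := kb_repr n _ (PA_shift n F xi PF)). assert (Np := kb_repr n _ (PA_shift n p xi Pp)). assert (Nq := kb_repr n _ (PA_shift n q xi Pq)).
  cbv beta in N0, Np, Nq. rewrite Cplus_0_l in N0, Np, Nq. fold K g kb in N0, Np, Nq.
  assert (Ws : forall z, WD (fun z => F (z + xi)%C) z (p (z + xi)%C) (q (z + xi)%C)).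
  { intros z. eapply WD_ext; [| | | apply (WD_chain F (fun z => z + xi)%C z _ _ _ _ (W (z + xi)%C) (WD_plus _ _ _ _ _ _ _ (WD_id z) (WD_const xi z)))].
    - reflexivity.
    - rewrite Cconj_plus. replace (Cconj 0) with (RtoC 0) by csolve. ring.
    - rewrite Cconj_plus. replace (Cconj 0) with (RtoC 0) by csolve. replace (Cconj 1) with (RtoC 1) by csolve. ring. }
  destruct (Null_exact 1 Ci det_std (fun z => F (z + xi) * kb z)%C _ _ (fun z => WD_mult _ _ _ _ _ _ _ (Ws z) (kb_WD n z))) as [X1 X2].
  - apply contC_plus; [apply contC_mult; [apply contC_shift, (PA_cont n), Pp | exact Ck] | apply contC_mult; [apply contC_shift, CF | apply kb1_cont]].
  - apply contC_plus; [apply contC_mult; [apply contC_shift, (PA_cont n), Pq | exact Ck] | apply contC_mult; [apply contC_shift, CF | apply kb2_cont]].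
  - apply Dkb_decays, Dkb_mult; [|apply kb_Dk].
    destruct (PA_shift n F xi PF) as [f [Hf Ef]].
    assert (Bd : exists M, 0 <= M /\ forall z, Cmod z <= 1 -> Cmod (Csum n (fun k => Cconj z ^ k * f k z)%C) <= M).
    { generalize n. intros m; induction m.
      - exists 0. split; [lra|]. intros; simpl; rewrite Cmod_0; lra.
      - destruct IHm as [M [M0 HM]]. destruct (entire_bounded (f m) 1 (Hf m)) as [M2 [M02 HM2]].
        exists (M + M2). split; [lra|]. intros z Hz. simpl. eapply Rle_trans; [apply Cmod_triangle|].
        apply Rplus_le_compat; [auto|]. rewrite Cmod_mult, Cmod_pow, Cmod_conj.
        rewrite <- (Rmult_1_l M2). apply Rmult_le_compat; auto using Cmod_ge_0.
        + apply pow_le, Cmod_ge_0.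
        + rewrite <- (pow1 m). apply pow_incr. split; [apply Cmod_ge_0 | assumption]. }
    destruct Bd as [M [M0 HM]]. exists M. split; [exact M0|]. intros z Hz. rewrite Ef. apply HM, Hz.
  - change (kap (bump (2 * n + 1)) n (fun _ => RtoC 1)) with kb in X1, X2.
    assert (LA : forall A, A <= Rmax A0 (Rmax A1 A2) -> A * Q <= Rmax A0 (Rmax A1 A2) * Q) by (intros; apply Rmult_le_compat_r; assumption).
    split; [|split].
    + eapply Rle_trans; [|apply LA, Rmax_l]. rewrite <- Cmod_opp. apply (H0 F _ xi Q R0); auto.
      eapply Null_ext; [|exact N0]. intros; cbv beta; ring.
    + eapply Rle_trans; [|apply LA; eapply Rle_trans; [apply Rmax_l | apply Rmax_r]]. apply (H1 F _ xi Q R0); auto.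
      eapply Null_ext; [|apply (Null_plus _ _ _ _ X1 (Null_scal _ _ (-(1)) _ Np))]. intros; cbv beta; ring.
    + eapply Rle_trans; [|apply LA; eapply Rle_trans; [apply Rmax_r | apply Rmax_r]]. apply (H2 F _ xi Q R0); auto.
      eapply Null_ext; [|apply (Null_plus _ _ _ _ X2 (Null_scal _ _ (-(1)) _ Nq))]. intros; cbv beta; ring.
Qed.
End LocalEstimate.

(** * The Fock weight *)

Definition SQ (u : C -> R) (r : R) : R := II (fun x y => u (x, y)) (- r) r (- r) r.
Definition wtC (F : C -> C) (z : C) : R := Cmod (F z) ^ 2 * exp (- PI * Cmod z ^ 2).
Definition contCR (u : C -> R) : Prop := contC (fun z => RtoC (u z)).

Lemma lp_std x y : lp 1 Ci 0 x y = (x, y).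
Proof. unfold lp. csolve. Qed.
Lemma SQ_IC u r : SQ u r = IC 1 Ci u 0 r.
Proof. unfold SQ, IC. apply II_ext. intros. rewrite lp_std. reflexivity. Qed.
Lemma contCR_cont2 u : contCR u -> cont2 (fun x y => u (x, y)).
Proof.
  intros H. apply (cont2_ext (fun s t => fst (RtoC (u (lp 1 Ci 0 s t))))); [intros; rewrite lp_std; reflexivity|].
  apply (cont2_fst 1 Ci (fun z => RtoC (u z)) 0 H).
Qed.
Lemma contCR_plus u v : contCR u -> contCR v -> contCR (fun z => u z + v z).
Proof. intros Hu Hv. apply contC_ext with (u := fun z => (RtoC (u z) + RtoC (v z))%C); [intros; rewrite RtoC_plus; reflexivity | apply contC_plus; assumption]. Qed.
Lemma contCR_mult u v : contCR u -> contCR v -> contCR (fun z => u z * v z).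
Proof. intros Hu Hv. apply contC_ext with (u := fun z => (RtoC (u z) * RtoC (v z))%C); [intros; rewrite RtoC_mult; reflexivity | apply contC_mult; assumption]. Qed.
Lemma contCR_const c : contCR (fun _ => c).
Proof. exact (contC_const (RtoC c)). Qed.
Lemma contCR_exp c w : contCR (fun z => exp (c * Cmod (z - w) ^ 2)).
Proof. apply (contC_shift (fun z => RtoC (exp (c * Cmod z ^ 2))) (- w)%C), contC_real_exp. Qed.
Lemma contCR_exp0 c : contCR (fun z => exp (c * Cmod z ^ 2)).
Proof. apply contC_real_exp. Qed.
Lemma contCR_Cmod F : contC F -> contCR (fun z => Cmod (F z)).
Proof. apply contC_Cmod. Qed.
Lemma contCR_wt F : contC F -> contCR (wtC F).
Proof.
  intros H. unfold wtC. apply contCR_mult; [|apply contCR_exp0].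
  apply contC_ext with (u := fun z => RtoC (Cmod (F z) * Cmod (F z))); [intros; f_equal; ring|].
  apply contCR_mult; apply contCR_Cmod, H.
Qed.
Lemma contCR_shift u w : contCR u -> contCR (fun z => u (z + w)%C).
Proof. apply (contC_shift (fun z => RtoC (u z))). Qed.
Lemma contCR_Rsum m (u : nat -> C -> R) : (forall i, (i < m)%nat -> contCR (u i)) -> contCR (fun z => Rsum m (fun i => u i z)).
Proof. intros H. induction m; simpl; [apply contCR_const | apply contCR_plus; [apply IHm; auto | apply H; lia]]. Qed.
Lemma wtC_ge_0 F z : 0 <= wtC F z.
Proof. apply Rmult_le_pos; [apply pow2_ge_0 | left; apply exp_pos]. Qed.

Lemma SQ_le u v r : 0 <= r -> contCR u -> contCR v -> (forall z, u z <= v z) -> SQ u r <= SQ v r.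
Proof.
  intros Hr Hu Hv H. apply (II_le (fun x y => u (x, y)) (fun x y => v (x, y))); try lra; [apply contCR_cont2, Hu | apply contCR_cont2, Hv | intros; apply H].
Qed.
Lemma SQ_scal c u r : contCR u -> SQ (fun z => c * u z) r = c * SQ u r.
Proof. intros H. apply (II_scal c (fun x y => u (x, y))), contCR_cont2, H. Qed.
Lemma SQ_plus u v r : contCR u -> contCR v -> SQ (fun z => u z + v z) r = SQ u r + SQ v r.
Proof. intros Hu Hv. apply (II_plus (fun x y => u (x, y)) (fun x y => v (x, y))); apply contCR_cont2; assumption. Qed.
Lemma SQ_ge_0 u r : 0 <= r -> contCR u -> (forall z, 0 <= u z) -> 0 <= SQ u r.
Proof. intros Hr Hu H. apply (II_ge_0 (fun x y => u (x, y))); try lra; [apply contCR_cont2, Hu | intros; apply H]. Qed.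
Lemma SQ_mono u r r' : 0 <= r -> r <= r' -> contCR u -> (forall z, 0 <= u z) -> SQ u r <= SQ u r'.
Proof. intros Hr L Hu H. apply (II_sub (fun x y => u (x, y))); try lra; [apply contCR_cont2, Hu | intros; apply H]. Qed.
Lemma SQ_ext u v r : (forall z, u z = v z) -> SQ u r = SQ v r.
Proof. intros E. replace v with u; [reflexivity | apply functional_extensionality, E]. Qed.
Lemma SQ_Rsum m (u : nat -> C -> R) r : (forall i, (i < m)%nat -> contCR (u i)) ->
  SQ (fun z => Rsum m (fun i => u i z)) r = Rsum m (fun i => SQ (u i) r).
Proof.
  intros H. induction m; simpl.
  - unfold SQ. rewrite II_const. ring.
  - rewrite SQ_plus, IHm; auto. apply contCR_Rsum; auto.
Qed.

Lemma RInt_shift (f : R -> R) a b v : (forall x, continuous f x) ->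
  RInt (fun x => f (x + v)) a b = RInt f (a + v) (b + v).
Proof.
  intros H. rewrite <- (Rmult_1_l a) at 2. rewrite <- (Rmult_1_l b) at 2.
  rewrite <- (RInt_comp_lin (V:=R_CompleteNormedModule) f 1 v a b).
  - apply RInt_ext. intros t _. unfold scal; simpl; unfold mult; simpl. rewrite !Rmult_1_l. reflexivity.
  - apply (ex_RInt_continuous (V:=R_CompleteNormedModule)). intros; apply H.
Qed.

Lemma II_shift G a b c d p q : cont2 G ->
  II (fun x y => G (x + p) (y + q)) a b c d = II G (a + p) (b + p) (c + q) (d + q).
Proof.
  intros H. unfold II. rewrite <- (RInt_shift (fun x => RInt (G x) (c + q) (d + q))).
  - apply RInt_ext. intros x _. rewrite <- (RInt_shift (G (x + p))); [reflexivity|]. intros; apply cont2_section, H.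
  - intros; apply cont2_RInt, H.
Qed.

Lemma SQ_shift_le u w r r' : contCR u -> (forall z, 0 <= u z) -> 0 <= r -> r + Cmod w <= r' ->
  SQ (fun z => u (z + w)%C) r <= SQ u r'.
Proof.
  intros Hu Hp Hr L. unfold SQ. assert (A := fst_le_Cmod w). assert (B := snd_le_Cmod w).
  apply Rabs_le_between in A. apply Rabs_le_between in B.
  rewrite (II_ext _ (fun x y => (fun x y => u (x, y)) (x + fst w) (y + snd w))) by (intros; f_equal; csolve).
  rewrite (II_shift (fun x y => u (x, y))) by (apply contCR_cont2, Hu).
  apply II_sub; try lra; [apply contCR_cont2, Hu | intros; apply Hp].
Qed.

(** Gaussians are dominated through exp(-x) <= 1/(1 + x), which leaves an arctangent and keeps the
    scale 1 / sqrt e of the Gaussian integral. *)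
Lemma RInt_gauss_le e x0 a b : 0 < e -> a <= b ->
  RInt (fun x => / (1 + e * (x - x0) ^ 2)) a b <= PI / sqrt e.
Proof.
  intros He L. set (q := sqrt e). assert (Hq : 0 < q) by (apply sqrt_lt_R0, He).
  assert (Eq : q * q = e) by (apply sqrt_sqrt; lra).
  rewrite (is_RInt_unique _ a b (/ q * atan (q * (b - x0)) - / q * atan (q * (a - x0)))).
  - assert (B1 := atan_bound (q * (b - x0))). assert (B2 := atan_bound (q * (a - x0))).
    assert (0 < / q) by (apply Rinv_0_lt_compat, Hq). unfold Rdiv. nra.
  - apply (is_RInt_derive (V:=R_CompleteNormedModule) (fun x => / q * atan (q * (x - x0)))).
    + intros x _. auto_derive; [trivial|]. rewrite <- Eq.
      field. split; [|lra]. assert (X := pow2_ge_0 (q * (x - x0))). simpl in X |- *. nra.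
    + intros x _. apply (ex_derive_continuous (K:=R_AbsRing) (V:=R_NormedModule)). auto_derive.
      assert (X := pow2_ge_0 (x - x0)). simpl in X |- *. nra.
Qed.

Lemma exp_neg_le x : 0 <= x -> exp (- x) <= / (1 + x).
Proof.
  intros H. rewrite exp_Ropp. apply Rinv_le_contravar; [lra | apply exp_ineq1_le].
Qed.

Lemma Cmod_sqr2 z : Cmod z ^ 2 = fst z ^ 2 + snd z ^ 2.
Proof. assert (H := Cmod_sqr z). simpl. lra. Qed.

Lemma SQ_gauss e w r : 0 < e -> 0 <= r -> SQ (fun z => exp (- e * Cmod (z - w) ^ 2)) r <= PI ^ 2 / e.
Proof.
  intros He Hr.
  assert (Q : forall c x, 0 < 1 + e * (x - c) ^ 2) by (intros c x; assert (X := pow2_ge_0 (x - c)); nra).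
  assert (Cn : forall c x, continuous (fun x => / (1 + e * (x - c) ^ 2)) x).
  { intros c x. apply (ex_derive_continuous (K:=R_AbsRing) (V:=R_NormedModule)). auto_derive.
    assert (X := Q c x). simpl in X. lra. }
  assert (CG : cont2 (fun x y => / (1 + e * (x - fst w) ^ 2) * / (1 + e * (y - snd w) ^ 2))).
  { apply cont2_mult; [apply (cont2_x (fun x => / (1 + e * (x - fst w) ^ 2))), Cn | apply (cont2_y (fun y => / (1 + e * (y - snd w) ^ 2))), Cn]. }
  apply Rle_trans with (II (fun x y => / (1 + e * (x - fst w) ^ 2) * / (1 + e * (y - snd w) ^ 2)) (- r) r (- r) r).
  - apply (II_le (fun x y => exp (- e * Cmod ((x, y) - w)%C ^ 2))); try lra; [apply (contCR_cont2 (fun z => exp (- e * Cmod (z - w) ^ 2))), contCR_exp | exact CG|]. intros x y _ _.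
    rewrite Cmod_sqr2. simpl fst; simpl snd.
    replace (- e * ((x + - fst w) ^ 2 + (y + - snd w) ^ 2)) with (- (e * (x - fst w) ^ 2) + - (e * (y - snd w) ^ 2)) by ring.
    rewrite exp_plus. apply Rmult_le_compat; try (left; apply exp_pos); apply exp_neg_le;
    (apply Rmult_le_pos; [lra | apply pow2_ge_0]).
  - unfold II. assert (sq : 0 < sqrt e) by (apply sqrt_lt_R0, He). assert (P := PI_RGT_0).
    set (B := RInt (fun y => / (1 + e * (y - snd w) ^ 2)) (- r) r).
    assert (HB : B <= PI / sqrt e) by (apply RInt_gauss_le; lra).
    rewrite (RInt_ext _ (fun x => B * / (1 + e * (x - fst w) ^ 2))).
    + rewrite (RInt_scal (V:=R_CompleteNormedModule)) by (apply (ex_RInt_continuous (V:=R_CompleteNormedModule)); intros; apply Cn).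
      assert (HA : RInt (fun x => / (1 + e * (x - fst w) ^ 2)) (- r) r <= PI / sqrt e) by (apply RInt_gauss_le; lra).
      assert (A0 : 0 <= RInt (fun x => / (1 + e * (x - fst w) ^ 2)) (- r) r).
      { apply RInt_ge_0; [lra | apply (ex_RInt_continuous (V:=R_CompleteNormedModule)); intros; apply Cn|].
        intros; left; apply Rinv_0_lt_compat, Q. }
      assert (B0 : 0 <= B).
      { apply RInt_ge_0; [lra | apply (ex_RInt_continuous (V:=R_CompleteNormedModule)); intros; apply Cn|].
        intros; left; apply Rinv_0_lt_compat, Q. }
      replace (PI ^ 2 / e) with ((PI / sqrt e) * (PI / sqrt e)).
      * apply Rmult_le_compat; assumption.
      * rewrite <- (sqrt_sqrt e) at 3 by lra. field. lra.
    + intros x _. transitivity (/ (1 + e * (x - fst w) ^ 2) * B); [|apply Rmult_comm].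
      apply (RInt_scal (V:=R_CompleteNormedModule) (fun y => / (1 + e * (y - snd w) ^ 2))).
      apply (ex_RInt_continuous (V:=R_CompleteNormedModule)); intros; apply Cn.
Qed.

(* Fock-space translation: it moves the weighted modulus by [w] and keeps the order of polyanalyticity. *)
Definition twist (F : C -> C) (w z : C) : C :=
  (RtoC (exp (- (PI / 2) * Cmod w ^ 2)) * cexp (RtoC (- PI) * Cconj w * z) * F (z + w))%C.

Lemma PA_twist n F w : PA n F -> PA n (twist F w).
Proof.
  intros H. apply (PA_entire_mult n (fun z => F (z + w)%C) (fun z => RtoC (exp (- (PI / 2) * Cmod w ^ 2)) * cexp (RtoC (- PI) * Cconj w * z))%C).
  - apply entireC_scal, entireC_cexp, entireC_scal, entireC_id.
  - apply PA_shift, H.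
Qed.
Lemma twist_mod F w z : Cmod (twist F w z) * exp (- (PI / 2) * Cmod z ^ 2) = Cmod (F (z + w)%C) * exp (- (PI / 2) * Cmod (z + w) ^ 2).
Proof.
  unfold twist. rewrite !Cmod_mult, Cmod_cexp, Cmod_R, Rabs_pos_eq by (left; apply exp_pos).
  rewrite (Rmult_comm _ (Cmod (F (z + w)%C))), Rmult_assoc. f_equal. rewrite <- !exp_plus. f_equal.
  rewrite !Cmod_sqr2. simpl. field.
Qed.
Lemma twist_wt F w z : wtC (twist F w) z = wtC F (z + w).
Proof.
  assert (H := twist_mod F w z).
  assert (E : forall G z, wtC G z = (Cmod (G z) * exp (- (PI / 2) * Cmod z ^ 2)) ^ 2).
  { intros G u. unfold wtC. rewrite Rpow_mult_distr. f_equal.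
    transitivity (exp (- (PI / 2) * Cmod u ^ 2) * exp (- (PI / 2) * Cmod u ^ 2)); [rewrite <- exp_plus; f_equal; field | ring]. }
  rewrite !E, H. reflexivity.
Qed.
Lemma twist_0 (F : C -> C) w : F w = 0%C -> twist F w 0 = 0%C.
Proof. intros H. unfold twist. rewrite Cplus_0_l, H. ring. Qed.

Lemma mean_value u p q xi B : (forall z, WD u z (p z) (q z)) ->
  (forall t : R, 0 <= t <= 1 -> Cmod (p (RtoC t * xi)%C) + Cmod (q (RtoC t * xi)%C) <= B) ->
  Cmod (u xi - u 0%C)%C <= 2 * B * Cmod xi.
Proof.
  intros W HB.
  assert (D : forall t : R, RD (fun t => u (0 + RtoC t * xi)%C) t (p (0 + RtoC t * xi)%C * xi + q (0 + RtoC t * xi)%C * Cconj xi)%C)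
    by (intros t; apply WD_RD, W).
  assert (Bd : forall t : R, 0 <= t <= 1 -> Cmod (p (0 + RtoC t * xi)%C * xi + q (0 + RtoC t * xi)%C * Cconj xi)%C <= B * Cmod xi).
  { intros t Ht. eapply Rle_trans; [apply dlin_le|]. apply Rmult_le_compat_r; [apply Cmod_ge_0|]. rewrite Cplus_0_l. apply HB, Ht. }
  eapply Rle_trans; [apply Cmod_le_sum|].
  assert (E1 : u xi = u (0 + RtoC 1 * xi)%C) by (f_equal; ring). assert (E0 : u 0%C = u (0 + RtoC 0 * xi)%C) by (f_equal; ring).
  assert (M : forall (g dg : R -> R), (forall t, is_derive g t (dg t)) -> (forall t, 0 <= t <= 1 -> Rabs (dg t) <= B * Cmod xi) -> Rabs (g 1 - g 0) <= B * Cmod xi).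
  { intros g dg Hd Hb. destruct (MVT_gen g 0 1 dg) as [c [Hc E]].
    - intros; apply Hd.
    - intros x _. apply continuity_pt_filterlim. apply (ex_derive_continuous (K:=R_AbsRing) (V:=R_NormedModule)). exists (dg x); apply Hd.
    - rewrite E, Rminus_0_r, Rmult_1_r. apply Hb. rewrite Rmin_left, Rmax_right in Hc by lra. exact Hc. }
  assert (M1 := M _ _ (fun t => proj1 (D t)) (fun t Ht => Rle_trans _ _ _ (fst_le_Cmod _) (Bd t Ht))).
  assert (M2 := M _ _ (fun t => proj2 (D t)) (fun t Ht => Rle_trans _ _ _ (snd_le_Cmod _) (Bd t Ht))).
  cbv beta in M1, M2. rewrite <- E1, <- E0 in M1, M2. simpl fst; simpl snd. unfold Rminus in M1, M2. lra.
Qed.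

(** Cauchy-Schwarz in disguise: a bound for every weight th of an arithmetic-geometric mean is used
    at th = X / (2 A). *)
Lemma sq_bound X A J : 0 <= X -> 0 < A -> 0 <= J -> (forall th, 0 < th -> X <= A * (th + J / th)) -> X ^ 2 <= 4 * A ^ 2 * J.
Proof.
  intros HX HA HJ H. destruct (Req_dec X 0) as [->|N].
  - assert (0 <= A ^ 2) by apply pow2_ge_0. nra.
  - set (th := X / (2 * A)). assert (Hth : 0 < th) by (apply Rdiv_lt_0_compat; lra).
    specialize (H th Hth). unfold th in H.
    replace (A * (X / (2 * A) + J / (X / (2 * A)))) with (X / 2 + 2 * A ^ 2 * J / X) in H by (field; lra).
    assert (X / 2 <= 2 * A ^ 2 * J / X) by lra. apply Rle_div_r in H0; [|lra]. nra.
Qed.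

(** The Gaussian is a smooth substitute for the indicator of a disk around w; its lattice translates
    have a bounded sum. *)
Definition locw (F : C -> C) (w u : C) : R := wtC F u * exp (- (1) * Cmod (u - w) ^ 2).

Lemma contCR_locw F w : contC F -> contCR (locw F w).
Proof. intros H. apply contCR_mult; [apply contCR_wt, H | apply contCR_exp]. Qed.
Lemma locw_ge_0 F w u : 0 <= locw F w u.
Proof. apply Rmult_le_pos; [apply wtC_ge_0 | left; apply exp_pos]. Qed.

(** [twist] moves w to the origin, and [sq_bound] turns the integral of |F| in [local_estimate] into
    one of |F|^2. If F vanishes at w, the mean value inequality with the derivative bounds gives the
    factor |xi|^2. *)
Theorem local_weight n : exists C1, 0 < C1 /\ forall F, PA n F -> forall w J,
  (forall r, 0 <= r -> SQ (locw F w) r <= J) -> forall xi, Cmod xi <= 1 ->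
  wtC F (w + xi)%C <= C1 * J /\ (F w = 0%C -> wtC F (w + xi)%C <= C1 * (Cmod xi ^ 2 * J)).
Proof.
  destruct (local_estimate n) as [C0 [HC0 LE]]. assert (P := PI_RGT_0).
  assert (P2 : 1 <= PI ^ 2) by (assert (x := PI2_1); nra).
  set (A := C0 * PI ^ 2). assert (HA : 0 < A) by (apply Rmult_lt_0_compat; [lra | nra]).
  exists (64 * A ^ 2). split; [assert (0 < A ^ 2) by (apply pow_lt; lra); lra|].
  intros F PF w J HJ xi Hxi.
  assert (CF := PA_cont n F PF).
  assert (J0 : 0 <= J).
  { eapply Rle_trans; [|apply (HJ 0 (Rle_refl 0))]. apply SQ_ge_0; [lra | apply contCR_locw, CF | apply locw_ge_0]. }
  set (G := twist F w). assert (PG : PA n G) by apply PA_twist, PF. assert (CG := PA_cont n G PG).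
  destruct (PA_WD n G PG) as [p [q [Pp [Pq W]]]].
  (* The factor exp(-|z|^2) in the weight of [local_estimate] serves both terms of s <= th/2 +
     s^2/(2 th): the first becomes integrable, the second becomes [locw]. *)
  assert (HQ : forall th, 0 < th -> forall R, 0 <= R ->
    IC 1 Ci (fun z => Cmod (G z) * exp (- (PI / 2 + 1) * Cmod z ^ 2)) 0 R <= PI ^ 2 * (th + J / th)).
  { intros th Hth R HR. rewrite <- SQ_IC.
    apply Rle_trans with (SQ (fun z => th / 2 * exp (- (1) * Cmod (z - 0) ^ 2) + / (2 * th) * locw F w (z + w)%C) R).
    - apply SQ_le; auto.
      + apply contCR_mult; [apply contCR_Cmod, CG | apply contCR_exp0].
      + apply contCR_plus; apply contCR_mult; try apply contCR_const; [apply contCR_exp | apply contCR_shift, contCR_locw, CF].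
      + intros z. unfold locw. rewrite <- twist_wt. fold G. replace (z + w - w)%C with z by ring. replace (z - 0)%C with z by ring.
        set (s := Cmod (G z) * exp (- (PI / 2) * Cmod z ^ 2)).
        assert (E1 : Cmod (G z) * exp (- (PI / 2 + 1) * Cmod z ^ 2) = s * exp (- (1) * Cmod z ^ 2)).
        { unfold s. rewrite Rmult_assoc, <- exp_plus. f_equal. f_equal. ring. }
        assert (E2 : wtC G z = s ^ 2).
        { unfold wtC, s. rewrite Rpow_mult_distr. f_equal.
          transitivity (exp (- (PI / 2) * Cmod z ^ 2) * exp (- (PI / 2) * Cmod z ^ 2)); [rewrite <- exp_plus; f_equal; field | ring]. }
        rewrite E1, E2. set (ee := exp (- (1) * Cmod z ^ 2)). assert (ee0 : 0 < ee) by apply exp_pos.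
        replace (th / 2 * ee + / (2 * th) * (s ^ 2 * ee)) with ((th / 2 + s ^ 2 / (2 * th)) * ee) by (field; lra).
        apply Rmult_le_compat_r; [lra|].
        assert (X : 0 <= (th - s) ^ 2 / (2 * th)) by (apply Rmult_le_pos; [apply pow2_ge_0 | left; apply Rinv_0_lt_compat; lra]).
        replace ((th - s) ^ 2 / (2 * th)) with (th / 2 + s ^ 2 / (2 * th) - s) in X by (field; lra). lra.
    - rewrite SQ_plus, !SQ_scal.
      + assert (g1 := SQ_gauss 1 0 R Rlt_0_1 HR). rewrite Rdiv_1_r in g1.
        assert (g2 : SQ (fun z => locw F w (z + w)%C) R <= J).
        { eapply Rle_trans; [apply (SQ_shift_le (locw F w) w R (R + Cmod w)); try lra; [apply contCR_locw, CF | apply locw_ge_0]|].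
          apply HJ. assert (x := Cmod_ge_0 w). lra. }
        assert (Jt : 0 <= J / th) by (apply Rmult_le_pos; [lra | left; apply Rinv_0_lt_compat; lra]).
        assert (h1 : th / 2 * SQ (fun z => exp (- (1) * Cmod (z - 0) ^ 2)) R <= th / 2 * PI ^ 2) by (apply Rmult_le_compat_l; lra).
        assert (i0 : 0 < / (2 * th)) by (apply Rinv_0_lt_compat; lra).
        assert (h2 : / (2 * th) * SQ (fun z => locw F w (z + w)%C) R <= / (2 * th) * J) by (apply Rmult_le_compat_l; lra).
        replace (/ (2 * th) * J) with (J / th / 2) in h2 by (field; lra). nra.
      + apply contCR_shift, contCR_locw, CF.
      + apply contCR_exp.
      + apply contCR_mult; [apply contCR_const | apply contCR_exp].
      + apply contCR_mult; [apply contCR_const | apply contCR_shift, contCR_locw, CF]. }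
  assert (B : forall th, 0 < th -> forall x, Cmod x <= 1 -> Cmod (G x) <= A * (th + J / th) /\ Cmod (p x) <= A * (th + J / th) /\ Cmod (q x) <= A * (th + J / th)).
  { intros th Hth x Hx. assert (X := LE G p q PG Pp Pq W x _ 0 Hx (HQ th Hth)). unfold A. rewrite !Rmult_assoc. exact X. }
  assert (S1 : forall z, wtC G z <= Cmod (G z) ^ 2).
  { intros z. unfold wtC. rewrite <- (Rmult_1_r (Cmod (G z) ^ 2)) at 2. apply Rmult_le_compat_l; [apply pow2_ge_0|].
    rewrite <- exp_0. apply exp_le. assert (x := pow2_ge_0 (Cmod z)). nra. }
  assert (EW : wtC F (w + xi)%C = wtC G xi) by (unfold G; rewrite twist_wt; f_equal; ring).
  assert (A2 : 0 < A ^ 2) by (apply pow_lt; lra).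
  split.
  - rewrite EW. eapply Rle_trans; [apply S1|].
    apply Rle_trans with (4 * A ^ 2 * J); [|nra].
    apply sq_bound; auto using Cmod_ge_0. intros th Hth. apply (B th Hth xi Hxi).
  - intros F0. rewrite EW. assert (G0 : G 0%C = 0%C) by exact (twist_0 F w F0).
    destruct (Req_dec (Cmod xi) 0) as [Z|Z].
    + apply Cmod_eq_0 in Z. rewrite Z. unfold wtC. rewrite G0, Cmod_0. lra.
    + assert (x0 := Cmod_ge_0 xi). eapply Rle_trans; [apply S1|].
      assert (Q : Cmod (G xi) ^ 2 <= 4 * (4 * A * Cmod xi) ^ 2 * J).
      { apply sq_bound; auto using Cmod_ge_0; [apply Rmult_lt_0_compat; lra|]. intros th Hth.
        assert (M := mean_value G p q xi (2 * (A * (th + J / th))) W). rewrite G0 in M.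
        replace (G xi - 0)%C with (G xi) in M by ring.
        replace (4 * A * Cmod xi * (th + J / th)) with (2 * (2 * (A * (th + J / th))) * Cmod xi) by ring. apply M.
        intros t Ht. assert (Hx : Cmod (RtoC t * xi) <= 1) by (rewrite Cmod_mult, Cmod_R, Rabs_pos_eq by lra; nra).
        destruct (B th Hth _ Hx) as [_ [b1 b2]]. lra. }
      eapply Rle_trans; [exact Q|]. right. ring.
Qed.

(** * Box sums over the lattice and the upper frame bound *)

Definition BS (h : Z -> Z -> R) (N : nat) : R :=
  Rsum (2 * N + 1) (fun i => Rsum (2 * N + 1) (fun j => h (Z.of_nat i - Z.of_nat N)%Z (Z.of_nat j - Z.of_nat N)%Z)).
Definition lat (w1 w2 : C) (k l : Z) : C := (RtoC (IZR k) * w1 + RtoC (IZR l) * w2)%C.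

Lemma BS_le h h' N : (forall k l, h k l <= h' k l) -> BS h N <= BS h' N.
Proof. intros H. apply Rsum_le. intros i _. apply Rsum_le. intros j _. apply H. Qed.
Lemma BS_scal c h N : BS (fun k l => c * h k l) N = c * BS h N.
Proof.
  unfold BS. rewrite <- Rsum_scal. apply Rsum_ext. intros i _. apply Rsum_scal.
Qed.
Lemma BS_plus h h' N : BS (fun k l => h k l + h' k l) N = BS h N + BS h' N.
Proof. unfold BS. rewrite <- Rsum_plus. apply Rsum_ext. intros i _. apply Rsum_plus. Qed.
Lemma BS_ext h h' N : (forall k l, h k l = h' k l) -> BS h N = BS h' N.
Proof. intros H. apply Rsum_ext. intros i _. apply Rsum_ext. intros j _. apply H. Qed.
Lemma BS_ge_0 h N : (forall k l, 0 <= h k l) -> 0 <= BS h N.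
Proof. intros H. apply Rsum_ge_0. intros i _. apply Rsum_ge_0. intros j _. apply H. Qed.

(** Each term is dominated by an increment of 4 / sqrt e times the arctangent, so the sum telescopes
    to a bound uniform in y and in the number of terms. *)
Lemma gauss_sum e y m : 0 < e -> e <= 1 -> Rsum m (fun i => exp (- (e * (INR i - y) ^ 2))) <= 4 * PI / sqrt e.
Proof.
  intros He L. set (q := sqrt e). assert (Hq : 0 < q) by (apply sqrt_lt_R0, He).
  assert (Eq : q * q = e) by (apply sqrt_sqrt; lra).
  assert (T : forall t, exp (- (e * t ^ 2)) <= 4 / q * (atan (q * (t + 1)) - atan (q * t))).
  { intros t. eapply Rle_trans; [apply exp_neg_le, Rmult_le_pos; [lra | apply pow2_ge_0]|].
    destruct (MVT_gen (fun s => atan s) (q * t) (q * (t + 1)) (fun s => / (1 + s ^ 2))) as [c [Hc E]].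
    - intros x _. auto_derive; [trivial|]. field. assert (X := pow2_ge_0 x). simpl in X |- *. lra.
    - intros x _. apply continuity_pt_filterlim. apply (ex_derive_continuous (K:=R_AbsRing) (V:=R_NormedModule)). auto_derive; trivial.
    - cbv beta in E. rewrite E. replace (q * (t + 1) - q * t) with q by ring.
      rewrite Rmin_left, Rmax_right in Hc by nra.
      assert (c2 := pow2_ge_0 c). assert (t2 := pow2_ge_0 t).
      replace (4 / q * (/ (1 + c ^ 2) * q)) with (4 / (1 + c ^ 2)) by (field; lra).
      assert (c2b : c ^ 2 <= 2 * e * t ^ 2 + 2).
      { assert (X : Rabs c <= q * Rabs t + q).
        { assert (A := Rle_abs t). assert (A' := Rle_abs (- t)). rewrite Rabs_Ropp in A'. apply Rabs_le. split; nra. }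
        assert (t0 := Rabs_pos t). assert (c0 := Rabs_pos c). rewrite <- (pow2_abs c), <- (pow2_abs t), <- Eq.
        assert (X2 : Rabs c ^ 2 <= (q * Rabs t + q) ^ 2) by (apply pow_incr; lra).
        assert (X3 : (q * q) * (Rabs t + 1) ^ 2 <= (q * q) * (2 * Rabs t ^ 2 + 2)) by (apply Rmult_le_compat_l; [lra | assert (y2 := pow2_ge_0 (Rabs t - 1)); lra]).
        replace ((q * Rabs t + q) ^ 2) with ((q * q) * (Rabs t + 1) ^ 2) in X2 by ring. lra. }
      assert (et : 0 <= e * t ^ 2) by (apply Rmult_le_pos; lra).
      apply Rle_div_r; [lra|]. apply Rmult_le_reg_l with (1 + e * t ^ 2); [lra|].
      rewrite <- Rmult_assoc, Rinv_r by lra. lra. }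
  assert (S : Rsum m (fun i => exp (- (e * (INR i - y) ^ 2))) <= 4 / q * (atan (q * (INR m - y)) - atan (q * (0 - y)))).
  { induction m; [simpl; lra|]. cbn [Rsum]. rewrite S_INR.
    specialize (T (INR m - y)). replace (INR m - y + 1) with (INR m + 1 - y) in T by ring. lra. }
  eapply Rle_trans; [exact S|]. assert (B1 := atan_bound (q * (INR m - y))). assert (B2 := atan_bound (q * (0 - y))).
  replace (4 * PI / q) with (4 / q * PI) by (field; lra). apply Rmult_le_compat_l; [left; apply Rdiv_lt_0_compat; lra | lra].
Qed.

Lemma lattice_coords (w1 w2 w : C) : snd (Cconj w1 * w2)%C <> 0 -> exists s t : R, w = (RtoC s * w1 + RtoC t * w2)%C.
Proof.
  intros det. set (D := snd (Cconj w1 * w2)%C) in *.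
  exists (- snd (Cconj w2 * w)%C / D), (snd (Cconj w1 * w)%C / D).
  unfold D in *. apply C_ext; simpl in *; field; lra.
Qed.

Lemma lattice_gauss (w1 w2 : C) : snd (Cconj w1 * w2)%C <> 0 -> exists Cg, 0 < Cg /\
  forall e, 0 < e -> e <= 1 -> forall w N, BS (fun k l => exp (- e * Cmod (lat w1 w2 k l - w) ^ 2)) N <= Cg / e.
Proof.
  intros det. destruct (lattice_lower w1 w2 det) as [k0 [Hk0 L0]].
  (* The minimum with 1 keeps e' = e k^2 at most 1, as [gauss_sum] requires. *)
  set (k := Rmin k0 1). assert (Hk : 0 < k) by (apply Rmin_pos; lra). assert (k1 : k <= 1) by apply Rmin_r.
  assert (L : forall s t : R, k * (Rabs s + Rabs t) <= Cmod (RtoC s * w1 + RtoC t * w2)%C).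
  { intros s t. eapply Rle_trans; [|apply L0]. apply Rmult_le_compat_r; [|apply Rmin_l].
    assert (x := Rabs_pos s). assert (y := Rabs_pos t). lra. }
  assert (P := PI_RGT_0). assert (PP : 0 < 16 * PI ^ 2) by (assert (0 < PI ^ 2) by (apply pow_lt; lra); lra).
  assert (k2 : 0 < k ^ 2) by (apply pow_lt; lra).
  exists (16 * PI ^ 2 / k ^ 2). split; [apply Rdiv_lt_0_compat; lra|]. intros e He e1 w N.
  destruct (lattice_coords w1 w2 w det) as [s [t Ew]].
  set (e' := e * k ^ 2). assert (He' : 0 < e') by (apply Rmult_lt_0_compat; lra). assert (e1' : e' <= 1) by (unfold e'; nra).
  apply Rle_trans with (BS (fun a b => exp (- (e' * (IZR a - s) ^ 2)) * exp (- (e' * (IZR b - t) ^ 2))) N).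
  - apply BS_le. intros a b. rewrite <- exp_plus. apply exp_le.
    assert (E : (lat w1 w2 a b - w = RtoC (IZR a - s) * w1 + RtoC (IZR b - t) * w2)%C).
    { rewrite Ew. unfold lat. rewrite !RtoC_minus. ring. }
    rewrite E. specialize (L (IZR a - s) (IZR b - t)). set (z := (RtoC (IZR a - s) * w1 + RtoC (IZR b - t) * w2)%C) in *.
    assert (x := Rabs_pos (IZR a - s)). assert (y := Rabs_pos (IZR b - t)).
    assert (Q : k ^ 2 * ((IZR a - s) ^ 2 + (IZR b - t) ^ 2) <= Cmod z ^ 2).
    { rewrite <- (pow2_abs (IZR a - s)), <- (pow2_abs (IZR b - t)).
      assert (X : (k * (Rabs (IZR a - s) + Rabs (IZR b - t))) ^ 2 <= Cmod z ^ 2) by (apply pow_incr; split; [apply Rmult_le_pos; lra | exact L]).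
      eapply Rle_trans; [|exact X]. rewrite Rpow_mult_distr. apply Rmult_le_compat_l; [lra|]. nra. }
    unfold e'. nra.
  - assert (G : forall y, Rsum (2 * N + 1) (fun i => exp (- (e' * (IZR (Z.of_nat i - Z.of_nat N) - y) ^ 2))) <= 4 * PI / sqrt e').
    { intros y. rewrite (Rsum_ext _ _ (fun i => exp (- (e' * (INR i - (INR N + y)) ^ 2)))).
      - apply gauss_sum; assumption.
      - intros i _. rewrite minus_IZR, <- !INR_IZR_INZ. f_equal. f_equal. ring. }
    unfold BS. set (B := 4 * PI / sqrt e') in *.
    assert (B0 : 0 <= B) by (left; apply Rdiv_lt_0_compat; [lra | apply sqrt_lt_R0, He']).
    apply Rle_trans with (Rsum (2 * N + 1) (fun i => B * exp (- (e' * (IZR (Z.of_nat i - Z.of_nat N) - s) ^ 2)))).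
    + apply Rsum_le. intros i _. rewrite Rsum_scal, Rmult_comm. apply Rmult_le_compat_r; [left; apply exp_pos | apply G].
    + rewrite Rsum_scal. apply Rle_trans with (B * B); [apply Rmult_le_compat_l; [exact B0 | apply G]|].
      right. unfold B. assert (sq : 0 < sqrt e') by (apply sqrt_lt_R0, He').
      replace (16 * PI ^ 2 / k ^ 2 / e) with (16 * PI ^ 2 / e') by (unfold e'; field; lra).
      rewrite <- (sqrt_sqrt e') at 3 by lra. field. lra.
Qed.

(** The mass of [locw] over the whole plane. [Lim_seq] may be infinite, where [real] gives a default
    value; [Jw_lim] excludes this for finite norm. *)
Definition Jw (F : C -> C) (w : C) : R := real (Lim_seq (fun M => SQ (locw F w) (INR M))).

Section Jw.
Variables (F : C -> C) (v : R).
Hypotheses (CF : contC F) (Hv : forall r, 0 <= r -> SQ (wtC F) r <= v).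

Lemma SQ_locw_le w r : 0 <= r -> SQ (locw F w) r <= v.
Proof.
  intros Hr. eapply Rle_trans; [|apply (Hv r Hr)]. apply SQ_le; auto using contCR_locw, contCR_wt.
  intros z. unfold locw. rewrite <- (Rmult_1_r (wtC F z)) at 2. apply Rmult_le_compat_l; [apply wtC_ge_0|].
  apply Rle_trans with (exp 0); [apply exp_le; assert (x := pow2_ge_0 (Cmod (z - w))); lra | rewrite exp_0; lra].
Qed.
Lemma Jw_lim w : is_lim_seq (fun M => SQ (locw F w) (INR M)) (Jw F w).
Proof.
  apply Lim_seq_correct', (ex_finite_lim_seq_incr _ v).
  - intros M. apply SQ_mono; auto using contCR_locw, locw_ge_0, pos_INR. rewrite S_INR. lra.
  - intros M. apply SQ_locw_le, pos_INR.
Qed.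
Lemma Jw_ge w r : 0 <= r -> SQ (locw F w) r <= Jw F w.
Proof.
  intros Hr. destruct (nfloor_ex r Hr) as [m [_ Hm]].
  apply Rle_trans with (SQ (locw F w) (INR (S m))).
  - apply SQ_mono; auto using contCR_locw, locw_ge_0. rewrite S_INR. lra.
  - apply (is_lim_seq_incr_compare (fun M => SQ (locw F w) (INR M)) (Jw F w) (Jw_lim w)).
    intros M. apply SQ_mono; auto using contCR_locw, locw_ge_0, pos_INR. rewrite S_INR. lra.
Qed.
Lemma is_lim_Rsum m (u : nat -> nat -> R) (l : nat -> R) :
  (forall i, is_lim_seq (u i) (l i)) -> is_lim_seq (fun M => Rsum m (fun i => u i M)) (Rsum m l).
Proof.
  intros H. induction m; simpl; [apply is_lim_seq_const|]. apply is_lim_seq_plus'; auto.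
Qed.
(** Exchanging sum and integral, the local masses count each point of the plane with the sum of the
    Gaussians there, which is at most B. *)
Lemma Jw_sum (w : Z -> Z -> C) N B : (forall u, BS (fun k l => exp (- (1) * Cmod (u - w k l)%C ^ 2)) N <= B) ->
  BS (fun k l => Jw F (w k l)) N <= B * v.
Proof.
  intros HB.
  assert (L : is_lim_seq (fun M => BS (fun k l => SQ (locw F (w k l)) (INR M)) N) (BS (fun k l => Jw F (w k l)) N)).
  { apply (is_lim_Rsum _ (fun i M => Rsum (2 * N + 1) (fun j => SQ (locw F (w (Z.of_nat i - Z.of_nat N)%Z (Z.of_nat j - Z.of_nat N)%Z)) (INR M)))).
    intros i. apply (is_lim_Rsum _ (fun j M => SQ (locw F (w (Z.of_nat i - Z.of_nat N)%Z (Z.of_nat j - Z.of_nat N)%Z)) (INR M))).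
    intros j. apply Jw_lim. }
  apply (is_lim_seq_le _ (fun _ => B * v) (BS (fun k l => Jw F (w k l)) N) (B * v)) in L; [exact L | | apply is_lim_seq_const].
  intros M. assert (M0 := pos_INR M).
  assert (B0 : 0 <= B) by (eapply Rle_trans; [|apply (HB 0%C)]; apply BS_ge_0; intros; left; apply exp_pos).
  apply Rle_trans with (B * SQ (wtC F) (INR M)); [|apply Rmult_le_compat_l; auto].
  assert (Cl : forall k l, contCR (locw F (w k l))) by (intros; apply contCR_locw, CF).
  apply Rle_trans with (SQ (fun u => wtC F u * BS (fun k l => exp (- (1) * Cmod (u - w k l)%C ^ 2)) N) (INR M)).
  - right. symmetry. unfold BS.
    rewrite (SQ_ext _ (fun u => Rsum (2 * N + 1) (fun i => Rsum (2 * N + 1) (fun j => locw F (w (Z.of_nat i - Z.of_nat N)%Z (Z.of_nat j - Z.of_nat N)%Z) u)))).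
    + rewrite SQ_Rsum by (intros; apply contCR_Rsum; auto). apply Rsum_ext. intros i _. apply SQ_Rsum. auto.
    + intros z. rewrite <- Rsum_scal. apply Rsum_ext. intros i _. rewrite <- Rsum_scal. reflexivity.
  - rewrite <- SQ_scal by (apply contCR_wt, CF). apply SQ_le; auto.
    + apply contCR_mult; [apply contCR_wt, CF|]. unfold BS.
      apply (contCR_Rsum _ (fun i z => Rsum (2 * N + 1) (fun j => exp (- (1) * Cmod (z - w (Z.of_nat i - Z.of_nat N)%Z (Z.of_nat j - Z.of_nat N)%Z)%C ^ 2)))).
      intros i _. apply (contCR_Rsum _ (fun j z => exp (- (1) * Cmod (z - w (Z.of_nat i - Z.of_nat N)%Z (Z.of_nat j - Z.of_nat N)%Z)%C ^ 2))).
      intros; apply contCR_exp.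
    + apply contCR_mult; [apply contCR_const | apply contCR_wt, CF].
    + intros z. rewrite Rmult_comm. apply Rmult_le_compat_r; [apply wtC_ge_0 | apply HB].
Qed.
End Jw.

Theorem bessel n (w1 w2 : C) : snd (Cconj w1 * w2)%C <> 0 -> exists B, 0 < B /\ forall F v, PA n F ->
  (forall r, 0 <= r -> SQ (wtC F) r <= v) -> forall N, BS (fun k l => wtC F (lat w1 w2 k l)) N <= B * v.
Proof.
  intros det. destruct (local_weight n) as [C1 [HC1 LW]]. destruct (lattice_gauss w1 w2 det) as [Cg [HCg G]].
  exists (C1 * Cg). split; [apply Rmult_lt_0_compat; assumption|]. intros F v PF Hv N.
  assert (CF := PA_cont n F PF).
  apply Rle_trans with (BS (fun k l => C1 * Jw F (lat w1 w2 k l)) N).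
  - apply BS_le. intros k l. destruct (LW F PF (lat w1 w2 k l) (Jw F (lat w1 w2 k l)) (Jw_ge F v CF Hv _) 0%C) as [X _].
    + rewrite Cmod_0. lra.
    + rewrite Cplus_0_r in X. exact X.
  - rewrite BS_scal, Rmult_assoc. apply Rmult_le_compat_l; [lra|].
    apply (Jw_sum F v CF Hv). intros u. rewrite <- (Rdiv_1_r Cg).
    eapply Rle_trans; [|apply (G 1 Rlt_0_1 (Rle_refl 1) u N)]. apply BS_le. intros k l. rewrite Cmod_minus_sym. lra.
Qed.

(** * Theta series *)

(** k is paired with -k-1 rather than -k, so that every integer occurs exactly once. *)
Definition zt (a : Z -> C) (k : nat) : C := (a (Z.of_nat k) + a (- Z.of_nat k - 1)%Z)%C.
Definition ZS (a : Z -> C) : C := CSer (zt a).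
Definition zdom (a : Z -> C) (M : R) : Prop := forall x, Cmod (a x) <= M * (/2) ^ (Z.abs_nat x).

Lemma zdom_zt a M k : zdom a M -> Cmod (zt a k) <= 2 * M * (/2) ^ k.
Proof.
  intros H. unfold zt. eapply Rle_trans; [apply Cmod_triangle|].
  assert (A := H (Z.of_nat k)). assert (B := H (- Z.of_nat k - 1)%Z).
  rewrite Zabs2Nat.id in A. replace (Z.abs_nat (- Z.of_nat k - 1)) with (S k) in B by lia.
  simpl in B. assert (M0 : 0 <= M * (/2) ^ k) by (eapply Rle_trans; [apply Cmod_ge_0 | exact A]). lra.
Qed.
Lemma ZS_ext a b : (forall x, a x = b x) -> ZS a = ZS b.
Proof. intros E. apply CSer_ext. intros; unfold zt; rewrite !E; reflexivity. Qed.
Lemma ZS_plus a b M M' : zdom a M -> zdom b M' -> ZS (fun x => a x + b x)%C = (ZS a + ZS b)%C.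
Proof.
  intros Ha Hb. unfold ZS. rewrite <- (CSer_plus _ _ (fun k => 2 * M * (/2) ^ k) (fun k => 2 * M' * (/2) ^ k));
    auto using zdom_zt, ex_series_half.
  apply CSer_ext. intros; unfold zt; ring.
Qed.
Lemma ZS_scal c a M : zdom a M -> ZS (fun x => c * a x)%C = (c * ZS a)%C.
Proof.
  intros Ha. unfold ZS. rewrite <- (CSer_scal _ _ (fun k => 2 * M * (/2) ^ k)); auto using zdom_zt, ex_series_half.
  apply CSer_ext. intros; unfold zt; ring.
Qed.
Lemma ZS_lim a M : zdom a M -> forall eps, 0 < eps -> exists N0, forall N, (N0 <= N)%nat -> Cmod (ZS a - Csum N (zt a))%C < eps.
Proof. intros H. apply (CSer_lim _ (fun k => 2 * M * (/2) ^ k)); auto using zdom_zt, ex_series_half. Qed.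
Lemma ZS_bound a M B : zdom a M -> (forall N, Cmod (Csum N (zt a)) <= B) -> Cmod (ZS a) <= B.
Proof.
  intros H HB. apply Rnot_lt_le. intros L. destruct (ZS_lim a M H (Cmod (ZS a) - B)) as [N HN]; [lra|].
  specialize (HN N (le_n N)). specialize (HB N). assert (T := Cmod_triangle_rev (ZS a) (Csum N (zt a))). lra.
Qed.
Lemma zdom_shift a M : zdom a M -> zdom (fun x => a (x + 1)%Z) (2 * M).
Proof.
  intros H x. eapply Rle_trans; [apply H|].
  assert (M0 : 0 <= M) by (assert (A := H 0%Z); simpl in A; assert (B := Cmod_ge_0 (a 0%Z)); lra).
  destruct (Z_lt_le_dec x 0) as [L|L].
  - replace (Z.abs_nat x) with (S (Z.abs_nat (x + 1))) by lia. simpl. lra.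
  - replace (Z.abs_nat (x + 1)) with (S (Z.abs_nat x)) by lia. simpl.
    assert (0 <= (/2) ^ Z.abs_nat x) by (apply pow_le; lra). nra.
Qed.
(** Partial sums of the shifted family differ by the two boundary terms at N and -N, which tend to
    0. *)
Lemma ZS_shift1 a M : zdom a M -> ZS (fun x => a (x + 1)%Z) = ZS a.
Proof.
  intros H. assert (H' := zdom_shift a M H).
  assert (M0 : 0 <= M) by (assert (A := H 0%Z); simpl in A; assert (B := Cmod_ge_0 (a 0%Z)); lra).
  assert (E : forall N, Csum N (zt (fun x => a (x + 1)%Z)) = (Csum N (zt a) + a (Z.of_nat N) - a (- Z.of_nat N)%Z)%C).
  { induction N; simpl Csum; [replace (- Z.of_nat 0)%Z with 0%Z by lia; simpl; ring|]. rewrite IHN. unfold zt.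
    replace (- Z.of_nat N - 1 + 1)%Z with (- Z.of_nat N)%Z by lia.
    replace (Z.of_nat N + 1)%Z with (Z.of_nat (S N)) by lia. replace (- Z.of_nat (S N))%Z with (- Z.of_nat N - 1)%Z by lia. ring. }
  assert (D : forall eps, 0 < eps -> Cmod (ZS (fun x => a (x + 1)%Z) - ZS a)%C <= eps).
  { intros eps He. destruct (ZS_lim _ _ H (eps / 4)) as [N1 h1]; [lra|]. destruct (ZS_lim _ _ H' (eps / 4)) as [N2 h2]; [lra|].
    destruct (pow_lt_1_zero (/2) ltac:(rewrite Rabs_pos_eq; lra) (eps / (4 * (M + 1))) ltac:(apply Rdiv_lt_0_compat; lra)) as [N3 h3].
    set (N := Nat.max N1 (Nat.max N2 N3)). specialize (h1 N ltac:(unfold N; lia)). specialize (h2 N ltac:(unfold N; lia)).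
    specialize (h3 N ltac:(unfold N; lia)). rewrite Rabs_pos_eq in h3 by (apply pow_le; lra). rewrite E in h2.
    assert (b1 := H (Z.of_nat N)). assert (b2 := H (- Z.of_nat N)%Z). rewrite Zabs2Nat.id in b1.
    replace (Z.abs_nat (- Z.of_nat N)) with N in b2 by lia.
    apply Rlt_div_r in h3; [|lra].
    assert (p0 : 0 <= (/2) ^ N) by (apply pow_le; lra). assert (M * (/2) ^ N <= eps / 4) by nra.
    replace (ZS (fun x => a (x + 1)%Z) - ZS a)%C with
      ((ZS (fun x => a (x + 1)%Z) - (Csum N (zt a) + a (Z.of_nat N) - a (- Z.of_nat N)%Z)) - (ZS a - Csum N (zt a)) + (a (Z.of_nat N) - a (- Z.of_nat N)%Z))%C by ring.
    eapply Rle_trans; [apply Cmod_triangle|].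
    assert (t1 := Cmod_triangle' (ZS (fun x => a (x + 1)%Z) - (Csum N (zt a) + a (Z.of_nat N) - a (- Z.of_nat N)%Z)) (ZS a - Csum N (zt a))).
    assert (t2 := Cmod_triangle' (a (Z.of_nat N)) (a (- Z.of_nat N)%Z)). lra. }
  destruct (Req_dec (Cmod (ZS (fun x => a (x + 1)%Z) - ZS a)%C) 0) as [Z0|Z0].
  - apply Cmod_eq_0 in Z0. replace (ZS (fun x => a (x + 1)%Z)) with (ZS (fun x => a (x + 1)%Z) - ZS a + ZS a)%C by ring. rewrite Z0. ring.
  - assert (P := Cmod_ge_0 (ZS (fun x => a (x + 1)%Z) - ZS a)%C). specialize (D (Cmod (ZS (fun x => a (x + 1)%Z) - ZS a)%C / 2)). lra.
Qed.
Lemma ZS_shift_nat a M k : zdom a M -> ZS (fun x => a (x + Z.of_nat k)%Z) = ZS a.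
Proof.
  revert a M. induction k; intros a M H.
  - apply ZS_ext. intros; f_equal; lia.
  - rewrite <- (ZS_shift1 a M H). rewrite <- (IHk _ _ (zdom_shift a M H)). apply ZS_ext. intros; f_equal; lia.
Qed.
Lemma zdom_shift_neg a M : zdom a M -> zdom (fun x => a (x - 1)%Z) (2 * M).
Proof.
  intros H x. eapply Rle_trans; [apply H|].
  assert (M0 : 0 <= M) by (assert (A := H 0%Z); simpl in A; assert (B := Cmod_ge_0 (a 0%Z)); lra).
  destruct (Z_lt_le_dec 0 x) as [L|L].
  - replace (Z.abs_nat x) with (S (Z.abs_nat (x - 1))) by lia. simpl. lra.
  - replace (Z.abs_nat (x - 1)) with (S (Z.abs_nat x)) by lia. simpl.
    assert (0 <= (/2) ^ Z.abs_nat x) by (apply pow_le; lra). nra.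
Qed.
Lemma ZS_shift a M b : zdom a M -> ZS (fun x => a (x + b)%Z) = ZS a.
Proof.
  intros H. destruct (Z_le_gt_dec 0 b).
  - rewrite <- (ZS_shift_nat a M (Z.to_nat b) H). apply ZS_ext. intros; f_equal; lia.
  - assert (K : forall k, exists M', zdom (fun x => a (x - Z.of_nat k)%Z) M').
    { induction k; [exists M; intros x; replace (x - Z.of_nat 0)%Z with x by lia; apply H|].
      destruct IHk as [M' H']. exists (2 * M'). intros x. assert (X := zdom_shift_neg _ _ H' x). cbv beta in X.
      replace (x - Z.of_nat (S k))%Z with (x - 1 - Z.of_nat k)%Z by lia. exact X. }
    destruct (K (Z.to_nat (- b))) as [M' H'].
    rewrite <- (ZS_ext (fun x => (fun x => a (x - Z.of_nat (Z.to_nat (- b)))%Z) (x + Z.of_nat (Z.to_nat (-b)))%Z) a) by (intros; f_equal; lia).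
    rewrite (ZS_shift_nat _ M' _ H'). apply ZS_ext. intros; f_equal; lia.
Qed.

(** Integrating a partial sum against [chi (- x0)] returns [a x0] once the range contains x0, while
    the partial sum is uniformly small, being minus a tail. *)
Lemma ZS_fourier a M : zdom a M -> (forall s, ZS (fun x => a x * chi x s)%C = 0%C) -> forall x0, a x0 = 0%C.
Proof.
  intros H Hz x0. assert (M0 : 0 <= M) by (assert (A := H 0%Z); simpl in A; assert (B := Cmod_ge_0 (a 0%Z)); lra).
  assert (Hs : forall s, zdom (fun x => a x * chi x s)%C M) by (intros s x; rewrite Cmod_mult, Cmod_chi, Rmult_1_r; apply H).
  set (P := fun N s => (Csum N (zt (fun x => a x * chi x s)%C) * chi (- x0) s)%C).
  assert (Ct : forall k, contRC (fun s => zt (fun x => a x * chi x s)%C k * chi (- x0) s)%C).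
  { intros k. apply contRC_mult; [|apply contRC_chi]. apply contRC_plus; (apply contRC_mult; [apply contRC_const | apply contRC_chi]). }
  assert (Cx : forall x, contRC (fun s => a x * chi x s * chi (- x0) s)%C).
  { intros x. apply contRC_mult; [apply contRC_mult; [apply contRC_const | apply contRC_chi] | apply contRC_chi]. }
  assert (CP : forall N, contRC (P N)).
  { induction N.
    - apply (contRC_ext (fun _ => RtoC 0)); [intros; unfold P; simpl; ring | apply contRC_const].
    - apply (contRC_ext (fun s => P N s + zt (fun x => a x * chi x s)%C N * chi (- x0) s)%C); [intros; unfold P; simpl; ring|].
      apply contRC_plus; auto. }
  assert (Ek : forall x, CI (fun s => a x * chi x s * chi (- x0) s)%C 0 1 = if Z.eq_dec x x0 then a x else RtoC 0).
  { intros x. rewrite (CI_ext _ (fun s => a x * chi (x - x0) s)%C) by (intros; unfold Z.sub; rewrite chi_plus; ring).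
    rewrite CI_scal by apply contRC_chi. destruct (Z.eq_dec x x0) as [->|N].
    - rewrite Z.sub_diag. rewrite (CI_ext _ (fun _ => 1%C)) by (intros; apply chi_0). rewrite CI_const. csolve.
    - rewrite <- (Rplus_0_l 1). rewrite CI_chi by lia. ring. }
  assert (EN : forall N, CI (P N) 0 1 = Csum N (zt (fun x => if Z.eq_dec x x0 then a x else RtoC 0))).
  { induction N.
    - simpl. rewrite (CI_ext _ (fun _ => RtoC 0)) by (intros; unfold P; simpl; ring). rewrite CI_const. ring.
    - cbn [Csum]. rewrite <- IHN. unfold zt. rewrite <- !Ek.
      rewrite <- (CI_plus _ _ 0 1 (Cx _) (Cx _)), <- (CI_plus (P N) _ 0 1 (CP N) (contRC_plus _ _ (Cx _) (Cx _))).
      apply CI_ext. intros; unfold P; cbn [Csum]. unfold zt at 2. ring. }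
  assert (ES : forall N, (Z.abs_nat x0 < N)%nat -> Csum N (zt (fun x => if Z.eq_dec x x0 then a x else RtoC 0)) = a x0).
  { intros N HN. destruct (Z_lt_le_dec x0 0) as [Lx|Lx].
    - induction N; [lia|]. simpl Csum. destruct (Z.eq_dec (- Z.of_nat N - 1) x0) as [E|E].
      + rewrite (Csum_ext N _ (fun _ => RtoC 0)), Csum_0.
        * unfold zt. destruct (Z.eq_dec (Z.of_nat N) x0); [lia|]. destruct (Z.eq_dec (- Z.of_nat N - 1) x0); [rewrite e; ring | lia].
        * intros k Hk. unfold zt. destruct (Z.eq_dec (Z.of_nat k) x0); [lia|]. destruct (Z.eq_dec (- Z.of_nat k - 1) x0); [lia | ring].
      + destruct (Nat.eq_dec (Z.abs_nat x0) N) as [E'|E'].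
        * unfold zt at 2. destruct (Z.eq_dec (Z.of_nat N) x0); [lia|]. destruct (Z.eq_dec (- Z.of_nat N - 1) x0); [lia|].
          destruct N as [|N']; [lia|]. simpl Csum.
          rewrite (Csum_ext N' _ (fun _ => RtoC 0)), Csum_0.
          -- unfold zt. destruct (Z.eq_dec (Z.of_nat N') x0); [lia|]. destruct (Z.eq_dec (- Z.of_nat N' - 1) x0); [rewrite e; ring | lia].
          -- intros k Hk. unfold zt. destruct (Z.eq_dec (Z.of_nat k) x0); [lia|]. destruct (Z.eq_dec (- Z.of_nat k - 1) x0); [lia | ring].
        * rewrite IHN by lia. unfold zt. destruct (Z.eq_dec (Z.of_nat N) x0); [lia|]. destruct (Z.eq_dec (- Z.of_nat N - 1) x0); [lia | ring].
    - induction N; [lia|]. simpl Csum. destruct (Z.eq_dec (Z.of_nat N) x0) as [E|E].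
      + rewrite (Csum_ext N _ (fun _ => RtoC 0)), Csum_0.
        * unfold zt. destruct (Z.eq_dec (Z.of_nat N) x0); [|lia]. destruct (Z.eq_dec (- Z.of_nat N - 1) x0); [lia | rewrite e; ring].
        * intros k Hk. unfold zt. destruct (Z.eq_dec (Z.of_nat k) x0); [lia|]. destruct (Z.eq_dec (- Z.of_nat k - 1) x0); [lia | ring].
      + rewrite IHN by lia. unfold zt. destruct (Z.eq_dec (Z.of_nat N) x0); [lia|]. destruct (Z.eq_dec (- Z.of_nat N - 1) x0); [lia | ring]. }
  apply Cmod_eq_0. apply Rle_antisym; [|apply Cmod_ge_0]. apply Rnot_lt_le. intros Hpos.
  set (b := fun k => 2 * M * (/2) ^ k).
  assert (b0 : forall k, 0 <= b k) by (intros; apply Rmult_le_pos; [lra | apply pow_le; lra]).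
  destruct (Series_tail_lim b (ex_series_half (2 * M)) b0 (Cmod (a x0) / 4)) as [N0 HN0]; [lra|].
  set (N := Nat.max N0 (S (Z.abs_nat x0))). specialize (HN0 N ltac:(unfold N; lia)).
  assert (BN : Cmod (CI (P N) 0 1) <= 2 * (Cmod (a x0) / 4) * (1 - 0)).
  { apply CI_bound; [lra | apply CP|]. intros s _. unfold P. rewrite Cmod_mult, Cmod_chi, Rmult_1_r.
    assert (T := CSer_tail (zt (fun x => a x * chi x s)%C) b N (fun k => zdom_zt _ M k (Hs s)) (ex_series_half (2 * M))).
    specialize (Hz s). unfold ZS in Hz. rewrite Hz in T. rewrite Cmod_minus_sym in T.
    replace (Csum N (zt (fun x => a x * chi x s)%C) - 0)%C with (Csum N (zt (fun x => a x * chi x s)%C)) in T by ring. lra. }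
  rewrite EN, ES in BN by (unfold N; lia). lra.
Qed.

Lemma cexp_rem1 w : Cmod (cexp w - 1)%C <= 2 * exp (Cmod w) * Cmod w.
Proof.
  assert (M := mean_value cexp cexp (fun _ => RtoC 0) w (exp (Cmod w)) WD_cexp). rewrite cexp_0 in M. apply M.
  intros t Ht. rewrite Cmod_0, Rplus_0_r, Cmod_cexp. apply exp_le. eapply Rle_trans; [apply Rle_abs|].
  eapply Rle_trans; [apply fst_le_Cmod|]. rewrite Cmod_mult, Cmod_R, Rabs_pos_eq by lra. assert (x := Cmod_ge_0 w). nra.
Qed.
Lemma cexp_rem2 w : Cmod (cexp w - 1 - w)%C <= 4 * exp (Cmod w) * Cmod w ^ 2.
Proof.
  assert (M := mean_value (fun w => cexp w - 1 - w)%C (fun w => cexp w - 1)%C (fun _ => RtoC 0) w (2 * exp (Cmod w) * Cmod w)).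
  replace (cexp w - 1 - w)%C with (cexp w - 1 - w - (cexp 0 - 1 - 0))%C by (rewrite cexp_0; ring).
  replace (4 * exp (Cmod w) * Cmod w ^ 2) with (2 * (2 * exp (Cmod w) * Cmod w) * Cmod w) by ring. apply M.
  - intros z. eapply WD_ext; [| | | apply (WD_minus _ _ _ _ _ _ _ (WD_minus _ _ _ _ _ _ _ (WD_cexp z) (WD_const 1 z)) (WD_id z))];
    [reflexivity | ring | ring].
  - intros t Ht. rewrite Cmod_0, Rplus_0_r. eapply Rle_trans; [apply cexp_rem1|].
    assert (x := Cmod_ge_0 w). assert (Lt : Cmod (RtoC t * w) <= Cmod w) by (rewrite Cmod_mult, Cmod_R, Rabs_pos_eq by lra; nra).
    assert (Le := exp_le _ _ Lt). assert (P := exp_pos (Cmod (RtoC t * w))). assert (y := Cmod_ge_0 (RtoC t * w)).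
    apply Rmult_le_compat; lra.
Qed.

Section Theta.
Variables (sg : C) (ka : R).
Hypotheses (Hsg : fst sg = - ka) (Hka : 0 < ka).

Definition et (x : Z) (u : C) : C := cexp (sg * RtoC (IZR x ^ 2) + RtoC (2 * PI * IZR x) * (Ci * u))%C.

Lemma Cmod_et x u : Cmod (et x u) = exp (- (ka * IZR x ^ 2) - 2 * PI * IZR x * snd u).
Proof. unfold et. rewrite Cmod_cexp. f_equal. simpl fst. rewrite Hsg. simpl. ring. Qed.

(** The polynomial covers powers of x, and exp(2 pi |x|) covers moving u within a unit disk. The
    Gaussian in x beats them all after completing the square; [b] collects the linear exponents, its
    summand 1 paying for the geometric majorant. *)
Lemma et_dom p (u : C) : exists M, 0 <= M /\ forall x,
  (1 + Rabs (IZR x)) ^ p * exp (2 * PI * Rabs (IZR x)) * Cmod (et x u) <= M * (/2) ^ Z.abs_nat x.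
Proof.
  assert (P := PI_RGT_0). set (b := INR p + 2 * PI + 2 * PI * Rabs (snd u) + 1).
  exists (exp (b ^ 2 / ka)). split; [left; apply exp_pos|]. intros x. rewrite Cmod_et.
  set (t := Rabs (IZR x)). assert (t0 : 0 <= t) by apply Rabs_pos.
  assert (E1 : (1 + t) ^ p <= exp (INR p * t)).
  { clear b. induction p as [|p' IH]; [simpl; rewrite Rmult_0_l, exp_0; lra|]. rewrite S_INR, Rmult_plus_distr_r, Rmult_1_l, exp_plus.
    simpl. rewrite Rmult_comm. apply Rmult_le_compat; try lra; [apply pow_le; lra | assert (x1 := exp_ineq1_le t); lra]. }
  assert (E2 : (/2) ^ Z.abs_nat x >= exp (- t)).
  { assert (Et : t = INR (Z.abs_nat x)) by (unfold t; rewrite INR_IZR_INZ, <- abs_IZR, Zabs2Nat.id_abs; reflexivity).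
    rewrite Et. generalize (Z.abs_nat x). induction n as [|k IH]; [simpl; rewrite Ropp_0, exp_0; lra|].
    rewrite S_INR. replace (- (INR k + 1)) with (- INR k + - (1)) by ring. rewrite exp_plus. simpl.
    assert (exp (- (1)) <= / 2) by (assert (y := exp_neg_le 1 ltac:(lra)); lra).
    assert (y := exp_pos (- INR k)). assert (y2 := exp_pos (-(1))). nra. }
  apply Rle_trans with (exp (b ^ 2 / ka) * exp (- t)); [|apply Rmult_le_compat_l; [left; apply exp_pos | lra]].
  apply Rle_trans with (exp (INR p * t) * exp (2 * PI * t) * exp (- (ka * IZR x ^ 2) - 2 * PI * IZR x * snd u)).
  { apply Rmult_le_compat_r; [left; apply exp_pos|]. apply Rmult_le_compat_r; [left; apply exp_pos | exact E1]. }
  rewrite <- !exp_plus. apply exp_le. rewrite <- (pow2_abs (IZR x)). fold t.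
  assert (Q : - (2 * PI * IZR x * snd u) <= 2 * PI * Rabs (snd u) * t).
  { eapply Rle_trans; [apply Rle_abs|]. rewrite Rabs_Ropp, !Rabs_mult, (Rabs_pos_eq 2), (Rabs_pos_eq PI) by lra. unfold t. lra. }
  assert (X : 0 <= (b - ka * t) ^ 2 / ka) by (apply Rmult_le_pos; [apply pow2_ge_0 | left; apply Rinv_0_lt_compat; lra]).
  replace ((b - ka * t) ^ 2 / ka) with (b ^ 2 / ka - 2 * (b * t) + ka * t ^ 2) in X by (field; lra).
  assert (0 <= b ^ 2 / ka) by (apply Rmult_le_pos; [apply pow2_ge_0 | left; apply Rinv_0_lt_compat; lra]).
  assert (bt : b * t = INR p * t + 2 * PI * t + 2 * PI * Rabs (snd u) * t + t) by (unfold b; ring).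
  assert (0 <= ka * t ^ 2) by (apply Rmult_le_pos; [lra | apply pow2_ge_0]). lra.
Qed.

Variable ga : Z -> C.
Variable B : R.
Hypothesis HB : forall x, Cmod (ga x) <= B.

Definition th (p : nat) (x : Z) (u : C) : C := (ga x * RtoC (IZR x ^ p) * et x u)%C.
Definition Theta (p : nat) (u : C) : C := ZS (fun x => th p x u).

Lemma B_ge_0 : 0 <= B.
Proof. eapply Rle_trans; [apply Cmod_ge_0 | apply (HB 0%Z)]. Qed.

Lemma th_mod p x u : Cmod (th p x u) <= B * ((1 + Rabs (IZR x)) ^ p * Cmod (et x u)).
Proof.
  unfold th. rewrite !Cmod_mult, Cmod_R, <- RPow_abs, Rmult_assoc. apply Rmult_le_compat; auto using Cmod_ge_0.
  - apply Rmult_le_pos; [apply pow_le, Rabs_pos | apply Cmod_ge_0].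
  - apply Rmult_le_compat_r; [apply Cmod_ge_0|]. apply pow_incr. assert (t0 := Rabs_pos (IZR x)). lra.
Qed.
Lemma th_zdom p u : exists M, zdom (fun x => th p x u) M.
Proof.
  destruct (et_dom p u) as [M [M0 H]]. exists (B * M). intros x. eapply Rle_trans; [apply th_mod|].
  rewrite Rmult_assoc. apply Rmult_le_compat_l; [apply B_ge_0|]. eapply Rle_trans; [|apply H].
  assert (1 <= exp (2 * PI * Rabs (IZR x))).
  { apply exp_ge_1. assert (P := PI_RGT_0). assert (t0 := Rabs_pos (IZR x)). nra. }
  assert (0 <= (1 + Rabs (IZR x)) ^ p) by (apply pow_le; assert (t0 := Rabs_pos (IZR x)); lra).
  apply Rmult_le_compat_r; [apply Cmod_ge_0|]. nra.
Qed.

Lemma et_add x u h : et x (u + h)%C = (et x u * cexp (RtoC (2 * PI * IZR x) * (Ci * h)))%C.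
Proof. unfold et. rewrite <- cexp_plus. f_equal. ring. Qed.

(** Differentiation in u brings down 2 pi i x, hence raises the power p of x by one. *)
Lemma WD_Theta p u : WD (Theta p) u (2 * PI * Ci * Theta (S p) u)%C 0.
Proof.
  assert (P := PI_RGT_0).
  destruct (et_dom (S (S p)) u) as [M [M0 H]]. assert (B0 := B_ge_0).
  (* A single majorant serves the terms near u, their derivatives and their remainders, whose
     constants 1, 2 pi and 16 pi^2 all lie below 64 pi^2. *)
  set (bb := fun x : Z => B * (64 * PI ^ 2) * (M * (/2) ^ Z.abs_nat x)).
  assert (P1 : 1 <= 64 * PI ^ 2) by (assert (x := PI2_1); nra).
  assert (Hx : forall x, 0 <= (1 + Rabs (IZR x)) ^ p /\ 1 <= 1 + Rabs (IZR x)).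
  { intros x. assert (t0 := Rabs_pos (IZR x)). split; [apply pow_le; lra | lra]. }
  set (tt := fun x => (1 + Rabs (IZR x)) ^ S (S p) * exp (2 * PI * Rabs (IZR x)) * Cmod (et x u)).
  assert (Htt : forall x, (1 + Rabs (IZR x)) ^ p * exp (2 * PI * Rabs (IZR x)) * Cmod (et x u) <= tt x /\
    (1 + Rabs (IZR x)) ^ S p * Cmod (et x u) <= tt x /\
    Rabs (IZR x) ^ 2 * (1 + Rabs (IZR x)) ^ p * exp (2 * PI * Rabs (IZR x)) * Cmod (et x u) <= tt x).
  { intros x. destruct (Hx x) as [h1 h2]. assert (e0 := Cmod_ge_0 (et x u)). unfold tt.
    assert (t0 := Rabs_pos (IZR x)).
    assert (E1 : 1 <= exp (2 * PI * Rabs (IZR x))) by (apply exp_ge_1; nra).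
    set (a := 1 + Rabs (IZR x)) in *. set (ap := a ^ p) in *. set (ee := exp (2 * PI * Rabs (IZR x))) in *.
    change (a ^ S (S p)) with (a * (a * ap)). change (a ^ S p) with (a * ap).
    assert (q1 : 1 <= a * a) by nra. assert (q2 : Rabs (IZR x) ^ 2 <= a * a) by (unfold a; nra).
    assert (q3 : 0 <= ap * ee * Cmod (et x u)) by (repeat apply Rmult_le_pos; lra).
    replace (a * (a * ap) * ee * Cmod (et x u)) with (a * a * (ap * ee * Cmod (et x u))) by ring.
    assert (q4 : 0 <= ap * Cmod (et x u)) by (apply Rmult_le_pos; lra).
    repeat split.
    - nra.
    - replace (a * a * (ap * ee * Cmod (et x u))) with (a * (a * ee) * (ap * Cmod (et x u))) by ring.
      replace (a * ap * Cmod (et x u)) with (a * (ap * Cmod (et x u))) by ring. apply Rmult_le_compat_r; [exact q4|]. nra.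
    - replace (Rabs (IZR x) ^ 2 * ap * ee * Cmod (et x u)) with (Rabs (IZR x) ^ 2 * (ap * ee * Cmod (et x u))) by ring. nra. }
  assert (Hb : forall x c, 0 <= c -> c <= 64 * PI ^ 2 -> B * (c * tt x) <= bb x).
  { intros x c c0 c1. unfold bb. specialize (H x). fold (tt x) in H.
    assert (tt0 : 0 <= tt x). { unfold tt. destruct (Hx x). apply Rmult_le_pos; [|apply Cmod_ge_0]. apply Rmult_le_pos; [apply pow_le; lra | left; apply exp_pos]. }
    rewrite Rmult_assoc. apply Rmult_le_compat_l; [exact B0|]. apply Rmult_le_compat; assumption. }
  assert (Hexp : forall x h, Cmod h <= 1 -> Cmod (RtoC (2 * PI * IZR x) * (Ci * h)) <= 2 * PI * Rabs (IZR x)).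
  { intros x h Hh. rewrite !Cmod_mult, Cmod_Ci, Rmult_1_l, Cmod_R, !Rabs_mult, (Rabs_pos_eq 2), (Rabs_pos_eq PI) by lra.
    assert (t0 := Rabs_pos (IZR x)). assert (0 <= 2 * PI * Rabs (IZR x)) by (apply Rmult_le_pos; lra).
    assert (h0 := Cmod_ge_0 h). nra. }
  set (v := fun x w => (2 * PI * Ci * th (S p) x w)%C).
  assert (V : forall x, Cmod (v x u) <= bb x).
  { intros x. unfold v. rewrite !Cmod_mult, Cmod_Ci, !Cmod_R, (Rabs_pos_eq 2), (Rabs_pos_eq PI) by lra.
    apply Rle_trans with (B * (2 * PI * tt x)); [|apply Hb; [lra | assert (y := PI2_1); nra]].
    assert (T := th_mod (S p) x u). destruct (Htt x) as [_ [h2 _]].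
    replace (B * (2 * PI * tt x)) with (2 * PI * 1 * (B * tt x)) by ring. apply Rmult_le_compat_l; [lra|].
    eapply Rle_trans; [exact T|]. apply Rmult_le_compat_l; [exact B0 | exact h2]. }
  assert (U : forall x h, Cmod h <= 1 -> Cmod (th p x (u + h)%C) <= bb x).
  { intros x h Hh. apply Rle_trans with (B * (1 * tt x)); [|apply Hb; lra]. rewrite Rmult_1_l.
    eapply Rle_trans; [apply th_mod|]. apply Rmult_le_compat_l; [exact B0|].
    destruct (Htt x) as [h1 _]. eapply Rle_trans; [|exact h1]. rewrite et_add, Cmod_mult.
    destruct (Hx x) as [x1 x2].
    replace ((1 + Rabs (IZR x)) ^ p * exp (2 * PI * Rabs (IZR x)) * Cmod (et x u)) with
      ((1 + Rabs (IZR x)) ^ p * (Cmod (et x u) * exp (2 * PI * Rabs (IZR x)))) by ring.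
    apply Rmult_le_compat_l; [exact x1|]. apply Rmult_le_compat_l; [apply Cmod_ge_0|].
    rewrite Cmod_cexp. apply exp_le. eapply Rle_trans; [apply Rle_abs|]. eapply Rle_trans; [apply fst_le_Cmod | apply Hexp, Hh]. }
  assert (D : forall x h, Cmod h <= 1 -> Cmod (th p x (u + h) - th p x u - v x u * h)%C <= bb x * Cmod h ^ 2).
  { intros x h Hh. set (w := (RtoC (2 * PI * IZR x) * (Ci * h))%C).
    replace (th p x (u + h) - th p x u - v x u * h)%C with (th p x u * (cexp w - 1 - w))%C.
    2:{ unfold v, th. rewrite et_add. fold w. unfold w at 2. simpl pow. rewrite !RtoC_mult. ring. }
    rewrite Cmod_mult. apply Rle_trans with (B * (16 * PI ^ 2 * tt x) * Cmod h ^ 2).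
    2:{ apply Rmult_le_compat_r; [apply pow2_ge_0|]. apply Hb; nra. }
    apply Rle_trans with (B * ((1 + Rabs (IZR x)) ^ p * Cmod (et x u)) * (4 * exp (2 * PI * Rabs (IZR x)) * (2 * PI * Rabs (IZR x) * Cmod h) ^ 2)).
    - apply Rmult_le_compat; auto using Cmod_ge_0, th_mod.
      eapply Rle_trans; [apply cexp_rem2|].
      assert (Ew : Cmod w = 2 * PI * Rabs (IZR x) * Cmod h).
      { unfold w. rewrite !Cmod_mult, Cmod_Ci, Rmult_1_l, Cmod_R, !Rabs_mult, (Rabs_pos_eq 2), (Rabs_pos_eq PI) by lra. reflexivity. }
      rewrite <- Ew. apply Rmult_le_compat_r; [apply pow2_ge_0|]. apply Rmult_le_compat_l; [lra|]. apply exp_le, Hexp, Hh.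
    - destruct (Htt x) as [_ [_ h3]].
      replace (B * ((1 + Rabs (IZR x)) ^ p * Cmod (et x u)) * (4 * exp (2 * PI * Rabs (IZR x)) * (2 * PI * Rabs (IZR x) * Cmod h) ^ 2))
       with (B * (16 * PI ^ 2 * (Rabs (IZR x) ^ 2 * (1 + Rabs (IZR x)) ^ p * exp (2 * PI * Rabs (IZR x)) * Cmod (et x u))) * Cmod h ^ 2) by ring.
      apply Rmult_le_compat_r; [apply pow2_ge_0|]. apply Rmult_le_compat_l; [exact B0|]. apply Rmult_le_compat_l; [nra | exact h3]. }
  set (L := B * (64 * PI ^ 2) * M).
  assert (bbE : forall k, bb (Z.of_nat k) + bb (- Z.of_nat k - 1)%Z <= 2 * L * (/2) ^ k).
  { intros k. unfold bb. rewrite Zabs2Nat.id. replace (Z.abs_nat (- Z.of_nat k - 1)) with (S k) by lia. fold L.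
    assert (L0 : 0 <= L) by (unfold L; apply Rmult_le_pos; [apply Rmult_le_pos; lra | lra]).
    assert (p0 : 0 <= (/2) ^ k) by (apply pow_le; lra). simpl.
    replace (B * (64 * (PI * (PI * 1))) * (M * (/ 2) ^ k) + B * (64 * (PI * (PI * 1))) * (M * (/ 2 * (/ 2) ^ k)))
      with (L * (/2) ^ k * (1 + / 2)) by (unfold L; ring).
    assert (0 <= L * (/2) ^ k) by (apply Rmult_le_pos; assumption). lra. }
  assert (zv : zdom (fun x => v x u) L) by (intros x; eapply Rle_trans; [apply V | unfold bb, L; right; ring]).
  eapply WD_ext; [| | | apply (WD_CSer (fun k w => zt (fun x => th p x w) k) (fun k w => zt (fun x => v x w) k) (fun k => 2 * L * (/2) ^ k) u)].
  - reflexivity.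
  - destruct (th_zdom (S p) u) as [M' HM']. change (CSer (fun k => zt (fun x => v x u) k)) with (ZS (fun x => v x u)).
    unfold v. rewrite (ZS_scal _ _ M' HM'). reflexivity.
  - reflexivity.
  - apply ex_series_half.
  - intros k h Hh. eapply Rle_trans; [apply Cmod_triangle|]. eapply Rle_trans; [|apply bbE]. apply Rplus_le_compat; apply U, Hh.
  - intros k. eapply Rle_trans; [apply Cmod_triangle|]. eapply Rle_trans; [|apply bbE]. apply Rplus_le_compat; apply V.
  - intros k h Hh. unfold zt.
    match goal with |- Cmod ?e <= _ => replace e with
      ((th p (Z.of_nat k) (u + h) - th p (Z.of_nat k) u - v (Z.of_nat k) u * h) +
       (th p (- Z.of_nat k - 1) (u + h) - th p (- Z.of_nat k - 1) u - v (- Z.of_nat k - 1)%Z u * h))%C by ring end.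
    eapply Rle_trans; [apply Cmod_triangle|].
    apply Rle_trans with ((bb (Z.of_nat k) + bb (- Z.of_nat k - 1)%Z) * Cmod h ^ 2).
    + rewrite Rmult_plus_distr_r. apply Rplus_le_compat; apply D, Hh.
    + apply Rmult_le_compat_r; [apply pow2_ge_0 | apply bbE].
Qed.
Lemma entireC_Theta p : entireC (Theta p).
Proof. intros z. eexists. apply WD_Theta. Qed.
End Theta.

(** * Functions vanishing on a lattice *)

(** Elimination of the last unknown by a pivot row [t0]; the reduced system skips that row, whence
    the renumbering. Without a pivot the last unit vector is a solution. *)
Lemma linear_system N : forall q (A : nat -> nat -> C), (q < N)%nat ->
  exists X : nat -> C, (exists p, (p < N)%nat /\ X p <> RtoC 0) /\
    forall t, (t < q)%nat -> Csum N (fun p => A t p * X p)%C = RtoC 0.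
Proof.
  induction N as [|N IH]; intros q A Hq; [lia|].
  destruct (classic (exists t, (t < q)%nat /\ A t N <> RtoC 0)) as [[t0 [L0 P0]]|Z].
  - destruct (IH (q - 1)%nat (fun t p => let r := if Nat.ltb t t0 then t else S t in
       (A r p - A r N / A t0 N * A t0 p)%C)) as [X [[p [Lp Xp]] HX]]; [lia|].
    set (c := (- Csum N (fun p => A t0 p * X p) / A t0 N)%C).
    assert (Ec : forall t, Csum N (fun p => A t p * (if Nat.eqb p N then c else X p))%C = Csum N (fun p => A t p * X p)%C).
    { intros t. apply Csum_ext. intros k Hk. destruct (Nat.eqb_spec k N); [lia | reflexivity]. }
    exists (fun p => if Nat.eqb p N then c else X p). split.
    + exists p. split; [lia|]. destruct (Nat.eqb_spec p N); [lia | exact Xp].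
    + intros t Ht. cbn [Csum]. rewrite Ec, Nat.eqb_refl. destruct (Nat.eq_dec t t0) as [->|Nt].
      * unfold c. field. exact P0.
      * set (t' := if Nat.ltb t t0 then t else (t - 1)%nat).
        assert (E := HX t'). assert (Er : (if Nat.ltb t' t0 then t' else S t') = t).
        { unfold t'. destruct (Nat.ltb_spec t t0).
          - destruct (Nat.ltb_spec t t0); lia.
          - destruct (Nat.ltb_spec (t - 1) t0); lia. }
        cbv zeta in E. rewrite Er in E. specialize (E ltac:(unfold t'; destruct (Nat.ltb_spec t t0); lia)).
        rewrite (Csum_ext N _ (fun p => A t p * X p + - (A t N / A t0 N) * (A t0 p * X p))%C) in E by (intros; unfold Cdiv; ring).
        rewrite Csum_plus, Csum_scal in E. rewrite <- E. unfold c. field. exact P0.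
  - exists (fun p => if Nat.eqb p N then RtoC 1 else RtoC 0). split.
    + exists N. split; [lia|]. rewrite Nat.eqb_refl. intros E. apply (f_equal fst) in E. simpl in E. lra.
    + intros t Ht. cbn [Csum]. rewrite Nat.eqb_refl.
      rewrite (Csum_ext N _ (fun _ => RtoC 0)), Csum_0.
      * destruct (classic (A t N = RtoC 0)) as [->|Q]; [ring | exfalso; apply Z; exists t; auto].
      * intros k Hk. destruct (Nat.eqb_spec k N); [lia | ring].
Qed.

Lemma Csum_single n j (f : nat -> C) : (j < n)%nat -> Csum n (fun k => if Nat.eqb k j then f k else RtoC 0) = f j.
Proof.
  induction n; intros L; [lia|]. cbn [Csum]. destruct (Nat.eqb_spec n j) as [->|Q].
  - rewrite (Csum_ext j _ (fun _ => RtoC 0)), Csum_0; [ring|]. intros k Hk. destruct (Nat.eqb_spec k j); [lia | reflexivity].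
  - rewrite IHn by lia. ring.
Qed.
Lemma Csum_add n m f : Csum (n + m) f = (Csum n f + Csum m (fun k => f (n + k)%nat))%C.
Proof.
  induction m; cbn [Csum]; [rewrite Nat.add_0_r; ring|]. rewrite Nat.add_succ_r. cbn [Csum]. rewrite IHm. ring.
Qed.
Lemma Csum_block n m f : Csum (n * m) f = Csum n (fun i => Csum m (fun r => f (i * m + r)%nat)).
Proof. induction n; cbn [Csum Nat.mul]; [reflexivity|]. rewrite Nat.add_comm, Csum_add, IHn. reflexivity. Qed.

(** Letting v decrease to 0 kills the constant coefficient; the others follow after division by
    v. *)
Lemma poly_zero n : forall c : nat -> C, (forall v, 0 < v -> Csum n (fun i => c i * RtoC (v ^ i))%C = RtoC 0) ->
  forall i, (i < n)%nat -> c i = RtoC 0.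
Proof.
  induction n; intros c H i Hi; [lia|].
  assert (E : forall v, 0 < v -> c O = (- RtoC v * Csum n (fun i => c (S i) * RtoC (v ^ i)))%C).
  { intros v Hv. assert (e := H v Hv). rewrite Csum_S_l in e. simpl pow in e at 1. rewrite Cmult_1_r in e.
    rewrite (Csum_ext n _ (fun i => RtoC v * (c (S i) * RtoC (v ^ i)))%C) in e by (intros; simpl pow; rewrite RtoC_mult; ring).
    rewrite Csum_scal in e. replace (c O) with (c O + RtoC v * Csum n (fun i => c (S i) * RtoC (v ^ i)) - RtoC v * Csum n (fun i => c (S i) * RtoC (v ^ i)))%C by ring.
    rewrite e. ring. }
  assert (c0 : c O = RtoC 0).
  { apply Cmod_eq_0. apply Rle_antisym; [|apply Cmod_ge_0]. apply Rnot_lt_le. intros L.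
    set (S0 := Rsum n (fun i => Cmod (c (S i)))). assert (S0p : 0 <= S0) by (apply Rsum_ge_0; intros; apply Cmod_ge_0).
    set (v := Rmin 1 (Cmod (c O) / (2 * (S0 + 1)))).
    assert (v0 : 0 < v) by (apply Rmin_glb_lt; [lra | apply Rdiv_lt_0_compat; lra]).
    assert (v1 : v <= 1) by apply Rmin_l. assert (v2 : v * (2 * (S0 + 1)) <= Cmod (c O)).
    { apply (proj2 (Rle_div_r _ _ (2 * (S0 + 1)) ltac:(lra))). apply Rmin_r. }
    assert (Q : Cmod (c O) <= v * S0); [|nra]. rewrite (E v v0) at 1.
    rewrite Cmod_mult, Cmod_opp, Cmod_R, Rabs_pos_eq by lra. apply Rmult_le_compat_l; [lra|].
    eapply Rle_trans; [apply Csum_mod|]. apply Rsum_le. intros k _. rewrite Cmod_mult, Cmod_R, Rabs_pos_eq by (apply pow_le; lra).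
    assert (v ^ k <= 1) by (rewrite <- (pow1 k); apply pow_incr; lra). assert (x := Cmod_ge_0 (c (S k))). nra. }
  destruct i as [|i]; [exact c0|]. apply (IHn (fun i => c (S i))); [|lia].
  intros v Hv. assert (e := E v Hv). rewrite c0 in e.
  assert (Nv : RtoC v <> RtoC 0) by (intros q; apply RtoC_inj in q; lra).
  destruct (classic (Csum n (fun i0 => c (S i0) * RtoC (v ^ i0))%C = RtoC 0)) as [|Q]; [assumption|].
  exfalso. assert (Nz := Cmult_neq_0 _ _ Nv Q). apply Nz.
  replace (RtoC v * Csum n (fun i0 => c (S i0) * RtoC (v ^ i0)))%C with (- (- RtoC v * Csum n (fun i0 => c (S i0) * RtoC (v ^ i0))))%C by ring.
  rewrite <- e. ring.
Qed.

Section PolyTheta.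
Variables (sg : C) (ka : R).
Hypotheses (Hsg : fst sg = - ka) (Hka : 0 < ka).
Variable ga : Z -> C.
Variable B : R.
Hypothesis HB : forall x, Cmod (ga x) <= B.

(** [y] will be a multiple of Im u, a real-linear function of z: this is what makes the series
    polyanalytic rather than analytic. *)
Definition pt (i p : nat) (y : R) (x : Z) (u : C) : C := (RtoC ((IZR x + y) ^ i) * th sg ga p x u)%C.

Lemma pt_zdom i p y u : exists M, zdom (fun x => pt i p y x u) M.
Proof.

  destruct (et_dom sg ka Hsg Hka (p + i) u) as [M [Mp H]].
  assert (B0 : 0 <= B) by (eapply Rle_trans; [apply Cmod_ge_0 | apply (HB 0%Z)]).
  exists ((1 + Rabs y) ^ i * (B * M)). intros x. unfold pt. rewrite Cmod_mult, Cmod_R.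
  assert (t0 := Rabs_pos (IZR x)). assert (y0 := Rabs_pos y).
  assert (a1 : Rabs ((IZR x + y) ^ i) <= (1 + Rabs y) ^ i * (1 + Rabs (IZR x)) ^ i).
  { rewrite <- RPow_abs, <- Rpow_mult_distr. apply pow_incr. split; [apply Rabs_pos|].
    assert (T := Rabs_triang (IZR x) y). nra. }
  rewrite Rmult_assoc. assert (T := th_mod sg ga B HB p x u).
  apply Rle_trans with ((1 + Rabs y) ^ i * (1 + Rabs (IZR x)) ^ i * (B * ((1 + Rabs (IZR x)) ^ p * Cmod (et sg x u)))).
  { apply Rmult_le_compat; auto using Rabs_pos, Cmod_ge_0. }
  rewrite Rmult_assoc. apply Rmult_le_compat_l; [apply pow_le; lra|].
  replace ((1 + Rabs (IZR x)) ^ i * (B * ((1 + Rabs (IZR x)) ^ p * Cmod (et sg x u)))) with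
    (B * ((1 + Rabs (IZR x)) ^ (p + i) * Cmod (et sg x u))) by (rewrite pow_add; ring).
  rewrite Rmult_assoc. apply Rmult_le_compat_l; [exact B0|]. eapply Rle_trans; [|apply H].
  assert (P := PI_RGT_0). assert (1 <= exp (2 * PI * Rabs (IZR x))) by (apply exp_ge_1; nra).
  assert (0 <= (1 + Rabs (IZR x)) ^ (p + i)) by (apply pow_le; lra).
  apply Rmult_le_compat_r; [apply Cmod_ge_0|]. nra.
Qed.

(** (x + Y)^(i+1) x^p = (x + Y)^i x^(p+1) + Y (x + Y)^i x^p, and a factor Y raises the order by
    one. *)
Lemma PA_pt (Y : C -> R) (w1 : C) : (forall n F, PA n F -> PA (S n) (fun z => RtoC (Y z) * F z)%C) ->
  forall i p, PA (S i) (fun z => ZS (fun x => pt i p (Y z) x (z / w1)%C)).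
Proof.
  intros HY. induction i; intros p.
  - apply (PA_ext 1 (fun z => Theta sg ga p (z / w1)%C)).
    + intros z. apply ZS_ext. intros x. unfold pt. simpl pow. ring.
    + apply PA_entire. apply (entireC_comp (Theta sg ga p) (fun z => z / w1)%C).
      * eapply entireC_Theta; eassumption.
      * apply (entireC_ext (fun z => / w1 * z)%C); [intros; apply Cmult_comm | apply entireC_scal, entireC_id].
  - apply (PA_ext _ (fun z => ZS (fun x => pt i (S p) (Y z) x (z / w1)%C) + RtoC (Y z) * ZS (fun x => pt i p (Y z) x (z / w1)%C))%C).
    + intros z. destruct (pt_zdom i (S p) (Y z) (z / w1)%C) as [M1 H1]. destruct (pt_zdom i p (Y z) (z / w1)%C) as [M2 H2].
      rewrite <- (ZS_scal _ _ M2 H2). rewrite <- (ZS_plus _ _ M1 (Cmod (RtoC (Y z)) * M2) H1).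
      * apply ZS_ext. intros x. unfold pt, th. simpl pow. rewrite !RtoC_mult, RtoC_plus. ring.
      * intros x. rewrite Cmod_mult, Rmult_assoc. apply Rmult_le_compat_l; [apply Cmod_ge_0 | apply H2].
    + apply PA_plus; [apply PA_le with (S i); [lia | apply IHi] | apply HY, IHi].
Qed.

Lemma pow_gauss i (k : R) : 0 < k -> exists K, 0 <= K /\ forall v, Rabs v ^ i * exp (- (k * v ^ 2)) <= K * exp (- (k / 2 * v ^ 2)).
Proof.
  intros Hk. destruct (Gr_pow _ i Gr_id (k / 2)) as [K [K0 H]]; [lra|]. exists K. split; [exact K0|]. intros v.
  specialize (H (RtoC v)). rewrite <- RtoC_pow, !Cmod_R, <- RPow_abs, pow2_abs in H.
  replace (- (k * v ^ 2)) with (- (k / 2 * v ^ 2) + - (k / 2 * v ^ 2)) by field. rewrite exp_plus, <- Rmult_assoc.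
  apply Rmult_le_compat_r; [left; apply exp_pos|].
  apply Rle_trans with (K * exp (k / 2 * v ^ 2) * exp (- (k / 2 * v ^ 2))).
  - apply Rmult_le_compat_r; [left; apply exp_pos | exact H].
  - rewrite Rmult_assoc, <- exp_plus, Rplus_opp_r, exp_0. lra.
Qed.

(** With Im u = y ka / pi the modulus of the exponential is exp(ka y^2) exp(-ka (x + y)^2). The
    powers are centred at the maximum x = -y of this Gaussian, so they add no polynomial growth in
    y. *)
Lemma pt_growth i : exists K, 0 <= K /\ forall y u, snd u = y * (ka / PI) ->
  Cmod (ZS (fun x => pt i 0 y x u)) <= K * exp (ka * y ^ 2).
Proof.
  assert (P := PI_RGT_0). assert (B0 : 0 <= B) by (eapply Rle_trans; [apply Cmod_ge_0 | apply (HB 0%Z)]).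
  destruct (pow_gauss i ka Hka) as [K [K0 HK]]. set (e := Rmin 1 (ka / 2)).
  assert (e0 : 0 < e) by (apply Rmin_glb_lt; lra). assert (e1 : e <= 1) by apply Rmin_l. assert (e2 : e <= ka / 2) by apply Rmin_r.
  set (G := 4 * PI / sqrt e). assert (G0 : 0 <= G) by (apply Rmult_le_pos; [lra | left; apply Rinv_0_lt_compat, sqrt_lt_R0, e0]).
  exists (B * K * (2 * G)). split; [apply Rmult_le_pos; [apply Rmult_le_pos; lra | lra]|]. intros y u Hu.
  assert (E : forall x, Cmod (pt i 0 y x u) <= B * K * exp (ka * y ^ 2) * exp (- (e * (IZR x + y) ^ 2))).
  { intros x. unfold pt, th. rewrite !Cmod_mult, (Cmod_et sg ka Hsg), Hu. simpl (IZR x ^ 0). rewrite !Cmod_R, Rabs_R1, <- RPow_abs, Rmult_1_r.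
    replace (- (ka * IZR x ^ 2) - 2 * PI * IZR x * (y * (ka / PI))) with (ka * y ^ 2 + - (ka * (IZR x + y) ^ 2)) by (field; lra).
    rewrite exp_plus.
    replace (Rabs (IZR x + y) ^ i * (Cmod (ga x) * (exp (ka * y ^ 2) * exp (- (ka * (IZR x + y) ^ 2))))) with
      (Cmod (ga x) * (Rabs (IZR x + y) ^ i * exp (- (ka * (IZR x + y) ^ 2))) * exp (ka * y ^ 2)) by ring.
    replace (B * K * exp (ka * y ^ 2) * exp (- (e * (IZR x + y) ^ 2))) with (B * (K * exp (- (e * (IZR x + y) ^ 2))) * exp (ka * y ^ 2)) by ring.
    apply Rmult_le_compat_r; [left; apply exp_pos|]. apply Rmult_le_compat; auto using Cmod_ge_0.
    - apply Rmult_le_pos; [apply pow_le, Rabs_pos | left; apply exp_pos].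
    - eapply Rle_trans; [apply HK|]. apply Rmult_le_compat_l; [exact K0|]. apply exp_le. assert (q := pow2_ge_0 (IZR x + y)). nra. }
  destruct (pt_zdom i 0 y u) as [M HM]. apply (ZS_bound _ M _ HM). intros N.
  assert (c0 : 0 <= B * K * exp (ka * y ^ 2)) by (apply Rmult_le_pos; [apply Rmult_le_pos; lra | left; apply exp_pos]).
  eapply Rle_trans; [apply Csum_mod|].
  apply Rle_trans with (Rsum N (fun k => B * K * exp (ka * y ^ 2) * (exp (- (e * (INR k - - y) ^ 2)) + exp (- (e * (INR k - (y - 1)) ^ 2))))).
  - apply Rsum_le. intros k _. unfold zt. eapply Rle_trans; [apply Cmod_triangle|]. rewrite Rmult_plus_distr_l.
    apply Rplus_le_compat; eapply Rle_trans; try apply E; apply Rmult_le_compat_l; auto; apply exp_le; right.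
    + rewrite <- INR_IZR_INZ. ring.
    + rewrite minus_IZR, opp_IZR, <- INR_IZR_INZ. ring.
  - rewrite Rsum_scal, Rsum_plus. assert (g1 := gauss_sum e (- y) N e0 e1). assert (g2 := gauss_sum e (y - 1) N e0 e1). fold G in g1, g2.
    replace (B * K * (2 * G) * exp (ka * y ^ 2)) with (B * K * exp (ka * y ^ 2) * (2 * G)) by ring.
    apply Rmult_le_compat_l; lra.
Qed.
End PolyTheta.

Lemma ZS_Csum M (a : nat -> Z -> C) : (forall r, (r < M)%nat -> exists K, zdom (a r) K) ->
  ZS (fun x => Csum M (fun r => a r x)) = Csum M (fun r => ZS (a r)) /\ exists K, zdom (fun x => Csum M (fun r => a r x)) K.
Proof.
  induction M; intros H.
  - split; [|exists 0; intros x; simpl; rewrite Cmod_0; lra]. cbn [Csum]. assert (Z0 : zdom (fun _ => RtoC 0) 0) by (intros x; rewrite Cmod_0; lra).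
    rewrite (ZS_ext _ (fun x => RtoC 0 * (fun _ => RtoC 0) x)%C) by (intros; ring). rewrite (ZS_scal _ _ 0 Z0). ring.
  - destruct IHM as [E [K HK]]; [intros; apply H; lia|]. destruct (H M (le_n _)) as [K' HK'].
    split.
    + cbn [Csum]. rewrite <- E. rewrite <- (ZS_plus _ _ K K' HK HK'). reflexivity.
    + exists (K + K'). intros x. cbn [Csum]. eapply Rle_trans; [apply Cmod_triangle|]. rewrite Rmult_plus_distr_r.
      apply Rplus_le_compat; [apply HK | apply HK'].
Qed.
Lemma Rsum_term n f k : (forall i, 0 <= f i) -> (k < n)%nat -> f k <= Rsum n f.
Proof.
  intros H. induction n; intros L; [lia|]. cbn [Rsum]. assert (P := Rsum_ge_0 n f (fun i _ => H i)). assert (Q := H n).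
  destruct (Nat.eq_dec k n) as [->|]; [lra|]. specialize (IHn ltac:(lia)). lra.
Qed.
Lemma PA_im (be : C) (r : R) n F : PA n F -> PA (S n) (fun z => RtoC (snd (z * be)%C * r) * F z)%C.
Proof.
  intros H. apply (PA_ext _ (fun z => (RtoC (- r / 2) * Ci * be) * z * F z + (RtoC (r / 2) * Ci * Cconj be) * (Cconj z * F z))%C).
  - intros z. replace (RtoC (snd (z * be)%C * r)) with ((RtoC (- r / 2) * Ci * be) * z + (RtoC (r / 2) * Ci * Cconj be) * Cconj z)%C.
    + ring.
    + apply C_ext; simpl; field.
  - apply PA_plus; [apply PA_S, PA_entire_mult; [apply entireC_scal, entireC_id | exact H] | apply PA_scal, PA_conj, H].
Qed.
(* At a lattice point [k * w1 + (q * b + t) * w2] the series reduces, up to a unit, to a sum that depends on [t < q] only. *)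
Theorem theta_exists (w1 w2 : C) (n : nat) (al : R) :
  0 < snd (Cconj w1 * w2)%C -> 0 < al -> 1 < INR n * al * snd (Cconj w1 * w2)%C ->
  exists F, PA n F /\ (forall k l, F (lat w1 w2 k l) = RtoC 0) /\ (exists z, F z <> RtoC 0) /\
    exists M, 0 <= M /\ forall z, Cmod (F z) <= M * exp (PI * al / 2 * Cmod z ^ 2).
Proof.
  set (d := snd (Cconj w1 * w2)%C). intros Hd Hal Hn. assert (P := PI_RGT_0).
  assert (W1 : w1 <> RtoC 0) by (intros E; unfold d in Hd; rewrite E in Hd; simpl in Hd; lra).
  assert (W : 0 < Cmod w1 ^ 2) by (apply pow_lt, Cmod_gt_0, W1).
  assert (n0 : 0 < INR n).
  { destruct n; [|apply lt_0_INR; lia]. simpl in Hn. rewrite !Rmult_0_l in Hn. lra. }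
  (* m / q approximates al d from below; since n al d > 1, a large q leaves n m > q, that is more
     unknowns than equations. *)
  assert (Q : exists q m : nat, (q < n * m)%nat /\ (0 < q)%nat /\ INR m <= al * d * INR q).
  { destruct (INR_unbounded (INR n / (INR n * al * d - 1))) as [q Hq].
    assert (Hq1 : INR n < INR q * (INR n * al * d - 1)) by (apply (proj1 (Rlt_div_l (INR n) (INR q) (INR n * al * d - 1) ltac:(lra))); exact Hq).
    assert (q0 : 0 < INR q) by nra.
    assert (r0 : 0 <= al * d * INR q) by (repeat apply Rmult_le_pos; lra).
    destruct (nfloor_ex (al * d * INR q) r0) as [m [m1 m2]]. exists q, m. repeat split; [| |exact m1].
    - apply INR_lt. rewrite mult_INR. nra.
    - apply INR_lt. exact q0. }
  destruct Q as [q [m [Hqm [Hq Hm]]]].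
  assert (q0 : 0 < INR q) by (apply lt_0_INR; lia).
  assert (m0n : (0 < m)%nat) by (destruct m; lia). assert (m0 : 0 < INR m) by (apply lt_0_INR; lia).
  set (tau := (w2 / w1)%C).
  assert (Htau : snd tau = d / Cmod w1 ^ 2).
  { unfold tau, d. rewrite Cmod_sqr2. rewrite Cmod_sqr2 in W. destruct w1, w2. simpl in *. field. lra. }
  (* For this modulus a shift of x by m amounts, up to a factor independent of x, to a translation
     of u by q tau. *)
  set (sg := (RtoC (PI * INR q / INR m) * (Ci * tau))%C). set (ka := PI * INR q / INR m * snd tau).
  assert (Hsg : fst sg = - ka) by (unfold sg, ka; simpl; ring).
  assert (Hka : 0 < ka).
  { unfold ka. rewrite Htau. apply Rmult_lt_0_compat; apply Rdiv_lt_0_compat; try lra. apply Rmult_lt_0_compat; lra. }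
  set (ind := fun (r : nat) (x : Z) => if Nat.eqb r (Z.to_nat (x mod Z.of_nat m)) then RtoC 1 else RtoC 0).
  assert (Hind : forall r x, Cmod (ind r x) <= 1).
  { intros r x. unfold ind. destruct (Nat.eqb r _); rewrite Cmod_R; [rewrite Rabs_R1 | rewrite Rabs_R0]; lra. }
  (* The unknown with index i m + r is the coefficient of the power i on the residue class r modulo
     m; equation t is vanishing at u = t tau. *)
  destruct (linear_system (n * m) q (fun t p => ZS (fun x => pt sg (ind (p mod m)%nat) (p / m) 0 (INR m * INR t / INR q) x (RtoC (INR t) * tau)%C)) Hqm)
    as [X [[p [Lp Xp]] HX]].
  set (ga := fun i (x : Z) => X (i * m + Z.to_nat (x mod Z.of_nat m))%nat).
  set (B := Rsum (n * m) (fun p => Cmod (X p))).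
  assert (Hr : forall x, (Z.to_nat (x mod Z.of_nat m) < m)%nat).
  { intros x. assert (b := Z.mod_pos_bound x (Z.of_nat m) ltac:(lia)). lia. }
  assert (HB : forall i, (i < n)%nat -> forall x, Cmod (ga i x) <= B).
  { intros i Hi x. apply (Rsum_term (n * m) (fun p => Cmod (X p))); [intros; apply Cmod_ge_0|]. specialize (Hr x). nia. }
  set (yy := fun u : C => snd u * (PI / ka)).
  set (S := fun u => Csum n (fun i => ZS (fun x => pt sg (ga i) i 0 (yy u) x u))).
  (* Chosen so that exp(ka yy^2) = exp(2 b (Im u)^2): the factor exp(b u^2) makes the growth radial,
     namely exp(b |u|^2), and m / (q d) <= al bounds it as required. *)
  set (b := PI * (INR m / (INR q * d)) / 2 * Cmod w1 ^ 2).
  exists (fun z => cexp (RtoC b * (z / w1) ^ 2)%C * S (z / w1)%C)%C.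
  assert (Zdom : forall i y u, (i < n)%nat -> exists K, zdom (fun x => pt sg (ga i) i 0 y x u) K).
  { intros i y u Hi. exact (pt_zdom sg ka Hsg Hka (ga i) B (HB i Hi) i 0%nat y u). }
  assert (Zdom' : forall r i y u, exists K, zdom (fun x => pt sg (ind r) i 0 y x u) K).
  { intros r i y u. exact (pt_zdom sg ka Hsg Hka (ind r) 1 (Hind r) i 0%nat y u). }
  repeat split.
  - apply PA_entire_mult.
    + apply entireC_cexp, entireC_scal, entireC_pow. apply (entireC_ext (fun z => / w1 * z)%C); [intros; apply Cmult_comm | apply entireC_scal, entireC_id].
    + unfold S. apply PA_Csum. intros i Hi. apply PA_le with (Datatypes.S i); [lia|].
      apply (PA_pt sg ka Hsg Hka (ga i) B (HB i Hi) (fun z => yy (z / w1)%C) w1). intros k F HF.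
      apply (PA_im (/ w1) (PI / ka)), HF.
  - intros k l. assert (E : S (lat w1 w2 k l / w1)%C = RtoC 0); [|rewrite E; ring].
    replace (lat w1 w2 k l / w1)%C with (RtoC (IZR k) + RtoC (IZR l) * tau)%C by (unfold lat, tau; field; exact W1).
    set (t := Z.to_nat (l mod Z.of_nat q)). set (bz := (l / Z.of_nat q)%Z).
    assert (bt := Z.mod_pos_bound l (Z.of_nat q) ltac:(lia)).
    assert (El : l = (Z.of_nat q * bz + Z.of_nat t)%Z).
    { unfold t, bz. rewrite Z2Nat.id by lia. apply Z.div_mod. lia. }
    assert (ElR : IZR l = INR q * IZR bz + INR t) by (rewrite El, plus_IZR, mult_IZR, <- !INR_IZR_INZ; reflexivity).
    assert (Ht : (t < q)%nat) by (unfold t; lia).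
    unfold S. set (y := yy (RtoC (IZR k) + RtoC (IZR l) * tau)%C).
    assert (Ey : y = INR m * IZR l / INR q).
    { unfold y, yy, ka. replace (snd (RtoC (IZR k) + RtoC (IZR l) * tau)%C) with (IZR l * snd tau) by (simpl; ring). rewrite Htau. field. repeat split; try lra. intro Q; rewrite Q in W; simpl in W; lra. }
    (* For l = q bz + t the summation index is shifted by m bz. The coefficients are m-periodic, x +
       y is unchanged, and this nonzero factor independent of x remains. *)
    set (v := cexp (sg * RtoC ((INR m * INR t / INR q) ^ 2 - (INR m * IZR l / INR q) ^ 2))%C).
    assert (T : forall i, (i < n)%nat -> ZS (fun x => pt sg (ga i) i 0 y x (RtoC (IZR k) + RtoC (IZR l) * tau)%C) =
       (v * ZS (fun x => pt sg (ga i) i 0 (INR m * INR t / INR q) x (RtoC (INR t) * tau)%C))%C).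
    { intros i Hi. destruct (Zdom i (INR m * INR t / INR q) (RtoC (INR t) * tau)%C Hi) as [K HK].
      rewrite <- (ZS_scal v _ _ HK).
      etransitivity; [|apply (ZS_shift _ (Cmod v * K) (Z.of_nat m * bz))].
      2:{ intros x. rewrite Cmod_mult, Rmult_assoc. apply Rmult_le_compat_l; [apply Cmod_ge_0 | apply HK]. }
      apply ZS_ext. intros x. unfold pt, th. simpl (_ ^ 0). unfold ga.
      replace ((x + Z.of_nat m * bz) mod Z.of_nat m)%Z with (x mod Z.of_nat m)%Z by (rewrite Z.mul_comm, Z.mod_add; [reflexivity | lia]).
      assert (Ex : IZR (x + Z.of_nat m * bz) + INR m * INR t / INR q = IZR x + y).
      { rewrite Ey, ElR, plus_IZR, mult_IZR, <- INR_IZR_INZ. field. lra. }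
      rewrite Ex. replace (et sg x (RtoC (IZR k) + RtoC (IZR l) * tau)%C) with (v * et sg (x + Z.of_nat m * bz) (RtoC (INR t) * tau))%C; [ring|].
      unfold v, et. rewrite <- cexp_plus.
      match goal with |- cexp ?u = cexp ?w => replace w with (u + Ci * RtoC (2 * PI * IZR (x * k)))%C end; [rewrite (cexp_plus _ (Ci * RtoC (2 * PI * IZR (x * k)))%C), cexp_2PI; ring|].
      rewrite ElR, mult_IZR, plus_IZR, mult_IZR, <- INR_IZR_INZ. unfold sg. clearbody tau. destruct tau as [a a'].
      apply C_ext; simpl; field; lra. }
    rewrite (Csum_ext n _ (fun i => v * Csum m (fun r => ZS (fun x => pt sg (ind r) i 0 (INR m * INR t / INR q) x (RtoC (INR t) * tau)%C) * X (i * m + r)%nat))%C).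
    + rewrite Csum_scal. specialize (HX t Ht). rewrite Csum_block in HX.
      replace (RtoC 0) with (v * RtoC 0)%C by ring. f_equal. rewrite <- HX. apply Csum_ext. intros i Hi. apply Csum_ext. intros r Lr.
      rewrite Nat.add_comm, Nat.Div0.mod_add, Nat.mod_small, Nat.div_add, Nat.div_small by lia. reflexivity.
    + intros i Hi. rewrite (T i Hi). f_equal.
      rewrite (Csum_ext m _ (fun r => ZS (fun x => X (i * m + r)%nat * pt sg (ind r) i 0 (INR m * INR t / INR q) x (RtoC (INR t) * tau))%C)).
      2:{ intros r _. destruct (Zdom' r i (INR m * INR t / INR q) (RtoC (INR t) * tau)%C) as [K HK]. rewrite (ZS_scal _ _ K HK). ring. }
      refine (eq_trans _ (proj1 (ZS_Csum m _ _))).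
      * apply ZS_ext. intros x. unfold pt, th, ga, ind.
        rewrite (Csum_ext m _ (fun r => if Nat.eqb r (Z.to_nat (x mod Z.of_nat m)) then
          RtoC ((IZR x + INR m * INR t / INR q) ^ i) * (X (i * m + r)%nat * RtoC (IZR x ^ 0) * et sg x (RtoC (INR t) * tau)) else RtoC 0)%C).
        -- rewrite Csum_single by apply Hr. reflexivity.
        -- intros r _. destruct (Nat.eqb r _); ring.
      * intros r _. destruct (Zdom' r i (INR m * INR t / INR q) (RtoC (INR t) * tau)%C) as [K HK].
        exists (Cmod (X (i * m + r)%nat) * K). intros x. rewrite Cmod_mult, Rmult_assoc. apply Rmult_le_compat_l; [apply Cmod_ge_0 | apply HK].
  (* If F vanished identically, Fourier uniqueness on horizontal lines and then [poly_zero] would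
     annihilate every coefficient, contradicting the nontrivial solution X. *)
  - apply NNPP. intros Hz.
    assert (S0 : forall u, S u = RtoC 0).
    { intros u. apply NNPP. intros Q. apply Hz. exists (u * w1)%C. replace (u * w1 / w1)%C with u by (field; exact W1).
      apply Cmult_neq_0; [apply cexp_nz | exact Q]. }
    apply Xp. rewrite (Nat.div_mod_eq p m). set (i0 := (p / m)%nat). set (x0 := (p mod m)%nat).
    assert (Li : (i0 < n)%nat) by (apply Nat.Div0.div_lt_upper_bound; lia).
    assert (Lx : (x0 < m)%nat) by (apply Nat.mod_upper_bound; lia).
    replace (m * i0 + x0)%nat with (i0 * m + Z.to_nat (Z.of_nat x0 mod Z.of_nat m))%nat by (rewrite Z.mod_small by lia; lia).
    change (ga i0 (Z.of_nat x0) = RtoC 0). generalize (Z.of_nat x0). intros x.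
    apply (poly_zero n (fun i => ga i x)); [|exact Li]. intros v _.
    (* The height is chosen with x + y = v, so that the x-th Fourier coefficient is, up to an
       exponential, the polynomial with coefficients [ga i x] at v. *)
    set (y := v - IZR x). set (u0 := (0, y * (ka / PI))%R : C).
    assert (Eet : forall x s, et sg x (u0 + RtoC s)%C = (et sg x u0 * chi x s)%C).
    { intros x' s. rewrite et_add. f_equal. unfold chi. f_equal. apply C_ext; simpl; ring. }
    assert (Ey : forall s, yy (u0 + RtoC s)%C = y) by (intros s; unfold yy, u0; simpl; field; lra).
    destruct (ZS_Csum n (fun i x => pt sg (ga i) i 0 y x u0)) as [_ [K HK]]; [intros; apply Zdom; assumption|].
    (* [yy] is constant along the horizontal line through u0, so the series is a Fourier series in
       the real displacement s. *)
    assert (a0 := ZS_fourier _ K HK). cbv beta in a0. assert (a1 := fun h => a0 h x). clear a0.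
    assert (a2 : Csum n (fun i => pt sg (ga i) i 0 y x u0) = RtoC 0).
    { apply a1. intros s. rewrite <- (S0 (u0 + RtoC s)%C). unfold S. rewrite Ey.
      refine (eq_trans _ (proj1 (ZS_Csum n (fun i x => pt sg (ga i) i 0 y x (u0 + RtoC s)%C) _))); [|intros; apply Zdom; assumption].
      apply ZS_ext. intros x'. rewrite Cmult_comm, <- Csum_scal. apply Csum_ext. intros i _. unfold pt, th. rewrite Eet. ring. }
    apply NNPP. intros Q. assert (Nz := Cmult_neq_0 _ _ (cexp_nz (sg * RtoC (IZR x ^ 2) + RtoC (2 * PI * IZR x) * (Ci * u0))%C) Q).
    apply Nz. rewrite <- a2. fold (et sg x u0). rewrite <- Csum_scal. apply Csum_ext. intros i _. unfold pt, th.
    replace (IZR x + y) with v by (unfold y; ring). simpl (_ ^ 0). ring.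
  - assert (G : forall i, exists K, 0 <= K /\ ((i < n)%nat -> forall y u, snd u = y * (ka / PI) ->
        Cmod (ZS (fun x => pt sg (ga i) i 0 y x u)) <= K * exp (ka * y ^ 2))).
    { intros i. destruct (Nat.lt_ge_cases i n) as [Hi|Hi].
      - destruct (pt_growth sg ka Hsg Hka (ga i) B (HB i Hi) i) as [K [K0 HK]]. exists K; auto.
      - exists 0. split; [lra | lia]. }
    destruct (choice _ G) as [K HK]. exists (Rsum n K). split; [apply Rsum_ge_0; intros; apply HK|]. intros z.
    set (u := (z / w1)%C). assert (Ez : z = (u * w1)%C) by (unfold u; field; exact W1).
    rewrite Cmod_mult, Cmod_cexp.
    assert (A : Cmod (S u) <= Rsum n K * exp (ka * yy u ^ 2)).
    { eapply Rle_trans; [apply Csum_mod|]. rewrite Rmult_comm, <- Rsum_scal. apply Rsum_le. intros i Hi. rewrite Rmult_comm.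
      apply HK; [exact Hi|]. unfold yy. field. lra. }
    apply Rle_trans with (exp (fst (RtoC b * u ^ 2)%C) * (Rsum n K * exp (ka * yy u ^ 2))); [apply Rmult_le_compat_l; [left; apply exp_pos | exact A]|].
    replace (exp (fst (RtoC b * u ^ 2)%C) * (Rsum n K * exp (ka * yy u ^ 2))) with (Rsum n K * (exp (fst (RtoC b * u ^ 2)%C) * exp (ka * yy u ^ 2))) by ring.
    apply Rmult_le_compat_l; [apply Rsum_ge_0; intros; apply HK|]. rewrite <- exp_plus. apply exp_le.
    replace (fst (RtoC b * u ^ 2)%C + ka * yy u ^ 2) with (b * Cmod u ^ 2).
    2:{ rewrite Cmod_sqr2. replace (ka * yy u ^ 2) with (2 * b * snd u ^ 2).
        - simpl. ring.
        - unfold yy, ka, b. rewrite Htau. field. repeat split; try lra. intro Q; rewrite Q in W; simpl in W; lra. }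
    rewrite Ez, Cmod_mult, Rpow_mult_distr. unfold b.
    assert (L : INR m / (INR q * d) <= al).
    { apply (proj2 (Rle_div_l (INR m) al (INR q * d) ltac:(apply Rlt_gt; apply Rmult_lt_0_compat; lra))). lra. }
    assert (u1 := pow2_ge_0 (Cmod u)). assert (0 <= PI / 2 * Cmod w1 ^ 2 * Cmod u ^ 2) by (apply Rmult_le_pos; [apply Rmult_le_pos; lra | exact u1]).
    nra.
Qed.

(** * Gaussian kernels *)

Lemma Gr_pow_k k f n : Gr k f -> Gr (INR n * k) (fun z => f z ^ n)%C.
Proof.
  intros H. induction n as [|n IH].
  - simpl INR. rewrite Rmult_0_l. exact (Gr_const (RtoC 1)).
  - rewrite S_INR. replace ((INR n + 1) * k) with (k + INR n * k) by ring. apply (Gr_mult k _ f (fun z => f z ^ n)%C H IH).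
Qed.
Lemma Gr_div_pow k p f g : entireC g -> (forall z, f z = (z ^ p * g z)%C) -> Gr k f -> Gr k g.
Proof.
  revert f. induction p; intros f Hg E H.
  - apply (Gr_ext k f); [intros z; rewrite E; simpl; ring | exact H].
  - apply (IHp (fun z => z ^ p * g z)%C Hg (fun z => eq_refl)). apply (Gr_div k f _ 0).
    + apply entireC_mult; [apply entireC_pow, entireC_id | exact Hg].
    + intros z. rewrite E. simpl. ring.
    + exact H.
Qed.

(** A polynomial inverse of h modulo z^n, built one coefficient at a time. It normalises the
    separating factor at 0 without affecting its growth exponent. *)
Lemma poly_inverse n h : entireC h -> h 0%C <> 0%C ->
  exists q r, entireC q /\ Gr 0 q /\ entireC r /\ forall z, (q z * h z - 1 = z ^ n * r z)%C.
Proof.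
  intros Hh h0. induction n as [|n [q [r [Hq [Gq [Hr E]]]]]].
  - exists (fun _ => RtoC 0), (fun _ => RtoC (-(1))). repeat split; auto using entireC_const, Gr_const. intros z. simpl. rewrite RtoC_opp. ring.
  - set (c := (r 0 / h 0)%C).
    destruct (entire_div0 (fun z => r z - c * h z)%C) as [r' [Hr' E']].
    + apply entireC_minus; [exact Hr | apply entireC_scal, Hh].
    + unfold c. field. exact h0.
    + exists (fun z => q z + - c * z ^ n)%C, r'. split; [|split; [|split; [exact Hr'|]]].
      * apply entireC_plus; [exact Hq | apply entireC_scal, entireC_pow, entireC_id].
      * apply Gr_plus; [exact Gq | apply Gr_scal, Gr_pow, Gr_id].
      * intros z. specialize (E z). specialize (E' z). simpl.
        replace (z * z ^ n * r' z)%C with (z ^ n * (z * r' z))%C by ring. rewrite <- E'.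
        replace ((q z + - c * z ^ n) * h z - 1)%C with (q z * h z - 1 - c * z ^ n * h z)%C by ring. rewrite E. ring.
Qed.

Lemma lat_nz (w1 w2 : C) k l : snd (Cconj w1 * w2)%C <> 0 -> (k <> 0 \/ l <> 0)%Z -> lat w1 w2 k l <> RtoC 0.
Proof.
  intros det Hkl E. destruct (lattice_lower w1 w2 det) as [c [Hc L]]. specialize (L (IZR k) (IZR l)).
  unfold lat in E. rewrite E, Cmod_0 in L. assert (A := Rabs_pos (IZR k)). assert (B := Rabs_pos (IZR l)).
  assert (Z : Rabs (IZR k) = 0 /\ Rabs (IZR l) = 0) by (split; nra). destruct Z as [Zk Zl].
  destruct Hkl as [N|N]; apply N; apply eq_IZR; [destruct (Rcase_abs (IZR k)) | destruct (Rcase_abs (IZR l))];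
  unfold Rabs in *; repeat destruct Rcase_abs; lra.
Qed.

(** [theta_exists] of order 1 on the dual lattice, whose cell has area 1/d, requires only al > d.
    Its zero at 0 is divided out, the n-th power provides the multiplicities, and [poly_inverse]
    gives 1 + O(z^n). *)
Lemma separating_factor (w1 w2 : C) n : (1 <= n)%nat -> let d := snd (Cconj w1 * w2)%C in 0 < d -> INR n * d < 1 ->
  exists E kE, entireC E /\ Gr kE E /\ kE < PI / 2 /\ Van n (fun z => E z - 1)%C 0%C /\
    forall k l, (k <> 0 \/ l <> 0)%Z -> Van n E (lat (RtoC (/ d) * w1) (RtoC (/ d) * w2) k l)%C.
Proof.
  intros Hn d Hd Hnd. assert (P := PI_RGT_0). assert (n1 : 1 <= INR n) by (apply (le_INR 1), Hn).
  assert (Id : 0 < / d) by (apply Rinv_0_lt_compat, Hd).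
  set (v1 := (RtoC (/ d) * w1)%C). set (v2 := (RtoC (/ d) * w2)%C).
  assert (Ed : snd (Cconj v1 * v2)%C = / d).
  { transitivity (/ d * (/ d * d)); [unfold v1, v2, d; simpl; ring | field; lra]. }
  (* Above d so that the theta function exists, below 1/n so that its n-th power grows with an
     exponent less than pi/2. *)
  set (al := (d + / INR n) / 2).
  assert (In : INR n * / INR n = 1) by (field; lra).
  assert (I0 : 0 < / INR n) by (apply Rinv_0_lt_compat; lra).
  assert (al1 : d < al) by (unfold al; nra).
  assert (al2 : INR n * al < 1) by (unfold al; nra).
  destruct (theta_exists v1 v2 1 al) as [f [PF [Hz [[z1 Nz] [M [M0 HM]]]]]].
  - rewrite Ed. exact Id.
  - lra.
  - rewrite Ed. simpl. apply Rmult_lt_reg_r with d; [exact Hd|]. replace (1 * al * / d * d) with al by (field; lra). lra.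
  - destruct PF as [phi [Hphi Ephi]].
    assert (Hf : entireC f) by (apply (entireC_ext (phi O)); [intros z; rewrite Ephi; simpl; ring | apply Hphi]).
    destruct (entire_order f z1 Hf Nz) as [p [f1 [Hf1 [f10 Ef]]]].
    assert (Gf : Gr (PI * al / 2) f).
    { intros k' L. exists M. split; [exact M0|]. intros z. eapply Rle_trans; [apply HM|]. apply Rmult_le_compat_l; [exact M0|].
      apply exp_le. apply Rmult_le_compat_r; [apply pow2_ge_0 | lra]. }
    assert (Gf1 := Gr_div_pow _ p f f1 Hf1 Ef Gf).
    set (h := fun z => (f1 z ^ n)%C). assert (Hh : entireC h) by (apply entireC_pow, Hf1).
    destruct (poly_inverse n h Hh (Cpow_nz _ n f10)) as [q [r [Hq [Gq [Hr E]]]]].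
    exists (fun z => q z * h z)%C, (0 + INR n * (PI * al / 2)). repeat split.
    + apply entireC_mult; assumption.
    + apply Gr_mult; [exact Gq | apply Gr_pow_k, Gf1].
    + nra.
    + apply (Van_ext n (fun z => r z * z ^ n)%C); [intros z; rewrite E; ring|].
      apply Van_mult_l; [apply entireC_pow, entireC_id | exact Hr |]. apply (Van_pow n (fun z => z)); [apply entireC_id | reflexivity].
    + intros k l Hkl. apply Van_mult_l; [exact Hh | exact Hq|]. apply Van_pow; [exact Hf1|].
      set (b := lat v1 v2 k l). assert (b0 : b <> RtoC 0) by (apply lat_nz; [rewrite Ed; lra | exact Hkl]).
      assert (e := Hz k l). fold b in e. rewrite Ef in e. apply NNPP. intros Q. apply (Cmult_neq_0 _ _ (Cpow_nz b p b0) Q), e.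
Qed.

(** Induction through the conj(z)-derivative q, which has order one less. A pointwise bound on q
    comes from [local_estimate] at each point; integrating q back in conj(z) gives all components
    but the first, and that one is F minus a controlled sum. *)
Lemma PA_weight_growth n : forall F M, PA n F -> (forall z, Cmod (F z) <= M * exp (PI / 2 * Cmod z ^ 2)) ->
  exists phi : nat -> C -> C, (forall k, entireC (phi k) /\ Gr (PI / 2) (phi k)) /\ forall z, F z = Csum n (fun k => Cconj z ^ k * phi k z)%C.
Proof.
  assert (P := PI_RGT_0).
  assert (GrB : forall F M, (forall z, Cmod (F z) <= M * exp (PI / 2 * Cmod z ^ 2)) -> Gr (PI / 2) F).
  { intros F M HM k' L. exists (Rabs M). split; [apply Rabs_pos|]. intros z. eapply Rle_trans; [apply HM|].
    apply Rmult_le_compat; [|left; apply exp_pos | apply Rle_abs | apply exp_le, Rmult_le_compat_r; [apply pow2_ge_0 | lra]].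
    assert (x := Cmod_ge_0 (F z)). specialize (HM z). assert (y := exp_pos (PI / 2 * Cmod z ^ 2)). nra. }
  induction n as [|n IH]; intros F M PF HM.
  - exists (fun _ _ => RtoC 0). split; [intros k; split; [apply entireC_const|]|].
    + apply (Gr_le 0); [lra | apply Gr_const].
    + destruct PF as [phi [_ E]]. intros z. rewrite E. reflexivity.
  - destruct PF as [phi [Hphi Ephi]].
    set (q := fun z => Csum n (fun k => Cconj z ^ k * (RtoC (INR (S k)) * phi (S k) z))%C).
    assert (Pq : PA n q) by (exists (fun k z => RtoC (INR (S k)) * phi (S k) z)%C; split; [intros; apply entireC_scal, Hphi | reflexivity]).
    assert (D : exists p, PA (S n) p /\ forall z, WD F z (p z) (q z)).
    { exists (fun z => Csum (S n) (fun k => Cconj z ^ k * der (phi k) z)%C). split; [exists (fun k => der (phi k)); split; [intros; apply entireC_der, Hphi | reflexivity]|].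
      intros z. eapply WD_ext; [intros z'; symmetry; apply Ephi | reflexivity | |].
      2:{ assert (Q : forall m, WD (fun z => Csum m (fun k => Cconj z ^ k * phi k z)%C) z (Csum m (fun k => Cconj z ^ k * der (phi k) z)%C)
           (Csum m (fun k => RtoC (INR k) * Cconj z ^ pred k * phi k z)%C)); [|apply Q].
          induction m; [exact (WD_const 0 z)|]. cbn [Csum]. apply WD_plus; [exact IHm|].
          eapply WD_ext; [| | | apply (WD_mult _ _ _ _ _ _ _ (WD_conj_pow m z) (WD_der (phi m) z (Hphi m)))]; [reflexivity | ring | ring]. }
      rewrite Csum_S_l. unfold q. simpl INR at 1. rewrite !Cmult_0_l, Cplus_0_l. apply Csum_ext. intros k _. simpl pred. ring. }
    destruct D as [p [Pp D]].
    destruct (local_estimate (S n)) as [C0 [c0 LE]].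
    assert (M0 : 0 <= M).
    { assert (x := HM (RtoC 0)). assert (y := exp_pos (PI / 2 * Cmod 0 ^ 2)). assert (y2 := Cmod_ge_0 (F 0)). nra. }
    destruct (IH q (C0 * (M * PI ^ 2)) Pq) as [psi [Hpsi Epsi]].
    (* The factor of F in [twist] is analytic in z, so the conj(z)-derivative of the translate at 0
       is q w times exp(-(pi/2) |w|^2). *)
    { intros w. set (T := twist F w). set (ew := (RtoC (exp (- (PI / 2) * Cmod w ^ 2)))).
      set (cx := fun z => cexp (RtoC (- PI) * Cconj w * z)%C).
      assert (entc : entireC cx) by (apply entireC_cexp, entireC_scal, entireC_id).
      assert (WT : forall z, WD T z (ew * (der cx z * F (z + w) + cx z * p (z + w)))%C (ew * (cx z * q (z + w)))%C).
      { intros z. eapply WD_ext; [| | | apply (WD_scal ew _ _ _ _ (WD_mult cx (fun z => F (z + w)%C) z _ _ _ _ (WD_der cx z entc)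
          (WD_chain F (fun z => z + w)%C z _ _ _ _ (D (z + w)%C) (WD_plus _ _ _ _ _ _ _ (WD_id z) (WD_const w z)))))].
        - intros z'. unfold T, twist. fold ew. fold (cx z'). ring.
        - csolve.
        - csolve. }
      destruct (LE T _ _ (PA_twist _ F w (ex_intro _ phi (conj Hphi Ephi))) ltac:(apply PA_scal, PA_plus;
         [apply PA_entire_mult; [apply entireC_der, entc | apply PA_shift; exists phi; auto] | apply PA_entire_mult; [exact entc | apply PA_shift, Pp]])
         ltac:(apply PA_scal, PA_entire_mult; [exact entc | apply PA_shift, PA_S, Pq]) WT 0%C (M * PI ^ 2) 0) as [_ [_ B]].
      - rewrite Cmod_0. lra.
      - intros R HR.
        assert (Ct : contCR (fun z => Cmod (T z) * exp (- (PI / 2 + 1) * Cmod z ^ 2))).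
        { apply contCR_mult; [apply contCR_Cmod; exact (WD_cont T _ _ WT) | apply contCR_exp0]. }
        rewrite <- SQ_IC. apply Rle_trans with (SQ (fun z => M * exp (- (1) * Cmod (z - 0)%C ^ 2)) R).
        + apply SQ_le; [exact HR | exact Ct | apply (contCR_mult (fun _ => M)); [apply contCR_const | apply contCR_exp] |]. intros z. replace (z - 0)%C with z by ring.
          replace (- (PI / 2 + 1) * Cmod z ^ 2) with (- (PI / 2) * Cmod z ^ 2 + - (1) * Cmod z ^ 2) by ring. rewrite exp_plus, <- Rmult_assoc.
          apply Rmult_le_compat_r; [left; apply exp_pos|]. unfold T. rewrite twist_mod.
          eapply Rle_trans; [apply Rmult_le_compat_r; [left; apply exp_pos | apply HM]|].
          rewrite Rmult_assoc, <- exp_plus. replace (PI / 2 * Cmod (z + w) ^ 2 + - (PI / 2) * Cmod (z + w) ^ 2) with 0 by ring. rewrite exp_0. lra.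
        + rewrite SQ_scal by apply contCR_exp. apply Rmult_le_compat_l; [exact M0|]. eapply Rle_trans; [apply SQ_gauss; lra|]. right. field.
      - unfold ew, cx in B. rewrite !Cmod_mult, Cmod_cexp, Cmod_R, Rabs_pos_eq in B by (left; apply exp_pos).
        replace (fst (RtoC (- PI) * Cconj w * 0)%C) with 0 in B by (simpl; ring). rewrite exp_0, Rmult_1_l in B.
        replace (0 + w)%C with w in B by ring.
        apply Rmult_le_reg_l with (exp (- (PI / 2) * Cmod w ^ 2)); [apply exp_pos|]. eapply Rle_trans; [exact B|].
        rewrite (Rmult_comm (exp (- (PI / 2) * Cmod w ^ 2))), Rmult_assoc, <- exp_plus.
        replace (PI / 2 * Cmod w ^ 2 + - (PI / 2) * Cmod w ^ 2) with 0 by ring. rewrite exp_0. lra. }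
    (* A primitive of q in the variable conj(z), so that G = F - H has no conj(z)-derivative and is
       entire. *)
    set (H := fun z => Csum n (fun k => Cconj z ^ S k * (RtoC (/ INR (S k)) * psi k z))%C).
    set (G := fun z => (F z - H z)%C).
    assert (GH : Gr (PI / 2) H).
    { unfold H. clear -Hpsi P. induction n as [|n IH]; [apply (Gr_le 0); [lra | exact (Gr_const (RtoC 0))]|]. cbn [Csum]. apply Gr_plus; [exact IH|].
      rewrite <- (Rplus_0_l (PI / 2)). apply Gr_mult; [apply (Gr_pow Cconj), Gr_conj | apply Gr_scal, Hpsi]. }
    exists (fun k => match k with O => G | S j => fun z => RtoC (/ INR (S j)) * psi j z end)%C. split.
    + intros [|j]; [|split; [apply entireC_scal, Hpsi | apply Gr_scal, Hpsi]]. split.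
      * intros z. exists (p z - Csum n (fun k => Cconj z ^ S k * (RtoC (/ INR (S k)) * der (psi k) z)))%C.
        assert (WH : WD H z (Csum n (fun k => Cconj z ^ S k * (RtoC (/ INR (S k)) * der (psi k) z)))%C (q z)).
        { rewrite Epsi. unfold H. clear -Hpsi. induction n as [|n IH]; [exact (WD_const 0 z)|]. cbn [Csum]. apply WD_plus; [exact IH|].
           assert (i0 : INR (S n) <> 0) by (apply not_0_INR; lia).
           eapply WD_ext; [| | | apply (WD_mult _ _ _ _ _ _ _ (WD_conj_pow (S n) z) (WD_scal (RtoC (/ INR (S n))) (psi n) z _ _ (WD_der (psi n) z (proj1 (Hpsi n)))))].
           ++ reflexivity.
           ++ ring.
           ++ simpl pred. replace (psi n z) with (RtoC (INR (S n) * / INR (S n)) * psi n z)%C at 2 by (rewrite Rinv_r by exact i0; ring).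
              rewrite RtoC_mult. ring. }
        eapply WD_ext; [| | | apply (WD_minus F H z _ _ _ _ (D z) WH)]; [reflexivity | reflexivity | ring].
      * apply (Gr_ext _ (fun z => F z + RtoC (-(1)) * H z)%C); [intros z; unfold G; rewrite RtoC_opp; ring|].
        apply Gr_plus; [eapply GrB, HM | apply Gr_scal, GH].
    + intros z. rewrite Csum_S_l. unfold G, H. simpl Cpow at 1. ring.
Qed.

(** Growth of the first derivatives is recorded too, since Poisson summation uses a Lipschitz bound
    ([WDG_lipschitz]). *)
Definition WDG (c : R) (u : C -> C) : Prop :=
  exists p q, (forall z, WD u z (p z) (q z)) /\ Gr c u /\ Gr c p /\ Gr c q.

Lemma WDG_ext c u v : (forall z, u z = v z) -> WDG c u -> WDG c v.
Proof. intros E. replace v with u; [auto | apply functional_extensionality, E]. Qed.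
Lemma WDG_cont c u : WDG c u -> contC u.
Proof. intros [p [q [H _]]]. exact (WD_cont u p q H). Qed.
Lemma WDG_Gr c u : WDG c u -> Gr c u.
Proof. intros [p [q H]]. apply H. Qed.
Lemma WDG_plus c u v : WDG c u -> WDG c v -> WDG c (fun z => u z + v z)%C.
Proof.
  intros [p [q [D [G [Gp Gq]]]]] [p' [q' [D' [G' [Gp' Gq']]]]]. exists (fun z => p z + p' z)%C, (fun z => q z + q' z)%C.
  repeat split; auto using Gr_plus. intros z. apply WD_plus; auto.
Qed.
Lemma WDG_mult c c' u v : WDG c u -> WDG c' v -> WDG (c + c') (fun z => u z * v z)%C.
Proof.
  intros [p [q [D [G [Gp Gq]]]]] [p' [q' [D' [G' [Gp' Gq']]]]].
  exists (fun z => p z * v z + u z * p' z)%C, (fun z => q z * v z + u z * q' z)%C.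
  repeat split; auto using Gr_mult, Gr_plus. intros z. apply WD_mult; auto.
Qed.
Lemma WDG_le c c' u : c <= c' -> WDG c u -> WDG c' u.
Proof. intros L [p [q [D [G [Gp Gq]]]]]. exists p, q. eauto 8 using Gr_le. Qed.
Lemma WDG_entire c f : entireC f -> Gr c f -> WDG c f.
Proof.
  intros Hf G. exists (der f), (fun _ => RtoC 0). repeat split.
  - intros z. apply WD_der, Hf.
  - exact G.
  - apply Gr_der; assumption.
  - apply (Gr_ext _ (fun z => 0 * f z)%C); [intros; ring | apply Gr_scal, G].
Qed.
Lemma WDG_const c : WDG 0 (fun _ => c).
Proof. apply WDG_entire; [apply entireC_const | apply Gr_const]. Qed.
Lemma WDG_scal a c u : WDG c u -> WDG c (fun z => a * u z)%C.
Proof. intros H. rewrite <- (Rplus_0_l c). apply (WDG_mult 0 c (fun _ => a)); [apply WDG_const | exact H]. Qed.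
Lemma WDG_conj : WDG 0 Cconj.
Proof.
  exists (fun _ => RtoC 0), (fun _ => RtoC 1). repeat split; auto using Gr_conj, Gr_const. intros z. apply WD_conj.
Qed.
Lemma WDG_conj_mult c u : WDG c u -> WDG c (fun z => Cconj z * u z)%C.
Proof. intros H. rewrite <- (Rplus_0_l c). apply (WDG_mult 0 c Cconj); [apply WDG_conj | exact H]. Qed.
Lemma WDG_conj_pow k c u : WDG c u -> WDG c (fun z => Cconj z ^ k * u z)%C.
Proof.
  intros H. induction k; [apply (WDG_ext c u); [intros; simpl; ring | exact H]|].
  apply (WDG_ext c (fun z => Cconj z * (Cconj z ^ k * u z))%C); [intros; simpl; ring | apply WDG_conj_mult, IHk].
Qed.
Lemma WDG_Csum c n (u : nat -> C -> C) : 0 <= c \/ (exists v, WDG c v) -> (forall k, (k < n)%nat -> WDG c (u k)) -> WDG c (fun z => Csum n (fun k => u k z)).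
Proof.
  intros Z H. induction n.
  - destruct Z as [Z|[v Z]]; [apply (WDG_le 0); [exact Z | exact (WDG_const 0)]|].
    apply (WDG_ext c (fun z => 0 * v z)%C); [intros; simpl; ring | apply WDG_scal, Z].
  - cbn [Csum]. apply WDG_plus; [apply IHn; auto | apply H; lia].
Qed.

(** Half of the exponent c is spent on the growth constants and half of the rest on the bounded
    shift, which leaves e = -c/4. *)
Lemma WDG_lipschitz c u W : c < 0 -> 0 <= W -> WDG c u -> exists L e, 0 <= L /\ 0 < e /\
  forall z h, Cmod h <= W -> Cmod (u (z + h) - u z)%C <= L * exp (- e * Cmod z ^ 2) * Cmod h.
Proof.
  intros Hc HW [p [q [D [G [Gp Gq]]]]]. destruct (Gp (c / 2)) as [M1 [m1 B1]]; [lra|]. destruct (Gq (c / 2)) as [M2 [m2 B2]]; [lra|].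
  destruct (exp_sq_shift (c / 2) (- c / 4) W ltac:(lra) HW) as [M3 [m3 B3]].
  exists (2 * ((M1 + M2) * M3)), (- c / 4). split; [|split; [lra|]].
  { apply Rmult_le_pos; [lra | apply Rmult_le_pos; lra]. }
  intros z h Hh.
  assert (V := mean_value (fun z' => u (z + z'))%C (fun z' => p (z + z'))%C (fun z' => q (z + z'))%C h ((M1 + M2) * (M3 * exp (- (- c / 4) * Cmod z ^ 2)))).
  cbv beta in V. replace (z + 0)%C with z in V by ring. eapply Rle_trans; [apply V|].
  - intros z'. eapply WD_ext; [| | | apply (WD_chain u (fun z' => z + z')%C z' _ _ _ _ (D (z + z')%C) (WD_plus _ _ _ _ _ _ _ (WD_const z z') (WD_id z')))].
    + reflexivity.
    + csolve.
    + csolve.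
  - intros t Ht. assert (Lt : Cmod (RtoC t * h) <= W) by (rewrite Cmod_mult, Cmod_R, Rabs_pos_eq by lra; assert (x := Cmod_ge_0 h); nra).
    specialize (B1 (z + RtoC t * h)%C). specialize (B2 (z + RtoC t * h)%C). specialize (B3 z _ Lt).
    replace (c / 2 + - c / 4) with (- (- c / 4)) in B3 by field.
    assert (x := exp_pos (c / 2 * Cmod (z + RtoC t * h) ^ 2)). nra.
  - right. ring.
Qed.

(** k-th derivative of exp(-pi t) at t = conj(z) (z + a): a Gaussian times half of a character,
    arranged so that [g_WD] holds with this a. *)
Definition gg (a : C) (k : nat) (z : C) : C := (RtoC (- PI) ^ k * cexp (RtoC (- PI) * (Cconj z * (z + a))))%C.

Lemma gg_WD a k z : WD (gg a k) z (Cconj z * gg a (S k) z) ((z + a) * gg a (S k) z).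
Proof.
  eapply WD_ext; [| | | apply (WD_scal (RtoC (- PI) ^ k) _ z _ _ (WD_cexp_comp _ z _ _ (WD_scal (RtoC (- PI)) _ z _ _
    (WD_mult Cconj (fun z => z + a)%C z _ _ _ _ (WD_conj z) (WD_plus _ _ _ _ _ _ _ (WD_id z) (WD_const a z))))))].
  - reflexivity.
  - unfold gg. simpl Cpow. ring.
  - unfold gg. simpl Cpow. ring.
Qed.
Lemma gg_Gr a k : Gr (- PI) (gg a k).
Proof.
  apply (Gr_ext _ (fun z => RtoC (- PI) ^ k * (RtoC (exp (- PI * Cmod z ^ 2)) * cexp (RtoC (- PI) * (Cconj z * a))))%C).
  - intros z. unfold gg. f_equal. rewrite <- cexp_R, <- cexp_plus. f_equal. rewrite Cmod_sqr2. csolve.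
  - apply Gr_scal, (Gr_le (- PI + 0)); [lra|]. apply Gr_mult.
    + intros k' L. exists 1. split; [lra|]. intros z. rewrite Cmod_R, Rabs_pos_eq by (left; apply exp_pos). rewrite Rmult_1_l.
      apply exp_le, Rmult_le_compat_r; [apply pow2_ge_0 | lra].
    + apply (Gr_cexp _ (PI * Cmod a)). intros z. assert (P := PI_RGT_0). eapply Rle_trans; [apply fst_le_Cmod|].
      rewrite !Cmod_mult, Cmod_R, Rabs_Ropp, Rabs_pos_eq, Cmod_conj by lra. right. ring.
Qed.
Lemma gg_WDG a k : WDG (- PI) (gg a k).
Proof.
  exists (fun z => Cconj z * gg a (S k) z)%C, (fun z => (z + a) * gg a (S k) z)%C. split; [intros; apply gg_WD|].
  split; [apply gg_Gr|]. split; apply (Gr_le (0 + - PI)); try lra; (apply Gr_mult; [|apply gg_Gr]); [apply Gr_conj | apply (Gr_plus 0 (fun z => z)); [apply Gr_id | apply Gr_const]].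
Qed.
(** exp(-pi conj(z) a) is a constant for d/dz and leaves all the derivatives in [TT]. *)
Lemma TT_twist a i k h z : TT (gg a) i k h z = (cexp (RtoC (- PI) * (Cconj z * a)) * TT (gg 0) i k h z)%C.
Proof.
  revert k h. induction i; intros k h; simpl; [|rewrite !IHi; ring]. unfold gg.
  replace (RtoC (- PI) * (Cconj z * (z + a)))%C with (RtoC (- PI) * (Cconj z * a) + RtoC (- PI) * (Cconj z * (z + 0)))%C by ring. rewrite cexp_plus. ring.
Qed.
Lemma kap_twist a n E z : kap (gg a) n E z = (cexp (RtoC (- PI) * (Cconj z * a)) * kap (gg 0) n E z)%C.
Proof.
  unfold kap. rewrite <- Csum_scal. apply Csum_ext. intros i _. rewrite TT_twist. ring.
Qed.
Lemma TT_WDG a c i k h : entireC h -> Gr c h -> WDG (c + - PI) (TT (gg a) i k h).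
Proof.
  revert k h. induction i; intros k h Hh G.
  - apply (WDG_mult c (- PI) h); [apply WDG_entire; assumption | apply gg_WDG].
  - apply WDG_plus; [apply IHi; [apply entireC_der, Hh | apply Gr_der; assumption] | apply WDG_conj_mult, IHi; assumption].
Qed.
Lemma kap_WDG a n E c : entireC E -> Gr c E -> WDG (c + - PI) (kap (gg a) n E).
Proof.
  intros HE G. apply (WDG_Csum _ n (fun i z => RtoC (/ INR (fact i)) * TT (gg a) i n (fun z => z ^ i * E z)%C z)%C).
  - right. eexists. apply (TT_WDG a c 0 0 E HE G).
  - intros i _. apply WDG_scal, TT_WDG.
    + apply entireC_mult; [apply entireC_pow, entireC_id | exact HE].
    + rewrite <- (Rplus_0_l c). apply Gr_mult; [apply (Gr_pow (fun z => z)), Gr_id | exact G].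
Qed.

Lemma Null_Csum w1 w2 n (u : nat -> C -> C) : (forall k, (k < n)%nat -> Null w1 w2 (u k)) -> Null w1 w2 (fun z => Csum n (fun k => u k z)).
Proof. intros H. induction n; [apply Null_0|]. cbn [Csum]. apply Null_plus; [apply IHn; auto | apply H; lia]. Qed.

Section Gauss.
Variables (w1 w2 : C) (n : nat) (E : C -> C) (kE : R).
Hypothesis det : snd (Cconj w1 * w2)%C <> 0.
Hypotheses (HE : entireC E) (GE : Gr kE E) (LE : kE < PI / 2).
Variable phi : nat -> C -> C.
Hypothesis Hphi : forall k, entireC (phi k) /\ Gr (PI / 2) (phi k).
Let F z := Csum n (fun k => Cconj z ^ k * phi k z)%C.

Let EG c f := entireC f /\ Gr c f.
(** Discharges the hypotheses of the abstract section with growth classes: F has exponent pi/2, E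
    has kE and the weight -pi, so products have the negative exponent pi/2 + kE - pi. *)
Ltac gauss_side :=
  [> exact det | intros; apply gg_WD | intros; eapply WDG_cont, gg_WDG | intros u v Huv; exact (Gr_ext _ u v Huv)
   | intros u Hu; apply (Gr_decays (PI / 2 + kE + - PI)); [lra | exact Hu] | intros; apply Gr_plus; assumption
   | intros u Hu; rewrite <- (Rplus_0_l (PI / 2 + kE + - PI)); apply (Gr_mult 0 _ Cconj u); [apply Gr_conj | exact Hu]
   | intros ? ? [_ Gf] _; apply Gr_mult; [exact Gf | apply gg_Gr]
   | intros u v Huv [a1 a2]; split; [exact (entireC_ext u v Huv a1) | exact (Gr_ext _ u v Huv a2)]
   | intros f [a1 _]; exact a1 | intros c; split; [apply entireC_const | apply (Gr_le 0); [lra |apply Gr_const]]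
   | intros c f [a1 a2]; split; [apply entireC_scal, a1 | apply Gr_scal, a2]
   | intros u v [a1 a2] [a3 a4]; split; [apply entireC_plus; assumption | apply Gr_plus; assumption]
   | intros f [a1 a2]; split; [apply entireC_der, a1 | apply Gr_der; assumption]
   | intros f h b [a1 a2] Hh Eh; split; [exact Hh | exact (Gr_div _ f h b Hh Eh a2)]
   | intros f [a1 _]; exact a1 | intros f [a1 _]; exact a1
   | intros f [a1 a2]; split; [apply entireC_der, a1 | apply Gr_der; assumption]
   | intros f [a1 a2]; split; [apply entireC_der, a1 | apply Gr_der; assumption]
   | intros f [a1 a2]; split; [apply entireC_mult; [apply entireC_id | exact a1] | rewrite <- (Rplus_0_l kE); apply (Gr_mult 0 _ (fun z => z)); [apply Gr_id | exact a2]]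
   | intros f h [a1 a2] [a3 a4]; split; [apply entireC_mult; assumption | apply Gr_mult; assumption] | .. ].

Lemma gauss_repr : (0 <= kE) -> Van n (fun z => E z - 1)%C 0%C -> Null w1 w2 (fun z => F z * kap (gg 0) n E z - F 0%C * gg 0 n z)%C.
Proof.
  intros kE0 V. assert (P := PI_RGT_0).
  assert (N : Null w1 w2 (fun z => Csum n (fun k => Cconj z ^ k * (phi k z * kap (gg 0) n E z) - (match k with O => phi k 0 | _ => 0 end) * gg 0 n z)%C)).
  { apply (Null_Csum w1 w2 n (fun k z => Cconj z ^ k * (phi k z * kap (gg 0) n E z) - (match k with O => phi k 0 | _ => 0 end) * gg 0 n z)%C). intros k Hk.
    refine (kap_repr w1 w2 0 (2 * n) (gg 0) (Gr (PI / 2 + kE + - PI)) (EG (PI / 2 + kE)) (EG (PI / 2)) (EG kE) _ _ _ _ _ _ _ _ _ _ _ _ _ _ _ _ _ _ _ _ _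
      n k (phi k) E eq_refl (Hphi k) (conj HE GE) _ Hk V); gauss_side; lia. }
  eapply Null_ext; [|exact N]. intros z. cbv beta. unfold F.
  assert (Q : forall m, Csum m (fun k => Cconj z ^ k * (phi k z * kap (gg 0) n E z) - (match k with O => phi k 0 | _ => 0 end) * gg 0 n z)%C =
    (Csum m (fun k => Cconj z ^ k * phi k z) * kap (gg 0) n E z - Csum m (fun k => Cconj 0 ^ k * phi k 0) * gg 0 n z)%C).
  { induction m; cbn [Csum]; [ring|]. rewrite IHm. destruct m; simpl; [ring|]. replace (Cconj 0) with (RtoC 0) by csolve. ring. }
  apply Q.
Qed.
(** exp(pi conj(a) z) is entire with growth exponent 0 and joins each [phi k], while exp(-pi conj(z)
    a) turns [gg 0] into [gg a], for which the zero of E at -a makes [kap_null] applicable. *)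
Lemma gauss_null a : 0 <= kE -> Van n E (- a)%C ->
  Null w1 w2 (fun z => F z * kap (gg 0) n E z * cexp (RtoC PI * (Cconj a * z - Cconj z * a)))%C.
Proof.
  intros kE0 V. assert (P := PI_RGT_0).
  apply (Null_ext w1 w2 (fun z => Csum n (fun k => Cconj z ^ k * ((phi k z * cexp (RtoC PI * (Cconj a * z))) * kap (gg a) n E z))%C)).
  - intros z. rewrite kap_twist. unfold F.
    replace (cexp (RtoC PI * (Cconj a * z - Cconj z * a))) with (cexp (RtoC PI * (Cconj a * z)) * cexp (RtoC (- PI) * (Cconj z * a)))%C
      by (rewrite <- cexp_plus; f_equal; rewrite RtoC_opp; ring).
    transitivity ((cexp (RtoC PI * (Cconj a * z)) * cexp (RtoC (- PI) * (Cconj z * a)) * kap (gg 0) n E z) * Csum n (fun k => Cconj z ^ k * phi k z))%C; [|ring].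
    rewrite <- Csum_scal. apply Csum_ext. intros k _. ring.
  - apply (Null_Csum w1 w2 n (fun k z => Cconj z ^ k * ((phi k z * cexp (RtoC PI * (Cconj a * z))) * kap (gg a) n E z))%C). intros k Hk.
    refine (kap_null w1 w2 a (2 * n) (gg a) (Gr (PI / 2 + kE + - PI)) (EG (PI / 2 + kE)) (EG (PI / 2)) (EG kE) _ _ _ _ _ _ _ _ _ _ _ _ _ _ _ _ _ _ _ _ _
      n k (fun z => phi k z * cexp (RtoC PI * (Cconj a * z)))%C E _ (conj HE GE) _ Hk V); gauss_side; [|lia].
    destruct (Hphi k) as [h1 h2]. split.
    + apply entireC_mult; [exact h1 | apply entireC_cexp, entireC_scal, entireC_scal, entireC_id].
    + rewrite <- (Rplus_0_r (PI / 2)). apply Gr_mult; [exact h2|]. apply (Gr_cexp _ (PI * Cmod a)). intros z.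
      eapply Rle_trans; [apply fst_le_Cmod|]. rewrite !Cmod_mult, Cmod_R, Rabs_pos_eq, Cmod_conj by lra. right. ring.
Qed.
End Gauss.

(** * Poisson summation *)

Definition cont2C (h : R -> R -> C) : Prop := cont2 (fun s t => fst (h s t)) /\ cont2 (fun s t => snd (h s t)).
Definition CI2 (h : R -> R -> C) (a b : R) : C := (II (fun s t => fst (h s t)) a b a b, II (fun s t => snd (h s t)) a b a b).

Lemma cont2C_mult h h' : cont2C h -> cont2C h' -> cont2C (fun s t => h s t * h' s t)%C.
Proof.
  intros [a b] [c d]. split; simpl.
  - apply (cont2_ext (fun s t => fst (h s t) * fst (h' s t) + (-1) * (snd (h s t) * snd (h' s t)))); [intros; ring|].
    apply cont2_plus; [|apply cont2_scal]; apply cont2_mult; assumption.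
  - apply cont2_plus; apply cont2_mult; assumption.
Qed.
Lemma cont2C_plus h h' : cont2C h -> cont2C h' -> cont2C (fun s t => h s t + h' s t)%C.
Proof. intros [a b] [c d]. split; simpl; apply cont2_plus; assumption. Qed.
Lemma cont2C_prod f g : contRC f -> contRC g -> cont2C (fun s t => f s * g t)%C.
Proof.
  intros Hf Hg. apply (cont2C_mult (fun s _ => f s) (fun _ t => g t)); split.
  - apply (cont2_x (fun s => fst (f s))). apply Hf.
  - apply (cont2_x (fun s => snd (f s))). apply Hf.
  - apply (cont2_y (fun s => fst (g s))). apply Hg.
  - apply (cont2_y (fun s => snd (g s))). apply Hg.
Qed.
Lemma cont2C_scal c h : cont2C h -> cont2C (fun s t => c * h s t)%C.
Proof. apply (cont2C_mult (fun _ _ => c)). split; apply cont2_const. Qed.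
Lemma CI2_ext h h' a b : (forall s t, h s t = h' s t) -> CI2 h a b = CI2 h' a b.
Proof. intros E. unfold CI2. f_equal; apply II_ext; intros; rewrite E; reflexivity. Qed.
Lemma CI2_plus h h' a b : cont2C h -> cont2C h' -> CI2 (fun s t => h s t + h' s t)%C a b = (CI2 h a b + CI2 h' a b)%C.
Proof. intros [c d] [c' d']. apply C_ext; simpl; [apply (II_plus (fun s t => fst (h s t))) | apply (II_plus (fun s t => snd (h s t)))]; assumption. Qed.
Lemma CI2_scal k h a b : cont2C h -> CI2 (fun s t => k * h s t)%C a b = (k * CI2 h a b)%C.
Proof.
  intros [c d]. apply C_ext; simpl.
  - rewrite (II_ext _ (fun s t => fst k * fst (h s t) + (- snd k) * snd (h s t))) by (intros; ring).
    rewrite II_plus by (apply cont2_scal; assumption). rewrite !II_scal by assumption. ring.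
  - rewrite (II_plus (fun s t => fst k * snd (h s t)) (fun s t => snd k * fst (h s t))) by (apply cont2_scal; assumption). rewrite !II_scal by assumption. ring.
Qed.
Lemma II_prod (f g : R -> R) a b c d : (forall s, continuous f s) -> (forall s, continuous g s) ->
  II (fun s t => f s * g t) a b c d = RInt f a b * RInt g c d.
Proof.
  intros Hf Hg. unfold II. rewrite (RInt_ext _ (fun s => RInt g c d * f s)).
  - transitivity (RInt g c d * RInt f a b); [|ring]. apply (RInt_scal (V:=R_CompleteNormedModule) f a b (RInt g c d)).
    apply (ex_RInt_continuous (V:=R_CompleteNormedModule)). intros; apply Hf.
  - intros s _. transitivity (f s * RInt g c d); [|apply Rmult_comm]. apply (RInt_scal (V:=R_CompleteNormedModule) g c d (f s)).
    apply (ex_RInt_continuous (V:=R_CompleteNormedModule)). intros; apply Hg.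
Qed.
Lemma CI2_prod f g a b : contRC f -> contRC g -> CI2 (fun s t => f s * g t)%C a b = (CI f a b * CI g a b)%C.
Proof.
  intros Hf Hg. assert (Hx := fun s => proj1 (Hf s)). assert (Hy := fun s => proj2 (Hf s)).
  assert (Gx := fun s => proj1 (Hg s)). assert (Gy := fun s => proj2 (Hg s)).
  assert (K : forall p q : R -> R, (forall s, continuous p s) -> (forall s, continuous q s) -> cont2 (fun s t => p s * q t)).
  { intros p q hp hq. apply (cont2_mult (fun s _ => p s) (fun _ t => q t)); [apply cont2_x | apply cont2_y]; assumption. }
  apply C_ext; simpl.
  - rewrite (II_ext _ (fun s t => fst (f s) * fst (g t) + (-1) * (snd (f s) * snd (g t)))) by (intros; ring).
    rewrite II_plus, II_scal, !(II_prod _ _ a b a b); auto using cont2_scal. unfold CI; simpl. ring.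
  - rewrite (II_plus (fun s t => fst (f s) * snd (g t)) (fun s t => snd (f s) * fst (g t))), !(II_prod _ _ a b a b); auto.
Qed.

Lemma RInt_cells (f : R -> R) x0 m : (forall s, continuous f s) ->
  RInt f x0 (x0 + INR m) = Rsum m (fun i => RInt (fun s => f (s + (x0 + / 2 + INR i))) (- / 2) (/ 2)).
Proof.
  intros H. assert (Ex : forall a b, ex_RInt f a b) by (intros; apply (ex_RInt_continuous (V:=R_CompleteNormedModule)); intros; apply H).
  induction m.
  - simpl. rewrite Rplus_0_r. apply (RInt_point (V:=R_CompleteNormedModule)).
  - cbn [Rsum]. rewrite <- IHm, S_INR. rewrite <- (RInt_Chasles (V:=R_CompleteNormedModule) f x0 (x0 + INR m)) by apply Ex.
    unfold plus; simpl. f_equal. rewrite (RInt_shift f) by exact H. f_equal; field.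
Qed.
Lemma II_Rsum m (u : nat -> R -> R -> R) a b c d : (forall i, (i < m)%nat -> cont2 (u i)) ->
  cont2 (fun s t => Rsum m (fun i => u i s t)) /\ II (fun s t => Rsum m (fun i => u i s t)) a b c d = Rsum m (fun i => II (u i) a b c d).
Proof.
  intros H. induction m; cbn [Rsum].
  - split; [apply cont2_const|]. rewrite II_const. ring.
  - destruct IHm as [Hc E]; [auto|]. split; [apply cont2_plus; auto|]. rewrite II_plus, E; auto.
Qed.
(** The half-integer radius makes the square the exact union of the unit cells centred at the
    integer points of the box. *)
Lemma II_cells (h : R -> R -> R) N : cont2 h ->
  II h (- (INR N + / 2)) (INR N + / 2) (- (INR N + / 2)) (INR N + / 2) =
  BS (fun k l => II (fun s t => h (s + IZR k) (t + IZR l)) (- / 2) (/ 2) (- / 2) (/ 2)) N.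
Proof.
  intros H. set (r := INR N + / 2). assert (Er : r = - r + INR (2 * N + 1)) by (unfold r; rewrite plus_INR, mult_INR; simpl; field).
  assert (Ei : forall i, - r + / 2 + INR i = IZR (Z.of_nat i - Z.of_nat N)) by (intros i; unfold r; rewrite minus_IZR, <- !INR_IZR_INZ; ring).
  assert (Hs : forall p q, cont2 (fun s t => h (s + p) (t + q))).
  { intros p q x y eps. destruct (H (x + p) (y + q) eps) as [d Hd]. exists d. intros u v Hu Hv. apply Hd; [replace (u + p - (x + p)) with (u - x) by ring | replace (v + q - (y + q)) with (v - y) by ring]; assumption. }
  unfold II at 1. rewrite Er at 2. rewrite (RInt_cells (fun x => RInt (h x) (- r) r)) by (intros; apply cont2_RInt, H).
  unfold BS. apply Rsum_ext. intros i Hi. rewrite Ei.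
  rewrite <- (proj2 (II_Rsum (2 * N + 1) (fun j s t => h (s + IZR (Z.of_nat i - Z.of_nat N)) (t + IZR (Z.of_nat j - Z.of_nat N))) _ _ _ _ (fun j _ => Hs _ _))).
  unfold II. apply RInt_ext. intros s _.
  assert (E := RInt_cells (h (s + IZR (Z.of_nat i - Z.of_nat N))) (- r) (2 * N + 1) ltac:(intros; apply cont2_section, H)).
  rewrite <- Er in E. rewrite E.
  assert (Q : forall m, ex_RInt (fun t => Rsum m (fun j => h (s + IZR (Z.of_nat i - Z.of_nat N)) (t + IZR (Z.of_nat j - Z.of_nat N)))) (- / 2) (/ 2) /\
    Rsum m (fun j => RInt (fun t => h (s + IZR (Z.of_nat i - Z.of_nat N)) (t + (- r + / 2 + INR j))) (- / 2) (/ 2)) =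
    RInt (fun t => Rsum m (fun j => h (s + IZR (Z.of_nat i - Z.of_nat N)) (t + IZR (Z.of_nat j - Z.of_nat N)))) (- / 2) (/ 2)); [|apply Q].
  induction m as [|m [X IH]]; cbn [Rsum].
  - split; [apply ex_RInt_const|]. rewrite (RInt_const (V:=R_CompleteNormedModule)). unfold scal; simpl; unfold mult; simpl. ring.
  - assert (X2 : ex_RInt (fun t => h (s + IZR (Z.of_nat i - Z.of_nat N)) (t + IZR (Z.of_nat m - Z.of_nat N))) (- / 2) (/ 2)) by (apply (cont2_ex_RInt _ s _ _ (Hs _ _))).
    split; [apply (ex_RInt_plus (V:=R_NormedModule)); assumption|].
    rewrite (RInt_plus (V:=R_CompleteNormedModule)) by assumption. rewrite <- IH, Ei. reflexivity.
Qed.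

Lemma contCR_fst u : contC u -> contCR (fun z => fst (u z)).
Proof.
  intros H z eps He. destruct (H z eps He) as [d [Hd B]]. exists d. split; [exact Hd|]. intros h Hh. eapply Rle_lt_trans; [|apply (B h Hh)].
  rewrite <- RtoC_minus, Cmod_R. apply (fst_le_Cmod (u (z + h) - u z)%C).
Qed.
Lemma contCR_snd u : contC u -> contCR (fun z => snd (u z)).
Proof.
  intros H z eps He. destruct (H z eps He) as [d [Hd B]]. exists d. split; [exact Hd|]. intros h Hh. eapply Rle_lt_trans; [|apply (B h Hh)].
  rewrite <- RtoC_minus, Cmod_R. apply (snd_le_Cmod (u (z + h) - u z)%C).
Qed.

Lemma BS_abs_le u b N : (forall k l, Rabs (u k l) <= b k l) -> Rabs (BS u N) <= BS b N.
Proof.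
  intros H. apply Rabs_le. split.
  - rewrite <- (Rmult_1_l (BS b N)), <- Ropp_mult_distr_l_reverse, <- BS_scal. apply BS_le. intros k l. specialize (H k l).
    apply Rabs_le_between in H. lra.
  - apply BS_le. intros k l. specialize (H k l). apply Rabs_le_between in H. lra.
Qed.

Section Poisson.
Variables (w1 w2 : C) (U G : C -> C).
Hypothesis det : snd (Cconj w1 * w2)%C <> 0.
Hypotheses (CU : contC U) (CG : contC G).
Hypothesis HUG : Null w1 w2 (fun z => U z - G z)%C.
Variable w : C.
Hypothesis HUc : forall k l, (k <> 0 \/ l <> 0)%Z -> forall eta, 0 < eta -> exists R0, forall r, R0 <= r ->
  Cmod (CI2 (fun s t => U (lp w1 w2 w s t) * (chi k s * chi l t))%C (- r) r) <= eta.

Let Ul s t := U (lp w1 w2 w s t).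
Let Gl s t := G (lp w1 w2 w s t).
Lemma cont2C_lp u : contC u -> cont2C (fun s t => u (lp w1 w2 w s t)).
Proof. intros H. split; [apply cont2_fst | apply cont2_snd]; exact H. Qed.

(** Against a trigonometric polynomial only the constant frequency of [rho] survives, and there U
    may be replaced by G. The property is linear in [rho], so it passes from characters to powers of
    the kernel. *)
Definition KernelMean (rho : R -> R -> C) : Prop := cont2C rho /\ forall eta, 0 < eta -> exists R0, forall r, R0 <= r ->
  Cmod (CI2 (fun s t => Ul s t * rho s t)%C (- r) r - CI2 rho (- / 2) (/ 2) * CI2 Gl (- r) r)%C <= eta.

Lemma KernelMean_ext rho rho' : (forall s t, rho s t = rho' s t) -> KernelMean rho -> KernelMean rho'.
Proof.
  intros E. replace rho' with rho; [auto|]. apply functional_extensionality; intros s. apply functional_extensionality, E.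
Qed.
Lemma KernelMean_plus rho rho' : KernelMean rho -> KernelMean rho' -> KernelMean (fun s t => rho s t + rho' s t)%C.
Proof.
  intros [c H] [c' H']. split; [apply cont2C_plus; assumption|]. intros eta He.
  destruct (H (eta / 2)) as [r1 h1]; [lra|]. destruct (H' (eta / 2)) as [r2 h2]; [lra|]. exists (Rmax r1 r2). intros r Hr.
  specialize (h1 r (Rle_trans _ _ _ (Rmax_l _ _) Hr)). specialize (h2 r (Rle_trans _ _ _ (Rmax_r _ _) Hr)).
  assert (CUl := cont2C_lp U CU). rewrite (CI2_ext _ (fun s t => Ul s t * rho s t + Ul s t * rho' s t)%C) by (intros; ring).
  rewrite !CI2_plus by auto using cont2C_mult.
  match goal with |- Cmod ?e <= _ => replace e with
   ((CI2 (fun s t => Ul s t * rho s t)%C (- r) r - CI2 rho (- / 2) (/ 2) * CI2 Gl (- r) r) +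
    (CI2 (fun s t => Ul s t * rho' s t)%C (- r) r - CI2 rho' (- / 2) (/ 2) * CI2 Gl (- r) r))%C by ring end.
  eapply Rle_trans; [apply Cmod_triangle|]. lra.
Qed.
Lemma KernelMean_scal c rho : KernelMean rho -> KernelMean (fun s t => c * rho s t)%C.
Proof.
  intros [cr H]. split; [apply cont2C_scal; assumption|]. intros eta He. assert (c0 := Cmod_ge_0 c).
  destruct (H (eta / (Cmod c + 1))) as [r1 h1]; [apply Rdiv_lt_0_compat; lra|]. exists r1. intros r Hr. specialize (h1 r Hr).
  assert (CUl := cont2C_lp U CU). rewrite (CI2_ext _ (fun s t => c * (Ul s t * rho s t))%C) by (intros; ring).
  rewrite !CI2_scal by auto using cont2C_mult.
  match goal with |- Cmod ?e <= _ => replace e with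
   (c * (CI2 (fun s t => Ul s t * rho s t)%C (- r) r - CI2 rho (- / 2) (/ 2) * CI2 Gl (- r) r))%C by ring end.
  rewrite Cmod_mult. apply (proj2 (Rle_div_r _ _ (Cmod c + 1) ltac:(lra))) in h1.
  assert (x := Cmod_ge_0 (CI2 (fun s t => Ul s t * rho s t)%C (- r) r - CI2 rho (- / 2) (/ 2) * CI2 Gl (- r) r)). nra.
Qed.
Lemma KernelMean_chi k l : KernelMean (fun s t => chi k s * chi l t)%C.
Proof.
  split; [apply cont2C_prod; apply contRC_chi|]. intros eta He. assert (E : / 2 = - / 2 + 1) by field.
  destruct (classic (k <> 0 \/ l <> 0)%Z) as [N|N].
  - destruct (HUc k l N eta He) as [r0 h]. exists r0. intros r Hr. rewrite CI2_prod by apply contRC_chi.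
    replace (CI (chi k) (- / 2) (/ 2) * CI (chi l) (- / 2) (/ 2))%C with (RtoC 0).
    + replace (CI2 (fun s t => Ul s t * (chi k s * chi l t))%C (- r) r - 0 * CI2 Gl (- r) r)%C with (CI2 (fun s t => Ul s t * (chi k s * chi l t))%C (- r) r) by ring. apply h, Hr.
    + destruct N as [N|N].
      * rewrite E at 2. rewrite (CI_chi k N). ring.
      * rewrite E at 4. rewrite (CI_chi l N). ring.
  - assert (k = 0%Z /\ l = 0%Z) as [-> ->] by (split; apply NNPP; tauto).
    destruct HUG as [_ Nl]. destruct (Nl w eta He) as [r0 h]. exists r0. intros r Hr. specialize (h r Hr).
    rewrite CI2_prod by apply contRC_chi.
    replace (CI (chi 0) (- / 2) (/ 2)) with (RtoC 1) by (rewrite (CI_ext _ (fun _ => RtoC 1)) by (intros; apply chi_0); rewrite CI_const; apply C_ext; simpl; field).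
    eapply Rle_trans; [|exact h]. right. f_equal.
    transitivity (CI2 Ul (- r) r - CI2 Gl (- r) r)%C.
    + rewrite (CI2_ext (fun s t => Ul s t * (chi 0 s * chi 0 t))%C Ul) by (intros; rewrite !chi_0; ring). ring.
    + transitivity (CI2 (fun s t => Ul s t + (- RtoC 1) * Gl s t)%C (- r) r).
      * assert (a := cont2C_lp U CU). assert (b := cont2C_lp G CG). rewrite CI2_plus, CI2_scal; auto using cont2C_scal. ring.
      * unfold CIC, IC. apply CI2_ext. intros s t. unfold Ul, Gl. ring.
Qed.
Lemma KernelMean_kernel M M' l : KernelMean (fun s t => RtoC (Kr s ^ M) * (RtoC (Kr t ^ M') * chi l t))%C.
Proof.
  assert (A : forall M k l, KernelMean (fun s t => (RtoC (Kr s ^ M) * chi k s) * chi l t)%C).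
  { clear M M' l. induction M; intros k l; [apply (KernelMean_ext (fun s t => chi k s * chi l t)%C); [intros; simpl; ring | apply KernelMean_chi]|].
    apply (KernelMean_ext (fun s t => RtoC (/2) * ((RtoC (Kr s ^ M) * chi k s) * chi l t) + (RtoC (/4) * ((RtoC (Kr s ^ M) * chi (k + 1) s) * chi l t) +
       RtoC (/4) * ((RtoC (Kr s ^ M) * chi (k + -1) s) * chi l t)))%C); [|auto using KernelMean_plus, KernelMean_scal].
    intros s t. rewrite !chi_plus. change (Kr s ^ S M) with (Kr s * Kr s ^ M). rewrite RtoC_mult, Kr_chi.
    replace (/4) with (/2 * /2) by field. rewrite RtoC_mult. ring. }
  revert l. induction M'; intros l.
  - apply (KernelMean_ext (fun s t => (RtoC (Kr s ^ M) * chi 0 s) * chi l t)%C); [intros; rewrite chi_0; simpl; ring | apply A].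
  - apply (KernelMean_ext (fun s t => RtoC (/2) * (RtoC (Kr s ^ M) * (RtoC (Kr t ^ M') * chi l t)) + (RtoC (/4) * (RtoC (Kr s ^ M) * (RtoC (Kr t ^ M') * chi (l + 1) t)) +
       RtoC (/4) * (RtoC (Kr s ^ M) * (RtoC (Kr t ^ M') * chi (l + -1) t))))%C); [|auto using KernelMean_plus, KernelMean_scal].
    intros s t. rewrite !chi_plus. change (Kr t ^ S M') with (Kr t * Kr t ^ M'). rewrite RtoC_mult, Kr_chi.
    replace (/4) with (/2 * /2) by field. rewrite RtoC_mult. ring.
Qed.

Variables (L e : R).
Hypotheses (L0 : 0 <= L) (e0 : 0 < e).
Hypothesis HL : forall z h, Cmod h <= Cmod w1 + Cmod w2 -> Cmod (U (z + h) - U z)%C <= L * exp (- e * Cmod z ^ 2) * Cmod h.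

Lemma Kr_period s k : Kr (s + IZR k) = Kr s.
Proof.
  apply RtoC_inj. rewrite !Kr_chi, !chi_period. reflexivity.
Qed.

(* The lattice sum is compared with its average against the kernel [Kr s ^ M * Kr t ^ M] over the fundamental cell. *)
Lemma poisson_component (f : C -> R) (g : R -> R) : contCR f ->
  (forall z h, Rabs (f (z + h)%C - f z) <= Cmod (U (z + h) - U z)%C) ->
  (forall M eta, 0 < eta -> exists R0, forall r, R0 <= r ->
    Rabs (II (fun s t => f (lp w1 w2 w s t) * (Kr s ^ M * Kr t ^ M)) (- r) r (- r) r - mK M ^ 2 * g r) <= eta) ->
  forall eta, 0 < eta -> exists N0, forall N, (N0 <= N)%nat ->
    Rabs (BS (fun k l => f (w + lat w1 w2 k l)%C) N - g (INR N + / 2)) <= eta.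
Proof.
  intros Cf Hf Hg eta He. set (W := Cmod w1 + Cmod w2). assert (W0 : 0 <= W) by (unfold W; assert (x := Cmod_ge_0 w1); assert (y := Cmod_ge_0 w2); lra).
  set (e' := Rmin e 1). assert (e1 : 0 < e') by (apply Rmin_glb_lt; lra).
  destruct (lattice_gauss w1 w2 det) as [Cg [Cg0 HG]]. set (La := L * W * (Cg / e')).
  assert (La0 : 0 <= La) by (repeat apply Rmult_le_pos; try lra; left; apply Rinv_0_lt_compat, e1).
  (* [La] bounds the Lipschitz constants summed over the whole lattice; the first moment of the
     kernel is made small against it, the 4 leaving eta/2 for both coordinates together. *)
  destruct (kernel_concentrates (eta / (4 * (La + 1)))) as [M HM]; [apply Rdiv_lt_0_compat; lra|].
  assert (mM := mK_pos M). set (m2 := mK M ^ 2). assert (m2p : 0 < m2) by (apply pow_lt, mM).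
  destruct (Hg M (eta / 2 * m2)) as [R0 HR0]; [apply Rmult_lt_0_compat; lra|].
  destruct (INR_unbounded R0) as [N0 HN0]. exists N0. intros N HN. apply le_INR in HN. specialize (HR0 (INR N + / 2) ltac:(lra)).
  set (h := fun s t => f (lp w1 w2 w s t) * (Kr s ^ M * Kr t ^ M)).
  assert (CK : cont2 (fun s t => Kr s ^ M * Kr t ^ M)).
  { apply (cont2_mult (fun s _ => Kr s ^ M) (fun _ t => Kr t ^ M)); [apply cont2_x | apply cont2_y]; apply Kr_pow_cont. }
  assert (Cfl : forall w', cont2 (fun s t => f (lp w1 w2 w' s t))) by (intros w'; apply (cont2_fst w1 w2 (fun z => RtoC (f z)) w'), Cf).
  fold h in HR0. rewrite (II_cells h N) in HR0 by (apply cont2_mult; [apply Cfl | exact CK]).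
  assert (Cell : forall k l, Rabs (II (fun s t => h (s + IZR k) (t + IZR l)) (- / 2) (/ 2) (- / 2) (/ 2) - m2 * f (w + lat w1 w2 k l)%C) <=
    L * W * exp (- e' * Cmod (lat w1 w2 k l - - w)%C ^ 2) * (2 * (eta / (4 * (La + 1)) * m2))).
  { intros k l. set (z0 := (w + lat w1 w2 k l)%C).
    assert (Em : II (fun s t => Kr s ^ M * Kr t ^ M) (- / 2) (/ 2) (- / 2) (/ 2) = m2).
    { rewrite (II_prod (fun s => Kr s ^ M) (fun s => Kr s ^ M)) by apply Kr_pow_cont. unfold m2, mK. ring. }
    rewrite (II_ext _ (fun s t => f (lp w1 w2 z0 s t) * (Kr s ^ M * Kr t ^ M))).
    2:{ intros s t _ _. unfold h. rewrite !Kr_period. f_equal. f_equal. unfold lp, z0, lat. rewrite !RtoC_plus. ring. }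
    replace (II (fun s t => f (lp w1 w2 z0 s t) * (Kr s ^ M * Kr t ^ M)) (- / 2) (/ 2) (- / 2) (/ 2) - m2 * f z0) with
      (II (fun s t => f (lp w1 w2 z0 s t) * (Kr s ^ M * Kr t ^ M) + (- f z0) * (Kr s ^ M * Kr t ^ M)) (- / 2) (/ 2) (- / 2) (/ 2)).
    2:{ rewrite II_plus, II_scal, Em by auto using cont2_mult, cont2_scal. ring. }
    eapply Rle_trans; [apply II_abs; [lra | lra | auto using cont2_mult, cont2_scal, cont2_plus]|].
    set (A := L * W * exp (- e' * Cmod (lat w1 w2 k l - - w)%C ^ 2)).
    assert (A0 : 0 <= A) by (apply Rmult_le_pos; [apply Rmult_le_pos; assumption | left; apply exp_pos]).
    assert (Cabs : forall s, continuous Rabs s) by apply continuous_Rabs.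
    assert (CaK : forall s, continuous (fun s => Rabs s * Kr s ^ M) s).
    { intros s. apply (continuous_mult (K:=R_AbsRing) Rabs); [apply Cabs | apply Kr_pow_cont]. }
    assert (c1 : cont2 (fun s t => (Rabs s * Kr s ^ M) * Kr t ^ M)) by
      (apply (cont2_mult (fun s _ => Rabs s * Kr s ^ M) (fun _ t => Kr t ^ M)); [apply cont2_x, CaK | apply cont2_y, Kr_pow_cont]).
    assert (c2 : cont2 (fun s t => Kr s ^ M * (Rabs t * Kr t ^ M))) by
      (apply (cont2_mult (fun s _ => Kr s ^ M) (fun _ t => Rabs t * Kr t ^ M)); [apply cont2_x, Kr_pow_cont | apply cont2_y, CaK]).
    apply Rle_trans with (II (fun s t => A * ((Rabs s * Kr s ^ M) * Kr t ^ M + Kr s ^ M * (Rabs t * Kr t ^ M))) (- / 2) (/ 2) (- / 2) (/ 2)).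
    - apply II_le; try lra; [auto using cont2_abs, cont2_mult, cont2_scal, cont2_plus | auto using cont2_scal, cont2_plus |].
      intros s t Hs Ht. assert (ks := pow_le _ M (Kr_ge_0 s)). assert (kt := pow_le _ M (Kr_ge_0 t)).
      replace (f (lp w1 w2 z0 s t) * (Kr s ^ M * Kr t ^ M) + - f z0 * (Kr s ^ M * Kr t ^ M)) with
        ((f (lp w1 w2 z0 s t) - f z0) * (Kr s ^ M * Kr t ^ M)) by ring.
      rewrite Rabs_mult, (Rabs_pos_eq (Kr s ^ M * Kr t ^ M)) by (apply Rmult_le_pos; assumption).
      replace (A * (Rabs s * Kr s ^ M * Kr t ^ M + Kr s ^ M * (Rabs t * Kr t ^ M))) with (A * (Rabs s + Rabs t) * (Kr s ^ M * Kr t ^ M)) by ring.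
      apply Rmult_le_compat_r; [apply Rmult_le_pos; assumption|].
      set (hh := (RtoC s * w1 + RtoC t * w2)%C).
      assert (Eh : lp w1 w2 z0 s t = (z0 + hh)%C) by (unfold lp, hh; ring).
      assert (s1 := Rabs_pos s). assert (t1 := Rabs_pos t).
      assert (Bh : Cmod hh <= (Rabs s + Rabs t) * W).
      { unfold hh. eapply Rle_trans; [apply Cmod_triangle|]. rewrite !Cmod_mult, !Cmod_R. unfold W.
        assert (x := Cmod_ge_0 w1). assert (y := Cmod_ge_0 w2). nra. }
      assert (st : Rabs s + Rabs t <= 1) by (assert (Rabs s <= /2) by (apply Rabs_le; lra); assert (Rabs t <= /2) by (apply Rabs_le; lra); lra).
      rewrite Eh. eapply Rle_trans; [apply Hf|]. eapply Rle_trans; [apply HL; fold W; nra|].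
      assert (Ex : exp (- e * Cmod z0 ^ 2) <= exp (- e' * Cmod (lat w1 w2 k l - - w)%C ^ 2)).
      { replace (lat w1 w2 k l - - w)%C with z0 by (unfold z0; ring). apply exp_le, Rmult_le_compat_r; [apply pow2_ge_0|].
        assert (x : e' <= e) by apply Rmin_l. lra. }
      unfold A. assert (xp := exp_pos (- e * Cmod z0 ^ 2)). assert (hp := Cmod_ge_0 hh).
      apply Rle_trans with (L * exp (- e' * Cmod (lat w1 w2 k l - - w)%C ^ 2) * ((Rabs s + Rabs t) * W)).
      + apply Rmult_le_compat; [apply Rmult_le_pos; lra | exact hp | apply Rmult_le_compat_l; lra | exact Bh].
      + right. ring.
    - rewrite II_scal, II_plus by auto using cont2_plus.
      rewrite (II_prod (fun s => Rabs s * Kr s ^ M) (fun s => Kr s ^ M)), (II_prod (fun s => Kr s ^ M) (fun s => Rabs s * Kr s ^ M)); auto using Kr_pow_cont.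
      fold (mK M). apply Rmult_le_compat_l; [exact A0|]. unfold m2. simpl. nra. }
  assert (Sum : Rabs (BS (fun k l => II (fun s t => h (s + IZR k) (t + IZR l)) (- / 2) (/ 2) (- / 2) (/ 2)) N - m2 * BS (fun k l => f (w + lat w1 w2 k l)%C) N) <= eta / 2 * m2).
  { replace (BS (fun k l => II (fun s t => h (s + IZR k) (t + IZR l)) (- / 2) (/ 2) (- / 2) (/ 2)) N - m2 * BS (fun k l => f (w + lat w1 w2 k l)%C) N) with
      (BS (fun k l => II (fun s t => h (s + IZR k) (t + IZR l)) (- / 2) (/ 2) (- / 2) (/ 2) + (- m2) * f (w + lat w1 w2 k l)%C) N) by (rewrite BS_plus, BS_scal; ring).
    eapply Rle_trans.
    - apply BS_abs_le. intros k l. rewrite Ropp_mult_distr_l_reverse. apply Cell.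
    - rewrite (BS_ext _ (fun k l => (L * W * (2 * (eta / (4 * (La + 1)) * m2))) * exp (- e' * Cmod (lat w1 w2 k l - - w)%C ^ 2))) by (intros; ring).
      rewrite BS_scal.
      assert (p1 : 0 <= 2 * (eta / (4 * (La + 1)) * m2)).
      { apply Rmult_le_pos; [lra|]. apply Rmult_le_pos; [left; apply Rdiv_lt_0_compat; lra | lra]. }
      apply Rle_trans with (L * W * (2 * (eta / (4 * (La + 1)) * m2)) * (Cg / e')).
      + apply Rmult_le_compat_l; [apply Rmult_le_pos; [apply Rmult_le_pos; assumption | exact p1]|]. apply HG; [exact e1 | apply Rmin_r].
      + replace (L * W * (2 * (eta / (4 * (La + 1)) * m2)) * (Cg / e')) with (La * (2 * (eta / (4 * (La + 1)) * m2))) by (unfold La; ring).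
        apply Rle_trans with ((La + 1) * (2 * (eta / (4 * (La + 1)) * m2))); [apply Rmult_le_compat_r; [exact p1 | lra]|].
        right. field. lra. }
  apply Rmult_le_reg_l with m2; [exact m2p|].
  rewrite <- (Rabs_pos_eq m2) at 1 by lra. rewrite <- Rabs_mult.
  replace (m2 * (BS (fun k l => f (w + lat w1 w2 k l)%C) N - g (INR N + / 2))) with
    ((BS (fun k l => II (fun s t => h (s + IZR k) (t + IZR l)) (- / 2) (/ 2) (- / 2) (/ 2)) N - m2 * g (INR N + / 2)) -
     (BS (fun k l => II (fun s t => h (s + IZR k) (t + IZR l)) (- / 2) (/ 2) (- / 2) (/ 2)) N - m2 * BS (fun k l => f (w + lat w1 w2 k l)%C) N)) by ring.
  eapply Rle_trans; [apply Rabs_triang|]. rewrite Rabs_Ropp. fold m2 in HR0. lra.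
Qed.

(** In each component the box sums approach the mean of G; the factor 2 comes from adding the two
    components. *)
Theorem poisson_bound c0 J : (exists R0, forall r, R0 <= r -> c0 <= Cmod (CIC w1 w2 G w r)) ->
  (forall N, BS (fun k l => Cmod (U (w + lat w1 w2 k l)%C)) N <= J) -> c0 <= 2 * J.
Proof.
  intros [R1 H1] HJ. apply Rnot_lt_le. intros Lt. set (eta := (c0 - 2 * J) / 4). assert (He : 0 < eta) by (unfold eta; lra).
  assert (HQ : forall M r eta', Cmod (CI2 (fun s t => Ul s t * (RtoC (Kr s ^ M) * (RtoC (Kr t ^ M) * chi 0 t)))%C (- r) r -
      CI2 (fun s t => RtoC (Kr s ^ M) * (RtoC (Kr t ^ M) * chi 0 t))%C (- / 2) (/ 2) * CI2 Gl (- r) r)%C <= eta' ->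
    Rabs (II (fun s t => fst (U (lp w1 w2 w s t)) * (Kr s ^ M * Kr t ^ M)) (- r) r (- r) r - mK M ^ 2 * fst (CIC w1 w2 G w r)) <= eta' /\
    Rabs (II (fun s t => snd (U (lp w1 w2 w s t)) * (Kr s ^ M * Kr t ^ M)) (- r) r (- r) r - mK M ^ 2 * snd (CIC w1 w2 G w r)) <= eta').
  { intros M r eta' B.
    rewrite (CI2_ext (fun s t => RtoC (Kr s ^ M) * (RtoC (Kr t ^ M) * chi 0 t))%C (fun s t => RtoC (Kr s ^ M) * RtoC (Kr t ^ M))%C) in B by (intros; rewrite chi_0; ring).
    rewrite (CI2_prod (fun s => RtoC (Kr s ^ M)) (fun s => RtoC (Kr s ^ M))) in B by (apply contRC_R, Kr_pow_cont).
    assert (Ec : CI (fun s => RtoC (Kr s ^ M)) (- / 2) (/ 2) = RtoC (mK M)).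
    { apply C_ext; simpl; [reflexivity|]. rewrite (RInt_const (V:=R_CompleteNormedModule)). unfold scal; simpl; unfold mult; simpl. ring. }
    rewrite Ec in B.
    rewrite (CI2_ext _ (fun s t => (fst (U (lp w1 w2 w s t)) * (Kr s ^ M * Kr t ^ M), snd (U (lp w1 w2 w s t)) * (Kr s ^ M * Kr t ^ M)))) in B
      by (intros; rewrite chi_0; unfold Ul; apply C_ext; cbn [fst snd Cmult RtoC]; ring).
    split; (eapply Rle_trans; [|exact B]); [eapply Rle_trans; [|apply fst_le_Cmod] | eapply Rle_trans; [|apply snd_le_Cmod]];
    right; f_equal; unfold CI2, CIC, IC, Gl; cbn [fst snd Cmult Cplus Cminus Copp RtoC]; ring. }
  assert (HM : forall M eta', 0 < eta' -> exists R0, forall r, R0 <= r ->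
    Rabs (II (fun s t => fst (U (lp w1 w2 w s t)) * (Kr s ^ M * Kr t ^ M)) (- r) r (- r) r - mK M ^ 2 * fst (CIC w1 w2 G w r)) <= eta' /\
    Rabs (II (fun s t => snd (U (lp w1 w2 w s t)) * (Kr s ^ M * Kr t ^ M)) (- r) r (- r) r - mK M ^ 2 * snd (CIC w1 w2 G w r)) <= eta').
  { intros M eta' He'. destruct (proj2 (KernelMean_kernel M M 0) eta' He') as [R0 HR0]. exists R0. intros r Hr. apply HQ, HR0, Hr. }
  destruct (poisson_component (fun z => fst (U z)) (fun r => fst (CIC w1 w2 G w r))) with (eta := eta) as [N1 h1].
  - exact (contCR_fst U CU).
  - intros z h. apply (fst_le_Cmod (U (z + h) - U z)%C).
  - intros M eta' He'. destruct (HM M eta' He') as [R0 h]. exists R0. intros r Hr. exact (proj1 (h r Hr)).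
  - exact He.
  - destruct (poisson_component (fun z => snd (U z)) (fun r => snd (CIC w1 w2 G w r))) with (eta := eta) as [N2 h2].
    + exact (contCR_snd U CU).
    + intros z h. apply (snd_le_Cmod (U (z + h) - U z)%C).
    + intros M eta' He'. destruct (HM M eta' He') as [R0 h]. exists R0. intros r Hr. exact (proj2 (h r Hr)).
    + exact He.
    + destruct (INR_unbounded R1) as [N3 h3]. set (N := Nat.max N1 (Nat.max N2 N3)).
      specialize (h1 N ltac:(unfold N; lia)). specialize (h2 N ltac:(unfold N; lia)).
      assert (LN : INR N3 <= INR N) by (apply le_INR; unfold N; lia). specialize (H1 (INR N + / 2) ltac:(lra)). specialize (HJ N).
      assert (b1 : Rabs (BS (fun k l => fst (U (w + lat w1 w2 k l)%C)) N) <= BS (fun k l => Cmod (U (w + lat w1 w2 k l)%C)) N).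
      { apply BS_abs_le. intros; apply fst_le_Cmod. }
      assert (b2 : Rabs (BS (fun k l => snd (U (w + lat w1 w2 k l)%C)) N) <= BS (fun k l => Cmod (U (w + lat w1 w2 k l)%C)) N).
      { apply BS_abs_le. intros; apply snd_le_Cmod. }
      assert (S := Cmod_le_sum (CIC w1 w2 G w (INR N + / 2))).
      assert (t1 := Rabs_triang_inv (fst (CIC w1 w2 G w (INR N + / 2))) (BS (fun k l => fst (U (w + lat w1 w2 k l)%C)) N)).
      assert (t2 := Rabs_triang_inv (snd (CIC w1 w2 G w (INR N + / 2))) (BS (fun k l => snd (U (w + lat w1 w2 k l)%C)) N)).
      rewrite Rabs_minus_sym in t1, t2. unfold eta in *. lra.
Qed.
End Poisson.

(** * The lower frame bound *)

Definition wmod (F : C -> C) (z : C) : R := Cmod (F z) * exp (- (PI / 2) * Cmod z ^ 2).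

Lemma wmod_sq F z : wmod F z ^ 2 = wtC F z.
Proof.
  unfold wmod, wtC. rewrite Rpow_mult_distr. f_equal.
  transitivity (exp (- (PI / 2) * Cmod z ^ 2) * exp (- (PI / 2) * Cmod z ^ 2)); [ring | rewrite <- exp_plus; f_equal; field].
Qed.
Lemma wmod_ge_0 F z : 0 <= wmod F z.
Proof. apply Rmult_le_pos; [apply Cmod_ge_0 | left; apply exp_pos]. Qed.

(** Duality is taken for the symplectic form Im(conj(a) z), for which the dual of a lattice is the
    lattice divided by d. This is why the frequency (k, l) appears rotated to (l, -k). *)
Lemma char_lp (w1 w2 w : C) d k l s t : d = snd (Cconj w1 * w2)%C -> d <> 0 ->
  let a := lat (RtoC (/ d) * w1) (RtoC (/ d) * w2) l (- k) in
  cexp (RtoC PI * (Cconj a * lp w1 w2 w s t - Cconj (lp w1 w2 w s t) * a))%C =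
  (cexp (RtoC PI * (Cconj a * w - Cconj w * a)) * (chi k s * chi l t))%C.
Proof.
  intros Ed Hd a. unfold chi. rewrite <- !cexp_plus. f_equal. unfold a, lat, lp. rewrite opp_IZR.
  destruct w1 as [x1 y1], w2 as [x2 y2], w as [x y]. simpl in Ed.
  apply C_ext; simpl; [ring|].
  transitivity (PI * (2 * ((x1 * y + x * - y1 ) * (/ d * IZR l) + (x2 * y + x * - y2) * (- / d * IZR k)) + 2 * (d / d) * (IZR k * s + IZR l * t))).
  - rewrite Ed. field. rewrite <- Ed. exact Hd.
  - field. exact Hd.
Qed.

Lemma CIC_real w1 w2 (c : C) (u : C -> R) w r : contCR u -> CIC w1 w2 (fun z => c * RtoC (u z))%C w r = (c * RtoC (IC w1 w2 u w r))%C.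
Proof.
  intros H. rewrite (CIC_scal w1 w2 c (fun z => RtoC (u z)) w r H). f_equal. apply C_ext; simpl; [reflexivity|].
  unfold IC. simpl. rewrite II_const. ring.
Qed.

(** [twist] moves w to 0, and Poisson summation with offset -w samples the translate where F is
    sampled on the lattice. The Gaussian of parameter [ep] is the unspent part of the growth
    margin. *)
Theorem pointwise_bound (w1 w2 : C) n : (1 <= n)%nat -> 0 < snd (Cconj w1 * w2)%C -> INR n * snd (Cconj w1 * w2)%C < 1 ->
  exists C1 ep, 0 < C1 /\ 0 < ep /\ ep <= 1 /\ forall F M, PA n F -> (forall z, Cmod (F z) <= M * exp (PI / 2 * Cmod z ^ 2)) ->
  forall w J, (forall N, BS (fun k l => wmod F (lat w1 w2 k l) * exp (- ep * Cmod (lat w1 w2 k l - w)%C ^ 2)) N <= J) -> wmod F w <= C1 * J.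
Proof.
  intros Hn Hd Hnd. assert (P := PI_RGT_0). set (d := snd (Cconj w1 * w2)%C) in *.
  destruct (separating_factor w1 w2 n Hn Hd Hnd) as [E [kE' [HE [GE' [LE' [V0 V]]]]]]. fold d in V.
  set (kE := Rmax 0 kE'). assert (GE : Gr kE E) by (apply (Gr_le kE'); [apply Rmax_r | exact GE']).
  assert (LE : kE < PI / 2) by (apply Rmax_lub_lt; lra). assert (kE0 : 0 <= kE) by apply Rmax_l.
  assert (det : d <> 0) by lra.
  set (ka := kap (gg 0) n E). assert (DK := kap_WDG 0 n E kE HE GE). fold ka in DK.
  (* The kernel decays with every exponent above kE - pi, in particular -(pi/2) - ep: the term
     -(pi/2) is the weight belonging to F, and ep is left over. *)
  set (ep := Rmin 1 ((PI / 2 - kE) / 2)). assert (ep0 : 0 < ep) by (apply Rmin_glb_lt; lra).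
  assert (ep1 : ep <= (PI / 2 - kE) / 2) by apply Rmin_r.
  destruct (WDG_Gr _ _ DK (- (PI / 2) - ep)) as [Mk [Mk0 HMk]]; [lra|].
  destruct (IC_lower w1 w2 (fun z => exp (- PI * Cmod z ^ 2)) (exp (- PI)) 1 det) as [c0 [c0p Hc0]].
  { apply contCR_exp0. } { intros; left; apply exp_pos. } { apply exp_pos. } { lra. }
  { intros z Hz. apply exp_le. assert (x := Cmod_ge_0 z). assert (Cmod z ^ 2 <= 1) by (simpl; nra). nra. }
  assert (pn : 1 <= PI ^ n) by (apply pow_R1_Rle; assert (x := PI2_1); lra).
  exists (2 * (Mk + 1) / c0), ep. split; [apply Rdiv_lt_0_compat; lra|]. split; [exact ep0|]. split; [apply Rmin_l|].
  intros F M PF HM w J HJ. set (T := twist F w). assert (PT : PA n T) by (apply PA_twist, PF).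
  destruct (PA_weight_growth n T M PT) as [phi [Hphi Ephi]].
  { intros z. apply Rmult_le_reg_r with (exp (- (PI / 2) * Cmod z ^ 2)); [apply exp_pos|]. unfold T. rewrite twist_mod.
    rewrite Rmult_assoc, <- exp_plus. replace (PI / 2 * Cmod z ^ 2 + - (PI / 2) * Cmod z ^ 2) with 0 by ring. rewrite exp_0, Rmult_1_r.
    apply Rle_trans with (M * exp (PI / 2 * Cmod (z + w) ^ 2) * exp (- (PI / 2) * Cmod (z + w) ^ 2)); [apply Rmult_le_compat_r; [left; apply exp_pos | apply HM]|].
    rewrite Rmult_assoc, <- exp_plus. replace (PI / 2 * Cmod (z + w) ^ 2 + - (PI / 2) * Cmod (z + w) ^ 2) with 0 by ring. rewrite exp_0. lra. }
  set (U := fun z => (T z * ka z)%C). set (G := fun z => (T 0%C * gg 0 n z)%C).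
  assert (DT : WDG (PI / 2) T).
  { apply (WDG_ext _ (fun z => Csum n (fun k => Cconj z ^ k * phi k z)%C)); [intros; symmetry; apply Ephi|].
    apply (WDG_Csum _ n (fun k z => Cconj z ^ k * phi k z)%C); [left; lra|]. intros k _. apply WDG_conj_pow, WDG_entire; apply Hphi. }
  assert (DU : WDG (PI / 2 + (kE + - PI)) U) by (apply WDG_mult; assumption).
  assert (CU := WDG_cont _ _ DU). assert (CG : contC G) by (apply contC_mult; [apply contC_const | eapply WDG_cont, gg_WDG]).
  destruct (WDG_lipschitz (PI / 2 + (kE + - PI)) U (Cmod w1 + Cmod w2) ltac:(lra) ltac:(assert (x := Cmod_ge_0 w1); assert (y := Cmod_ge_0 w2); lra) DU)
    as [L [e [L0 [e0 HL]]]].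
  assert (HUG : Null w1 w2 (fun z => U z - G z)%C).
  { eapply Null_ext; [|apply (gauss_repr w1 w2 n E kE det HE GE LE phi Hphi kE0 V0)].
    intros z. cbv beta. rewrite <- !Ephi. reflexivity. }
  assert (HUc : forall k l, (k <> 0 \/ l <> 0)%Z -> forall eta, 0 < eta -> exists R0, forall r, R0 <= r ->
     Cmod (CI2 (fun s t => U (lp w1 w2 (- w) s t) * (chi k s * chi l t))%C (- r) r) <= eta).
  { intros k l Hkl eta He. set (a := lat (RtoC (/ d) * w1) (RtoC (/ d) * w2) l (- k)).
    assert (Va : Van n E (- a)%C).
    { replace (- a)%C with (lat (RtoC (/ d) * w1) (RtoC (/ d) * w2) (- l) k); [apply V; lia|]. unfold a, lat. rewrite !opp_IZR, !RtoC_opp. ring. }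
    destruct (gauss_null w1 w2 n E kE det HE GE LE phi Hphi a kE0 Va) as [_ N]. destruct (N (- w)%C eta He) as [R0 HR0]. exists R0. intros r Hr.
    specialize (HR0 r Hr). set (cc := cexp (RtoC PI * (Cconj a * (- w) - Cconj (- w) * a))%C).
    assert (Mc : Cmod cc = 1) by (unfold cc; rewrite Cmod_cexp, <- exp_0; f_equal; simpl; ring).
    assert (Eq : CIC w1 w2 (fun z => Csum n (fun k => Cconj z ^ k * phi k z)%C * kap (gg 0) n E z * cexp (RtoC PI * (Cconj a * z - Cconj z * a)))%C (- w) r =
       (cc * CI2 (fun s t => U (lp w1 w2 (- w) s t) * (chi k s * chi l t))%C (- r) r)%C).
    { rewrite <- CI2_scal by (apply (cont2C_mult (fun s t => U (lp w1 w2 (- w) s t))); [apply cont2C_lp, CU | apply cont2C_prod; apply contRC_chi]).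
      unfold CIC, IC. apply (CI2_ext _ _ (- r) r). intros s t. rewrite <- Ephi.
      assert (cl := char_lp w1 w2 (- w) d k l s t eq_refl det). cbv zeta in cl. fold a cc in cl. rewrite cl. unfold U, ka. ring. }
    rewrite Eq, Cmod_mult, Mc, Rmult_1_l in HR0. exact HR0. }
  assert (T0 : Cmod (T 0%C) = wmod F w).
  { assert (x := twist_mod F w 0). replace (0 + w)%C with w in x by ring. fold T in x. unfold wmod. rewrite <- x, Cmod_0.
    replace (- (PI / 2) * 0 ^ 2) with 0 by ring. rewrite exp_0. ring. }
  assert (J0 : 0 <= J). { eapply Rle_trans; [|apply (HJ O)]. apply BS_ge_0. intros; apply Rmult_le_pos; [apply wmod_ge_0 | left; apply exp_pos]. }
  assert (B := poisson_bound w1 w2 U G det CU CG HUG (- w)%C HUc L e L0 e0 HL (wmod F w * c0) (Mk * J)).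
  apply Rmult_le_reg_l with c0; [exact c0p|]. replace (c0 * (2 * (Mk + 1) / c0 * J)) with (2 * (Mk + 1) * J) by (field; lra).
  apply Rle_trans with (2 * (Mk * J)); [rewrite Rmult_comm; apply B | nra].
  - destruct (Hc0 (- w)%C) as [R0 HR0]. exists R0. intros r Hr. specialize (HR0 r Hr).
    replace (CIC w1 w2 G (- w) r) with (T 0%C * RtoC (- PI) ^ n * RtoC (IC w1 w2 (fun z => exp (- PI * Cmod z ^ 2)) (- w) r))%C.
    + rewrite !Cmod_mult, T0, Cmod_R, Rmult_assoc. apply Rmult_le_compat_l; [apply wmod_ge_0|].
      rewrite <- RtoC_pow, Cmod_R, <- RPow_abs, Rabs_Ropp, (Rabs_pos_eq PI), Rabs_pos_eq by lra. nra.
    + rewrite <- CIC_real by apply contCR_exp0. apply CIC_ext. intros z. unfold G, gg. rewrite <- cexp_R.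
      replace (RtoC (- PI * Cmod z ^ 2)) with (RtoC (- PI) * (Cconj z * (z + 0)))%C by (rewrite Cmod_sqr2; csolve). ring.
  - intros N. apply Rle_trans with (Mk * BS (fun k l => wmod F (lat w1 w2 k l) * exp (- ep * Cmod (lat w1 w2 k l - w)%C ^ 2)) N);
      [|apply Rmult_le_compat_l; [exact Mk0 | apply HJ]].
    rewrite <- BS_scal. apply BS_le. intros k l. set (z := (- w + lat w1 w2 k l)%C).
    replace (lat w1 w2 k l - w)%C with z by (unfold z; ring). unfold U. rewrite Cmod_mult.
    assert (x := twist_mod F w z). replace (z + w)%C with (lat w1 w2 k l) in x by (unfold z; ring). fold (wmod F (lat w1 w2 k l)) in x. rewrite <- x. fold T.
    specialize (HMk z). replace ((- (PI / 2) - ep) * Cmod z ^ 2) with (- (PI / 2) * Cmod z ^ 2 + - ep * Cmod z ^ 2) in HMk by ring.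
    rewrite exp_plus in HMk. assert (y := Cmod_ge_0 (T z)).
    apply Rle_trans with (Cmod (T z) * (Mk * (exp (- (PI / 2) * Cmod z ^ 2) * exp (- ep * Cmod z ^ 2)))); [apply Rmult_le_compat_l; assumption | right; ring].
Qed.

Lemma BS_mono h N N' : (forall k l, 0 <= h k l) -> (N <= N')%nat -> BS h N <= BS h N'.
Proof.
  intros H L. induction L as [|m L IH]; [lra|]. eapply Rle_trans; [exact IH|]. clear IH L N.
  assert (Sh : forall (f : Z -> R), (forall x, 0 <= f x) ->
    Rsum (2 * m + 1) (fun i => f (Z.of_nat i - Z.of_nat m)%Z) <= Rsum (2 * S m + 1) (fun i => f (Z.of_nat i - Z.of_nat (S m))%Z)).
  { intros f Hf. assert (Q : forall q g, (forall i, 0 <= g i) -> Rsum q (fun i => g (S i)) <= Rsum (S q) g).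
    { intros q g Hg. assert (E : Rsum (S q) g = g O + Rsum q (fun i => g (S i))); [|specialize (Hg O); lra].
      induction q; [cbn [Rsum]; ring|]. cbn [Rsum] in *. rewrite IHq. ring. }
    replace (2 * S m + 1)%nat with (S (S (2 * m + 1))) by lia.
    eapply Rle_trans; [|cbn [Rsum]; apply Rplus_le_compat_l, Hf]. rewrite Rplus_0_r.
    eapply Rle_trans; [|apply (Q (2 * m + 1)%nat (fun i => f (Z.of_nat i - Z.of_nat (S m))%Z)); intros; apply Hf].
    right. apply Rsum_ext. intros i _. f_equal. lia. }
  unfold BS. eapply Rle_trans; [apply (Rsum_le (2 * m + 1)); intros i _; apply (Sh (fun l => h (Z.of_nat i - Z.of_nat m)%Z l)); intros; apply H|].
  apply (Sh (fun k => Rsum (2 * S m + 1) (fun j => h k (Z.of_nat j - Z.of_nat (S m))%Z))). intros. apply Rsum_ge_0. intros; apply H.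
Qed.
Lemma BS_tail h S0 eta : (forall k l, 0 <= h k l) -> (forall N, BS h N <= S0) -> 0 < eta -> exists N, forall M, BS h M <= BS h N + eta.
Proof.
  intros H0 HS He. destruct (completeness (fun x => exists N, x = BS h N)) as [m [ub lub]].
  - exists S0. intros x [N ->]. apply HS.
  - exists (BS h O), O. reflexivity.
  - apply NNPP. intros Q. assert (m <= m - eta); [|lra]. apply lub. intros x [N ->].
    apply Rnot_lt_le. intros Lt. apply Q. exists N. intros M. specialize (ub (BS h M) (ex_intro _ M eq_refl)). lra.
Qed.
Lemma BS_term h N k l : (forall k l, 0 <= h k l) -> (Z.abs_nat k <= N)%nat -> (Z.abs_nat l <= N)%nat -> h k l <= BS h N.
Proof.
  intros H Hk Hl. unfold BS.
  eapply Rle_trans; [|apply (Rsum_term _ (fun i => Rsum (2 * N + 1) (fun j => h (Z.of_nat i - Z.of_nat N)%Z (Z.of_nat j - Z.of_nat N)%Z)) (Z.to_nat (k + Z.of_nat N)))].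
  - cbv beta. replace (Z.of_nat (Z.to_nat (k + Z.of_nat N)) - Z.of_nat N)%Z with k by lia.
    eapply Rle_trans; [|apply (Rsum_term _ (fun j => h k (Z.of_nat j - Z.of_nat N)%Z) (Z.to_nat (l + Z.of_nat N)))].
    + cbv beta. replace (Z.of_nat (Z.to_nat (l + Z.of_nat N)) - Z.of_nat N)%Z with l by lia. lra.
    + intros; apply H.
    + lia.
  - intros i. apply Rsum_ge_0. intros; apply H.
  - lia.
Qed.
Lemma BS_cauchy (a b : Z -> Z -> R) N : (forall k l, 0 <= b k l) -> (BS (fun k l => a k l * b k l) N) ^ 2 <= BS (fun k l => a k l ^ 2 * b k l) N * BS b N.
Proof.
  intros H. set (A := BS (fun k l => a k l ^ 2 * b k l) N). set (X := BS (fun k l => a k l * b k l) N). set (B := BS b N).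
  assert (A0 : 0 <= A) by (apply BS_ge_0; intros; apply Rmult_le_pos; [apply pow2_ge_0 | apply H]).
  assert (B0 : 0 <= B) by (apply BS_ge_0, H).
  assert (Q : forall t, 0 <= A - 2 * t * X + t ^ 2 * B).
  { intros t. replace (A - 2 * t * X + t ^ 2 * B) with (BS (fun k l => (a k l ^ 2 * b k l + (- 2 * t) * (a k l * b k l)) + t ^ 2 * b k l) N).
    - apply BS_ge_0. intros k l. replace (a k l ^ 2 * b k l + - 2 * t * (a k l * b k l) + t ^ 2 * b k l) with ((a k l - t) ^ 2 * b k l) by ring.
      apply Rmult_le_pos; [apply pow2_ge_0 | apply H].
    - rewrite !BS_plus, !BS_scal. unfold A, X, B. ring. }
  destruct (Req_dec B 0) as [Z|Z].
  - assert (X0 : X = 0); [|rewrite X0; nra]. apply NNPP. intros N0. assert (q := Q ((A + 1) / X)). rewrite Z in q.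
    replace (A - 2 * ((A + 1) / X) * X + ((A + 1) / X) ^ 2 * 0) with (- A - 2) in q by (field; exact N0). lra.
  - assert (q := Q (X / B)). replace (A - 2 * (X / B) * X + (X / B) ^ 2 * B) with ((A * B - X ^ 2) / B) in q by (field; exact Z).
    assert (B0' : 0 < B) by lra. assert (0 <= A * B - X ^ 2); [|lra].
    apply Rmult_le_reg_r with (/ B); [apply Rinv_0_lt_compat, B0'|]. rewrite Rmult_0_l. exact q.
Qed.

Lemma SQ_BS N (u : Z -> Z -> C -> R) r : (forall k l, contCR (u k l)) ->
  contCR (fun z => BS (fun k l => u k l z) N) /\ SQ (fun z => BS (fun k l => u k l z) N) r = BS (fun k l => SQ (u k l) r) N.
Proof.
  intros H. unfold BS. split.
  - apply contCR_Rsum. intros i _. apply contCR_Rsum. intros; apply H.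
  - rewrite (SQ_Rsum _ (fun i z => Rsum (2 * N + 1) (fun j => u (Z.of_nat i - Z.of_nat N)%Z (Z.of_nat j - Z.of_nat N)%Z z))).
    + apply Rsum_ext. intros i _. apply SQ_Rsum. intros; apply H.
    + intros i _. apply contCR_Rsum. intros; apply H.
Qed.

Lemma bounded_weight n : exists C1, 0 < C1 /\ forall F v, PA n F -> (forall r, 0 <= r -> SQ (wtC F) r <= v) ->
  forall z, wtC F z <= C1 * v.
Proof.
  destruct (local_weight n) as [C1 [c1 LW]]. exists C1. split; [exact c1|]. intros F v PF Hv z.
  destruct (LW F PF z v (SQ_locw_le F v (PA_cont n F PF) Hv z) 0%C) as [X _]; [rewrite Cmod_0; lra|].
  replace (z + 0)%C with z in X by ring. exact X.
Qed.
Lemma wmod_le F z K : wtC F z <= K -> wmod F z <= sqrt K.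
Proof. intros H. rewrite <- (sqrt_pow2 (wmod F z)) by apply wmod_ge_0. apply sqrt_le_1_alt. rewrite wmod_sq. exact H. Qed.

(** Cauchy-Schwarz with the Gaussian as weight squares the pointwise bound at the cost of a lattice
    sum Cg / ep; integration over w then costs pi^2 / ep per lattice point. *)
Theorem lower_bound (w1 w2 : C) n : (1 <= n)%nat -> 0 < snd (Cconj w1 * w2)%C -> INR n * snd (Cconj w1 * w2)%C < 1 ->
  exists A, 0 < A /\ forall F v s, PA n F -> (forall r, 0 <= r -> SQ (wtC F) r <= v) ->
  (forall N, BS (fun k l => wtC F (lat w1 w2 k l)) N <= s) -> forall r, 0 <= r -> A * SQ (wtC F) r <= s.
Proof.
  intros Hn Hd Hnd. assert (P := PI_RGT_0).
  destruct (pointwise_bound w1 w2 n Hn Hd Hnd) as [C1 [ep [c1 [e0 [e1 PB]]]]].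
  assert (det : snd (Cconj w1 * w2)%C <> 0) by lra.
  destruct (lattice_gauss w1 w2 det) as [Cg [Cg0 HG]]. destruct (bounded_weight n) as [C2 [c2 BW]].
  set (C3 := C1 ^ 2 * (Cg / ep)). assert (c3 : 0 < C3) by (apply Rmult_lt_0_compat; [apply pow_lt, c1 | apply Rdiv_lt_0_compat; assumption]).
  set (Q := C3 * (PI ^ 2 / ep)). assert (Q0 : 0 < Q) by (apply Rmult_lt_0_compat; [exact c3 | apply Rdiv_lt_0_compat; [apply pow_lt; lra | exact e0]]).
  exists (/ Q). split; [apply Rinv_0_lt_compat, Q0|]. intros F v s PF Hv Hs r Hr. assert (CF := PA_cont n F PF).
  set (h := fun w k l => wtC F (lat w1 w2 k l) * exp (- ep * Cmod (lat w1 w2 k l - w)%C ^ 2)).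
  assert (h0 : forall w k l, 0 <= h w k l) by (intros; apply Rmult_le_pos; [apply wtC_ge_0 | left; apply exp_pos]).
  assert (Pt : forall w K, (forall N, BS (h w) N <= K) -> wtC F w <= C3 * K).
  { intros w K HK. assert (K0 : 0 <= K) by (eapply Rle_trans; [apply BS_ge_0, (h0 w) | apply (HK O)]).
    assert (G0 : 0 <= K * (Cg / ep)) by (apply Rmult_le_pos; [exact K0 | left; apply Rdiv_lt_0_compat; assumption]).
    assert (B := PB F (sqrt (C2 * v)) PF). specialize (B) with (w := w) (J := sqrt (K * (Cg / ep))).
    assert (X : wmod F w <= C1 * sqrt (K * (Cg / ep))).
    { apply B.
      - intros z. assert (Y := wmod_le F z _ (BW F v PF Hv z)). unfold wmod in Y.
        apply Rmult_le_reg_r with (exp (- (PI / 2) * Cmod z ^ 2)); [apply exp_pos|]. rewrite Rmult_assoc, <- exp_plus.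
        replace (PI / 2 * Cmod z ^ 2 + - (PI / 2) * Cmod z ^ 2) with 0 by ring. rewrite exp_0, Rmult_1_r. exact Y.
      - intros N. set (X := BS (fun k l => wmod F (lat w1 w2 k l) * exp (- ep * Cmod (lat w1 w2 k l - w)%C ^ 2)) N).
        assert (X0 : 0 <= X) by (apply BS_ge_0; intros; apply Rmult_le_pos; [apply wmod_ge_0 | left; apply exp_pos]).
        rewrite <- (sqrt_pow2 X X0). apply sqrt_le_1_alt.
        eapply Rle_trans; [apply (BS_cauchy (fun k l => wmod F (lat w1 w2 k l)) (fun k l => exp (- ep * Cmod (lat w1 w2 k l - w)%C ^ 2))); intros; left; apply exp_pos|].
        apply Rmult_le_compat; [apply BS_ge_0 | apply BS_ge_0 | | apply HG; assumption]; try (intros; left; apply exp_pos).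
        + intros; apply Rmult_le_pos; [apply pow2_ge_0 | left; apply exp_pos].
        + rewrite (BS_ext _ (h w)) by (intros; unfold h; rewrite wmod_sq; reflexivity). apply HK. }
    rewrite <- wmod_sq. apply Rle_trans with ((C1 * sqrt (K * (Cg / ep))) ^ 2).
    - apply pow_incr. split; [apply wmod_ge_0 | exact X].
    - rewrite Rpow_mult_distr, pow2_sqrt by exact G0. right. unfold C3. ring. }
  apply Rmult_le_reg_l with Q; [exact Q0|]. rewrite <- Rmult_assoc, Rinv_r, Rmult_1_l by lra.
  assert (s0 : 0 <= s) by (eapply Rle_trans; [|apply (Hs O)]; apply BS_ge_0; intros; apply wtC_ge_0).
  (* The bound at w involves arbitrarily large boxes. On the square a summable majorant [g]
     independent of w makes one finite box suffice up to [del], chosen to contribute at most [et]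
     after integration. *)
  apply le_epsilon. intros et Het. set (del := et / (C3 * (4 * r ^ 2 + 1))).
  assert (r2 : 0 <= r ^ 2) by apply pow2_ge_0.
  assert (del0 : 0 < del) by (apply Rdiv_lt_0_compat; [exact Het | apply Rmult_lt_0_compat; lra]).
  destruct (exp_sq_shift (- ep) (ep / 2) (2 * r) ltac:(lra) ltac:(lra)) as [M [M0 HM]].
  set (g := fun k l => s * M * exp (- (ep / 2) * Cmod (lat w1 w2 k l - 0)%C ^ 2)).
  assert (g0 : forall k l, 0 <= g k l) by (intros; apply Rmult_le_pos; [apply Rmult_le_pos; lra | left; apply exp_pos]).
  assert (wts : forall k l, wtC F (lat w1 w2 k l) <= s).
  { intros k l. eapply Rle_trans; [|apply (Hs (Nat.max (Z.abs_nat k) (Z.abs_nat l)))].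
    apply (BS_term (fun k l => wtC F (lat w1 w2 k l))); [intros; apply wtC_ge_0 | lia | lia]. }
  assert (hg : forall w k l, Cmod w <= 2 * r -> h w k l <= g k l).
  { intros w k l Hw. unfold h, g. rewrite Rmult_assoc. apply Rmult_le_compat; [apply wtC_ge_0 | left; apply exp_pos | apply wts|].
    specialize (HM (lat w1 w2 k l) (- w)%C ltac:(rewrite Cmod_opp; exact Hw)). replace (- ep + ep / 2) with (- (ep / 2)) in HM by field.
    replace (lat w1 w2 k l - 0)%C with (lat w1 w2 k l) by ring. exact HM. }
  destruct (BS_tail g (s * M * (Cg / (ep / 2))) del g0) as [N HN]; [|exact del0|].
  { intros N. unfold g. rewrite BS_scal. apply Rmult_le_compat_l; [apply Rmult_le_pos; lra | apply HG; lra]. }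
  assert (Tl : forall w, Cmod w <= 2 * r -> wtC F w <= C3 * (BS (h w) N + del)).
  { intros w Hw. apply Pt. intros m. destruct (Nat.le_ge_cases m N) as [L|L].
    - assert (X := BS_mono (h w) m N (h0 w) L). lra.
    - assert (X := BS_mono (fun k l => g k l + (-1) * h w k l) N m ltac:(intros k l; specialize (hg w k l Hw); lra) L).
      rewrite !BS_plus, !BS_scal in X. specialize (HN m). lra. }
  assert (Ch : forall k l, contCR (fun w => h w k l)).
  { intros k l. apply (contCR_mult (fun _ => wtC F (lat w1 w2 k l))); [apply contCR_const|].
    apply (contC_ext (fun w => RtoC (exp (- ep * Cmod (w - lat w1 w2 k l)%C ^ 2)))); [intros; rewrite Cmod_minus_sym; reflexivity | apply contCR_exp]. }
  destruct (SQ_BS N (fun k l w => h w k l) r Ch) as [Cb Eb].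
  change (SQ (fun w => BS (h w) N) r = BS (fun k l => SQ (fun w => h w k l) r) N) in Eb.
  apply Rle_trans with (SQ (fun w => C3 * (BS (h w) N + del)) r).
  - unfold SQ. apply II_le; try lra.
    + apply contCR_cont2, contCR_wt, CF.
    + apply (contCR_cont2 (fun w => C3 * (BS (h w) N + del))).
      apply (contCR_mult (fun _ => C3)); [apply contCR_const | apply (contCR_plus (fun w => BS (h w) N) (fun _ => del)); [exact Cb | apply contCR_const]].
    + intros x y Hx Hy. apply Tl. eapply Rle_trans; [apply Cmod_le_sum|]. simpl.
      assert (Rabs x <= r) by (apply Rabs_le; lra). assert (Rabs y <= r) by (apply Rabs_le; lra). lra.
  - rewrite SQ_scal by (apply (contCR_plus (fun w => BS (h w) N) (fun _ => del)); [exact Cb | apply contCR_const]).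
    rewrite (SQ_plus (fun w => BS (h w) N) (fun _ => del)) by (exact Cb || apply contCR_const). rewrite Eb.
    replace (SQ (fun _ => del) r) with (4 * r ^ 2 * del) by (unfold SQ; rewrite II_const; ring).
    assert (B : BS (fun k l => SQ (fun w => h w k l) r) N <= PI ^ 2 / ep * s).
    { apply Rle_trans with (BS (fun k l => PI ^ 2 / ep * wtC F (lat w1 w2 k l)) N).
      - apply BS_le. intros k l. unfold h. rewrite (SQ_ext _ (fun w => wtC F (lat w1 w2 k l) * exp (- ep * Cmod (w - lat w1 w2 k l)%C ^ 2)))
          by (intros; rewrite Cmod_minus_sym; reflexivity).
        rewrite SQ_scal by apply contCR_exp. rewrite Rmult_comm. apply Rmult_le_compat_r; [apply wtC_ge_0 | apply SQ_gauss; assumption].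
      - rewrite BS_scal. apply Rmult_le_compat_l; [left; apply Rdiv_lt_0_compat; [apply pow_lt; lra | exact e0] | apply Hs]. }
    assert (D : C3 * (4 * r ^ 2 * del) <= et).
    { apply Rle_trans with (C3 * ((4 * r ^ 2 + 1) * del)).
      - apply Rmult_le_compat_l; [lra|]. apply Rmult_le_compat_r; lra.
      - right. unfold del. field. split; [nra | lra]. }
    apply (Rmult_le_compat_l C3) in B; [|lra]. unfold Q. nra.
Qed.

(** * Necessity of the density condition *)

Lemma Rsum_add n m f : Rsum (n + m) f = Rsum n f + Rsum m (fun k => f (n + k)%nat).
Proof.
  induction m; cbn [Rsum]; [rewrite Nat.add_0_r; ring|]. rewrite Nat.add_succ_r. cbn [Rsum]. rewrite IHm. ring.
Qed.
Lemma Rsum_exchange n m (f : nat -> nat -> R) : Rsum n (fun i => Rsum m (f i)) = Rsum m (fun j => Rsum n (fun i => f i j)).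
Proof.
  induction n; cbn [Rsum].
  - rewrite Rsum_const. ring.
  - rewrite IHn, <- Rsum_plus. reflexivity.
Qed.
Lemma BS_exchange (h : Z -> Z -> Z -> Z -> R) N M :
  BS (fun k l => BS (h k l) M) N = BS (fun a b => BS (fun k l => h k l a b) N) M.
Proof.
  unfold BS. etransitivity; [apply Rsum_ext; intros i _; apply (Rsum_exchange (2 * N + 1) (2 * M + 1) (fun j a => Rsum (2 * M + 1) (fun b => h _ _ _ _)))|].
  rewrite Rsum_exchange. apply Rsum_ext. intros a _.
  etransitivity; [apply Rsum_ext; intros i _; apply (Rsum_exchange (2 * N + 1) (2 * M + 1) (fun j b => h _ _ _ _))|].
  rewrite Rsum_exchange. apply Rsum_ext. intros b _. reflexivity.
Qed.
Lemma BS_prod f g N : BS (fun k l => f k * g l) N = Rsum (2 * N + 1) (fun i => f (Z.of_nat i - Z.of_nat N)%Z) * Rsum (2 * N + 1) (fun j => g (Z.of_nat j - Z.of_nat N)%Z).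
Proof.
  unfold BS. rewrite Rmult_comm, <- Rsum_scal. apply Rsum_ext. intros i _. rewrite Rmult_comm, Rsum_scal. ring.
Qed.

(** Keeps only the m integers following s, each within distance m of it; N is large enough for the
    box to contain them. *)
Lemma gauss_sum_lower b m N s : 0 <= b -> Rabs s + INR m + 1 <= INR N ->
  INR m * exp (- (b * INR m ^ 2)) <= Rsum (2 * N + 1) (fun i => exp (- (b * (IZR (Z.of_nat i - Z.of_nat N) - s) ^ 2))).
Proof.
  intros Hb HN. destruct (archimed s) as [u1 u2]. assert (A := Rle_abs s). assert (A' := Rle_abs (- s)). rewrite Rabs_Ropp in A'.
  assert (b1 : (- Z.of_nat N <= up s)%Z) by (apply le_IZR; rewrite opp_IZR, <- INR_IZR_INZ; assert (x := pos_INR m); lra).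
  assert (b2 : (up s + Z.of_nat m <= Z.of_nat N)%Z) by (apply le_IZR; rewrite plus_IZR, <- !INR_IZR_INZ; lra).
  set (p := Z.to_nat (up s + Z.of_nat N)). replace (2 * N + 1)%nat with (p + (m + (2 * N + 1 - p - m)))%nat by (unfold p; lia).
  rewrite !Rsum_add.
  assert (q1 := Rsum_ge_0 p (fun i => exp (- (b * (IZR (Z.of_nat i - Z.of_nat N) - s) ^ 2))) ltac:(intros; left; apply exp_pos)).
  assert (q2 := Rsum_ge_0 (2 * N + 1 - p - m) (fun k => exp (- (b * (IZR (Z.of_nat (p + (m + k)) - Z.of_nat N) - s) ^ 2))) ltac:(intros; left; apply exp_pos)).
  assert (q3 : INR m * exp (- (b * INR m ^ 2)) <= Rsum m (fun k => exp (- (b * (IZR (Z.of_nat (p + k) - Z.of_nat N) - s) ^ 2)))); [|lra].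
  rewrite <- Rsum_const. apply Rsum_le. intros k Hk. apply exp_le.
  replace (Z.of_nat (p + k) - Z.of_nat N)%Z with (up s + Z.of_nat k)%Z by (unfold p; lia). rewrite plus_IZR, <- INR_IZR_INZ.
  assert (k1 : INR k + 1 <= INR m) by (rewrite <- S_INR; apply le_INR; lia). assert (k0 := pos_INR k).
  apply Ropp_le_contravar, Rmult_le_compat_l; [exact Hb|]. apply pow_incr. lra.
Qed.

Lemma contCR_dilate (u : C -> R) de : 0 < de -> contCR u -> contCR (fun z => u (RtoC de * z)%C).
Proof.
  intros Hd H z eps He. destruct (H (RtoC de * z)%C eps He) as [d [d0 B]]. exists (d / de). split; [apply Rdiv_lt_0_compat; assumption|].
  intros h Hh. replace (RtoC de * (z + h))%C with (RtoC de * z + RtoC de * h)%C by ring. apply B.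
  rewrite Cmod_mult, Cmod_R, Rabs_pos_eq, Rmult_comm by lra. apply (proj2 (Rlt_div_r _ _ de Hd)), Hh.
Qed.
Lemma SQ_dilate (u : C -> R) de r : 0 < de -> contCR u -> de ^ 2 * SQ (fun z => u (RtoC de * z)%C) r = SQ u (de * r).
Proof.
  intros Hd Hu. assert (C2 := contCR_cont2 u Hu). unfold SQ, II.
  assert (L : forall f, (forall x, continuous f x) -> de * RInt (fun x => f (de * x)) (- r) r = RInt f (- (de * r)) (de * r)).
  { intros f Hf. assert (X := RInt_comp_lin (V:=R_CompleteNormedModule) f de 0 (- r) r).
    rewrite !Rplus_0_r in X. replace (de * - r) with (- (de * r)) in X by ring. rewrite <- X by (apply (ex_RInt_continuous (V:=R_CompleteNormedModule)); intros; apply Hf).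
    rewrite (RInt_scal (V:=R_CompleteNormedModule)).
    - unfold scal; simpl; unfold mult; simpl. f_equal. apply RInt_ext. intros x _. f_equal. ring.
    - apply (ex_RInt_continuous (V:=R_CompleteNormedModule)). intros x _. apply (continuous_comp (fun x => de * x + 0) f); [|apply Hf].
      apply (ex_derive_continuous (K:=R_AbsRing) (V:=R_NormedModule)). auto_derive. trivial. }
  etransitivity; [|apply (L (fun x => RInt (fun y => u (x, y)) (- (de * r)) (de * r))); intros; apply (cont2_RInt (fun x y => u (x, y))), C2].
  simpl. rewrite Rmult_1_r, Rmult_assoc. f_equal.
  assert (Cs : cont2 (fun x y => u (RtoC de * (x, y))%C)).
  { apply (contCR_cont2 (fun z => u (RtoC de * z)%C)), (contCR_dilate u de Hd Hu). }
  assert (Ex : ex_RInt (fun x => RInt (fun y => u (RtoC de * (x, y))%C) (- r) r) (- r) r) by (apply (II_ex _ _ _ _ _ Cs)).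
  etransitivity; [symmetry; apply (RInt_scal (V:=R_CompleteNormedModule) _ _ _ de Ex)|]. apply RInt_ext. intros x _.
  etransitivity; [|apply (L (fun y => u (de * x, y))); intros; apply (cont2_section (fun x y => u (x, y))), C2].
  unfold scal; simpl; unfold mult; simpl. f_equal. apply RInt_ext. intros y _. f_equal. csolve.
Qed.

(* Where [F] vanishes at the nearby point the gain is quadratic in [h]; when [h] is large the factor is harmless. *)
Lemma vanishing_shift_sum n : exists K, 0 < K /\ forall (w1 w2 : C) Cg F v (h : C) N,
  (forall u, BS (fun k l => exp (- (1) * Cmod (lat w1 w2 k l - u)%C ^ 2)) N <= Cg) ->
  PA n F -> (forall r, 0 <= r -> SQ (wtC F) r <= v) -> forall b,
  (forall k l, F (lat w1 w2 k l + b)%C = RtoC 0) ->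
  BS (fun k l => wtC F (lat w1 w2 k l + b + h)%C) N <= K * Cmod h ^ 2 * (Cg * v).
Proof.
  destruct (local_weight n) as [C1 [c1 LW]]. exists (2 * C1). split; [lra|]. intros w1 w2 Cg F v h N HG PF Hv b Hz.
  assert (CF := PA_cont n F PF). assert (h2 := pow2_ge_0 (Cmod h)).
  assert (G : forall y, BS (fun k l => Jw F (lat w1 w2 k l + y)%C) N <= Cg * v).
  { intros y. apply (Jw_sum F v CF Hv (fun k l => lat w1 w2 k l + y)%C). intros u. eapply Rle_trans; [|apply (HG (u - y)%C)]. right. apply BS_ext. intros k l.
    rewrite Cmod_minus_sym. replace (lat w1 w2 k l + y - u)%C with (lat w1 w2 k l - (u - y))%C by ring. reflexivity. }
  assert (J0 : forall y, 0 <= Jw F y) by (intros y; eapply Rle_trans; [|apply (Jw_ge F v CF Hv y 0); lra]; apply SQ_ge_0; [lra | apply contCR_locw, CF | apply locw_ge_0]).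
  apply Rle_trans with (BS (fun k l => C1 * Cmod h ^ 2 * (Jw F (lat w1 w2 k l + b)%C + Jw F (lat w1 w2 k l + (b + h))%C)) N).
  - apply BS_le. intros k l. set (c := (lat w1 w2 k l + b)%C). replace (lat w1 w2 k l + (b + h))%C with (c + h)%C by (unfold c; ring).
    assert (j1 := J0 c). assert (j2 := J0 (c + h)%C).
    destruct (Rle_dec (Cmod h) 1) as [L|L].
    + destruct (LW F PF c (Jw F c) (Jw_ge F v CF Hv c) h L) as [_ X]. specialize (X (Hz k l)). eapply Rle_trans; [exact X|].
      rewrite <- Rmult_assoc. apply Rmult_le_compat_l; [apply Rmult_le_pos; lra | lra].
    + destruct (LW F PF (c + h)%C (Jw F (c + h)%C) (Jw_ge F v CF Hv _) 0%C) as [X _]; [rewrite Cmod_0; lra|].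
      replace (c + h + 0)%C with (c + h)%C in X by ring. eapply Rle_trans; [exact X|]. rewrite Rmult_assoc. apply Rmult_le_compat_l; [lra|].
      assert (1 <= Cmod h ^ 2) by (simpl; nra). nra.
  - rewrite BS_scal, BS_plus. assert (g1 := G b). assert (g2 := G (b + h)%C).
    replace (2 * C1 * Cmod h ^ 2 * (Cg * v)) with (C1 * Cmod h ^ 2 * (Cg * v + Cg * v)) by ring.
    apply Rmult_le_compat_l; [apply Rmult_le_pos; lra | lra].
Qed.

Lemma lat_scal a w1 w2 k l : lat (RtoC a * w1) (RtoC a * w2) k l = (RtoC a * lat w1 w2 k l)%C.
Proof. unfold lat. ring. Qed.

(** For every u in a bounded set at least m^2 points of the dilated lattice have both coordinates
    within m of those of u. When b is of size 1 / m^2 their Gaussians stay bounded below, so the sum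
    is of order m^2. *)
Lemma count_lower (w1 w2 : C) (de b W ka : R) (m : nat) r1 : snd (Cconj w1 * w2)%C <> 0 -> 0 < de -> 0 <= b ->
  W = Cmod w1 + Cmod w2 -> ka = b * (2 * de ^ 2 * W ^ 2) -> exists N, forall u, Cmod u <= r1 ->
  INR m ^ 2 * exp (- (2 * (ka * INR m ^ 2))) <= BS (fun k l => exp (- b * Cmod (u - lat (RtoC de * w1) (RtoC de * w2) k l)%C ^ 2)) N.
Proof.
  intros det Hd Hb EW Eka. destruct (lattice_lower w1 w2 det) as [c [Hc L]].
  destruct (INR_unbounded (r1 / de / c + INR m + 1)) as [N HN]. exists N. intros u Hu.
  assert (W0 : 0 <= W) by (rewrite EW; assert (x := Cmod_ge_0 w1); assert (y := Cmod_ge_0 w2); lra).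
  assert (ka0 : 0 <= ka) by (rewrite Eka; apply Rmult_le_pos; [exact Hb | apply Rmult_le_pos; [assert (x := pow2_ge_0 de); lra | apply pow2_ge_0]]).
  assert (de0 : RtoC de <> RtoC 0) by (intros Q; apply RtoC_inj in Q; lra).
  destruct (lattice_coords w1 w2 (u / RtoC de)%C det) as [s [t Est]].
  assert (Eu : u = (RtoC de * (RtoC s * w1 + RtoC t * w2))%C) by (rewrite <- Est; field; exact de0).
  specialize (L s t). rewrite <- Est in L.
  assert (Bu : Cmod (u / RtoC de)%C <= r1 / de).
  { rewrite Cmod_div by exact de0. rewrite Cmod_R, Rabs_pos_eq by lra. apply Rmult_le_compat_r; [left; apply Rinv_0_lt_compat, Hd | exact Hu]. }
  assert (st : Rabs s + Rabs t <= r1 / de / c) by (apply (proj1 (Rle_div_r _ _ c Hc)); lra).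
  assert (s0 := Rabs_pos s). assert (t0 := Rabs_pos t).
  apply Rle_trans with (BS (fun k l => exp (- (ka * (IZR k - s) ^ 2)) * exp (- (ka * (IZR l - t) ^ 2))) N).
  - rewrite (BS_prod (fun k => exp (- (ka * (IZR k - s) ^ 2))) (fun l => exp (- (ka * (IZR l - t) ^ 2)))).
    assert (q1 := gauss_sum_lower ka m N s ka0 ltac:(lra)). assert (q2 := gauss_sum_lower ka m N t ka0 ltac:(lra)).
    assert (q0 : 0 <= INR m * exp (- (ka * INR m ^ 2))) by (apply Rmult_le_pos; [apply pos_INR | left; apply exp_pos]).
    eapply Rle_trans; [|apply (Rmult_le_compat _ _ _ _ q0 q0 q1 q2)]. right.
    replace (- (2 * (ka * INR m ^ 2))) with (- (ka * INR m ^ 2) + - (ka * INR m ^ 2)) by ring. rewrite exp_plus. ring.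
  - apply BS_le. intros k l. rewrite <- exp_plus. apply exp_le. rewrite lat_scal.
    replace (u - RtoC de * lat w1 w2 k l)%C with (RtoC de * (RtoC (s - IZR k) * w1 + RtoC (t - IZR l) * w2))%C
      by (rewrite Eu; unfold lat; rewrite !RtoC_minus; ring).
    set (x := Rabs (IZR k - s)). set (y := Rabs (IZR l - t)). assert (x0 : 0 <= x) by apply Rabs_pos. assert (y0 : 0 <= y) by apply Rabs_pos.
    assert (B : Cmod (RtoC (s - IZR k) * w1 + RtoC (t - IZR l) * w2)%C <= (x + y) * W).
    { eapply Rle_trans; [apply Cmod_triangle|]. rewrite !Cmod_mult, !Cmod_R, (Rabs_minus_sym s), (Rabs_minus_sym t). fold x y. rewrite EW.
      assert (p := Cmod_ge_0 w1). assert (p' := Cmod_ge_0 w2). nra. }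
    rewrite Cmod_mult, Cmod_R, Rabs_pos_eq, Rpow_mult_distr by lra. rewrite <- (pow2_abs (IZR k - s)), <- (pow2_abs (IZR l - t)). fold x y. rewrite Eka.
    assert (B2 : Cmod (RtoC (s - IZR k) * w1 + RtoC (t - IZR l) * w2)%C ^ 2 <= ((x + y) * W) ^ 2) by (apply pow_incr; split; [apply Cmod_ge_0 | exact B]).
    assert (B3 : ((x + y) * W) ^ 2 <= 2 * W ^ 2 * (x ^ 2 + y ^ 2)).
    { replace (2 * W ^ 2 * (x ^ 2 + y ^ 2)) with (((x + y) * W) ^ 2 + ((x - y) * W) ^ 2) by ring. assert (z := pow2_ge_0 ((x - y) * W)). lra. }
    assert (bd : 0 <= b * de ^ 2) by (apply Rmult_le_pos; [exact Hb | apply pow2_ge_0]).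
    assert (B4 := Rmult_le_compat_l _ _ _ bd (Rle_trans _ _ _ B2 B3)). lra.
Qed.

(** A bounded square that carries half of the norm allows [count_lower] to be applied with one
    finite box. *)
Lemma SQ_half_mass F n z0 M a : PA n F -> F z0 <> RtoC 0 -> 0 < a -> (forall z, wtC F z <= M * exp (- a * Cmod (z - 0)%C ^ 2)) ->
  exists V r1, 0 < V /\ 0 <= r1 /\ (forall r, 0 <= r -> SQ (wtC F) r <= V) /\ V / 2 <= SQ (wtC F) r1.
Proof.
  intros PF Nz Ha HM. assert (CF := PA_cont n F PF). assert (P := PI_RGT_0).
  assert (M0 : 0 <= M). { assert (x := HM z0). assert (y := wtC_ge_0 F z0). assert (z := exp_pos (- a * Cmod (z0 - 0)%C ^ 2)). nra. }
  assert (B : forall r, 0 <= r -> SQ (wtC F) r <= M * (PI ^ 2 / a)).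
  { intros r Hr. apply Rle_trans with (SQ (fun z => M * exp (- a * Cmod (z - 0)%C ^ 2)) r).
    - apply SQ_le; [exact Hr | apply contCR_wt, CF | apply (contCR_mult (fun _ => M)); [apply contCR_const | apply contCR_exp] | exact HM].
    - rewrite SQ_scal by apply contCR_exp. apply Rmult_le_compat_l; [exact M0 | apply SQ_gauss; assumption]. }
  destruct (completeness (fun x => exists r, 0 <= r /\ x = SQ (wtC F) r)) as [V [ub lub]].
  - exists (M * (PI ^ 2 / a)). intros x [r [Hr ->]]. apply B, Hr.
  - exists (SQ (wtC F) 0), 0. split; [lra | reflexivity].
  - assert (HV : forall r, 0 <= r -> SQ (wtC F) r <= V) by (intros r Hr; apply ub; exists r; auto).
    destruct (bounded_weight n) as [C1 [c1 BW]]. specialize (BW F V PF HV z0).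
    assert (wz : 0 < wtC F z0) by (apply Rmult_lt_0_compat; [apply pow_lt, Cmod_gt_0, Nz | apply exp_pos]).
    assert (V0 : 0 < V) by nra.
    assert (E : exists r1, 0 <= r1 /\ V / 2 <= SQ (wtC F) r1).
    { apply NNPP. intros Q. assert (V <= V / 2); [|lra]. apply lub. intros x [r [Hr ->]]. apply Rnot_lt_le. intros Lt. apply Q. exists r. split; lra. }
    destruct E as [r1 [h1 h2]]. exists V, r1. auto.
Qed.

Theorem density_necessary (w1 w2 : C) n A : (1 <= n)%nat -> 0 < snd (Cconj w1 * w2)%C -> 1 <= INR n * snd (Cconj w1 * w2)%C -> 0 < A ->
  ~ (forall G v s, PA n G -> (forall r, 0 <= r -> SQ (wtC G) r <= v) ->
     (forall N, BS (fun k l => wtC G (lat w1 w2 k l)) N <= s) -> forall r, 0 <= r -> A * SQ (wtC G) r <= s).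
Proof.
  set (d := snd (Cconj w1 * w2)%C). intros Hn Hd Hnd HA LS. assert (P := PI_RGT_0).
  assert (det : snd (Cconj w1 * w2)%C <> 0) by (unfold d in Hd; lra).
  destruct (lattice_gauss w1 w2 det) as [Cg [Cg0 HG]]. destruct (vanishing_shift_sum n) as [Kv [Kv0 VS]]. destruct (bounded_weight n) as [C2 [C20 BW]].
  (* [kap0] is the exponential of [count_lower] once ep m^2 = 1, using b <= 2 pi ep and de'^2 <=
     2. *)
  set (W := Cmod w1 + Cmod w2). set (kap0 := exp (- (2 * (8 * PI * W ^ 2)))). assert (k0 : 0 < kap0) by apply exp_pos.
  (* After division by the norm of F the test functions yield m^2 on the left and a constant
     independent of m on the right, which fails for large m. *)
  assert (Main : forall m : nat, (2 <= m)%nat -> A * (INR m ^ 2 * kap0 / 2) <= 4 * Kv * Cg * Cg).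
  2:{ destruct (INR_unbounded (4 * Kv * Cg * Cg / (A * (kap0 / 2)))) as [m0 Hm0]. set (m := Nat.max 2 m0).
      specialize (Main m ltac:(unfold m; lia)). assert (mm : INR m0 <= INR m) by (apply le_INR; unfold m; lia).
      assert (m1 : 1 <= INR m) by (apply (le_INR 1); unfold m; lia).
      assert (q : 0 < A * (kap0 / 2)) by (apply Rmult_lt_0_compat; lra).
      assert (Hm : 4 * Kv * Cg * Cg < INR m * (A * (kap0 / 2))) by (apply (proj1 (Rlt_div_l _ _ _ q)); lra).
      assert (X : INR m * (A * (kap0 / 2)) <= A * (INR m ^ 2 * kap0 / 2)); [|lra].
      replace (A * (INR m ^ 2 * kap0 / 2)) with (INR m ^ 2 * (A * (kap0 / 2))) by field. apply Rmult_le_compat_r; [lra | simpl; nra]. }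
  intros m Hm. apply le_INR in Hm. simpl in Hm. assert (m2 : 4 <= INR m ^ 2) by (simpl; nra).
  set (ep := / INR m ^ 2). assert (ep0 : 0 < ep) by (apply Rinv_0_lt_compat; lra). assert (em : ep * INR m ^ 2 = 1) by (unfold ep; field; lra).
  assert (ep1 : ep <= / 4) by (apply Rinv_le_contravar; lra).
  set (de := sqrt (1 - ep)). set (de' := sqrt (1 + ep)).
  assert (d1 : de ^ 2 = 1 - ep) by (apply pow2_sqrt; lra). assert (d2 : de' ^ 2 = 1 + ep) by (apply pow2_sqrt; lra).
  assert (dp : 0 < de) by (apply sqrt_lt_R0; lra). assert (dp' : 1 <= de') by (rewrite <- sqrt_1; apply sqrt_le_1_alt; lra).
  (* For a lattice point x and a centre c of the dilated lattice, de x + c = (de' x + c) + (de -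
     de') x, and F vanishes at de' x + c. The squared displacement is therefore at most 4 ep^2
     |x|^2. *)
  assert (dd : (de - de') ^ 2 <= 4 * ep ^ 2).
  { assert (X : (de' - de) * (de' + de) = 2 * ep) by (replace ((de' - de) * (de' + de)) with (de' ^ 2 - de ^ 2) by ring; rewrite d1, d2; ring).
    assert (Y : 0 <= de' - de) by nra. assert (Z : de' - de <= 2 * ep) by nra. nra. }
  (* al < 1 puts F in the Fock space, and al (1 + ep) > 1 with n d >= 1 gives the vanishing on the
     dilated lattice. *)
  set (v1 := (RtoC de' * w1)%C). set (v2 := (RtoC de' * w2)%C). set (al := (/ (1 + ep) + 1) / 2).
  assert (Ed : snd (Cconj v1 * v2)%C = (1 + ep) * d) by (rewrite <- d2; unfold v1, v2, d; simpl; ring).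
  assert (ie : / (1 + ep) * (1 + ep) = 1) by (field; lra). assert (ie0 : 0 < / (1 + ep)) by (apply Rinv_0_lt_compat; lra).
  assert (al1 : al < 1) by (unfold al; nra). assert (al0 : 0 < al) by (unfold al; lra). assert (al2 : 1 < al * (1 + ep)) by (unfold al; nra).
  destruct (theta_exists v1 v2 n al) as [F [PF [Hz [[z0 Nz] [M [M0 HM]]]]]].
  { rewrite Ed. apply Rmult_lt_0_compat; lra. } { exact al0. }
  { rewrite Ed. replace (INR n * al * ((1 + ep) * d)) with (al * (1 + ep) * (INR n * d)) by ring. nra. }
  assert (CF := PA_cont n F PF).
  destruct (SQ_half_mass F n z0 (M ^ 2) (PI * (1 - al)) PF Nz ltac:(apply Rmult_lt_0_compat; lra)) as [V [r1 [V0 [r10 [HV Hr1]]]]].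
  { intros z. replace (z - 0)%C with z by ring. unfold wtC.
    apply Rle_trans with ((M * exp (PI * al / 2 * Cmod z ^ 2)) ^ 2 * exp (- PI * Cmod z ^ 2)).
    - apply Rmult_le_compat_r; [left; apply exp_pos | apply pow_incr; split; [apply Cmod_ge_0 | apply HM]].
    - right. rewrite Rpow_mult_distr, Rmult_assoc. f_equal.
      transitivity (exp (PI * al / 2 * Cmod z ^ 2) * exp (PI * al / 2 * Cmod z ^ 2) * exp (- PI * Cmod z ^ 2)); [ring|]. rewrite <- !exp_plus. f_equal. field. }
  set (cc := lat v1 v2). set (G := fun k l z => twist F (cc k l) (RtoC de * z + 0)%C).
  assert (PG : forall k l, PA n (G k l)) by (intros k l; apply (PA_affine_conj n (twist F (cc k l))), PA_twist, PF).
  (* The contraction by de leaves the spare Gaussian exp(-pi ep |z|^2), as de^2 = 1 - ep. *)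
  assert (EG : forall k l z, wtC (G k l) z = wtC F (RtoC de * z + cc k l)%C * exp (- (PI * ep) * Cmod z ^ 2)).
  { intros k l z. rewrite <- twist_wt. unfold G, wtC. replace (RtoC de * z + 0)%C with (RtoC de * z)%C by ring. rewrite Rmult_assoc, <- exp_plus. do 2 f_equal.
    rewrite Cmod_mult, Cmod_R, Rabs_pos_eq, Rpow_mult_distr, d1 by lra. ring. }
  assert (BG : forall k l z, wtC (G k l) z <= C2 * V * exp (- ep * Cmod (z - 0)%C ^ 2)).
  { intros k l z. rewrite EG. apply Rmult_le_compat; [apply wtC_ge_0 | left; apply exp_pos | apply BW; assumption|].
    replace (z - 0)%C with z by ring. apply exp_le, Rmult_le_compat_r; [apply pow2_ge_0|]. assert (x := PI2_1). nra. }
  assert (C2V : 0 <= C2 * V) by (apply Rmult_le_pos; lra).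
  set (T := fun k l N => BS (fun a b => wtC (G k l) (lat w1 w2 a b)) N).
  assert (TB : forall k l N, T k l N <= C2 * V * (Cg / ep)).
  { intros k l N. eapply Rle_trans; [apply BS_le; intros a b; apply BG|]. rewrite BS_scal. apply Rmult_le_compat_l; [exact C2V | apply HG; lra]. }
  assert (TL : forall k l, is_lim_seq (T k l) (real (Lim_seq (T k l)))).
  { intros k l. apply Lim_seq_correct', (ex_finite_lim_seq_incr _ (C2 * V * (Cg / ep))); [|apply TB].
    intros N. apply BS_mono; [intros; apply wtC_ge_0 | lia]. }
  set (S0 := fun k l => real (Lim_seq (T k l))).
  assert (TS : forall k l N, T k l N <= S0 k l).
  { intros k l. apply (is_lim_seq_incr_compare (T k l) (S0 k l) (TL k l)). intros N. apply BS_mono; [intros; apply wtC_ge_0 | lia]. }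
  assert (LSG : forall k l r, 0 <= r -> A * SQ (wtC (G k l)) r <= S0 k l).
  { intros k l. apply (LS (G k l) (C2 * V * (PI ^ 2 / ep)) (S0 k l) (PG k l)); [|apply TS]. intros r Hr.
    apply Rle_trans with (SQ (fun z => C2 * V * exp (- ep * Cmod (z - 0)%C ^ 2)) r).
    - apply SQ_le; [exact Hr | eapply contCR_wt, PA_cont, PG | apply (contCR_mult (fun _ => C2 * V)); [apply contCR_const | apply contCR_exp] | apply BG].
    - rewrite SQ_scal by apply contCR_exp. apply Rmult_le_compat_l; [exact C2V | apply SQ_gauss; assumption]. }
  assert (Up : forall N, BS S0 N <= 4 * Kv * Cg * Cg * V).
  { intros N.
    assert (L : is_lim_seq (fun M => BS (fun k l => T k l M) N) (BS S0 N)).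
    { apply (is_lim_Rsum _ (fun i M => Rsum (2 * N + 1) (fun j => T (Z.of_nat i - Z.of_nat N)%Z (Z.of_nat j - Z.of_nat N)%Z M))).
      intros i. apply (is_lim_Rsum _ (fun j M => T (Z.of_nat i - Z.of_nat N)%Z (Z.of_nat j - Z.of_nat N)%Z M)). intros j. apply TL. }
    apply (is_lim_seq_le _ (fun _ => 4 * Kv * Cg * Cg * V) (BS S0 N) (4 * Kv * Cg * Cg * V)) in L; [exact L | | apply is_lim_seq_const].
    intros Q. unfold T. rewrite BS_exchange.
    apply Rle_trans with (BS (fun a b => 4 * Kv * Cg * V * ep * exp (- ep * Cmod (lat w1 w2 a b - 0)%C ^ 2)) Q).
    - apply BS_le. intros a b. set (la := lat w1 w2 a b).
      assert (X := VS v1 v2 Cg F V (RtoC (de - de') * la)%C N).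
      rewrite (BS_ext _ (fun k l => exp (- (PI * ep) * Cmod la ^ 2) * wtC F (lat v1 v2 k l + RtoC de' * la + RtoC (de - de') * la)%C)).
      2:{ intros k l. rewrite EG, Rmult_comm. do 2 f_equal. unfold cc. rewrite RtoC_minus. ring. }
      rewrite BS_scal. eapply Rle_trans; [apply Rmult_le_compat_l; [left; apply exp_pos | apply X]|].
      + intros u. eapply Rle_trans; [|eapply Rle_trans; [apply (HG 1 ltac:(lra) ltac:(lra) (u / RtoC de')%C N)|right; field]].
        apply BS_le. intros k l. apply exp_le. unfold v1, v2. rewrite lat_scal.
        assert (dn : RtoC de' <> RtoC 0) by (intros q; apply RtoC_inj in q; lra).
        replace (RtoC de' * lat w1 w2 k l - u)%C with (RtoC de' * (lat w1 w2 k l - u / RtoC de'))%C by (field; exact dn).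
        rewrite Cmod_mult, Cmod_R, Rabs_pos_eq, Rpow_mult_distr, d2 by lra. assert (q := pow2_ge_0 (Cmod (lat w1 w2 k l - u / RtoC de')%C)). nra.
      + exact PF.
      + exact HV.
      + intros k l. rewrite <- (Hz (k + a) (l + b))%Z. f_equal. unfold v1, v2. rewrite !lat_scal. unfold la, lat. rewrite !plus_IZR, !RtoC_plus. ring.
      + rewrite Cmod_mult, Cmod_R, Rpow_mult_distr, pow2_abs. replace (la - 0)%C with la by ring. set (x := Cmod la ^ 2). assert (x0 : 0 <= x) by apply pow2_ge_0.
        (* One of the two factors ep is consumed with |x|^2; the other cancels the 1/ep of the
           Gaussian lattice sum, so the total is bounded independently of ep. *)
        assert (E1 : ep * x * exp (- (PI * ep) * x) <= exp (- ep * x)).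
        { assert (y1 := exp_ineq1_le (ep * x)). assert (yx : 0 <= ep * x) by (apply Rmult_le_pos; lra).
          apply Rle_trans with (exp (ep * x) * exp (- (PI * ep) * x)); [apply Rmult_le_compat_r; [left; apply exp_pos | lra]|].
          rewrite <- exp_plus. apply exp_le. assert (y2 := PI2_1). nra. }
        apply Rle_trans with (exp (- (PI * ep) * x) * (Kv * (4 * ep ^ 2 * x) * (Cg * V))).
        * apply Rmult_le_compat_l; [left; apply exp_pos|]. apply Rmult_le_compat_r; [apply Rmult_le_pos; lra|].
          apply Rmult_le_compat_l; [lra|]. apply Rmult_le_compat_r; [exact x0 | exact dd].
        * replace (exp (- (PI * ep) * x) * (Kv * (4 * ep ^ 2 * x) * (Cg * V))) with (4 * Kv * Cg * V * ep * (ep * x * exp (- (PI * ep) * x))) by ring.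
          apply Rmult_le_compat_l; [|exact E1]. repeat (apply Rmult_le_pos; [|lra]). lra.
    - rewrite BS_scal. eapply Rle_trans; [apply Rmult_le_compat_l; [|apply HG; lra]|].
      + repeat (apply Rmult_le_pos; [|lra]). lra.
      + right. field. lra. }
  (* The spare Gaussian rewritten in the variable u = de z + c, where it is centred at c. *)
  set (b := PI * ep / de ^ 2). assert (b0 : 0 <= b) by (left; apply Rdiv_lt_0_compat; [apply Rmult_lt_0_compat; lra | lra]).
  set (q := fun k l u => wtC F u * exp (- b * Cmod (u - cc k l)%C ^ 2)).
  assert (Cq : forall k l, contCR (q k l)) by (intros; apply contCR_mult; [apply contCR_wt, CF | apply contCR_exp]).
  assert (q0 : forall k l u, 0 <= q k l u) by (intros; apply Rmult_le_pos; [apply wtC_ge_0 | left; apply exp_pos]).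
  assert (Low : forall k l, A * SQ (q k l) r1 <= S0 k l).
  { intros k l. set (r := (r1 + Cmod (cc k l)) / de).
    assert (r0 : 0 <= r) by (apply Rmult_le_pos; [assert (x := Cmod_ge_0 (cc k l)); lra | left; apply Rinv_0_lt_compat, dp]).
    eapply Rle_trans; [|apply (LSG k l r r0)]. apply Rmult_le_compat_l; [lra|].
    assert (Cq' := contCR_shift (q k l) (cc k l) (Cq k l)).
    assert (X := SQ_dilate (fun z => q k l (z + cc k l)%C) de r dp Cq').
    rewrite (SQ_ext (wtC (G k l)) (fun z => q k l (RtoC de * z + cc k l)%C)).
    2:{ intros z. rewrite EG. unfold q. do 2 f_equal. replace (RtoC de * z + cc k l - cc k l)%C with (RtoC de * z)%C by ring.
        rewrite Cmod_mult, Cmod_R, Rabs_pos_eq, Rpow_mult_distr by lra. unfold b. field. lra. }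
    assert (Y := SQ_shift_le (fun z => q k l (z + cc k l)%C) (- cc k l)%C r1 (de * r) Cq' (fun z => q0 k l _) r10
       ltac:(rewrite Cmod_opp; unfold r; right; field; lra)).
    rewrite (SQ_ext _ (q k l)) in Y by (intros; f_equal; ring).
    assert (Z : 0 <= SQ (fun z => q k l (RtoC de * z + cc k l)%C) r).
    { apply SQ_ge_0; [exact r0 | apply (contCR_dilate (fun z => q k l (z + cc k l)%C) de dp Cq') | intros; apply q0]. }
    rewrite d1 in X. nra. }
  destruct (count_lower w1 w2 de' b W (b * (2 * de' ^ 2 * W ^ 2)) m (2 * r1) det ltac:(lra) b0 eq_refl eq_refl) as [N HN].
  apply Rmult_le_reg_r with V; [exact V0|]. eapply Rle_trans; [|apply (Up N)].
  apply Rle_trans with (BS (fun k l => A * SQ (q k l) r1) N); [|apply BS_le; intros; apply Low].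
  rewrite BS_scal, Rmult_assoc. apply Rmult_le_compat_l; [lra|].
  destruct (SQ_BS N q r1 Cq) as [Cb Eb]. rewrite <- Eb.
  apply Rle_trans with (SQ (fun u => INR m ^ 2 * kap0 * wtC F u) r1).
  - rewrite SQ_scal by (apply contCR_wt, CF).
    replace (INR m ^ 2 * kap0 / 2 * V) with (INR m ^ 2 * kap0 * (V / 2)) by field. apply Rmult_le_compat_l; [apply Rmult_le_pos; lra | exact Hr1].
  - unfold SQ. apply II_le; try lra.
    + apply (contCR_cont2 (fun u => INR m ^ 2 * kap0 * wtC F u)), (contCR_mult (fun _ => INR m ^ 2 * kap0)); [apply contCR_const | apply contCR_wt, CF].
    + apply (contCR_cont2 _ Cb).
    + intros x y Hx Hy. set (u := (x, y) : C).
      rewrite (BS_ext _ (fun k l => wtC F u * exp (- b * Cmod (u - cc k l)%C ^ 2))) by reflexivity. rewrite BS_scal, Rmult_comm. apply Rmult_le_compat_l; [apply wtC_ge_0|].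
      eapply Rle_trans; [|apply HN].
      * apply Rmult_le_compat_l; [lra|]. apply exp_le. apply Ropp_le_contravar, Rmult_le_compat_l; [lra|].
        assert (be : b <= 2 * PI * ep).
        { apply (proj2 (Rle_div_l (PI * ep) (2 * PI * ep) (de ^ 2) ltac:(lra))). rewrite d1. assert (0 < PI * ep) by (apply Rmult_lt_0_compat; lra). nra. }
        rewrite d2. assert (w0 := pow2_ge_0 W).
        apply Rle_trans with (2 * PI * ep * (2 * 2 * W ^ 2) * INR m ^ 2).
        -- apply Rmult_le_compat_r; [lra|]. apply Rmult_le_compat; [exact b0 | apply Rmult_le_pos; lra | exact be | apply Rmult_le_compat_r; lra].
        -- right. transitivity (8 * PI * W ^ 2 * (ep * INR m ^ 2)); [ring | rewrite em; ring].
      * eapply Rle_trans; [apply Cmod_le_sum|]. simpl. assert (Rabs x <= r1) by (apply Rabs_le; lra). assert (Rabs y <= r1) by (apply Rabs_le; lra). lra.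
Qed.

(** * Translation to the given definitions *)

(** The squared norm as a supremum over squares; the integrals increase with the square, so this
    agrees with the limit. *)
Definition normC (F : C -> C) (v : R) : Prop :=
  (forall r, 0 <= r -> SQ (wtC F) r <= v) /\ forall eps, 0 < eps -> exists r, 0 <= r /\ v - eps < SQ (wtC F) r.
Definition sampC (n : nat) (w1 w2 : C) : Prop :=
  exists A B, 0 < A /\ 0 < B /\ forall F v, PA n F -> normC F v ->
    (forall N, BS (fun k l => wtC F (lat w1 w2 k l)) N <= B * v) /\
    (forall s, (forall N, BS (fun k l => wtC F (lat w1 w2 k l)) N <= s) -> A * v <= s).

Lemma normC_ex F v : (forall r, 0 <= r -> SQ (wtC F) r <= v) -> exists V, normC F V.
Proof.
  intros H. destruct (completeness (fun x => exists r, 0 <= r /\ x = SQ (wtC F) r)) as [V [ub lub]].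
  - exists v. intros x [r [Hr ->]]. apply H, Hr.
  - exists (SQ (wtC F) 0), 0. split; [lra | reflexivity].
  - exists V. split; [intros r Hr; apply ub; exists r; auto|]. intros eps He. apply NNPP. intros Q.
    assert (V <= V - eps); [|lra]. apply lub. intros x [r [Hr ->]]. apply Rnot_lt_le. intros Lt. apply Q. exists r. split; lra.
Qed.

Theorem sampC_iff (w1 w2 : C) n : (1 <= n)%nat -> 0 < snd (Cconj w1 * w2)%C -> sampC n w1 w2 <-> INR n * snd (Cconj w1 * w2)%C < 1.
Proof.
  intros Hn Hd. split.
  - intros [A [B [HA [HB HS]]]]. apply Rnot_le_lt. intros L. apply (density_necessary w1 w2 n A Hn Hd L HA).
    intros G v s PG Hv Hs r Hr. destruct (normC_ex G v Hv) as [V NV]. destruct (HS G V PG NV) as [_ X]. specialize (X s Hs).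
    eapply Rle_trans; [|exact X]. apply Rmult_le_compat_l; [lra | apply NV, Hr].
  - intros L. destruct (lower_bound w1 w2 n Hn Hd L) as [A [HA LB]]. destruct (bessel n w1 w2) as [B [HB UB]]; [lra|].
    exists A, B. split; [exact HA|]. split; [exact HB|]. intros F v PF [N1 N2]. split; [apply UB; assumption|].
    intros s Hs. apply le_epsilon. intros e He. destruct (N2 (e / A)) as [r [Hr Lt]]; [apply Rdiv_lt_0_compat; assumption|].
    assert (X := LB F v s PF N1 Hs r Hr). apply Rmult_lt_compat_l with (r := A) in Lt; [|exact HA].
    replace (A * (v - e / A)) with (A * v - e) in Lt by (field; lra). lra.
Qed.

Lemma Rsum_S_l n f : Rsum (S n) f = f O + Rsum n (fun i => f (S i)).
Proof. induction n; [cbn [Rsum]; ring|]. cbn [Rsum] in *. rewrite IHn. ring. Qed.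
Lemma Rsum_rev n f : Rsum n (fun i => f (n - 1 - i)%nat) = Rsum n f.
Proof.
  induction n; [reflexivity|]. rewrite Rsum_S_l. cbn [Rsum]. rewrite <- IHn, Rplus_comm. f_equal.
  - apply Rsum_ext. intros i Hi. f_equal. lia.
  - f_equal. lia.
Qed.
Lemma BS_neg h N : BS (fun k l => h k (- l)%Z) N = BS h N.
Proof.
  unfold BS. apply Rsum_ext. intros i _.
  rewrite <- (Rsum_rev _ (fun j => h (Z.of_nat i - Z.of_nat N)%Z (Z.of_nat j - Z.of_nat N)%Z)).
  apply Rsum_ext. intros j Hj. f_equal. lia.
Qed.
(** Reversing w2 permutes the points of every symmetric box and changes the sign of the determinant,
    which reduces matters to positively oriented bases. *)
Lemma sampC_neg n w1 w2 : sampC n w1 (- w2)%C <-> sampC n w1 w2.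
Proof.
  assert (E : forall F N, BS (fun k l => wtC F (lat w1 (- w2) k l)%C) N = BS (fun k l => wtC F (lat w1 w2 k l)) N).
  { intros F N. rewrite <- (BS_neg (fun k l => wtC F (lat w1 w2 k l))). apply BS_ext. intros k l. f_equal. unfold lat. rewrite opp_IZR, RtoC_opp. ring. }
  split; intros [A [B [HA [HB H]]]]; exists A, B; (split; [exact HA|]; split; [exact HB|]; intros F v PF NF; destruct (H F v PF NF) as [h1 h2]; split;
    [intros N; specialize (h1 N); rewrite ?E in h1 |- *; rewrite <- ?E in h1; rewrite ?E; rewrite ?E in h1; exact h1 | intros s Hs; apply h2; intros N; specialize (Hs N); rewrite ?E in *; exact Hs]).
Qed.

(** * Conversion between [Cx] and Coquelicot's complex numbers *)

Definition toC (z : Cx) : C := (re z, im z).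
Definition ofC (z : C) : Cx := mkC (fst z) (snd z).
Definition liftC (F : Cx -> Cx) (z : C) : C := toC (F (ofC z)).

Lemma toC_ofC z : toC (ofC z) = z. Proof. destruct z; reflexivity. Qed.
Lemma ofC_toC z : ofC (toC z) = z. Proof. destruct z; reflexivity. Qed.
Lemma toC_inj z w : toC z = toC w -> z = w.
Proof. intros E. rewrite <- (ofC_toC z), E, ofC_toC. reflexivity. Qed.
Lemma toC_add z w : toC (Cadd z w) = (toC z + toC w)%C. Proof. reflexivity. Qed.
Lemma toC_sub z w : toC (Csub z w) = (toC z - toC w)%C. Proof. reflexivity. Qed.
Lemma toC_mul z w : toC (Cmul z w) = (toC z * toC w)%C. Proof. reflexivity. Qed.
Lemma toC_conj z : toC (Defs.Cconj z) = Cconj (toC z). Proof. reflexivity. Qed.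
Lemma Cnorm2_toC z : Cnorm2 z = Cmod (toC z) ^ 2.
Proof. rewrite Cmod_sqr2. unfold Cnorm2. simpl. ring. Qed.
Lemma Cmod_toC z : Defs.Cmod z = Cmod (toC z).
Proof. unfold Defs.Cmod. rewrite Cnorm2_toC. apply sqrt_pow2, Cmod_ge_0. Qed.
Lemma toC_div z w : toC w <> RtoC 0 -> toC (Defs.Cdiv z w) = (toC z / toC w)%C.
Proof.
  intros Hw. assert (E : toC (Defs.Cinv w) = (/ toC w)%C).
  { unfold Defs.Cinv, toC, Cinv, Cnorm2. simpl. f_equal; f_equal; ring. }
  unfold Defs.Cdiv. rewrite toC_mul, E. reflexivity.
Qed.
Lemma toC_pow z k : toC (Defs.Cpow z k) = (toC z ^ k)%C.
Proof. induction k; [reflexivity|]. cbn [Defs.Cpow]. rewrite toC_mul, IHk. simpl. ring. Qed.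
Lemma toC_csum n g : toC (csum n g) = Csum n (fun k => toC (g k)).
Proof. induction n; [reflexivity|]. cbn [csum Csum]. rewrite toC_add, IHn. reflexivity. Qed.

Lemma entire_liftC f : entire f <-> entireC (liftC f).
Proof.
  assert (Q : forall z h l : C, h <> RtoC 0 -> (liftC f (z + h) - liftC f z - (l * h + 0 * Cconj h) = ((liftC f (z + h) - liftC f z) / h - l) * h)%C).
  { intros z h l Hh. field. exact Hh. }
  assert (T : forall z h l, h <> C0 -> toC (Csub (Defs.Cdiv (Csub (f (Cadd z h)) (f z)) h) l) = ((liftC f (toC z + toC h) - liftC f (toC z)) / toC h - toC l)%C).
  { intros z h l Hh. assert (Nh : toC h <> RtoC 0) by (intros E; apply Hh, toC_inj; exact E).
    rewrite toC_sub, toC_div, toC_sub by exact Nh. unfold liftC. rewrite ofC_toC. reflexivity. }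
  split.
  - intros H z. destruct (H (ofC z)) as [l Hl]. exists (toC l). intros eps He. destruct (Hl eps He) as [d [Hd B]]. exists d. split; [exact Hd|].
    intros h Hh. destruct (Ceq_dec h 0) as [->|Nh].
    + replace (z + 0)%C with z by ring. replace (liftC f z - liftC f z - (toC l * 0 + 0 * Cconj 0))%C with (RtoC 0) by ring. rewrite Cmod_0. lra.
    + assert (Nh' : ofC h <> C0) by (intros E; apply Nh; rewrite <- (toC_ofC h), E; reflexivity).
      specialize (B (ofC h) Nh'). rewrite !Cmod_toC, T, !toC_ofC in B by exact Nh'.
      rewrite Q, Cmod_mult by exact Nh. apply Rmult_le_compat_r; [apply Cmod_ge_0 | left; apply B, Hh].
  - intros H z. destruct (H (toC z)) as [l Hl]. exists (ofC l). intros eps He. destruct (Hl (eps / 2)) as [d [Hd B]]; [lra|]. exists d. split; [exact Hd|].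
    intros h Nh Hh. rewrite Cmod_toC in Hh |- *. rewrite T, toC_ofC by exact Nh. specialize (B (toC h) Hh).
    assert (Nh' : toC h <> RtoC 0) by (intros E; apply Nh, toC_inj; exact E). rewrite Q, Cmod_mult in B by exact Nh'.
    assert (p := proj1 (Cmod_gt_0 _) Nh'). apply Rmult_le_reg_r in B; [lra | exact p].
Qed.

Lemma liftC_ofC f z : toC (f z) = liftC f (toC z).
Proof. unfold liftC. rewrite ofC_toC. reflexivity. Qed.
Definition lowerC (f : C -> C) (z : Cx) : Cx := ofC (f (toC z)).
Lemma lift_lower f : liftC (lowerC f) = f.
Proof. apply functional_extensionality. intros z. unfold liftC, lowerC. rewrite !toC_ofC. reflexivity. Qed.

Lemma polyanalytic_PA n F : polyanalytic n F <-> PA n (liftC F).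
Proof.
  split.
  - intros [phi [H E]]. exists (fun k => if Nat.ltb k n then liftC (phi k) else fun _ => RtoC 0). split.
    + intros k. destruct (Nat.ltb_spec k n); [apply entire_liftC, H; assumption | apply entireC_const].
    + intros z. unfold liftC at 1. rewrite E, toC_csum. apply Csum_ext. intros k Hk.
      destruct (Nat.ltb_spec k n); [|lia]. rewrite toC_mul, toC_pow, toC_conj, toC_ofC. reflexivity.
  - intros [phi [H E]]. exists (fun k => lowerC (phi k)). split.
    + intros k _. apply entire_liftC. rewrite lift_lower. apply H.
    + intros z. apply toC_inj. rewrite liftC_ofC, E, toC_csum. apply Csum_ext. intros k _. rewrite toC_mul, toC_pow, toC_conj.
      unfold lowerC. rewrite toC_ofC. reflexivity.
Qed.

Lemma wt_wtC F z : wt F z = wtC (liftC F) (toC z).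
Proof. unfold wt, wtC. rewrite !Cnorm2_toC, liftC_ofC. reflexivity. Qed.

Lemma IntR_RInt f a b v : IntR f a b v <-> ex_RInt f a b /\ RInt f a b = v.
Proof.
  split.
  - intros [pr <-]. split; [apply ex_RInt_Reals_1, pr | apply RInt_Reals].
  - intros [e <-]. exists (ex_RInt_Reals_0 _ _ _ e). symmetry. apply RInt_Reals.
Qed.
(** The inner function in [SqInt] is determined at every point by uniqueness of the Riemann
    integral. *)
Lemma SqInt_II G r v : cont2 G -> SqInt G r v <-> v = II G (- r) r (- r) r.
Proof.
  intros H. split.
  - intros [g [Hg Hv]]. apply IntR_RInt in Hv. destruct Hv as [_ <-]. unfold II. apply RInt_ext. intros x _.
    specialize (Hg x). apply IntR_RInt in Hg. symmetry. apply Hg.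
  - intros ->. exists (fun x => RInt (G x) (- r) r). split; [intros x|]; apply IntR_RInt; (split; [|reflexivity]).
    + apply (cont2_ex_RInt G x (- r) r H).
    + apply (II_ex G (- r) r (- r) r H).
Qed.
Lemma FockNormSq_normC n F v : PA n (liftC F) -> FockNormSq F v <-> normC (liftC F) v.
Proof.
  intros PF. assert (Cw := contCR_wt _ (PA_cont n _ PF)).
  assert (Ew : (fun x y => wt F (mkC x y)) = (fun x y => wtC (liftC F) (x, y))).
  { apply functional_extensionality; intros x. apply functional_extensionality; intros y. apply (wt_wtC F (mkC x y)). }
  assert (S : forall r w, SqInt (fun x y => wt F (mkC x y)) r w <-> w = SQ (wtC (liftC F)) r).
  { intros r w. rewrite Ew. apply SqInt_II, (contCR_cont2 _ Cw). }
  assert (Mo : forall r r', 0 <= r -> r <= r' -> SQ (wtC (liftC F)) r <= SQ (wtC (liftC F)) r').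
  { intros r r' h1 h2. apply SQ_mono; auto. apply wtC_ge_0. }
  split; intros [h1 h2]; split.
  (* [FockNormSq] speaks of positive radii only, so r = 0 is reached through r + 1. *)
  - intros r Hr. apply Rle_trans with (SQ (wtC (liftC F)) (r + 1)); [apply Mo; lra|]. apply (h1 (r + 1)); [lra | apply S; reflexivity].
  - intros eps He. destruct (h2 eps He) as [r0 H0]. destruct (H0 (Rmax 0 r0) (Rmax_r _ _)) as [w [Hw Lt]]. apply S in Hw. rewrite Hw in Lt.
    exists (Rmax 0 r0). split; [apply Rmax_l | exact Lt].
  - intros r w Hr Hw. apply S in Hw. rewrite Hw. apply h1. lra.
  - intros eps He. destruct (h2 eps He) as [r0 [Hr0 Lt]]. exists r0. intros r Hr. exists (SQ (wtC (liftC F)) r). split; [apply S; reflexivity|].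
    specialize (Mo r0 r Hr0 Hr). lra.
Qed.
Lemma sum_f_R0_Rsum f n : sum_f_R0 f n = Rsum (S n) f.
Proof. induction n; [cbn [Rsum sum_f_R0]; ring|]. cbn [sum_f_R0]. rewrite IHn. reflexivity. Qed.
Lemma boxsum_BS F a b c d N : boxsum F a b c d N = BS (fun k l => wtC (liftC F) (lat (a, c) (b, d) k l)) N.
Proof.
  unfold boxsum, BS. rewrite sum_f_R0_Rsum, Nat.add_1_r. apply Rsum_ext. intros i _. rewrite sum_f_R0_Rsum. apply Rsum_ext. intros j _.
  rewrite wt_wtC. f_equal. unfold latpt, lat, toC. apply C_ext; simpl; ring.
Qed.
Lemma sampling_sampC n a b c d : sampling n a b c d <-> sampC n (a, c) (b, d).
Proof.
  split; intros [A [B [HA [HB H]]]]; exists A, B; (split; [exact HA|]; split; [exact HB|]); intros F v.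
  - intros PF NF. assert (PF' : PA n (liftC (lowerC F))) by (rewrite lift_lower; exact PF).
    assert (NF' : FockNormSq (lowerC F) v) by (apply (FockNormSq_normC n _ _ PF'); rewrite lift_lower; exact NF).
    destruct (H (lowerC F) v (conj (proj2 (polyanalytic_PA n _) PF') (ex_intro _ v NF')) NF') as [h1 h2]. split.
    + intros N. specialize (h1 N). rewrite boxsum_BS, lift_lower in h1. exact h1.
    + intros s Hs. apply h2. intros N. rewrite boxsum_BS, lift_lower. apply Hs.
  - intros [PF _] NF. apply polyanalytic_PA in PF. apply (FockNormSq_normC n F v PF) in NF. destruct (H (liftC F) v PF NF) as [h1 h2]. split.
    + intros N. rewrite boxsum_BS. apply h1.
    + intros s Hs. apply h2. intros N. rewrite <- boxsum_BS. apply Hs.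
Qed.

Theorem theorem4 (n : nat) (a b c d : R) :
  (1 <= n)%nat -> a * d - b * c <> 0 ->
  (sampling n a b c d <-> density a b c d > INR n).
Proof.
  intros Hn Hdet. set (D := a * d - b * c) in *.
  assert (De : density a b c d > INR n <-> INR n * Rabs D < 1).
  { unfold density. fold D. assert (p := Rabs_pos_lt D Hdet).
    assert (i : / Rabs D * Rabs D = 1) by (apply Rinv_l; lra). split; intros L.
    - rewrite <- i. apply Rmult_lt_compat_r; assumption.
    - apply Rlt_gt, (Rmult_lt_reg_r (Rabs D)); [exact p | rewrite i; exact L]. }
  rewrite De, sampling_sampC. assert (n0 : 0 < INR n) by (apply lt_0_INR; lia).
  destruct (Rdichotomy D 0 Hdet) as [L|L].
  - rewrite <- sampC_neg, sampC_iff by (exact Hn || (simpl; unfold D in L; lra)). rewrite Rabs_left by exact L.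
    replace (snd (Cconj (a, c) * - (b, d))%C) with (- D) by (unfold D; simpl; ring). reflexivity.
  - rewrite sampC_iff by (exact Hn || (simpl; unfold D in L; lra)). rewrite Rabs_pos_eq by lra.
    replace (snd (Cconj (a, c) * (b, d))%C) with D by (unfold D; simpl; ring). reflexivity.
Qed.
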